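(* Let $\mathcal C$ be a finite tensor category, and let $\mathcal M$ and $\mathcal N$ be unimodular $\mathcal C$-module categories. The $\mathcal Z(\mathcal C)$-module category $\mathrm{Fun}_{\mathcal C}(\mathcal M,\mathcal N)$ is unimodular.
   Context: Work over an algebraically closed field $\Bbbk$. A finite multitensor category is a finite $\Bbbk$-linear abelian rigid monoidal category with bilinear tensor product; it is a finite tensor category if also $\mathrm{End}(\mathbb 1)\cong\Bbbk$. A (left) $\mathcal C$-module category is a finite $\Bbbk$-linear category with a $\mathcal C$-action exact in each variable; it is exact if $p\triangleright m$ is projective for every projective $p\in\mathcal C$ and all $m$. For exact $\mathcal M$, $\mathcal C^*_{\mathcal M}=\mathrm{Fun}_{\mathcal C}(\mathcal M,\mathcal M)$ is the finite multitensor category of $\mathcal C$-module endofunctors under composition. The distinguished invertible object of a finite multitensor category $\mathcal A$ is $D_{\mathcal A}=\int_{y\in\mathcal A}\mathrm{Hom}(y,\mathbb 1)\otimes_\Bbbk y$. A unimodular $\mathcal C$-module category is an exact $\mathcal C$-module category $\mathcal M$ with a module natural isomorphism $\mathrm{id}_{\mathcal M}\cong D_{\mathcal C^*_{\mathcal M}}$. $\mathrm{Fun}_{\mathcal C}(\mathcal M,\mathcal N)$ is the category of $\mathcal C$-module functors; the Drinfeld center $\mathcal Z(\mathcal C)$ (objects $(c,\nu)$, $\nu_x\colon c\otimes x\cong x\otimes c$) acts on it by $(c,\nu)\triangleright H=c\triangleright H(-)$, where $c\triangleright-\colon\mathcal N\to\mathcal N$ is a $\mathcal C$-module functor via $\nu$.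 *)

(* Defs.v *)
From HB Require Import structures.
From mathcomp Require Import all_boot all_algebra.
From mathcomp Require Import boolp.

Set Implicit Arguments.
Unset Strict Implicit.
Unset Printing Implicit Defensive.

Import GRing.Theory.
Local Open Scope ring_scope.

Declare Scope cat_scope.
Delimit Scope cat_scope with C.
Local Open Scope cat_scope.

Reserved Notation "g ∘ f" (at level 40, left associativity).
Reserved Notation "x ⊗ y" (at level 37, left associativity).
Reserved Notation "f ⊗' g" (at level 37, left associativity).
Reserved Notation "x ▷ m" (at level 38, right associativity).
Reserved Notation "f ▷' g" (at level 38, right associativity).

Record category (k : fieldType) := Category {
  ob :> Type;
  hom : ob -> ob -> lmodType k;
  idm : forall x, hom x x;
  compm : forall x y z, hom y z -> hom x y -> hom x z;
  compA : forall w x y z (h : hom y z) (g : hom x y) (f : hom w x),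
    compm h (compm g f) = compm (compm h g) f;
  comp1m : forall x y (f : hom x y), compm (idm y) f = f;
  compm1 : forall x y (f : hom x y), compm f (idm x) = f;
  comp_linearl : forall x y z (f : hom x y),
    linear (fun g : hom y z => compm g f);
  comp_linearr : forall x y z (g : hom y z),
    linear (fun f : hom x y => compm g f) }.

Arguments hom {k c} x y.
Arguments idm {k c} x.
Arguments compm {k c x y z} g f.
Notation "g ∘ f" := (compm g f) : cat_scope.

Record iso (k : fieldType) (A : category k) (x y : A) := Iso {
  fwd :> hom x y;
  bwd : hom y x;
  fwdK : bwd ∘ fwd = idm x;
  bwdK : fwd ∘ bwd = idm y }.

Arguments bwd {k A x y} i.

Definition isomorphic (k : fieldType) (A : category k) (x y : A) : Prop :=
  inhabited (iso x y).

Section Iso.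
Variables (k : fieldType) (A : category k).
Implicit Types x y z : A.

Definition iso_id x : iso x x := Iso (comp1m (idm x)) (comp1m (idm x)).

Definition iso_inv x y (i : iso x y) : iso y x := Iso (bwdK i) (fwdK i).

Definition iso_comp x y z (j : iso y z) (i : iso x y) : iso x z.
Proof.
apply: (@Iso _ _ _ _ (j ∘ i) (bwd i ∘ bwd j)).
  by rewrite compA -(compA (bwd i)) fwdK compm1 fwdK.
by rewrite compA -(compA j i) bwdK compm1 bwdK.
Defined.

Lemma iso_monic x y z (i : iso y z) (f g : hom x y) : i ∘ f = i ∘ g -> f = g.
Proof. by move=> e; rewrite -[f]comp1m -[g]comp1m -(fwdK i) -!compA e. Qed.

Lemma iso_epic x y z (i : iso x y) (f g : hom y z) : f ∘ i = g ∘ i -> f = g.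
Proof. by move=> e; rewrite -[f]compm1 -[g]compm1 -(bwdK i) !compA e. Qed.

Lemma isoK w x y (i : iso x y) (f : hom y w) : f ∘ i ∘ bwd i = f.
Proof. by rewrite -compA bwdK compm1. Qed.

Lemma isoVK w x y (i : iso x y) (f : hom x w) : f ∘ bwd i ∘ i = f.
Proof. by rewrite -compA fwdK compm1. Qed.

End Iso.

Arguments iso_monic {k A x y z} i [f g] _.
Arguments iso_epic {k A x y z} i [f g] _.

Section Abelian.
Variables (k : fieldType) (A : category k).
Implicit Types x y z : A.

Definition is_zero x : Prop := idm x = 0.

Definition mono x y (f : hom x y) : Prop :=
  forall w (g h : hom w x), f ∘ g = f ∘ h -> g = h.

Definition epi x y (f : hom x y) : Prop :=
  forall z (g h : hom y z), g ∘ f = h ∘ f -> g = h.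

Definition is_iso x y (f : hom x y) : Prop :=
  exists g : hom y x, g ∘ f = idm x /\ f ∘ g = idm y.

Definition is_kernel x y z (i : hom x y) (f : hom y z) : Prop :=
  f ∘ i = 0 /\
  forall w (g : hom w y), f ∘ g = 0 -> exists! u : hom w x, i ∘ u = g.

Definition is_cokernel x y z (f : hom x y) (p : hom y z) : Prop :=
  p ∘ f = 0 /\
  forall w (g : hom y w), g ∘ f = 0 -> exists! u : hom z w, u ∘ p = g.

Definition is_biproduct x y s (i1 : hom x s) (i2 : hom y s)
    (p1 : hom s x) (p2 : hom s y) : Prop :=
  [/\ p1 ∘ i1 = idm x, p2 ∘ i2 = idm y, p1 ∘ i2 = 0, p2 ∘ i1 = 0
    & i1 ∘ p1 + i2 ∘ p2 = idm s].

Definition abelian_category : Prop :=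
  [/\ exists x, is_zero x,
      forall x y, exists s (i1 : hom x s) (i2 : hom y s) p1 p2,
        is_biproduct i1 i2 p1 p2,
      forall x y (f : hom x y),
        (exists w (i : hom w x), is_kernel i f) /\
        (exists w (p : hom y w), is_cokernel f p),
      forall x y (f : hom x y), mono f -> exists z (g : hom y z), is_kernel f g
    & forall x y (f : hom x y), epi f ->
        exists w (g : hom w x), is_cokernel g f].

Definition short_exact x y z (i : hom x y) (p : hom y z) : Prop :=
  is_kernel i p /\ is_cokernel i p.

Definition simple_object x : Prop :=
  ~ is_zero x /\ forall w (i : hom w x), mono i -> is_zero w \/ is_iso i.

Inductive finite_length : A -> Prop :=
| finite_length_zero x : is_zero x -> finite_length x
| finite_length_ext x y z (i : hom x y) (p : hom y z) :
    short_exact i p -> finite_length x -> simple_object z -> finite_length y.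

Definition projective x : Prop :=
  forall y z (e : hom y z) (f : hom x z), epi e -> exists g, e ∘ g = f.

End Abelian.

Definition finite_dimensional (k : fieldType) (V : lmodType k) : Prop :=
  exists (n : nat) (b : 'I_n -> V),
    forall v, exists c : 'I_n -> k, v = \sum_i c i *: b i.

(** The intrinsic form of being equivalent to the finite-dimensional modules over
    a finite-dimensional algebra. The zero category is finite. *)
Definition finite_category (k : fieldType) (A : category k) : Prop :=
  [/\ abelian_category A,
      forall x y : A, finite_dimensional (hom x y),
      forall x : A, finite_length x,
      forall x : A, exists (p : A) (e : hom p x), projective p /\ epi e
    & exists (n : nat) (s : 'I_n -> A), forall x : A,
        simple_object x -> exists i, isomorphic x (s i)].

Record functor (k : fieldType) (A B : category k) := Functor {
  fob :> A -> B;
  fhom : forall x y, hom x y -> hom (fob x) (fob y);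
  fhom1 : forall x, fhom (idm x) = idm (fob x);
  fhomM : forall x y z (g : hom y z) (f : hom x y),
    fhom (g ∘ f) = fhom g ∘ fhom f;
  fhom_linear : forall x y, linear (@fhom x y) }.

Arguments fhom {k A B} f {x y} _ : rename.

Definition exact_functor (k : fieldType) (A B : category k)
    (F : functor A B) : Prop :=
  forall x y z (i : hom x y) (p : hom y z),
    short_exact i p -> short_exact (fhom F i) (fhom F p).

Section Functor.
Variables (k : fieldType) (A B D : category k).

Definition functor_id : functor A A.
Proof. by exists id (fun x y f => f). Defined.

Definition functor_comp (G : functor B D) (F : functor A B) : functor A D.
Proof.
exists (fun x => G (F x)) (fun x y f => fhom G (fhom F f)).
- by move=> x; rewrite !fhom1.
- by move=> x y z g f; rewrite !fhomM.
- by move=> x y a f g; rewrite !fhom_linear.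
Defined.

Definition fiso (F : functor A B) x y (i : iso x y) : iso (F x) (F y).
Proof.
by exists (fhom F i) (fhom F (bwd i)); rewrite -fhomM ?fwdK ?bwdK fhom1.
Defined.

End Functor.

Record monoidal (k : fieldType) := Monoidal {
  mcat :> category k;
  tunit : mcat;
  tob : mcat -> mcat -> mcat;
  thom : forall x x' y y' : mcat,
    hom x x' -> hom y y' -> hom (tob x y) (tob x' y');
  thom1 : forall x y, thom (idm x) (idm y) = idm (tob x y);
  thomM : forall x x' x'' y y' y'' (f' : hom x' x'') (f : hom x x')
    (g' : hom y' y'') (g : hom y y'),
    thom (f' ∘ f) (g' ∘ g) = thom f' g' ∘ thom f g;
  thom_linearl : forall x x' y y' (g : hom y y'),
    linear (fun f : hom x x' => thom f g);
  thom_linearr : forall x x' y y' (f : hom x x'),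
    linear (fun g : hom y y' => thom f g);
  assoc : forall x y z, iso (tob (tob x y) z) (tob x (tob y z));
  lunit : forall x, iso (tob tunit x) x;
  runit : forall x, iso (tob x tunit) x;
  assoc_natural : forall x x' y y' z z' (f : hom x x') (g : hom y y')
    (h : hom z z'),
    assoc x' y' z' ∘ thom (thom f g) h = thom f (thom g h) ∘ assoc x y z;
  lunit_natural : forall x y (f : hom x y),
    lunit y ∘ thom (idm tunit) f = f ∘ lunit x;
  runit_natural : forall x y (f : hom x y),
    runit y ∘ thom f (idm tunit) = f ∘ runit x;
  pentagon : forall w x y z,
    assoc w x (tob y z) ∘ assoc (tob w x) y z =
    thom (idm w) (assoc x y z) ∘ assoc w (tob x y) z
      ∘ thom (assoc w x y) (idm z);
  triangle : forall x y,
    thom (idm x) (lunit y) ∘ assoc x tunit y = thom (runit x) (idm y) }.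

Arguments tunit {k m}.
Notation "x ⊗ y" := (tob x y) : cat_scope.
Notation "f ⊗' g" := (thom f g) : cat_scope.
Arguments assoc {k m} x y z.
Arguments lunit {k m} x.
Arguments runit {k m} x.

(** [y] is a left dual of [x], equivalently [x] is a right dual of [y]. *)
Definition left_dual (k : fieldType) (C : monoidal k) (x y : C) : Prop :=
  exists (ev : hom (y ⊗ x) tunit) (coev : hom tunit (x ⊗ y)),
    runit x ∘ (idm x ⊗' ev) ∘ assoc x y x ∘ (coev ⊗' idm x) = lunit x /\
    lunit y ∘ (ev ⊗' idm y) ∘ bwd (assoc y x y) ∘ (idm y ⊗' coev) = runit y.

Definition rigid (k : fieldType) (C : monoidal k) : Prop :=
  forall x : C, (exists y, left_dual x y) /\ (exists y, left_dual y x).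

Definition finite_multitensor (k : fieldType) (C : monoidal k) : Prop :=
  finite_category C /\ rigid C.

Definition finite_tensor (k : fieldType) (C : monoidal k) : Prop :=
  finite_multitensor C /\
  bijective (fun a : k => a *: idm tunit : hom (tunit : C) tunit).

Record modcat (k : fieldType) (C : monoidal k) := Modcat {
  mdcat :> category k;
  aob : C -> mdcat -> mdcat;
  ahom : forall x x' m m',
    hom x x' -> hom m m' -> hom (aob x m) (aob x' m');
  ahom1 : forall x m, ahom (idm x) (idm m) = idm (aob x m);
  ahomM : forall x x' x'' m m' m'' (f' : hom x' x'') (f : hom x x')
    (g' : hom m' m'') (g : hom m m'),
    ahom (f' ∘ f) (g' ∘ g) = ahom f' g' ∘ ahom f g;
  ahom_linearl : forall x x' m m' (g : hom m m'),
    linear (fun f : hom x x' => ahom f g);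
  ahom_linearr : forall x x' m m' (f : hom x x'),
    linear (fun g : hom m m' => ahom f g);
  aassoc : forall x y m, iso (aob (x ⊗ y) m) (aob x (aob y m));
  aunit : forall m, iso (aob tunit m) m;
  aassoc_natural : forall x x' y y' m m' (f : hom x x') (g : hom y y')
    (h : hom m m'),
    aassoc x' y' m' ∘ ahom (f ⊗' g) h = ahom f (ahom g h) ∘ aassoc x y m;
  aunit_natural : forall m n (f : hom m n),
    aunit n ∘ ahom (idm tunit) f = f ∘ aunit m;
  apentagon : forall x y z m,
    aassoc x y (aob z m) ∘ aassoc (x ⊗ y) z m =
    ahom (idm x) (aassoc y z m) ∘ aassoc x (y ⊗ z) m
      ∘ ahom (assoc x y z) (idm m);
  atriangle : forall x m,
    ahom (idm x) (aunit m) ∘ aassoc x tunit m = ahom (runit x) (idm m) }.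

Notation "x ▷ m" := (aob x m) : cat_scope.
Notation "f ▷' g" := (ahom f g) : cat_scope.
Arguments aassoc {k C m} x y _ : rename.
Arguments aunit {k C m} _ : rename.

Section ActionFunctors.
Variables (k : fieldType) (C : monoidal k) (M : modcat C).

Definition act_left (x : C) : functor M M.
Proof.
exists (aob x) (fun m n f => idm x ▷' f).
- exact: ahom1.
- by move=> m n p g f; rewrite -ahomM comp1m.
- by move=> m n; apply: ahom_linearr.
Defined.

Definition act_right (m : M) : functor C M.
Proof.
exists (fun x => x ▷ m) (fun x y f => f ▷' idm m).
- by move=> x; apply: ahom1.
- by move=> x y z g f; rewrite -ahomM comp1m.
- by move=> x y; apply: ahom_linearl.
Defined.

Definition is_module_category : Prop :=
  [/\ finite_category M, forall x, exact_functor (act_left x)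
    & forall m, exact_functor (act_right m)].

Definition exact_module : Prop :=
  is_module_category /\
  forall (p : C) (m : M), projective p -> projective (p ▷ m).

End ActionFunctors.

Section ActionFacts.
Variables (k : fieldType) (C : monoidal k) (M : modcat C).
Implicit Types (x y z : C) (m n : M).

Lemma ahomMl x m n p (g : hom n p) (f : hom m n) :
  idm x ▷' (g ∘ f) = (idm x ▷' g) ∘ (idm x ▷' f).
Proof. by rewrite -ahomM comp1m. Qed.

Lemma ahomMr x y z m (g : hom y z) (f : hom x y) :
  (g ∘ f) ▷' idm m = (g ▷' idm m) ∘ (f ▷' idm m).
Proof. by rewrite -ahomM comp1m. Qed.

Lemma ahom_lr x y m n (f : hom x y) (g : hom m n) :
  f ▷' g = (idm y ▷' g) ∘ (f ▷' idm m).
Proof. by rewrite -ahomM comp1m compm1. Qed.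

Lemma ahom_rl x y m n (f : hom x y) (g : hom m n) :
  f ▷' g = (f ▷' idm n) ∘ (idm x ▷' g).
Proof. by rewrite -ahomM comp1m compm1. Qed.

Lemma aassoc_nat_id x x' y m (f : hom x x') :
  aassoc x' y m ∘ ((f ⊗' idm y) ▷' idm m) = (f ▷' idm (y ▷ m)) ∘ aassoc x y m.
Proof. by rewrite aassoc_natural ahom1. Qed.

Lemma aunit_faithful m n (f g : hom m n) :
  idm tunit ▷' f = idm tunit ▷' g -> f = g.
Proof.
by move=> e; apply: (iso_epic (aunit m)); rewrite -!aunit_natural e.
Qed.

Lemma aunit_assoc x m : aunit (x ▷ m) ∘ aassoc tunit x m = lunit x ▷' idm m.
Proof.
apply: aunit_faithful.
apply: (iso_epic (aassoc tunit (tunit ⊗ x) m)).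
apply: (iso_epic (fiso (act_right m) (assoc tunit tunit x))) => /=.
rewrite ahomMl -!compA [X in _ ∘ X]compA -apentagon compA atriangle.
rewrite -aassoc_nat_id -triangle ahomMr !compA.
by rewrite (aassoc_natural (idm tunit) (lunit x) (idm m)).
Qed.

End ActionFacts.

Section Regular.
Variables (k : fieldType) (C : monoidal k).

Definition regular : modcat C.
Proof.
exists C (@tob k C) (@thom k C) (@assoc k C) (@lunit k C).
- exact: thom1.
- exact: thomM.
- exact: thom_linearl.
- exact: thom_linearr.
- exact: assoc_natural.
- exact: lunit_natural.
- exact: pentagon.
- exact: triangle.
Defined.

Lemma tunit_faithful (x y : C) (f g : hom x y) :
  f ⊗' idm tunit = g ⊗' idm tunit -> f = g.
Proof.
by move=> e; apply: (iso_epic (runit x)); rewrite -!runit_natural e.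
Qed.

End Regular.

Section Structure.
Variables (k : fieldType) (C : monoidal k) (M N : modcat C).

Definition str (F : M -> N) := forall (x : C) (m : M), hom (F (x ▷ m)) (x ▷ F m).

Definition is_modfun (F : functor M N) (s : str F) : Prop :=
  [/\ forall x y m n (f : hom x y) (g : hom m n),
        s y n ∘ fhom F (f ▷' g) = (f ▷' fhom F g) ∘ s x m,
      forall x y m, aassoc x y (F m) ∘ s (x ⊗ y) m =
        (idm x ▷' s y m) ∘ s x (y ▷ m) ∘ fhom F (aassoc x y m)
    & forall m, aunit (F m) ∘ s tunit m = fhom F (aunit m)].

Definition is_modnat (F G : M -> N) (s : str F) (t : str G)
    (eta : forall m, hom (F m) (G m)) : Prop :=
  forall x m, t x m ∘ eta (x ▷ m) = (idm x ▷' eta m) ∘ s x m.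

Lemma is_modnat_comp (F G H : M -> N) (s : str F) (t : str G) (u : str H)
    (eta : forall m, hom (F m) (G m)) (theta : forall m, hom (G m) (H m)) :
  is_modnat s t eta -> is_modnat t u theta ->
  is_modnat s u (fun m => theta m ∘ eta m).
Proof. by move=> e f x m; rewrite compA f -compA e ahomMl compA. Qed.

Lemma is_modnat_cancel (F G H : M -> N) (s : str F) (t : str G) (u : str H)
    (eta : forall m, hom (F m) (G m)) (theta : forall m, iso (G m) (H m))
    (zeta : forall m, hom (F m) (H m)) :
  (forall m, theta m ∘ eta m = zeta m) ->
  is_modnat t u (fun m => theta m) -> is_modnat s u zeta -> is_modnat s t eta.
Proof.
move=> E f e x m; apply: (iso_monic (fiso (act_left N x) (theta m))) => /=.
by rewrite !compA -f -compA E e -ahomMl E.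
Qed.

Lemma is_modnat_id (F : M -> N) (s : str F) : is_modnat s s (fun m => idm (F m)).
Proof. by move=> x m; rewrite ahom1 comp1m compm1. Qed.

Lemma is_modnat_inv (F G : M -> N) (s : str F) (t : str G)
    (theta : forall m, iso (F m) (G m)) :
  is_modnat s t (fun m => theta m) -> is_modnat t s (fun m => bwd (theta m)).
Proof.
move=> e; apply: is_modnat_cancel e (is_modnat_id t) => m.
exact: bwdK.
Qed.

Lemma is_modfun_transport (F G : functor M N) (s : str F) (t : str G)
    (theta : forall m, iso (F m) (G m)) :
  (forall m n (f : hom m n), theta n ∘ fhom F f = fhom G f ∘ theta m) ->
  is_modnat s t (fun m => theta m) -> is_modfun t -> is_modfun s.
Proof.
move=> thN th [tN t2 t1]; split.
- move=> x y m n f g.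
  apply: (iso_monic (fiso (act_left N y) (theta n))) => /=.
  rewrite !compA -th -[LHS]compA thN compA tN.
  rewrite -!ahomM comp1m thN -[f in RHS]compm1 ahomM -!compA; congr (_ ∘ _).
  by rewrite th.
- move=> x y m.
  pose i := fiso (act_left N x) (fiso (act_left N y) (theta m)).
  apply: (iso_monic i) => /=.
  rewrite !compA -aassoc_natural thom1 -(compA (aassoc _ _ _)) -th compA t2.
  rewrite -(compA _ (fhom G _)) -thN !compA -(compA _ (t x _)) th compA.
  by rewrite -!ahomMl th.
- move=> m; apply: (iso_monic (theta m)).
  by rewrite compA -aunit_natural -compA -th compA t1 thN.
Qed.

End Structure.

Definition str_comp (k : fieldType) (C : monoidal k) (M N P : modcat C)
    (G : functor N P) (F : functor M N) (t : str G) (s : str F) :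
    str (functor_comp G F) := fun x m => t x (F m) ∘ fhom G (s x m).

Definition str_id (k : fieldType) (C : monoidal k) (M : modcat C) :
    str (functor_id M) := fun x m => idm (x ▷ m).

Section StructureComp.
Variables (k : fieldType) (C : monoidal k) (M N P : modcat C).

Lemma is_modfun_comp (G : functor N P) (F : functor M N) (t : str G) (s : str F) :
  is_modfun t -> is_modfun s -> is_modfun (str_comp t s).
Proof.
move=> [tN t2 t1] [sN s2 s1]; split; rewrite /str_comp /=.
- by move=> x y m n f g; rewrite -compA -fhomM sN fhomM compA tN compA.
- move=> x y m; rewrite compA t2 -(compA _ (fhom G (aassoc _ _ _))) -fhomM s2.
  rewrite !fhomM !ahomMl !compA -(compA _ (t x _) (fhom G _)).
  by rewrite tN !compA.
- by move=> m; rewrite compA t1 -fhomM s1.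
Qed.

Lemma is_modfun_id : is_modfun (@str_id k C M).
Proof.
split; rewrite /str_id /= => *; rewrite ?ahom1 ?comp1m ?compm1 //.
Qed.

Lemma is_modnat_whiskr (G G' : functor N P) (F : functor M N)
    (t : str G) (t' : str G') (s : str F) (theta : forall n, hom (G n) (G' n)) :
  (forall m n (f : hom m n), theta n ∘ fhom G f = fhom G' f ∘ theta m) ->
  is_modnat t t' theta ->
  is_modnat (str_comp t s) (str_comp t' s) (fun m => theta (F m)).
Proof. by move=> n th x m; rewrite /str_comp -compA -n !compA th. Qed.

Lemma is_modnat_whiskl (G : functor N P) (F F' : functor M N)
    (t : str G) (s : str F) (s' : str F') (eta : forall m, hom (F m) (F' m)) :
  is_modfun t -> is_modnat s s' eta ->
  is_modnat (str_comp t s) (str_comp t s') (fun m => fhom G (eta m)).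
Proof.
move=> [tN _ _] e x m; rewrite /str_comp /=.
by rewrite [RHS]compA -tN -!compA -!fhomM e.
Qed.

End StructureComp.

(** Functors are k-linear. No exactness is imposed: it is automatic when [M] is
    an exact module category. *)
Record modfun (k : fieldType) (C : monoidal k) (M N : modcat C) := Modfun {
  mfun :> functor M N;
  mstr : forall x m, iso (mfun (x ▷ m)) (x ▷ mfun m);
  mstrP : is_modfun (fun x m => mstr x m) }.

Record modnat (k : fieldType) (C : monoidal k) (M N : modcat C)
    (F G : modfun M N) := Modnat {
  nt :> forall m, hom (F m) (G m);
  nt_natural : forall m n (f : hom m n), nt n ∘ fhom F f = fhom G f ∘ nt m;
  nt_mod : is_modnat (fun x m => mstr F x m) (fun x m => mstr G x m) nt }.

(** The k-module structure that a type [T] inherits from an embedding into a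
    product of k-modules, once its image is known to be a submodule. *)
Section SubLmod.
Variables (k : fieldType) (I : Type) (V : I -> lmodType k).
Variables (T : Type) (v : T -> forall i, V i).
Hypothesis v_inj : forall s t, (forall i, v s i = v t i) -> s = t.
Variables (z : T) (l : k -> T -> T -> T).
Hypothesis vz : forall i, v z i = 0.
Hypothesis vl : forall b s t i, v (l b s t) i = b *: v s i + v t i.

Definition sub_add s t := l 1 s t.
Definition sub_opp s := l (-1) s z.
Definition sub_scale b s := l b s z.

Lemma sub_vaE s t i : v (sub_add s t) i = v s i + v t i.
Proof. by rewrite vl scale1r. Qed.
Lemma sub_voE s i : v (sub_opp s) i = - v s i.
Proof. by rewrite vl vz addr0 scaleN1r. Qed.
Lemma sub_vcE b s i : v (sub_scale b s) i = b *: v s i.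
Proof. by rewrite vl vz addr0. Qed.

Lemma sub_addA : associative sub_add.
Proof. by move=> s t u; apply: v_inj => i; rewrite !sub_vaE addrA. Qed.
Lemma sub_addC : commutative sub_add.
Proof. by move=> s t; apply: v_inj => i; rewrite !sub_vaE addrC. Qed.
Lemma sub_add0 : left_id z sub_add.
Proof. by move=> s; apply: v_inj => i; rewrite sub_vaE vz add0r. Qed.
Lemma sub_addN : left_inverse z sub_opp sub_add.
Proof. by move=> s; apply: v_inj => i; rewrite sub_vaE sub_voE vz addNr. Qed.

Definition sub_choice : choiceType :=
  HB.pack T (gen_eqMixin T) (gen_choiceMixin T).

Definition sub_zmod : zmodType := HB.pack T sub_choice
  (GRing.isZmodule.Build sub_choice sub_addA sub_addC sub_add0 sub_addN).

Lemma sub_scA b1 b2 (s : sub_zmod) : sub_scale b1 (sub_scale b2 s) = sub_scale (b1 * b2) s.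
Proof. by apply: v_inj => i; rewrite !sub_vcE scalerA. Qed.
Lemma sub_sc1 : left_id 1 (sub_scale : k -> sub_zmod -> sub_zmod).
Proof. by move=> s; apply: v_inj => i; rewrite sub_vcE scale1r. Qed.
Lemma sub_scDr : right_distributive (sub_scale : k -> sub_zmod -> sub_zmod) +%R.
Proof. by move=> b s t; apply: v_inj => i; rewrite !(sub_vcE, sub_vaE) scalerDr. Qed.
Lemma sub_scDl (s : sub_zmod) : {morph (sub_scale^~ s : k -> sub_zmod) : b1 b2 / b1 + b2}.
Proof. by move=> b1 b2; apply: v_inj => i; rewrite !(sub_vcE, sub_vaE) scalerDl. Qed.

Definition sub_lmod : lmodType k :=
  HB.pack T sub_zmod (GRing.Zmodule_isLmodule.Build k sub_zmod sub_scA sub_sc1 sub_scDr sub_scDl).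

End SubLmod.

Lemma linear0 (k : fieldType) (U V : lmodType k) (f : U -> V) :
  linear f -> f 0 = 0.
Proof.
move=> lf; have := lf (-1) 0 0.
by rewrite scaler0 addr0 scaleN1r addNr.
Qed.

Section ModuleFunctorCategory.
Variables (k : fieldType) (C : monoidal k) (M N : modcat C).
Implicit Types (F G H : modfun M N).

Lemma modnat_eq F G (s t : modnat F G) : (forall m, s m = t m) -> s = t.
Proof.
case: s t => [s s1 s2] [t t1 t2] /= e.
have {}e : s = t by apply: functional_extensionality_dep.
by case: _ / e in t1 t2 *; congr Modnat; apply: Prop_irrelevance.
Qed.

Lemma ahom0r x y (m n : N) (f : hom x y) : f ▷' (0 : hom m n) = 0.
Proof. exact: (linear0 (@ahom_linearr _ _ N x y m n f)). Qed.

Definition modnat_zero F G : modnat F G.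
Proof.
exists (fun m => 0).
- move=> m n f.
  by rewrite (linear0 (comp_linearl _)) (linear0 (comp_linearr _)).
- move=> x m; rewrite ahom0r.
  by rewrite (linear0 (comp_linearl _)) (linear0 (comp_linearr _)).
Defined.

Definition modnat_lin F G (a : k) (s t : modnat F G) : modnat F G.
Proof.
exists (fun m => a *: s m + t m).
- by move=> m n f; rewrite comp_linearl comp_linearr !nt_natural.
- by move=> x m; rewrite ahom_linearr comp_linearl comp_linearr !nt_mod.
Defined.

Definition modnat_lmod F G : lmodType k :=
  @sub_lmod k M (fun m => hom (F m) (G m)) (modnat F G) (@nt k C M N F G)
    (@modnat_eq F G) (modnat_zero F G) (@modnat_lin F G)
    (fun m => erefl) (fun a s t m => erefl).

Definition modnat_id F : modnat F F.
Proof.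
exists (fun m => idm (F m)).
- by move=> m n f; rewrite comp1m compm1.
- exact: is_modnat_id.
Defined.

Definition modnat_comp F G H (t : modnat G H) (s : modnat F G) : modnat F H.
Proof.
exists (fun m => t m ∘ s m).
- by move=> m n f; rewrite -compA nt_natural !compA nt_natural.
- exact: is_modnat_comp (nt_mod s) (nt_mod t).
Defined.

Definition modfun_cat : category k.
Proof.
apply: (@Category k (modfun M N) modnat_lmod modnat_id modnat_comp).
- by move=> F G H L u t s; apply: modnat_eq => m /=; rewrite compA.
- by move=> F G s; apply: modnat_eq => m /=; rewrite comp1m.
- by move=> F G s; apply: modnat_eq => m /=; rewrite compm1.
- move=> F G H s a t u; apply: modnat_eq => m /=.
  by rewrite !(scale1r, addr0) comp_linearl.
- move=> F G H t a s u; apply: modnat_eq => m /=.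
  by rewrite !(scale1r, addr0) comp_linearr.
Defined.

End ModuleFunctorCategory.

Section ModuleFunctorComp.
Variables (k : fieldType) (C : monoidal k).

Definition modfun_id (M : modcat C) : modfun M M :=
  @Modfun _ _ M M (functor_id M) (fun x m => iso_id (x ▷ m)) (is_modfun_id M).

Definition modfun_comp (M N P : modcat C) (G : modfun N P) (F : modfun M N) :
    modfun M P :=
  @Modfun _ _ M P (functor_comp G F)
    (fun x m => iso_comp (mstr G x (F m)) (fiso G (mstr F x m)))
    (is_modfun_comp (mstrP G) (mstrP F)).

Definition modnat_hcomp (M N P : modcat C) (G G' : modfun N P)
    (F F' : modfun M N) (t : modnat G G') (s : modnat F F') :
    modnat (modfun_comp G F) (modfun_comp G' F').
Proof.
exists (fun m => fhom G' (s m) ∘ t (F m)).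
- move=> m n f /=.
  by rewrite -compA nt_natural !compA -!fhomM nt_natural.
- apply: is_modnat_comp (is_modnat_whiskr _ (@nt_natural _ _ _ _ _ _ t) (nt_mod t)) _.
  exact: is_modnat_whiskl (mstrP G') (nt_mod s).
Defined.

Definition modnat_iso (M N : modcat C) (F G : modfun M N)
    (t : forall m, iso (F m) (G m))
    (tN : forall m n (f : hom m n), t n ∘ fhom F f = fhom G f ∘ t m)
    (tP : is_modnat (fun x m => mstr F x m) (fun x m => mstr G x m)
      (fun m => t m)) :
  @iso k (modfun_cat M N) F G.
Proof.
unshelve eexists (Modnat tN tP : @hom _ (modfun_cat M N) F G) _.
- exists (fun m => bwd (t m)); last exact: is_modnat_inv tP.
  move=> m n f; apply: (iso_monic (t n)).
  by rewrite !compA bwdK comp1m tN isoK.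
- by apply: modnat_eq => m /=; rewrite fwdK.
- by apply: modnat_eq => m /=; rewrite bwdK.
Defined.

Variable M : modcat C.

Definition dual_assoc (F G H : modfun M M) : @iso k (modfun_cat M M)
  (modfun_comp (modfun_comp F G) H) (modfun_comp F (modfun_comp G H)).
Proof.
refine (@modnat_iso M M (modfun_comp (modfun_comp F G) H)
  (modfun_comp F (modfun_comp G H)) (fun m => iso_id (F (G (H m)))) _ _).
- by move=> m n f /=; rewrite comp1m compm1.
- by move=> x m /=; rewrite ahom1 comp1m compm1 /str_comp /= fhomM compA.
Defined.

Definition dual_lunit (F : modfun M M) :
  @iso k (modfun_cat M M) (modfun_comp (modfun_id M) F) F.
Proof.
refine (@modnat_iso M M (modfun_comp (modfun_id M) F) F
  (fun m => iso_id (F m)) _ _).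
- by move=> m n f /=; rewrite comp1m compm1.
- by move=> x m /=; rewrite ahom1 compm1 /str_comp /str_id /= !comp1m.
Defined.

Definition dual_runit (F : modfun M M) :
  @iso k (modfun_cat M M) (modfun_comp F (modfun_id M)) F.
Proof.
refine (@modnat_iso M M (modfun_comp F (modfun_id M)) F
  (fun m => iso_id (F m)) _ _).
- by move=> m n f /=; rewrite comp1m compm1.
- by move=> x m /=; rewrite ahom1 compm1 /str_comp /str_id /= fhom1 compm1 comp1m.
Defined.

(** The dual category [Fun_C(M, M)], tensored by composition of functors. *)
Definition dual_cat : monoidal k.
Proof.
apply: (@Monoidal k (modfun_cat M M) (modfun_id M) (@modfun_comp M M M)
  (fun F F' G G' => @modnat_hcomp M M M F F' G G') _ _ _ _
  dual_assoc dual_lunit dual_runit).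
- by move=> F G; apply: modnat_eq => m /=; rewrite fhom1 comp1m.
- move=> F F' F'' G G' G'' t' t s' s; apply: modnat_eq => m /=.
  rewrite fhomM -!compA; congr (_ ∘ _).
  by rewrite !compA nt_natural.
- move=> F F' G G' s a t u; apply: modnat_eq => m /=.
  by rewrite !(scale1r, addr0) comp_linearr.
- move=> F F' G G' t a s u; apply: modnat_eq => m /=.
  by rewrite !(scale1r, addr0) fhom_linear comp_linearl.
- move=> F F' G G' H H' t s u; apply: modnat_eq => m /=.
  by rewrite comp1m compm1 fhomM compA.
- by move=> F G t; apply: modnat_eq => m /=; rewrite comp1m !compm1.
- move=> F G t; apply: modnat_eq => m /=.
  by rewrite comp1m compm1 fhom1 comp1m.
- move=> F G H L; apply: modnat_eq => m /=.
  by rewrite !fhom1 !comp1m.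
- move=> F G; apply: modnat_eq => m /=.
  by rewrite !fhom1 !comp1m.
Defined.

End ModuleFunctorComp.

Section Copower.
Variables (k : fieldType) (A : category k).

(** The copower [V ⊗ y] of an object [y] by a vector space [V]: it represents
    the functor [z |-> Hom_k(V, hom y z)]. *)
Record copower (V : lmodType k) (y : A) := Copower {
  cp_ob : A;
  cp_in : V -> hom y cp_ob;
  cp_in_linear : linear cp_in;
  cp_desc : forall z (f : V -> hom y z), linear f -> hom cp_ob z;
  cp_descE : forall z (f : V -> hom y z) (lf : linear f) v,
    cp_desc lf ∘ cp_in v = f v;
  cp_ext : forall z (g h : hom cp_ob z),
    (forall v, g ∘ cp_in v = h ∘ cp_in v) -> g = h }.

Lemma cp_map_linear (V W : lmodType k) (y z : A) (Q : copower W z)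
    (phi : V -> W) (f : hom y z) :
  linear phi -> linear (fun v => cp_in Q (phi v) ∘ f).
Proof. by move=> lp a u v; rewrite lp cp_in_linear comp_linearl. Qed.

Definition cp_map (V W : lmodType k) (y z : A) (P : copower V y)
    (Q : copower W z) (phi : V -> W) (lphi : linear phi) (f : hom y z) :
    hom (cp_ob P) (cp_ob Q) :=
  cp_desc P (cp_map_linear Q f lphi).

End Copower.

Lemma id_linear (k : fieldType) (V : lmodType k) : linear (fun v : V => v).
Proof. by []. Qed.

Section Distinguished.
Variables (k : fieldType) (A : monoidal k).

(** Wedges over the functor [(x, y) |-> hom x tunit ⊗ y], which is
    contravariant in [x] and covariant in [y]. *)
Definition wedge (T : forall x y : A, copower (hom x tunit) y) (E : A)
    (pi : forall y, hom E (cp_ob (T y y))) : Prop :=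
  forall (x y : A) (f : hom x y),
    cp_map (T x x) (T x y) (id_linear (V := _)) f ∘ pi x =
    cp_map (T y y) (T x y) (comp_linearl f) (idm y) ∘ pi y.

(** [D] is an end of [(x, y) |-> hom x tunit ⊗ y]. *)
Definition is_distinguished (D : A) : Prop :=
  exists (T : forall x y : A, copower (hom x tunit) y)
         (pi : forall y, hom D (cp_ob (T y y))),
    wedge pi /\
    forall (E : A) (rho : forall y, hom E (cp_ob (T y y))), wedge rho ->
      exists! u : hom E D, forall y, pi y ∘ u = rho y.

End Distinguished.

Definition unimodular (k : fieldType) (C : monoidal k) (M : modcat C) : Prop :=
  exact_module M /\
  exists D : dual_cat M, is_distinguished D /\ isomorphic (tunit : dual_cat M) D.

Section HalfBraiding.
Variables (k : fieldType) (C : monoidal k).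

(** The unit condition follows from the hexagon, every [nu x] being invertible. *)
Definition half_braiding (c : C) (nu : forall x, iso (c ⊗ x) (x ⊗ c)) : Prop :=
  [/\ forall x y (f : hom x y), nu y ∘ (idm c ⊗' f) = (f ⊗' idm c) ∘ nu x,
      forall x y, assoc x y c ∘ nu (x ⊗ y) ∘ assoc c x y =
        (idm x ⊗' nu y) ∘ assoc x c y ∘ (nu x ⊗' idm y)
    & lunit c ∘ nu tunit = runit c].

Variable N : modcat C.

(** The structure morphisms [c ▷ (x ▷ n) -> x ▷ (c ▷ n)] of [c ▷ -]. *)
Definition act_str (c : C) (nu : forall x, iso (c ⊗ x) (x ⊗ c)) (x : C) (n : N) :
    iso (c ▷ (x ▷ n)) (x ▷ (c ▷ n)) :=
  iso_comp (aassoc x c n)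
    (iso_comp (fiso (act_right n) (nu x)) (iso_inv (aassoc c x n))).

Lemma act_strE (c : C) (nu : forall x, iso (c ⊗ x) (x ⊗ c)) x n :
  act_str nu x n ∘ aassoc c x n = aassoc x c n ∘ (nu x ▷' idm n).
Proof. by rewrite /= !compA isoVK. Qed.

Section OneObject.
Variables (c : C) (nu : forall x, iso (c ⊗ x) (x ⊗ c)).
Variable s : forall x (n : N), hom (c ▷ (x ▷ n)) (x ▷ (c ▷ n)).
Hypothesis sE : forall x n,
  s x n ∘ aassoc c x n = aassoc x c n ∘ (nu x ▷' idm n).

Lemma act_nat x y m n (f : hom x y) (g : hom m n) :
  nu y ∘ (idm c ⊗' f) = (f ⊗' idm c) ∘ nu x ->
  s y n ∘ (idm c ▷' (f ▷' g)) = (f ▷' (idm c ▷' g)) ∘ s x m.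
Proof.
move=> e; apply: (iso_epic (aassoc c x m)).
rewrite -!compA -aassoc_natural sE compA sE.
rewrite [RHS]compA -aassoc_natural -!compA; congr (_ ∘ _).
by rewrite -!ahomM comp1m compm1 e.
Qed.

Lemma act_nat_inv x y n (f : hom x y) :
  s y n ∘ (idm c ▷' (f ▷' idm n)) = (f ▷' (idm c ▷' idm n)) ∘ s x n ->
  (nu y ∘ (idm c ⊗' f)) ▷' idm n = ((f ⊗' idm c) ∘ nu x) ▷' idm n.
Proof.
move=> e; apply: (iso_monic (aassoc y c n)).
rewrite !ahomMr !compA -sE -compA aassoc_natural compA e.
by rewrite -compA sE compA -aassoc_natural.
Qed.

Lemma act_hex x y n :
  (aassoc x y (c ▷ n) ∘ s (x ⊗ y) n =
   (idm x ▷' s y n) ∘ s x (y ▷ n) ∘ (idm c ▷' aassoc x y n))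
  <->
  (assoc x y c ∘ nu (x ⊗ y) ∘ assoc c x y) ▷' idm n =
  ((idm x ⊗' nu y) ∘ assoc x c y ∘ (nu x ⊗' idm y)) ▷' idm n.
Proof.
pose i := iso_comp (aassoc c (x ⊗ y) n) (fiso (act_right n) (assoc c x y)).
pose j := iso_comp (fiso (act_left N x) (aassoc y c n)) (aassoc x (y ⊗ c) n).
have L : aassoc x y (c ▷ n) ∘ s (x ⊗ y) n ∘ i =
    j ∘ ((assoc x y c ∘ nu (x ⊗ y) ∘ assoc c x y) ▷' idm n).
  rewrite /= compA -(compA _ (s _ _)) sE !compA apentagon.
  by rewrite -!compA !ahomMr !compA.
have R : (idm x ▷' s y n) ∘ s x (y ▷ n) ∘ (idm c ▷' aassoc x y n) ∘ i =
    j ∘ (((idm x ⊗' nu y) ∘ assoc x c y ∘ (nu x ⊗' idm y)) ▷' idm n).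
  rewrite /= -!compA [X in _ ∘ (_ ∘ X)]compA -apentagon.
  rewrite !compA -(compA _ (s _ _)) sE !compA.
  rewrite -(compA _ (nu x ▷' _)) -aassoc_nat_id !compA.
  rewrite -(compA _ (fwd (aassoc x c (y ▷ n)))) apentagon !compA.
  rewrite -ahomMl sE ahomMl -(compA _ _ (fwd (aassoc x (c ⊗ y) n))).
  by rewrite -aassoc_natural !ahomMr !compA.
split=> e; first by apply: (iso_monic j); rewrite -L e R.
by apply: (iso_epic i); rewrite L e R.
Qed.

Lemma act_unit n :
  (aunit (c ▷ n) ∘ s tunit n = idm c ▷' aunit n) <->
  (lunit c ∘ nu tunit) ▷' idm n = runit c ▷' idm n.
Proof.
have L : aunit (c ▷ n) ∘ s tunit n ∘ aassoc c tunit n =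
    (lunit c ∘ nu tunit) ▷' idm n.
  by rewrite -compA sE compA aunit_assoc ahomMr.
split=> e; first by rewrite -L e atriangle.
by apply: (iso_epic (aassoc c tunit n)); rewrite L e atriangle.
Qed.

End OneObject.

Lemma act_str_modfun (c : C) (nu : forall x, iso (c ⊗ x) (x ⊗ c)) :
  half_braiding nu ->
  is_modfun (F := act_left N c) (fun x n => act_str nu x n).
Proof.
have sE := act_strE nu.
move=> [nN n2 n1]; split.
- by move=> x y m n f g; apply: (act_nat sE).
- by move=> x y n; apply/(act_hex sE); rewrite n2.
- by move=> n; apply/(act_unit sE); rewrite n1.
Qed.

Lemma act_hom (c d : C) (nu : forall x, iso (c ⊗ x) (x ⊗ c))
    (mu : forall x, iso (d ⊗ x) (x ⊗ d))
    (s : forall x (n : N), hom (c ▷ (x ▷ n)) (x ▷ (c ▷ n)))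
    (t : forall x (n : N), hom (d ▷ (x ▷ n)) (x ▷ (d ▷ n)))
    (sE : forall x n, s x n ∘ aassoc c x n = aassoc x c n ∘ (nu x ▷' idm n))
    (tE : forall x n, t x n ∘ aassoc d x n = aassoc x d n ∘ (mu x ▷' idm n))
    (f : hom c d) (x : C) (n : N) :
  (t x n ∘ (f ▷' idm (x ▷ n)) = (idm x ▷' (f ▷' idm n)) ∘ s x n) <->
  (mu x ∘ (f ⊗' idm x)) ▷' idm n = ((idm x ⊗' f) ∘ nu x) ▷' idm n.
Proof.
have L : t x n ∘ (f ▷' idm (x ▷ n)) ∘ aassoc c x n =
    aassoc x d n ∘ ((mu x ∘ (f ⊗' idm x)) ▷' idm n).
  by rewrite -compA -aassoc_nat_id compA tE ahomMr compA.
have R : (idm x ▷' (f ▷' idm n)) ∘ s x n ∘ aassoc c x n =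
    aassoc x d n ∘ (((idm x ⊗' f) ∘ nu x) ▷' idm n).
  by rewrite -compA sE compA -aassoc_natural ahomMr compA.
split=> e; first by apply: (iso_monic (aassoc x d n)); rewrite -L e R.
by apply: (iso_epic (aassoc c x n)); rewrite L e R.
Qed.

Definition tensor_br (c d : C) (nu : forall x, iso (c ⊗ x) (x ⊗ c))
    (mu : forall x, iso (d ⊗ x) (x ⊗ d)) (x : C) :
    iso ((c ⊗ d) ⊗ x) (x ⊗ (c ⊗ d)) :=
  iso_comp (assoc x c d)
    (iso_comp (fiso (act_right (d : regular C)) (nu x))
      (iso_comp (iso_inv (assoc c x d))
        (iso_comp (fiso (act_left (regular C) c) (mu x)) (assoc c d x)))).

Definition unit_br (x : C) : iso (tunit ⊗ x) (x ⊗ tunit) :=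
  iso_comp (iso_inv (runit x)) (lunit x).

Lemma tensor_brE (c d : C) (nu : forall x, iso (c ⊗ x) (x ⊗ c))
    (mu : forall x, iso (d ⊗ x) (x ⊗ d)) x :
  fwd (tensor_br nu mu x) = assoc x c d ∘ (nu x ⊗' idm d) ∘ bwd (assoc c x d)
    ∘ (idm c ⊗' mu x) ∘ assoc c d x.
Proof. by rewrite /= !compA. Qed.

Lemma act_tensor (c d : C) (nu : forall x, iso (c ⊗ x) (x ⊗ c))
    (mu : forall x, iso (d ⊗ x) (x ⊗ d)) (x : C) (n : N)
    (s : hom (c ▷ (x ▷ (d ▷ n))) (x ▷ (c ▷ (d ▷ n))))
    (t : hom (d ▷ (x ▷ n)) (x ▷ (d ▷ n)))
    (u : hom ((c ⊗ d) ▷ (x ▷ n)) (x ▷ ((c ⊗ d) ▷ n)))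
    (br : hom ((c ⊗ d) ⊗ x) (x ⊗ (c ⊗ d)))
    (brE : br = assoc x c d ∘ (nu x ⊗' idm d) ∘ bwd (assoc c x d)
      ∘ (idm c ⊗' mu x) ∘ assoc c d x)
    (sE : s ∘ aassoc c x (d ▷ n) = aassoc x c (d ▷ n) ∘ (nu x ▷' idm (d ▷ n)))
    (tE : t ∘ aassoc d x n = aassoc x d n ∘ (mu x ▷' idm n))
    (uE : u ∘ aassoc (c ⊗ d) x n = aassoc x (c ⊗ d) n ∘ (br ▷' idm n)) :
  s ∘ (idm c ▷' t) ∘ aassoc c d (x ▷ n) =
  (idm x ▷' aassoc c d n) ∘ u.
Proof.
apply: (iso_epic (aassoc (c ⊗ d) x n)).
rewrite -[RHS]compA uE brE !ahomMr !compA -apentagon.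
rewrite -(compA (fwd (aassoc x c (d ▷ n)))) aassoc_nat_id !compA -sE.
rewrite -[LHS]compA apentagon !compA -(compA s) -ahomMl tE ahomMl.
rewrite -!compA; congr (_ ∘ _); rewrite !compA; congr (_ ∘ _).
rewrite -(compA _ (idm c ▷' (mu x ▷' idm n))) -aassoc_natural !compA.
congr (_ ∘ _).
apply: (iso_epic (fiso (act_right n) (assoc c x d))) => /=.
rewrite -apentagon -[RHS]compA -ahomMr fwdK ahom1 compm1.
by [].
Qed.

Lemma act_tunit (x : C) (n : N) (s : hom (tunit ▷ (x ▷ n)) (x ▷ (tunit ▷ n)))
    (br : hom (tunit ⊗ x) (x ⊗ tunit)) (brE : br = bwd (runit x) ∘ lunit x)
    (sE : s ∘ aassoc tunit x n = aassoc x tunit n ∘ (br ▷' idm n)) :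
  (idm x ▷' aunit n) ∘ s = aunit (x ▷ n).
Proof.
apply: (iso_epic (aassoc tunit x n)).
rewrite -compA sE compA atriangle -ahomMr brE compA bwdK comp1m.
by rewrite aunit_assoc.
Qed.

End HalfBraiding.

Section Center.
Variables (k : fieldType) (C : monoidal k).

Lemma half_braiding_regular (c : C) (nu : forall x, iso (c ⊗ x) (x ⊗ c)) :
  is_modfun (F := act_left (regular C) c) (fun x n => act_str nu x n) ->
  half_braiding nu.
Proof.
have sE := act_strE (N := regular C) nu.
move=> [nN n2 n1]; split.
- move=> x y f; apply: tunit_faithful.
  exact: (act_nat_inv sE (nN x y tunit tunit f (idm tunit))).
- move=> x y; apply: tunit_faithful.
  exact: (proj1 (act_hex sE x y tunit) (n2 x y tunit)).
- apply: tunit_faithful.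
  exact: (proj1 (act_unit sE tunit) (n1 tunit)).
Qed.

Record center_ob := CenterOb {
  cob :> C;
  hbr : forall x, iso (cob ⊗ x) (x ⊗ cob);
  hbrP : half_braiding hbr }.

Record center_hom (c d : center_ob) := CenterHom {
  chom :> hom (cob c) (cob d);
  chomP : forall x,
    hbr d x ∘ (chom ⊗' idm x) = (idm x ⊗' chom) ∘ hbr c x }.

Lemma center_hom_eq c d (f g : center_hom c d) : chom f = chom g -> f = g.
Proof.
case: f g => [f fP] [g gP] /= e.
by case: _ / e in gP *; congr CenterHom; apply: Prop_irrelevance.
Qed.

Definition center_zero c d : center_hom c d.
Proof.
exists 0 => x.
rewrite (linear0 (@thom_linearl _ C _ _ _ _ _)).
rewrite (linear0 (@thom_linearr _ C _ _ _ _ _)).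
by rewrite (linear0 (comp_linearl _)) (linear0 (comp_linearr _)).
Defined.

Definition center_lin c d (a : k) (f g : center_hom c d) : center_hom c d.
Proof.
exists (a *: chom f + chom g) => x.
by rewrite thom_linearl thom_linearr comp_linearl comp_linearr !chomP.
Defined.

Definition center_lmod c d : lmodType k :=
  @sub_lmod k Datatypes.unit (fun => hom (cob c) (cob d)) (center_hom c d)
    (fun f => fun => chom f) (fun f g e => center_hom_eq (e tt))
    (center_zero c d) (@center_lin c d) (fun => erefl) (fun a f g => fun => erefl).

Definition center_id c : center_hom c c.
Proof. by exists (idm (cob c)) => x; rewrite !thom1 comp1m compm1. Defined.

Definition center_comp c d e (g : center_hom d e) (f : center_hom c d) :
  center_hom c e.
Proof.
exists (chom g ∘ f) => x.
rewrite -[idm x]comp1m !thomM compA chomP -compA chomP.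
by rewrite compA.
Defined.

Definition center_cat : category k.
Proof.
apply: (@Category k center_ob center_lmod center_id center_comp).
- by move=> c d e f u t s; apply: center_hom_eq; rewrite /= compA.
- by move=> c d f; apply: center_hom_eq; rewrite /= comp1m.
- by move=> c d f; apply: center_hom_eq; rewrite /= compm1.
- move=> c d e f a g h; apply: center_hom_eq => /=.
  by rewrite !(scale1r, addr0) comp_linearl.
- move=> c d e g a f h; apply: center_hom_eq => /=.
  by rewrite !(scale1r, addr0) comp_linearr.
Defined.

Section Action.
Variable N : modcat C.

Definition act_fun (c : center_ob) : modfun N N :=
  @Modfun _ _ N N (act_left N c) (fun x n => act_str (hbr c) x n)
    (act_str_modfun N (hbrP c)).

Definition act_nt (c d : center_ob) (f : center_hom c d) :
  modnat (act_fun c) (act_fun d).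
Proof.
exists (fun n => chom f ▷' idm n).
- by move=> m n g /=; rewrite -ahom_lr -ahom_rl.
- move=> x n; apply/(act_hom (act_strE (hbr c)) (act_strE (hbr d))).
  by rewrite chomP.
Defined.

End Action.

Lemma center_hom_regular (c d : center_ob) (f : hom (cob c) (cob d)) :
  is_modnat (fun x m => mstr (act_fun (regular C) c) x m)
    (fun x m => mstr (act_fun (regular C) d) x m)
    (fun n => f ▷' idm n) ->
  forall x, hbr d x ∘ (f ⊗' idm x) = (idm x ⊗' f) ∘ hbr c x.
Proof.
move=> fP x; apply: tunit_faithful.
have sE := act_strE (N := regular C) (hbr c).
have tE := act_strE (N := regular C) (hbr d).
exact: (proj1 (act_hom sE tE f x tunit) (fP x tunit)).
Qed.

Lemma act_tensor_modnat (N : modcat C) (c d : center_ob) :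
  @is_modnat _ _ N N (fun n => (c ⊗ d) ▷ n) (fun n => c ▷ (d ▷ n))
    (fun x n => act_str (tensor_br (hbr c) (hbr d)) x n)
    (fun x n => mstr (modfun_comp (act_fun N c) (act_fun N d)) x n)
    (fun n => aassoc c d n).
Proof.
move=> x n; apply: (act_tensor (br := tensor_br (hbr c) (hbr d) x)).
- exact: tensor_brE.
- exact: act_strE.
- exact: act_strE.
- exact: act_strE.
Qed.

Lemma act_tunit_modnat (N : modcat C) :
  @is_modnat _ _ N N (fun n => tunit ▷ n) (fun n => n)
    (fun x n => act_str (@unit_br k C) x n)
    (fun x n => mstr (modfun_id N) x n)
    (fun n => aunit n).
Proof.
move=> x n; rewrite [LHS]comp1m; symmetry.
by apply: (act_tunit (br := unit_br x)) => //; apply: act_strE.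
Qed.

Definition center_tensor (c d : center_ob) : center_ob.
Proof.
exists (c ⊗ d) (tensor_br (hbr c) (hbr d)).
apply: half_braiding_regular.
pose R := regular C; pose F := modfun_comp (act_fun R c) (act_fun R d).
refine (@is_modfun_transport k C R R (act_left R (c ⊗ d)) F _ _
  (fun n => @aassoc k C R c d n) _ (@act_tensor_modnat R c d) (mstrP F)).
move=> m n f; rewrite [fhom (act_left _ _) _]/= -thom1.
exact: (assoc_natural (idm (cob c)) (idm (cob d)) f).
Defined.

Definition center_unit : center_ob.
Proof.
exists tunit (@unit_br k C).
apply: half_braiding_regular.
pose R := regular C.
refine (@is_modfun_transport k C R R (act_left R tunit) (modfun_id R) _ _
  (fun n => @aunit k C R n) _ (@act_tunit_modnat R) (mstrP (modfun_id R))).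
exact: lunit_natural.
Defined.

Definition act_fun_tensor (N : modcat C) (c d : center_ob) :
  @iso k (modfun_cat N N) (act_fun N (center_tensor c d))
    (modfun_comp (act_fun N c) (act_fun N d)).
Proof.
refine (@modnat_iso _ _ N N (act_fun N (center_tensor c d))
  (modfun_comp (act_fun N c) (act_fun N d)) (fun n => aassoc c d n) _ _).
- by move=> m n f /=; rewrite -aassoc_natural thom1.
- exact: act_tensor_modnat.
Defined.

Definition act_fun_unit (N : modcat C) :
  @iso k (modfun_cat N N) (act_fun N center_unit) (modfun_id N).
Proof.
refine (@modnat_iso _ _ N N (act_fun N center_unit) (modfun_id N)
  (fun n => aunit n) _ _).
- by move=> m n f /=; rewrite aunit_natural.
- exact: act_tunit_modnat.
Defined.


Lemma center_homP (c d : center_ob) (f : hom (cob c) (cob d))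
    (t : modnat (act_fun (regular C) c) (act_fun (regular C) d)) :
  (forall n, t n = f ▷' idm n) ->
  forall x, hbr d x ∘ (f ⊗' idm x) = (idm x ⊗' f) ∘ hbr c x.
Proof.
move=> e; apply: center_hom_regular => x n.
by rewrite -!e; apply: nt_mod.
Qed.

Definition center_iso (c d : center_ob) (f : iso (cob c) (cob d))
    (fP : forall x, hbr d x ∘ (f ⊗' idm x) = (idm x ⊗' f) ∘ hbr c x) :
  @iso k center_cat c d.
Proof.
unshelve eexists (CenterHom fP : @hom _ center_cat c d) _.
- exists (bwd f) => x.
  apply: (iso_monic (fiso (act_left (regular C) x) f)).
  apply: (iso_epic (fiso (act_right (x : regular C)) f)) => /=.
  rewrite -!compA -thomM fwdK comp1m thom1 compm1 fP.
  by rewrite !compA -!thomM !comp1m bwdK comp1m.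
- by apply: center_hom_eq; rewrite /= fwdK.
- by apply: center_hom_eq; rewrite /= bwdK.
Defined.

Definition center_thom (c c' d d' : center_ob) (f : center_hom c c')
  (g : center_hom d d') : center_hom (center_tensor c d) (center_tensor c' d').
Proof.
pose R := regular C; exists (chom f ⊗' chom g).
pose t : modnat (act_fun R (center_tensor c d)) (act_fun R (center_tensor c' d')) :=
  modnat_comp (bwd (act_fun_tensor R c' d') : modnat _ _)
    (modnat_comp (modnat_hcomp (act_nt R f) (act_nt R g))
      (fwd (act_fun_tensor R c d) : modnat _ _)).
apply: (center_homP (t := t)) => n.
apply: (iso_monic (@aassoc k C R c' d' n)).
rewrite aassoc_natural ahom_lr /= !compA bwdK comp1m.
by [].
Defined.

Definition center_assoc (c d e : center_ob) : @iso k center_cat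
  (center_tensor (center_tensor c d) e) (center_tensor c (center_tensor d e)).
Proof.
refine (@center_iso (center_tensor (center_tensor c d) e)
  (center_tensor c (center_tensor d e)) (assoc (cob c) (cob d) (cob e)) _).
pose R := regular C; pose F := act_fun R.
pose t : modnat (F (center_tensor (center_tensor c d) e))
    (modfun_comp (F c) (modfun_comp (F d) (F e))) :=
  modnat_comp (fwd (dual_assoc (F c) (F d) (F e)) : modnat _ _)
    (modnat_comp (modnat_hcomp (fwd (act_fun_tensor R c d) : modnat _ _)
      (modnat_id (F e))) (fwd (act_fun_tensor R (center_tensor c d) e) : modnat _ _)).
pose u : modnat (modfun_comp (F c) (modfun_comp (F d) (F e)))
    (F (center_tensor c (center_tensor d e))) :=
  modnat_comp (bwd (act_fun_tensor R c (center_tensor d e)) : modnat _ _)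
    (modnat_hcomp (modnat_id (F c)) (bwd (act_fun_tensor R d e) : modnat _ _)).
apply: (center_homP (t := modnat_comp u t)) => n.
pose i := fiso (act_left R c) (@aassoc k C R d e n).
apply: (iso_monic (iso_comp i (@aassoc k C R c (d ⊗ e) n))).
rewrite /= !thom1 !(comp1m, compm1) !compA isoK.
by rewrite -thomM comp1m bwdK thom1 comp1m pentagon.
Defined.

Definition center_lunit (c : center_ob) :
  @iso k center_cat (center_tensor center_unit c) c.
Proof.
refine (@center_iso (center_tensor center_unit c) c (lunit (cob c)) _).
pose R := regular C; pose F := act_fun R.
pose t : modnat (F (center_tensor center_unit c)) (F c) :=
  modnat_comp (fwd (dual_lunit (F c)) : modnat _ _)
    (modnat_comp (modnat_hcomp (fwd (act_fun_unit R) : modnat _ _)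
      (modnat_id (F c))) (fwd (act_fun_tensor R center_unit c) : modnat _ _)).
apply: (center_homP (t := t)) => n.
by rewrite -(@aunit_assoc k C R) /= !comp1m.
Defined.

Definition center_runit (c : center_ob) :
  @iso k center_cat (center_tensor c center_unit) c.
Proof.
refine (@center_iso (center_tensor c center_unit) c (runit (cob c)) _).
pose R := regular C; pose F := act_fun R.
pose t : modnat (F (center_tensor c center_unit)) (F c) :=
  modnat_comp (fwd (dual_runit (F c)) : modnat _ _)
    (modnat_comp (modnat_hcomp (modnat_id (F c)) (fwd (act_fun_unit R) : modnat _ _))
      (fwd (act_fun_tensor R c center_unit) : modnat _ _)).
apply: (center_homP (t := t)) => n.
by rewrite -(@atriangle k C R) /= !(comp1m, compm1).
Defined.

Definition center : monoidal k.
Proof.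
apply: (@Monoidal k center_cat center_unit center_tensor center_thom _ _ _ _
  center_assoc center_lunit center_runit).
- by move=> c d; apply: center_hom_eq; rewrite /= thom1.
- by move=> c c' c'' d d' d'' f' f g' g; apply: center_hom_eq; rewrite /= thomM.
- move=> c c' d d' g a f h; apply: center_hom_eq => /=.
  by rewrite !(scale1r, addr0) thom_linearl.
- move=> c c' d d' g a f h; apply: center_hom_eq => /=.
  by rewrite !(scale1r, addr0) thom_linearr.
- move=> c c' d d' e e' f g h; apply: center_hom_eq.
  exact: assoc_natural.
- by move=> c d f; apply: center_hom_eq; apply: lunit_natural.
- by move=> c d f; apply: center_hom_eq; apply: runit_natural.
- by move=> c d e f; apply: center_hom_eq; apply: pentagon.
- by move=> c d; apply: center_hom_eq; apply: triangle.
Defined.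

Variables M N : modcat C.

Definition fun_act (c : center_ob) (H : modfun M N) : modfun M N :=
  modfun_comp (act_fun N c) H.

Definition fun_act_hom (c d : center_ob) (G H : modfun M N)
    (f : center_hom c d) (t : modnat G H) : modnat (fun_act c G) (fun_act d H) :=
  modnat_hcomp (act_nt N f) t.

Definition fun_assoc (c d : center_ob) (H : modfun M N) :
  @iso k (modfun_cat M N) (fun_act (center_tensor c d) H)
    (fun_act c (fun_act d H)).
Proof.
refine (@modnat_iso _ _ M N (fun_act (center_tensor c d) H)
  (fun_act c (fun_act d H)) (fun m => aassoc (cob c) (cob d) (H m)) _ _).
- by move=> m n f /=; rewrite -aassoc_natural thom1.
- move=> x m; pose T := fwd (act_fun_tensor N c d) : modnat _ _.
  have TP := is_modnat_whiskr (fun x m => mstr H x m) (nt_natural T) (nt_mod T).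
  by rewrite -[RHS]TP /str_comp /= !ahomMl !compA.
Defined.

Definition fun_unit (H : modfun M N) :
  @iso k (modfun_cat M N) (fun_act center_unit H) H.
Proof.
refine (@modnat_iso _ _ M N (fun_act center_unit H) H
  (fun m => aunit (H m)) _ _).
- by move=> m n f /=; rewrite aunit_natural.
- move=> x m; pose T := fwd (act_fun_unit N) : modnat _ _.
  have TP := is_modnat_whiskr (fun x m => mstr H x m) (nt_natural T) (nt_mod T).
  by rewrite -[RHS]TP /str_comp /= comp1m.
Defined.

Definition fun_modcat : modcat center.
Proof.
apply: (@Modcat k center (modfun_cat M N) fun_act fun_act_hom _ _ _ _
  fun_assoc fun_unit).
- by move=> c H; apply: modnat_eq => m /=; rewrite ahom1 comp1m.
- move=> c c' c'' F G H f' f t' t; apply: modnat_eq => m /=.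
  by rewrite -!ahom_lr ahomM.
- move=> c d G H t a f g; apply: modnat_eq => m /=.
  by rewrite !(scale1r, addr0) -!ahom_lr ahom_linearl.
- move=> c d G H f a t u; apply: modnat_eq => m /=.
  by rewrite !(scale1r, addr0) -!ahom_lr ahom_linearr.
- move=> c c' d d' G H f g t; apply: modnat_eq => m /=.
  by rewrite -!ahom_lr aassoc_natural.
- move=> G H t; apply: modnat_eq => m /=.
  by rewrite -ahom_lr aunit_natural.
- move=> c d e H; apply: modnat_eq => m /=.
  by rewrite -!ahom_lr apentagon.
- move=> c H; apply: modnat_eq => m /=.
  by rewrite -!ahom_lr atriangle.
Defined.


End Center.

(* Main.v *)
From HB Require Import structures.
From mathcomp Require Import all_boot all_algebra.
From mathcomp Require Import boolp.
Require Import Defs.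

Set Implicit Arguments.
Unset Strict Implicit.
Unset Printing Implicit Defensive.

Import GRing.Theory.
Local Open Scope ring_scope.
Local Open Scope cat_scope.


(** Write [FM] for the category of module functors from M to N and E for the category of its
    endofunctors over the centre. A module endofunctor X of N and a module endofunctor Y of M give
    the object [bim X Y] of E, namely H |-> X H Y. Morally E is a Deligne product of the two dual
    categories, so its distinguished object ought to be H |-> D_N H D_M, which is the identity when
    M and N are unimodular. No Deligne product is formed here. The end defining the distinguished
    object is compared directly with those of the dual categories of N and M, using three facts
    about the objects [bim X Y], where X and Y run through free module functors Hom(t, -) ▷ w and
    Hom(mu, -) ▷ P with t and P projective.

    Generation: every object of E is a quotient of some [bim X Y] ([fun_endo_generated]). Spanning:
    every map out of [bim X Y] into some [bim X' Y'] is a sum of products of a map X -> X' and a map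
    Y -> Y' ([bim_span], from [center_natural]). Independence: these products satisfy no unexpected
    relation for maps to the identity, because the unit of a finite tensor category is simple
    ([sub_unit], [bim_independent]). Hence Hom([bim X Y], id) is the tensor product of Hom(X, id)
    and Hom(Y, id).

    An end over a finite category can be computed on any family of objects that covers all others
    ([funiv_restrict], [funiv_extend]). On the family of the [bim X Y] the product of the universal
    wedges of the two dual categories is universal ([bim_univ]). Unimodularity lets both of those
    wedges start at the identity, so the product starts at the identity of [FM].

    Generation and spanning rest on induction to the centre. For q in C there is an object L(q) of
    the centre, the value of the left adjoint of the forgetful functor, such that module
    transformations L(q) ▷ F -> H are exactly the natural transformations q ▷ F -> H, module maps or
    not ([ind_act_adj]). So a functor out of [FM] over the centre feels all plain natural
    transformations ([transfer]). These are plentiful: for q projective, T = q ▷ F is exact with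
    projective values, and is therefore the direct sum of the functors Hom(P_j, -) ⊗ T(s_j), where
    P_j is the projective cover of the simple object s_j ([free_functor]; the field being
    algebraically closed makes End(s_j) one-dimensional). A plain transformation out of T can thus
    be prescribed freely on the spaces T(s_j). The same two facts show that L(q) ▷ F is projective
    for q projective, which makes [FM] an exact module category over the centre
    ([ind_act_projective], [fun_exact]). *)

Lemma dep_choice (I : Type) (T : I -> Type) (P : forall i, T i -> Prop) :
  (forall i, exists t, P i t) -> exists f, forall i, P i (f i).
Proof. by move=> h; exists (fun i => projT1 (cid (h i))) => i; case: cid. Qed.

(** * Linear algebra of finite-dimensional spaces *)

Section LinearMaps.
Variables (k : fieldType) (U V : lmodType k) (f : U -> V).
Hypothesis lf : linear f.

Lemma lin0 : f 0 = 0. Proof. exact: Defs.linear0. Qed.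
Lemma linD u v : f (u + v) = f u + f v.
Proof. by have := lf 1 u v; rewrite !scale1r. Qed.
Lemma linZ a u : f (a *: u) = a *: f u.
Proof. by have := lf a u 0; rewrite lin0 !addr0. Qed.
Lemma linN u : f (- u) = - f u.
Proof. by rewrite -scaleN1r linZ scaleN1r. Qed.
Lemma linB u v : f (u - v) = f u - f v.
Proof. by rewrite linD linN. Qed.
Lemma lin_sum (I : Type) (r : seq I) (F : I -> U) :
  f (\sum_(i <- r) F i) = \sum_(i <- r) f (F i).
Proof. by elim/big_rec2: _ => [|i y x _ <-]; rewrite ?lin0 ?linD. Qed.

End LinearMaps.

Section FiniteDimension.
Variable k : fieldType.
Implicit Types U V W : lmodType k.

Definition functional V (phi : V -> k) : Prop :=
  forall a u v, phi (a *: u + v) = a * phi u + phi v.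

Definition spans V n (b : 'I_n -> V) : Prop :=
  forall v, exists c : 'I_n -> k, v = \sum_i c i *: b i.

Definition independent V n (b : 'I_n -> V) : Prop :=
  forall c : 'I_n -> k, \sum_i c i *: b i = 0 -> forall i, c i = 0.

Definition submod V (S : V -> Prop) : Prop :=
  S 0 /\ forall a u v, S u -> S v -> S (a *: u + v).

Lemma functional0 V (phi : V -> k) : functional phi -> phi 0 = 0.
Proof. by move=> p; have := p (-1) 0 0; rewrite scaler0 addr0 mulN1r addNr. Qed.

Lemma functional_sum V (phi : V -> k) (I : Type) (r : seq I) (c : I -> k)
    (F : I -> V) : functional phi ->
  phi (\sum_(i <- r) c i *: F i) = \sum_(i <- r) c i * phi (F i).
Proof.
move=> p; elim/big_rec2: _ => [|i y x _ <-]; first exact: functional0.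
exact: p.
Qed.

Lemma submod_sum V (S : V -> Prop) (I : Type) (r : seq I) (c : I -> k)
    (F : I -> V) : submod S -> (forall i, S (F i)) ->
  S (\sum_(i <- r) c i *: F i).
Proof. by move=> [S0 SD] SF; elim/big_rec: _ => // i x _; apply: SD. Qed.

Lemma independent_le V m n (v : 'I_m -> V) (b : 'I_n -> V) :
  independent v -> spans b -> (m <= n)%N.
Proof.
move=> iv sb; rewrite leqNgt; apply/negP => lt_nm.
have [A Av] := choice (fun i => sb (v i)).
pose B := \matrix_(i < m, j < n) A i j.
have : kermx B != 0.
  by rewrite -mxrank_eq0 mxrank_ker subn_eq0 -ltnNge (leq_ltn_trans (rank_leq_col B)).
case/rowV0Pn => u /sub_kermxP uB; case/eqP; apply/rowP => i; rewrite mxE.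
apply: (iv (u 0)); under eq_bigr do rewrite Av scaler_sumr.
rewrite exchange_big big1 // => j _.
under eq_bigr do rewrite scalerA.
rewrite -scaler_suml; have := congr1 (fun C : 'rV_n => C 0 j) uB.
by rewrite !mxE; under eq_bigr do rewrite mxE; move=> ->; rewrite scale0r.
Qed.

Lemma spans_drop V n (b : 'I_n.+1 -> V) (c : 'I_n.+1 -> k) j :
  spans b -> \sum_i c i *: b i = 0 -> c j != 0 ->
  spans (fun i => b (lift j i)).
Proof.
move=> sb c0 cj v; have [d ->] := sb v.
exists (fun i => d (lift j i) - d j / c j * c (lift j i)).
have e : b j = - \sum_i (c (lift j i) / c j) *: b (lift j i).
  move: c0; rewrite (bigD1_ord j) //= => /eqP; rewrite addr_eq0 => /eqP e.
  rewrite -[b j]scale1r -(mulVf cj) -scalerA e scalerN scaler_sumr; congr (- _).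
  by apply: eq_bigr => i _; rewrite scalerA mulrC.
rewrite (bigD1_ord j) //= e scalerN scaler_sumr -sumrN -big_split /=.
apply: eq_bigr => i _; rewrite scalerA -scaleNr -scalerDl addrC.
by rewrite mulrCA mulrC.
Qed.

Lemma fd_basis V : finite_dimensional V ->
  exists n (b : 'I_n -> V), spans b /\ independent b.
Proof.
case=> n0 [b0 sb0].
have ex : exists n, `[< exists b : 'I_n -> V, spans b >].
  by exists n0; apply/asboolP; exists b0.
case: (ex_minnP ex) => n /asboolP [b sb] min; exists n, b; split=> // c c0 j.
apply/eqP; apply/negPn/negP => cj; case: n b c c0 j cj sb min => [|n] b c c0 j.
  by case: j.
move=> cj sb min; suff /min : `[< exists b : 'I_n -> V, spans b >] by rewrite ltnn.
by apply/asboolP; eexists; apply: spans_drop c0 cj.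
Qed.

Lemma fd_coord V : finite_dimensional V ->
  exists n (b : 'I_n -> V) (c : 'I_n -> V -> k),
    [/\ forall i, functional (c i), forall v, v = \sum_i c i v *: b i
      & forall i j, c i (b j) = (i == j)%:R].
Proof.
move=> /fd_basis [n [b [sb ib]]]; exists n, b.
have uniq (c d : 'I_n -> k) : \sum_i c i *: b i = \sum_i d i *: b i -> c =1 d.
  move=> e i; apply/eqP; rewrite -subr_eq0; apply/eqP.
  apply: (ib (fun i => c i - d i)).
  by under eq_bigr do rewrite scalerBl; rewrite sumrB e subrr.
have [c cE] := choice sb.
exists (fun i v => c v i); split=> //.
- move=> i a u v; apply: (uniq (c (a *: u + v)) (fun i => a * c u i + c v i)).
  rewrite -cE; under eq_bigr do rewrite scalerDl -scalerA.
  by rewrite big_split /= -scaler_sumr -!cE.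
- move=> i j; rewrite (uniq (c (b j)) (fun i => (i == j)%:R)) //.
  rewrite -cE (bigD1 j) //= eqxx scale1r big1 ?addr0 // => l /negbTE ->.
  by rewrite scale0r.
Qed.

(** In coordinates, take a square matrix of maximal rank among those whose rows represent elements
    of [S]. Adjoining the coordinates of a further element of [S] cannot raise the rank, so that
    element already lies in the row space. *)
Lemma fd_submod V (S : V -> Prop) : finite_dimensional V -> submod S ->
  exists n (b : 'I_n -> V), (forall i, S (b i)) /\
    forall v, S v -> exists c : 'I_n -> k, v = \sum_i c i *: b i.
Proof.
case=> n [b sb] subS; pose lc (x : 'rV[k]_n) := \sum_i x 0 i *: b i.
have lcS m (x : 'rV_m) (A : 'M_(m, n)) :
    (forall i, S (lc (row i A))) -> lc (x *m A) = \sum_i x 0 i *: lc (row i A).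
  move=> _; rewrite /lc; under [RHS]eq_bigr do rewrite scaler_sumr.
  rewrite exchange_big; apply: eq_bigr => j _; rewrite mxE scaler_suml.
  by apply: eq_bigr => i _; rewrite !mxE scalerA.
pose P r := `[< exists A : 'M[k]_n, (forall i, S (lc (row i A))) /\ \rank A = r >].
have exP : exists r, P r.
  exists 0%N; apply/asboolP; exists 0; rewrite mxrank0; split=> // i.
  by rewrite row0 /lc big1 => [|j _]; rewrite ?mxE ?scale0r //; case: subS.
have bP r : P r -> (r <= n)%N by move=> /asboolP [A [_ <-]]; apply: rank_leq_row.
case: (ex_maxnP exP bP) => r /asboolP [A [SA rA]] max.
exists n, (fun i => lc (row i A)); split=> // v Sv; have [c vE] := sb v.
pose x := \row_i c i; have xE : lc x = v.
  by rewrite vE; apply: eq_bigr => i _; rewrite mxE.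
have : (x <= A)%MS.
  have /max : P (\rank (A + x)%MS).
    apply/asboolP; exists (A + x)%MS; split=> // i.
    have /sub_addsmxP [[u1 u2] /= ->] := row_sub i (A + x)%MS.
    have e (y z : 'rV_n) : lc (y + z) = 1 *: lc y + lc z.
      rewrite scale1r /lc -big_split; apply: eq_bigr => j _.
      by rewrite mxE scalerDl.
    rewrite e (lcS _ u1 A) // (lcS _ u2 x) => [|j]; last by rewrite row_id xE.
    apply: (proj2 subS); first exact: submod_sum.
    by apply: submod_sum => // j; rewrite row_id xE.
  rewrite -rA => le; apply: (submx_trans (addsmxSr A x)).
  by have := mxrank_leqif_sup (addsmxSl A x) => /leqifP; case: ifP => // _; rewrite ltnNge le.
case/submxP => y e; exists (y 0); rewrite -xE e; exact: lcS.
Qed.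

Lemma fd_inj V W (f : V -> W) : linear f -> injective f ->
  finite_dimensional W -> finite_dimensional V.
Proof.
move=> lf fI fdW.
have subS : submod (fun w => exists v, w = f v).
  split; first by exists 0; rewrite lin0.
  by move=> a _ _ [u ->] [v ->]; exists (a *: u + v); rewrite lf.
have [n [b [/choice [g bE] sb]]] := fd_submod fdW subS.
exists n, g => v; have [c e] := sb (f v) (ex_intro _ v erefl).
exists c; apply: fI; rewrite e lin_sum //.
by apply: eq_bigr => i _; rewrite linZ // bE.
Qed.

Lemma fd_surj V W (f : V -> W) : linear f -> (forall w, exists v, f v = w) ->
  finite_dimensional V -> finite_dimensional W.
Proof.
move=> lf fS [n [b sb]]; exists n, (f \o b) => w; have [v <-] := fS w.
have [c ->] := sb v; exists c; rewrite lin_sum //.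
by apply: eq_bigr => i _; rewrite linZ.
Qed.

(** The missed vector [w], together with the image of a basis of [V], is still independent in [W].
    This strict drop of dimension is what makes the minimality and length arguments in finite
    categories work. *)
Lemma spans_proper V W n (f : V -> W) (b : 'I_n.+1 -> W) (w : W) :
  linear f -> injective f -> (forall v, f v <> w) -> spans b ->
  exists r (c : 'I_r -> V), (r <= n)%N /\ spans c.
Proof.
move=> lf fI nw sb.
have fdV : finite_dimensional V by apply: fd_inj lf fI _; exists n.+1, b.
have [r [c [sc ic]]] := fd_basis fdV; exists r, c; split=> //.
pose d (i : 'I_r.+1) := if unlift ord0 i is Some j then f (c j) else w.
have id : independent d.
  move=> a; rewrite big_ord_recl /d unlift_none.
  under eq_bigr do rewrite liftK -linZ //.
  rewrite -lin_sum // => e.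
  have a0 : a ord0 = 0.
    apply/eqP; apply/negPn/negP => a0.
    case: (nw (- (a ord0)^-1 *: \sum_j a (lift ord0 j) *: c j)).
    move/eqP: e; rewrite addr_eq0 => /eqP e; rewrite linZ // -[f _]opprK -e.
    by rewrite scaleNr scalerN opprK scalerA mulVf // scale1r.
  move=> i; case: (unliftP ord0 i) => [j ->|->] //.
  apply: (ic (fun j => a (lift ord0 j))); apply: fI.
  by rewrite lin0 // -e a0 scale0r add0r.
exact: independent_le id sb.
Qed.

(** Exactness of duality: a functional that vanishes on the kernel of [D] extends from the image of
    [D] to [W]. It is the source of injective objects below and of functionals on tensor
    products. *)
Lemma functional_factor V W (D : V -> W) (phi : V -> k) :
  finite_dimensional V -> finite_dimensional W -> linear D -> functional phi ->
  (forall v, D v = 0 -> phi v = 0) ->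
  exists psi, functional psi /\ forall v, psi (D v) = phi v.
Proof.
move=> [n [b sb]] /fd_coord [m [w [c [cf cE _]]]] lD fphi van.
pose B := \matrix_(i < n, j < m) c j (D (b i)); pose p := \col_i phi (b i).
have [x xE] : exists x : 'cV_m, B *m x = p.
  suff /submxP [x xE] : (p^T <= B^T)%MS.
    by exists x^T; rewrite -[B]trmxK -trmx_mul -xE trmxK.
  rewrite submxE; apply/eqP; apply/matrixP => i j.
  (* Solvability is tested on the cokernel of [B^T]: each of its columns is the coordinate vector of
     some [v] with [D v = 0], and the hypothesis makes [phi] vanish there. *)
  pose K := cokermx B^T; have BK : B^T *m K = 0 by apply: mulmx_coker.
  pose v := \sum_l K l j *: b l.
  have Dv : D v = 0.
    rewrite [D v]cE; apply: big1 => l _.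
    suff -> : c l (D v) = 0 by rewrite scale0r.
    rewrite (lin_sum lD); under eq_bigr do rewrite (linZ lD).
    rewrite functional_sum //; have e := congr1 (fun C : 'M_(m, _) => C l j) BK.
    rewrite !mxE in e; rewrite -[RHS]e; apply: eq_bigr => t _.
    by rewrite !mxE mulrC.
  have := van v Dv; rewrite functional_sum // => e; rewrite !mxE -[RHS]e.
  by apply: eq_bigr => l _; rewrite !mxE mulrC.
exists (fun w => \sum_j c j w * x j 0); split.
- move=> a u v; rewrite mulr_sumr -big_split; apply: eq_bigr => j _.
  by rewrite cf mulrDl mulrA.
- have f2 : functional (fun v => \sum_j c j (D v) * x j 0).
    move=> a u v; rewrite mulr_sumr -big_split; apply: eq_bigr => j _.
    by rewrite lD cf mulrDl mulrA.
  move=> v; have [d ->] := sb v; rewrite (functional_sum _ d b f2) (functional_sum _ d b fphi).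
  apply: eq_bigr => i _; congr (_ * _).
  have := congr1 (fun C : 'cV_n => C i 0) xE; rewrite !mxE => <-.
  by apply: eq_bigr => j _; rewrite mxE.
Qed.

Lemma functional_separate V (v : V) : finite_dimensional V ->
  (forall phi : V -> k, functional phi -> phi v = 0) -> v = 0.
Proof.
move=> /fd_coord [n [b [c [cf cE _]]]] h; rewrite [v]cE big1 // => i _.
by rewrite h ?scale0r.
Qed.

Definition dual_zero V : {phi : V -> k | functional phi}.
Proof. by exists (fun => 0) => a u v; rewrite mulr0 addr0. Defined.

Definition dual_lin V (a : k) (s t : {phi : V -> k | functional phi}) :
  {phi : V -> k | functional phi}.
Proof.
exists (fun v => a * sval s v + sval t v) => b u v.
rewrite (svalP s) (svalP t) !mulrDr !mulrA [a * b]mulrC.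
by rewrite -!addrA; congr (_ + _); rewrite addrCA.
Defined.

Lemma dual_inj V (s t : {phi : V -> k | functional phi}) :
  (forall v, sval s v = sval t v) -> s = t.
Proof.
case: s t => [s ps] [t pt] /= e; have {}e : s = t by apply/funext.
by case: _ / e in pt *; congr exist; apply: Prop_irrelevance.
Qed.

Definition dual_lmod V : lmodType k :=
  @sub_lmod k V (fun => k^o) {phi : V -> k | functional phi} (fun s => sval s)
    (@dual_inj V) (dual_zero V) (@dual_lin V) (fun => erefl) (fun a s t => fun => erefl).

Lemma dual_fd V : finite_dimensional V -> finite_dimensional (dual_lmod V).
Proof.
move=> fdV; have [n [b [c [cf cE cb]]]] := fd_coord fdV.
exists n, (fun i => exist _ (c i) (cf i) : dual_lmod V) => phi.
exists (fun i => sval (phi : {phi | _}) (b i)); apply: dual_inj => v.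
have -> : forall r, sval (\sum_(i <- r) sval (phi : {phi | _}) (b i) *:
    (exist _ (c i) (cf i) : dual_lmod V) : {phi | functional phi}) v =
    \sum_(i <- r) sval (phi : {phi | _}) (b i) * c i v.
  elim=> [|i r IH]; first by rewrite !big_nil.
  by rewrite !big_cons -IH /= mul1r addr0.
rewrite {1}[v]cE functional_sum; last exact: (svalP (phi : {phi | _})).
by apply: eq_bigr => i _; rewrite mulrC.
Qed.

End FiniteDimension.

(** * Linear and abelian categories *)

Section Composition.
Variables (k : fieldType) (A : category k).
Implicit Types x y z : A.

Lemma compDl x y z (g h : hom y z) (f : hom x y) : (g + h) ∘ f = g ∘ f + h ∘ f.
Proof. exact: linD (comp_linearl f) g h. Qed.
Lemma compDr x y z (g : hom y z) (f h : hom x y) : g ∘ (f + h) = g ∘ f + g ∘ h.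
Proof. exact: linD (comp_linearr g) f h. Qed.
Lemma comp0l x y z (f : hom x y) : (0 : hom y z) ∘ f = 0.
Proof. exact: lin0 (comp_linearl f). Qed.
Lemma comp0r x y z (g : hom y z) : g ∘ (0 : hom x y) = 0.
Proof. exact: lin0 (comp_linearr g). Qed.
Lemma compNl x y z (g : hom y z) (f : hom x y) : (- g) ∘ f = - (g ∘ f).
Proof. exact: linN (comp_linearl f) g. Qed.
Lemma compNr x y z (g : hom y z) (f : hom x y) : g ∘ (- f) = - (g ∘ f).
Proof. exact: linN (comp_linearr g) f. Qed.
Lemma compBl x y z (g h : hom y z) (f : hom x y) : (g - h) ∘ f = g ∘ f - h ∘ f.
Proof. by rewrite compDl compNl. Qed.
Lemma compBr x y z (g : hom y z) (f h : hom x y) : g ∘ (f - h) = g ∘ f - g ∘ h.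
Proof. by rewrite compDr compNr. Qed.
Lemma compZl x y z a (g : hom y z) (f : hom x y) : (a *: g) ∘ f = a *: (g ∘ f).
Proof. exact: linZ (comp_linearl f) a g. Qed.
Lemma compZr x y z a (g : hom y z) (f : hom x y) : g ∘ (a *: f) = a *: (g ∘ f).
Proof. exact: linZ (comp_linearr g) a f. Qed.
Lemma comp_suml x y z (I : Type) (r : seq I) (g : I -> hom y z) (f : hom x y) :
  (\sum_(i <- r) g i) ∘ f = \sum_(i <- r) (g i ∘ f).
Proof. exact: (lin_sum (comp_linearl f)). Qed.
Lemma comp_sumr x y z (I : Type) (r : seq I) (g : hom y z) (f : I -> hom x y) :
  g ∘ (\sum_(i <- r) f i) = \sum_(i <- r) (g ∘ f i).
Proof. exact: (lin_sum (comp_linearr g)). Qed.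

Lemma is_zeroP x : is_zero x -> (forall y (f : hom x y), f = 0) /\
  (forall y (f : hom y x), f = 0).
Proof.
move=> zx; split=> y f; first by rewrite -[f]compm1 zx comp0r.
by rewrite -[f]comp1m zx comp0l.
Qed.

Lemma monoP x y (f : hom x y) :
  mono f <-> forall w (g : hom w x), f ∘ g = 0 -> g = 0.
Proof.
split=> [mf w g e|h w g g' e]; first by apply: mf; rewrite e comp0r.
by apply/eqP; rewrite -subr_eq0; apply/eqP/h; rewrite compBr e subrr.
Qed.

Lemma epiP x y (f : hom x y) :
  epi f <-> forall w (g : hom y w), g ∘ f = 0 -> g = 0.
Proof.
split=> [ef w g e|h w g g' e]; first by apply: ef; rewrite e comp0l.
by apply/eqP; rewrite -subr_eq0; apply/eqP/h; rewrite compBl e subrr.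
Qed.

Lemma mono_comp x y z (g : hom y z) (f : hom x y) : mono g -> mono f -> mono (g ∘ f).
Proof. by move=> mg mf w u v; rewrite -!compA => /mg /mf. Qed.
Lemma epi_comp x y z (g : hom y z) (f : hom x y) : epi g -> epi f -> epi (g ∘ f).
Proof. by move=> eg ef w u v; rewrite !compA => /ef /eg. Qed.
Lemma mono_cancel x y z (g : hom y z) (f : hom x y) : mono (g ∘ f) -> mono f.
Proof. by move=> m w u v e; apply: m; rewrite -!compA e. Qed.
Lemma epi_cancel x y z (g : hom y z) (f : hom x y) : epi (g ∘ f) -> epi g.
Proof. by move=> m w u v e; apply: m; rewrite !compA e. Qed.

Lemma iso_mono x y (i : iso x y) : mono i.
Proof. by move=> w g h; apply: iso_monic. Qed.
Lemma iso_epi x y (i : iso x y) : epi i.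
Proof. by move=> w g h; apply: iso_epic. Qed.

Lemma retract_mono x y (r : hom y x) (i : hom x y) : r ∘ i = idm x -> mono i.
Proof. by move=> e w u v h; rewrite -[u]comp1m -[v]comp1m -e -!compA h. Qed.
Lemma retract_epi x y (r : hom y x) (i : hom x y) : r ∘ i = idm x -> epi r.
Proof. by move=> e w u v h; rewrite -[u]compm1 -[v]compm1 -e !compA h. Qed.

Lemma is_iso_iso x y (f : hom x y) : is_iso f -> exists i : iso x y, fwd i = f.
Proof. by move=> [g [e1 e2]]; exists (Iso e1 e2). Qed.

Lemma kernel_mono x y z (i : hom x y) (f : hom y z) : is_kernel i f -> mono i.
Proof.
move=> [fi U] w g h e; have [|u [_ Uu]] := U w (i ∘ g).
  by rewrite compA fi comp0l.
by rewrite -(Uu g) // -(Uu h).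
Qed.

Lemma cokernel_epi x y z (f : hom x y) (p : hom y z) : is_cokernel f p -> epi p.
Proof.
move=> [pf U] w g h e; have [|u [_ Uu]] := U w (g ∘ p).
  by rewrite -compA pf comp0r.
by rewrite -(Uu g) // -(Uu h).
Qed.

Lemma is_kernelP x y z (i : hom x y) (f : hom y z) :
  mono i -> f ∘ i = 0 -> (forall w (g : hom w y), f ∘ g = 0 -> exists u, i ∘ u = g) ->
  is_kernel i f.
Proof.
move=> mi fi U; split=> // w g fg; have [u iu] := U w g fg.
by exists u; split=> // v iv; apply: mi; rewrite iu iv.
Qed.

Lemma is_cokernelP x y z (f : hom x y) (p : hom y z) :
  epi p -> p ∘ f = 0 -> (forall w (g : hom y w), g ∘ f = 0 -> exists u, u ∘ p = g) ->
  is_cokernel f p.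
Proof.
move=> ep pf U; split=> // w g gf; have [u up] := U w g gf.
by exists u; split=> // v vp; apply: ep; rewrite up vp.
Qed.

Lemma kernel_lift x y z (i : hom x y) (f : hom y z) w (g : hom w y) :
  is_kernel i f -> f ∘ g = 0 -> exists u, i ∘ u = g.
Proof. by move=> [_ U] /U [u [e _]]; exists u. Qed.

Lemma cokernel_desc x y z (f : hom x y) (p : hom y z) w (g : hom y w) :
  is_cokernel f p -> g ∘ f = 0 -> exists u, u ∘ p = g.
Proof. by move=> [_ U] /U [u [e _]]; exists u. Qed.

Lemma zero_mono x y (f : hom x y) : mono f -> f = 0 -> is_zero x.
Proof. by move=> mf f0; apply: mf; rewrite f0 !comp0l. Qed.

Lemma zero_epi x y (f : hom x y) : epi f -> f = 0 -> is_zero y.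
Proof. by move=> mf f0; apply: mf; rewrite f0 !comp0r. Qed.

Lemma projective_retract x y (r : hom y x) (i : hom x y) :
  r ∘ i = idm x -> projective y -> projective x.
Proof.
move=> ri py u v e f ee; have [g ge] := py _ _ e (f ∘ r) ee.
by exists (g ∘ i); rewrite compA ge -compA ri compm1.
Qed.

Lemma projective_split x y (e : hom y x) :
  projective x -> epi e -> exists s, e ∘ s = idm x.
Proof. by move=> px ee; apply: px. Qed.

End Composition.

Arguments iso_mono {k A x y} i.
Arguments iso_epi {k A x y} i.

Section Opposite.
Variables (k : fieldType) (A : category k).

Definition op : category k.
Proof.
apply: (@Category k A (fun x y => hom y x) (fun x => idm x) (fun x y z g f => f ∘ g)).
- by move=> w x y z h g f; rewrite compA.
- by move=> x y f; rewrite compm1.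
- by move=> x y f; rewrite comp1m.
- by move=> x y z f a g h; rewrite comp_linearr.
- by move=> x y z g a f h; rewrite comp_linearl.
Defined.

Lemma op_abelian : abelian_category A -> abelian_category op.
Proof.
move=> [[z zz] bi kc mk ec]; split.
- by exists z.
- move=> x y; have [s [i1 [i2 [p1 [p2 [e1 e2 e3 e4 e5]]]]]] := bi x y.
  by exists s, p1, p2, i1, i2; split.
- by move=> x y f; have [kf cf] := kc y x f; split.
- by move=> x y f mf; apply: ec.
- by move=> x y f mf; apply: mk.
Qed.

End Opposite.

Section AbelianFacts.
Variables (k : fieldType) (A : category k) (abA : abelian_category A).
Implicit Types x y z : A.

Lemma kernel_ex x y (f : hom x y) : exists w (i : hom w x), is_kernel i f.
Proof. by case: abA => _ _ kc _ _; case: (kc x y f). Qed.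
Lemma cokernel_ex x y (f : hom x y) : exists w (p : hom y w), is_cokernel f p.
Proof. by case: abA => _ _ kc _ _; case: (kc x y f). Qed.

Lemma mono_kernel_cokernel x y z (i : hom x y) (p : hom y z) :
  mono i -> is_cokernel i p -> is_kernel i p.
Proof.
move=> mi cp; case: abA => _ _ _ mk _; have [w [g kg]] := mk _ _ i mi.
case: (cp) => pi _; apply: is_kernelP => // w' h ph.
have [u ug] : exists u, u ∘ p = g by apply: cokernel_desc cp _; case: kg.
by apply: kernel_lift kg _; rewrite -ug -compA ph comp0r.
Qed.

Lemma epi_cokernel_kernel x y z (i : hom x y) (p : hom y z) :
  epi p -> is_kernel i p -> is_cokernel i p.
Proof.
move=> ep ki; case: abA => _ _ _ _ ec; have [w [g cg]] := ec _ _ p ep.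
case: (ki) => pi _; apply: is_cokernelP => // w' h hi.
have [u iu] : exists u, i ∘ u = g by apply: kernel_lift ki _; case: cg.
by apply: cokernel_desc cg _; rewrite -iu compA hi comp0l.
Qed.

Lemma mono_short_exact x y (i : hom x y) : mono i ->
  exists z (p : hom y z), short_exact i p.
Proof.
move=> mi; have [z [p cp]] := cokernel_ex i; exists z, p; split=> //.
exact: mono_kernel_cokernel.
Qed.

Lemma epi_short_exact y z (p : hom y z) : epi p ->
  exists x (i : hom x y), short_exact i p.
Proof.
move=> ep; have [x [i ki]] := kernel_ex p; exists x, i; split=> //.
exact: epi_cokernel_kernel.
Qed.

Lemma mono_epi_iso x y (f : hom x y) : mono f -> epi f -> is_iso f.
Proof.
move=> mf ef; have [z [p [kf cp]]] := mono_short_exact mf.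
have p0 : p = 0 by apply: ef; case: cp => -> _; rewrite comp0l.
have [u fu] : exists u, f ∘ u = idm y.
  by apply: kernel_lift kf _; rewrite p0 comp0l.
by exists u; split=> //; apply: mf; rewrite compA fu comp1m compm1.
Qed.

(** The image is the kernel of the cokernel [p] of [f]. If [g] kills [e], then [f] factors through
    [i ∘ j] with [j] the kernel of [g]; the cokernel of [i ∘ j] factors through [p], so it kills
    [i], and [j] is split epi. *)
Lemma image_ex x y (f : hom x y) :
  exists w (i : hom w y) (e : hom x w), [/\ mono i, epi e & f = i ∘ e].
Proof.
have [z [p cp]] := cokernel_ex f; have [w [i ki]] := kernel_ex p.
have [e ie] : exists e, i ∘ e = f by apply: kernel_lift ki _; case: cp.
exists w, i, e; split=> //; first exact: kernel_mono ki.
apply/epiP => v g ge.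
have [w' [j kj]] := kernel_ex g; have mj := kernel_mono kj.
have [e' je'] : exists e', j ∘ e' = e by exact: kernel_lift kj ge.
have mij : mono (i ∘ j) by apply: mono_comp mj; apply: kernel_mono ki.
have [c [q [kq cq]]] := mono_short_exact mij.
have [u up] : exists u, u ∘ p = q.
  apply: cokernel_desc cp _; rewrite -ie -je' [i ∘ _]compA compA.
  by case: kq => -> _; rewrite comp0l.
have [s ijs] : exists s, (i ∘ j) ∘ s = i.
  apply: kernel_lift kq _; rewrite -up -compA.
  by case: ki => -> _; rewrite comp0r.
have js : j ∘ s = idm w by apply: (kernel_mono ki); rewrite compA ijs compm1.
by rewrite -[g]compm1 -js compA; case: kj => -> _; rewrite comp0l.
Qed.

Lemma kernel_zero_mono x y z (i : hom x y) (f : hom y z) :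
  is_kernel i f -> is_zero x -> mono f.
Proof.
move=> ki zx; apply/monoP => w g fg; have [u <-] := kernel_lift ki fg.
by rewrite (proj2 (is_zeroP zx) _ u) comp0r.
Qed.

Lemma cokernel_zero_epi x y z (f : hom x y) (p : hom y z) :
  is_cokernel f p -> is_zero z -> epi f.
Proof.
move=> ki zx; apply/epiP => w g fg; have [u <-] := cokernel_desc ki fg.
by rewrite (proj1 (is_zeroP zx) _ u) comp0l.
Qed.

Lemma short_exactP x y z (i : hom x y) (p : hom y z) :
  short_exact i p <-> is_kernel i p /\ epi p.
Proof.
split=> [[ki cp]|[ki ep]]; first by split=> //; apply: cokernel_epi cp.
by split=> //; apply: epi_cokernel_kernel.
Qed.

Definition bigsum n (x : 'I_n -> A) s (i : forall j, hom (x j) s)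
    (p : forall j, hom s (x j)) : Prop :=
  (forall j l, j != l -> p j ∘ i l = 0) /\ (forall j, p j ∘ i j = idm (x j)) /\
  \sum_j i j ∘ p j = idm s.

Lemma bigsum_ex n (x : 'I_n -> A) : exists s i p, @bigsum n x s i p.
Proof.
elim: n x => [|n IH] x.
  case: abA => -[z zz] _ _ _ _.
  exists z, (fun j => 0), (fun j => 0); split; first by case.
  by split; [case|rewrite big_ord0 zz].
have [s [i [p [o [e1 e2]]]]] := IH (fun j => x (lift ord0 j)).
case: abA => _ bi _ _ _.
have [t [i1 [i2 [p1 [p2 [E1 E2 E3 E4 E5]]]]]] := bi (x ord0) s.
(* The components live in types depending on the index, so the split between index 0 and the others
   transports along the equality returned by [unliftP]. *)
pose I j : hom (x j) t := match unliftP ord0 j with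
  | UnliftSome l e => ecast j (hom (x j) t) (esym e) (i2 ∘ i l)
  | UnliftNone e => ecast j (hom (x j) t) (esym e) i1 end.
pose P j : hom t (x j) := match unliftP ord0 j with
  | UnliftSome l e => ecast j (hom t (x j)) (esym e) (p l ∘ p2)
  | UnliftNone e => ecast j (hom t (x j)) (esym e) p1 end.
have I0 : I ord0 = i1.
  rewrite /I; case: (unliftP ord0 ord0) => [l e|e].
    by case/eqP: (neq_lift ord0 l).
  by rewrite (eq_irrelevance e erefl).
have P0 : P ord0 = p1.
  rewrite /P; case: (unliftP ord0 ord0) => [l e|e].
    by case/eqP: (neq_lift ord0 l).
  by rewrite (eq_irrelevance e erefl).
have IS l : I (lift ord0 l) = i2 ∘ i l.
  rewrite /I; case: (unliftP ord0 (lift ord0 l)) => [l' e|e].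
    have e' := lift_inj e; case: _ / e' in e *.
    by rewrite (eq_irrelevance e erefl).
  by case/eqP: (neq_lift ord0 l); apply: esym.
have PS l : P (lift ord0 l) = p l ∘ p2.
  rewrite /P; case: (unliftP ord0 (lift ord0 l)) => [l' e|e].
    have e' := lift_inj e; case: _ / e' in e *.
    by rewrite (eq_irrelevance e erefl).
  by case/eqP: (neq_lift ord0 l); apply: esym.
exists t, I, P; split=> [j l|]; last split=> [j|].
- case: (unliftP ord0 j) => [j' ->|->]; case: (unliftP ord0 l) => [l' ->|->].
  + rewrite (inj_eq lift_inj) PS IS => /o e.
    by rewrite -compA (compA p2) E2 comp1m.
  + by rewrite PS I0 -compA E4 comp0r.
  + by rewrite P0 IS compA E3 comp0l.
  + by rewrite eqxx.
- case: (unliftP ord0 j) => [j' ->|->]; last by rewrite P0 I0.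
  by rewrite PS IS -compA (compA p2) E2 comp1m.
- rewrite big_ord_recl I0 P0.
  under eq_bigr do rewrite IS PS -compA (compA (i _)).
  by rewrite -comp_sumr -comp_suml e2 comp1m.
Qed.

Lemma bigsum_proj n (x : 'I_n -> A) s i p : @bigsum n x s i p ->
  (forall j, projective (x j)) -> projective s.
Proof.
move=> [_ [_ e]] px y z g f eg.
have [h hE] := dep_choice (fun j => px j _ _ g (f ∘ i j) eg).
exists (\sum_j h j ∘ p j); rewrite comp_sumr.
under eq_bigr do rewrite compA hE -compA.
by rewrite -comp_sumr e compm1.
Qed.

Lemma bigsum_pi n (x : 'I_n -> A) s i p w (f : forall j, hom w (x j)) l :
  @bigsum n x s i p -> p l ∘ (\sum_j i j ∘ f j) = f l.
Proof.
move=> [o [e _]]; rewrite comp_sumr (bigD1 l) //= compA e comp1m big1 ?addr0 //.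
by move=> j nj; rewrite compA o ?comp0l // eq_sym.
Qed.

Lemma bigsum_in n (x : 'I_n -> A) s i p w (f : forall j, hom (x j) w) l :
  @bigsum n x s i p -> (\sum_j f j ∘ p j) ∘ i l = f l.
Proof.
move=> [o [e _]]; rewrite comp_suml (bigD1 l) //= -compA e compm1 big1 ?addr0 //.
by move=> j nj; rewrite -compA o ?comp0r.
Qed.

Lemma short_exact_split x y z (i : hom x y) (p : hom y z) (s : hom z y) :
  short_exact i p -> p ∘ s = idm z ->
  exists r : hom y x, [/\ r ∘ i = idm x, r ∘ s = 0 & i ∘ r + s ∘ p = idm y].
Proof.
move=> [ki _] ps; have mi := kernel_mono ki.
have [r ir] : exists r, i ∘ r = idm y - s ∘ p.
  by apply: kernel_lift ki _; rewrite compBr compm1 compA ps comp1m subrr.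
exists r; split; last by rewrite ir subrK.
- by apply: mi; rewrite compA ir compBl comp1m compm1 -compA; case: ki => -> _;
    rewrite comp0r subr0.
- by apply: mi; rewrite compA ir compBl comp1m -compA ps compm1 subrr comp0r.
Qed.

Lemma split_short_exact x y z (i : hom x y) (p : hom y z) r s :
  r ∘ i = idm x -> p ∘ s = idm z -> p ∘ i = 0 -> i ∘ r + s ∘ p = idm y ->
  short_exact i p.
Proof.
move=> ri ps pi e; apply/short_exactP; split; last exact: retract_epi ps.
apply: is_kernelP (retract_mono ri) pi _ => w g pg; exists (r ∘ g).
by rewrite compA -[i ∘ r](addrK (s ∘ p)) e compBl comp1m -compA pg comp0r subr0.
Qed.

End AbelianFacts.

(** * Linear and exact functors *)

Section FunctorLinear.
Variables (k : fieldType) (A B : category k) (F : functor A B).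
Implicit Types x y : A.

Lemma fhom0 x y : fhom F (0 : hom x y) = 0.
Proof. exact: lin0 (fhom_linear F (x:=x) (y:=y)). Qed.
Lemma fhomD x y (f g : hom x y) : fhom F (f + g) = fhom F f + fhom F g.
Proof. exact: linD (fhom_linear F (x:=x) (y:=y)) f g. Qed.
Lemma fhomB x y (f g : hom x y) : fhom F (f - g) = fhom F f - fhom F g.
Proof. exact: linB (fhom_linear F (x:=x) (y:=y)) f g. Qed.
Lemma fhomZ x y a (f : hom x y) : fhom F (a *: f) = a *: fhom F f.
Proof. exact: linZ (fhom_linear F (x:=x) (y:=y)) a f. Qed.
Lemma fhom_sum x y (I : Type) (r : seq I) (f : I -> hom x y) :
  fhom F (\sum_(i <- r) f i) = \sum_(i <- r) fhom F (f i).
Proof. exact: (lin_sum (fhom_linear F (x:=x) (y:=y))). Qed.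

Lemma fhom_zero x : is_zero x -> is_zero (F x).
Proof. by rewrite /is_zero -fhom1 => ->; rewrite fhom0. Qed.

Lemma fhom_split x y z (i : hom x y) (p : hom y z) r s :
  abelian_category B ->
  r ∘ i = idm x -> p ∘ s = idm z -> p ∘ i = 0 -> i ∘ r + s ∘ p = idm y ->
  short_exact (fhom F i) (fhom F p).
Proof.
move=> abB ri ps pi e.
apply: (split_short_exact abB (r := fhom F r) (s := fhom F s)).
- by rewrite -fhomM ri fhom1.
- by rewrite -fhomM ps fhom1.
- by rewrite -fhomM pi fhom0.
- by rewrite -!fhomM -fhomD e fhom1.
Qed.

End FunctorLinear.

Section ExactFunctor.
Variables (k : fieldType) (A B : category k) (F : functor A B).
Hypotheses (abA : abelian_category A) (eF : exact_functor F).
Implicit Types x y : A.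

Lemma exact_mono x y (f : hom x y) : mono f -> mono (fhom F f).
Proof. by move=> /(mono_short_exact abA) [z [p /eF [kf _]]]; apply: kernel_mono kf. Qed.

Lemma exact_epi x y (f : hom x y) : epi f -> epi (fhom F f).
Proof. by move=> /(epi_short_exact abA) [z [p /eF [_ cf]]]; apply: cokernel_epi cf. Qed.

(** Exactness only speaks of short exact sequences; the kernel of [f] is that of the epi part of its
    image factorisation, and the mono part stays mono. *)
Lemma exact_kernel x y z (i : hom x y) (f : hom y z) :
  is_kernel i f -> is_kernel (fhom F i) (fhom F f).
Proof.
move=> ki; have [w [m [e [mm ee fE]]]] := image_ex abA f.
have /eF [kFi _] : short_exact i e.
  apply/(short_exactP abA); split=> //; apply: is_kernelP (kernel_mono ki) _ _.
    by apply: mm; rewrite compA -fE comp0r; case: ki.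
  by move=> w' g eg; apply: kernel_lift ki _; rewrite fE -compA eg comp0r.
have mFm := exact_mono mm; case: (kFi) => e0 _.
apply: is_kernelP (kernel_mono kFi) _ _; first by rewrite fE fhomM -compA e0 comp0r.
move=> w' g fg; apply: kernel_lift kFi _; apply: mFm.
by rewrite compA -fhomM -fE fg comp0r.
Qed.

Lemma exact_cokernel x y z (f : hom x y) (p : hom y z) :
  is_cokernel f p -> is_cokernel (fhom F f) (fhom F p).
Proof.
move=> ki; have [w [m [e [mm ee fE]]]] := image_ex abA f.
have /eF [_ cFp] : short_exact m p.
  have cm : is_cokernel m p.
    apply: is_cokernelP (cokernel_epi ki) _ _.
      by apply: ee; rewrite -compA -fE comp0l; case: ki.
    by move=> w' g eg; apply: cokernel_desc ki _; rewrite fE compA eg comp0l.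
  by split=> //; apply: mono_kernel_cokernel.
have mFm := exact_epi ee; case: (cFp) => e0 _.
apply: is_cokernelP (cokernel_epi cFp) _ _; first by rewrite fE fhomM compA e0 comp0l.
move=> w' g fg; apply: cokernel_desc cFp _; apply: mFm.
by rewrite -compA -fhomM -fE fg comp0l.
Qed.

End ExactFunctor.

(** * Projective generators and representability *)

Section Generators.
Variables (k : fieldType) (A : category k).
Implicit Types x y : A.

(** Stated through faithfulness of Hom(P, -), so that it dualises without change: a generator of
    [op A] is an injective cogenerator of [A]. *)
Definition generator (P : A) : Prop :=
  projective P /\ forall x y (f : hom x y), (forall u : hom P x, f ∘ u = 0) -> f = 0.

Definition fd_homs : Prop := forall x y : A, finite_dimensional (hom x y).

Variable P : A.
Hypotheses (abA : abelian_category A) (gP : generator P).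

Lemma gen_mono x y (f : hom x y) :
  (forall u : hom P x, f ∘ u = 0 -> u = 0) -> mono f.
Proof.
move=> h; apply/monoP => w g fg; apply: (proj2 gP) => u; apply: h.
by rewrite compA fg comp0l.
Qed.

Lemma gen_epi x y (f : hom x y) :
  (forall u : hom P y, exists v, f ∘ v = u) -> epi f.
Proof.
move=> h; apply/epiP => w g gf; apply: (proj2 gP) => u; have [v <-] := h u.
by rewrite compA gf comp0l.
Qed.

Lemma gen_zero x : (forall u : hom P x, u = 0) -> is_zero x.
Proof. by move=> h; apply: (proj2 gP) => u; rewrite [u]h comp0r. Qed.

Hypothesis fdA : fd_homs.

Lemma gen_cover x : exists n s (i : 'I_n -> hom P s) (p : 'I_n -> hom s P) (e : hom s x),
  [/\ bigsum i p, projective s & epi e].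
Proof.
have [n [b sb]] := fdA P x; have [s [i [p bs]]] := bigsum_ex abA (fun _ : 'I_n => P).
exists n, s, i, p, (\sum_j b j ∘ p j); split=> //.
  by apply: (bigsum_proj bs) => _; case: gP.
apply: gen_epi => u; have [c ->] := sb u; exists (\sum_j c j *: i j).
by rewrite comp_sumr; apply: eq_bigr => j _; rewrite compZr (bigsum_in _ _ bs).
Qed.

Lemma enough_proj x : exists p (e : hom p x), projective p /\ epi e.
Proof. by have [n [s [i [p [e [_ ? ?]]]]]] := gen_cover x; exists s, e. Qed.

Lemma proj_retract x : projective x ->
  exists n (r : 'I_n -> hom P x) (i : 'I_n -> hom x P), \sum_j r j ∘ i j = idm x.
Proof.
move=> px; have [n [s [i [p [e [[_ [_ bs]] ps ee]]]]]] := gen_cover x.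
have [t et] := projective_split px ee; exists n, (fun j => e ∘ i j), (fun j => p j ∘ t).
under eq_bigr do rewrite -compA (compA (i _)).
by rewrite -comp_sumr -comp_suml bs comp1m.
Qed.

End Generators.

Section Copowers.
Variables (k : fieldType) (A : category k) (abA : abelian_category A).

Lemma copower_ex (V : lmodType k) (y : A) :
  finite_dimensional V -> inhabited (copower V y).
Proof.
case/fd_coord => n [b [c [cf cE cb]]].
have [s [i [p bs]]] := bigsum_ex abA (fun _ : 'I_n => y).
have descE z (f : V -> hom y z) (lf : linear f) v :
    (\sum_j f (b j) ∘ p j) ∘ (\sum_j c j v *: i j) = f v.
  rewrite {2}[v]cE (lin_sum lf) comp_sumr; apply: eq_bigr => j _.
  by rewrite compZr (bigsum_in _ _ bs) (linZ lf).
split; apply: (@Copower _ _ V y s (fun v => \sum_j c j v *: i j) _ _ descE).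
- move=> a u v; rewrite scaler_sumr -big_split /=; apply: eq_bigr => j _.
  by rewrite cf scalerDl scalerA.
- move=> z g h e; rewrite -[g]compm1 -[h]compm1; case: (bs) => _ [_ <-].
  rewrite !comp_sumr; apply: eq_bigr => j _; rewrite !compA; congr (_ ∘ _).
  have := e (b j); suff -> : \sum_l c l (b j) *: i l = i j by [].
  rewrite (bigD1 j) //= cb eqxx scale1r big1 ?addr0 // => l /negbTE nl.
  by rewrite cb nl scale0r.
Qed.

End Copowers.

Section Representability.
Variables (k : fieldType) (A : category k) (P : A).
Hypotheses (abA : abelian_category A) (gP : generator P) (fdP : forall x, finite_dimensional (hom P x)).
Variables (Phi : A -> lmodType k) (res : forall x y, hom x y -> Phi y -> Phi x).
Hypotheses (res_linear : forall x y (f : hom x y), linear (res f))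
  (res_linearf : forall x y (phi : Phi y), linear (fun f : hom x y => res f phi))
  (res1 : forall x (phi : Phi x), res (idm x) phi = phi)
  (resM : forall x y z (g : hom y z) (f : hom x y) phi, res (g ∘ f) phi = res f (res g phi))
  (res_mono : forall x y z (i : hom x y) (p : hom y z) phi,
    short_exact i p -> res p phi = 0 -> phi = 0)
  (res_exact : forall x y z (i : hom x y) (p : hom y z) phi,
    short_exact i p -> res i phi = 0 -> exists psi, res p psi = phi)
  (fdPhi : finite_dimensional (Phi P)).

Let res_epi x y (p : hom x y) phi psi : epi p -> res p phi = res p psi -> phi = psi.
Proof.
move=> /(epi_short_exact abA) [w [i se]] e; apply/eqP; rewrite -subr_eq0; apply/eqP.
by apply: (res_mono se); rewrite (linB (res_linear p)) e subrr.
Qed.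

(* The representing object is the quotient of [Phi P ⊗ P] by the images of all
   maps from [P] along which the universal element of [Phi P ⊗ P] vanishes. *)
Lemma representable : exists (X : A) (xi : Phi X),
  forall y (phi : Phi y), exists! f : hom y X, res f xi = phi.
Proof.
have [n [b sb]] := fdPhi.
have [c0 [i [p bs]]] := bigsum_ex abA (fun _ : 'I_n => P).
pose xi0 := \sum_j res (p j) (b j).
have resi j : res (i j) xi0 = b j.
  rewrite /xi0 (lin_sum (res_linear _)) (bigD1 j) //=.
  rewrite -resM; case: (bs) => o [-> _]; rewrite res1 big1 ?addr0 // => l nl.
  by rewrite -resM o // (lin0 (res_linearf _)).
have subK : submod (fun u : hom P c0 => res u xi0 = 0).
  split; first by rewrite (lin0 (res_linearf _)).
  by move=> a u v e1 e2; rewrite res_linearf e1 e2 scaler0 addr0.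
have [m [u [uK su]]] := fd_submod (fdP c0) subK.
have [d [i' [p' bs']]] := bigsum_ex abA (fun _ : 'I_m => P).
pose w := \sum_j u j ∘ p' j.
have [W [mW [eW [mm em wE]]]] := image_ex abA w.
have [X [q se]] := mono_short_exact abA mm.
have eq : epi q by case/(short_exactP abA): se.
have qw : q ∘ w = 0 by rewrite wE compA; case: se => -[-> _]; rewrite comp0l.
(* A map along which [xi0] vanishes is a combination of the [u j], and [q] is the quotient by the
   image of all of these. *)
have Kq (v : hom P c0) : res v xi0 = 0 -> q ∘ v = 0.
  move=> /su [c ->]; rewrite comp_sumr big1 // => j _.
  by rewrite compZr -[u j](bigsum_in (fun j => u j) j bs') compA qw comp0l scaler0.
have [xi qxi] : exists xi, res q xi = xi0.
  apply: (res_exact se); apply: (res_epi em); rewrite -resM -wE (lin0 (res_linear _)).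
  by rewrite /w (lin_sum (res_linearf _)) big1 // => j _; rewrite resM uK (lin0 (res_linear _)).
exists X, xi => y phi.
have [N [c sc]] := fdP y.
have [s [I [Q bS]]] := bigsum_ex abA (fun _ : 'I_N => P).
pose e := \sum_j c j ∘ Q j.
have ee : epi e.
  apply: (gen_epi gP) => v; have [a ->] := sc v; exists (\sum_j a j *: I j).
  by rewrite comp_sumr; apply: eq_bigr => j _; rewrite compZr (bigsum_in _ _ bS).
have [a aE] := choice (fun j => sb (res (c j) phi)).
pose f0 : hom s c0 := \sum_j (\sum_l a j l *: i l) ∘ Q j.
have f0E : res f0 xi0 = res e phi.
  rewrite /f0 /e !(lin_sum (res_linearf _)); apply: eq_bigr => j _.
  rewrite !resM aE (lin_sum (res_linearf _)); congr (res _ _).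
  by apply: eq_bigr => l _; rewrite (linZ (res_linearf _)) resi.
have [K [kap seK]] := epi_short_exact abA ee.
have [f fe] : exists f, f ∘ e = q ∘ f0.
  apply: (cokernel_desc (proj2 seK)); apply: (proj2 gP) => v; rewrite -!compA.
  apply: Kq; rewrite resM f0E -resM compA.
  by case: seK => -[-> _] _; rewrite comp0l (lin0 (res_linearf _)).
exists f; split=> [|g gE].
  by apply: (res_epi ee); rewrite -resM fe resM qxi.
have fE : res f xi = phi by apply: (res_epi ee); rewrite -resM fe resM qxi.
apply/eqP; rewrite -subr_eq0; apply/eqP; apply: (proj2 gP) => v.
have [v' e'] := proj1 gP _ _ q ((f - g) ∘ v) eq.
rewrite -e'; apply: Kq; rewrite -qxi -resM e' resM.
by rewrite (linB (res_linearf _)) fE gE subrr (lin0 (res_linear _)).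
Qed.

End Representability.

(** * Finite categories *)

Section FiniteCategories.
Variables (k : fieldType) (A : category k).
Implicit Types x y : A.

Lemma simple_epi (abA : abelian_category A) x y (f : hom x y) :
  simple_object y -> f <> 0 -> epi f.
Proof.
move=> [_ sy] nf; have [w [i [e [mi ee fE]]]] := image_ex abA f.
case: (sy _ i mi) => [zw|[j [_ ij]]].
  by case: nf; rewrite fE (proj2 (is_zeroP zw) _ e) comp0r.
by rewrite fE; apply: epi_comp ee; apply: retract_epi ij.
Qed.

Lemma simple_mono (abA : abelian_category A) x y (f : hom x y) :
  simple_object x -> f <> 0 -> mono f.
Proof.
move=> [_ sx] nf; have [w [i ki]] := kernel_ex abA f.
case: (sx _ i (kernel_mono ki)) => [/(kernel_zero_mono ki) //|[j [_ ij]]].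
by case: nf; rewrite -[f]compm1 -ij compA; case: ki => -> _; rewrite comp0l.
Qed.

Lemma finite_length_quotient x : finite_length x -> ~ is_zero x ->
  exists z (p : hom x z), simple_object z /\ epi p.
Proof.
case=> [y zy|y x' z i p [_ cp] _ sz] // _; exists z, p; split=> //.
exact: cokernel_epi cp.
Qed.

Section FromGenerator.
Variable P : A.
Hypotheses (abA : abelian_category A) (gP : generator P) (fdA : fd_homs A).

Let size_le n x := exists r (b : 'I_r -> hom P x), (r <= n)%N /\ spans b.

Let simple_quotient x : ~ is_zero x ->
  exists z (p : hom x z), simple_object z /\ epi p.
Proof.
move=> nx; pose Q n := `[< exists z (p : hom x z), [/\ epi p, ~ is_zero z & size_le n z] >].
have exQ : exists n, Q n.
  have [n [b sb]] := fdA P x; exists n; apply/asboolP; exists x, (idm x); split=> //.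
    by move=> w g h; rewrite !compm1.
  by exists n, b.
case: (ex_minnP exQ) => n /asboolP [z [p [ep nz [r [b [ler sb]]]]]] min.
exists z, p; split=> //; split=> // w i mi.
have [zw|nw] := EM (is_zero w); [by left|right].
have [c [q [ki cq]]] := mono_short_exact abA mi.
apply: mono_epi_iso => //; apply: (cokernel_zero_epi cq).
apply: contrapT => nc.
have [u nu] : exists u : hom P w, u <> 0.
  apply/existsNP => h; apply: nw; exact: (gen_zero gP).
have [d iuE] := sb (i ∘ u).
have [j dj] : exists j, d j != 0.
  apply: contrapT => h; apply: nu; apply: mi; rewrite comp0r iuE big1 // => l _.
  have [->|dl] := eqVneq (d l) 0; first by rewrite scale0r.
  by case: h; exists l.
have sc : spans (fun j => q ∘ b j).
  move=> v; have [v' <-] := proj1 gP _ _ q v (cokernel_epi cq).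
  have [a ->] := sb v'; exists a; rewrite comp_sumr.
  by apply: eq_bigr => l _; rewrite compZr.
have rel : \sum_l d l *: (q ∘ b l) = 0.
  under eq_bigr do rewrite -compZr; rewrite -comp_sumr -iuE compA.
  by case: ki => -> _; rewrite comp0l.
case: r b ler sb d j iuE dj sc rel => [|r] b ler sb d j; first by case: j.
move=> iuE dj sc rel; have := spans_drop sc rel dj => sd.
suff /min : Q r by move/(leq_trans ler); rewrite ltnn.
apply/asboolP; exists c, (q ∘ p); split=> //.
  by apply: epi_comp ep; apply: cokernel_epi cq.
by exists r; eexists; split; last exact: sd.
Qed.

Let finite_length_of x : finite_length x.
Proof.
have [n [b sb]] := fdA P x.
have : size_le n x by exists n, b.
elim: n x {b sb} => [|n IH] x [r [b [ler sb]]].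
  apply: finite_length_zero; apply: (gen_zero gP) => u; have [c ->] := sb u.
  by case: r b ler sb c => [|//] b _ _ c; rewrite big_ord0.
have [zx|/simple_quotient [z [p [sz ep]]]] := EM (is_zero x).
  exact: finite_length_zero.
have [K [i se]] := epi_short_exact abA ep.
apply: (finite_length_ext se _ sz); apply: IH.
have [u nu] : exists u : hom P x, p ∘ u <> 0.
  apply/existsNP => h; case: sz => nz _; apply: nz; apply: (zero_epi ep).
  exact: (proj2 gP).
case: r b ler sb => [|r] b ler sb.
  by case: nu; have [c ->] := sb u; rewrite big_ord0 comp0r.
have li : linear (fun v : hom P K => i ∘ v) by apply: comp_linearr.
have ii : injective (fun v : hom P K => i ∘ v) by apply: kernel_mono (proj1 se) _.
have nu' (v : hom P K) : i ∘ v <> u.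
  by move=> e; apply: nu; rewrite -e compA; case: se => -[-> _]; rewrite comp0l.
have [m [c [lem sc]]] := spans_proper li ii nu' sb.
by exists m, c; split=> //; apply: leq_trans lem ler.
Qed.

Let simple_targets x : finite_length x -> exists (n : nat) (s : 'I_n -> A),
  forall y, simple_object y -> (exists f : hom x y, f <> 0) ->
  exists i, isomorphic y (s i).
Proof.
elim=> {x} [x zx|x y z i p se _ [n [s IH]] sz].
  exists 0%N, (fun => x) => y _ [f []]; exact: (proj1 (is_zeroP zx)).
exists n.+1, (fun j => if unlift ord0 j is Some l then s l else z) => w sw [f nf].
have [fi|fi] := EM (f ∘ i = 0); last first.
  have [|l sl] := IH w sw; first by exists (f ∘ i).
  by exists (lift ord0 l); rewrite liftK.
have [g gp] := cokernel_desc (proj2 se) fi.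
have ng : g <> 0 by move=> g0; apply: nf; rewrite -gp g0 comp0l.
have [j _] := is_iso_iso (mono_epi_iso abA (simple_mono abA sz ng) (simple_epi abA sw ng)).
by exists ord0; rewrite unlift_none; split; apply: iso_inv.
Qed.

(** The dimension of Hom(P, -) serves as a length function: a nonzero quotient of least dimension is
    simple, and the dimension drops on its kernel. Every simple object receives a nonzero map from
    [P], hence is one of the finitely many composition factors of [P]. *)
Lemma finite_of_generator : finite_category A.
Proof.
split=> //; first exact: (enough_proj abA gP fdA).
have [n [s sP]] := simple_targets (finite_length_of P); exists n, s => y sy.
apply: sP => //; apply: contrapT => h; case: (sy) => nz _; apply: nz.
by apply: (gen_zero gP) => u; apply: contrapT => nu; apply: h; exists u.
Qed.

End FromGenerator.

(** Add up projectives mapping onto the finitely many simple objects. If [f] is nonzero, its image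
    has a simple quotient, and the projective above that quotient lifts to a map that [f] cannot
    kill. *)
Lemma finite_generator : finite_category A -> exists P : A, generator P.
Proof.
case=> abA _ fl ep [n [s sE]].
have [p pE] := choice (fun j => ep (s j)); have [e eE] := dep_choice pE.
have [P [i [r bs]]] := bigsum_ex abA p.
exists P; split; first by apply: (bigsum_proj bs) => j; case: (eE j).
move=> x y f h; apply: contrapT => nf.
have [w [m [q [mm eq fE]]]] := image_ex abA f.
have [|z [t [sz et]]] := finite_length_quotient (fl w).
  by move=> zw; apply: nf; rewrite fE (proj2 (is_zeroP zw) _ q) comp0r.
have [j [g]] := sE z sz.
have [pj ej] := eE j; have tq := epi_comp et eq.
have [v tqv] := pj _ _ _ (bwd g ∘ e j) tq.
have fv : f ∘ v = 0.
  rewrite -[v]compm1; case: bs => _ [/(_ j) <- _].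
  by rewrite !compA -(compA f) h comp0l.
have qv : q ∘ v = 0 by apply: mm; rewrite compA -fE fv comp0r.
have : epi (bwd g ∘ e j) by exact: epi_comp (iso_epi (iso_inv g)) ej.
move/zero_epi => zz; case: (sz) => nz _; apply: nz; apply: zz.
by rewrite -tqv -compA qv comp0r.
Qed.

(** The object [I] represents the functor sending x to the dual of Hom(P, x), with [P] a projective
    generator. Injectivity of [I] is [functional_factor] and cogeneration is [functional_separate],
    read through this representation. *)
Lemma injective_cogenerator : finite_category A ->
  exists I : op A, generator I.
Proof.
move=> fA; have [P gP] := finite_generator fA; case: fA => abA fdA _ _ _.
pose Phi x := dual_lmod (hom P x).
have resP x y (f : hom x y) (phi : {phi : hom P y -> k | functional phi}) :
    functional (fun u => sval phi (f ∘ u)).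
  by move=> a u v; rewrite comp_linearr (svalP phi).
pose res x y (f : hom x y) (phi : Phi y) : Phi x := exist _ _ (resP x y f phi).
have resE x y (f : hom x y) phi u :
  sval (res x y f phi : {phi | functional phi}) u =
  sval (phi : {phi | functional phi}) (f ∘ u) by [].
have E0 x (phi : Phi x) :
    phi = 0 <-> forall u, sval (phi : {phi | functional phi}) u = 0.
  by split=> [-> //|h]; apply: dual_inj.
have [I [xi U]] : exists I (xi : Phi I), forall y (phi : Phi y),
    exists! f : hom y I, res y I f xi = phi.
  apply: (representable abA gP (fun x => fdA P x) (res := res)).
  - by move=> x y f a u v; apply: dual_inj => w /=; rewrite !mul1r !addr0.
  - move=> x y phi a f g; apply: dual_inj => w /=.
    by rewrite compDl compZl (svalP (phi : {phi | _})) !mul1r !addr0.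
  - by move=> x phi; apply: dual_inj => u /=; rewrite comp1m.
  - by move=> x y z g f phi; apply: dual_inj => u /=; rewrite compA.
  - move=> x y z i p phi se e; apply/E0 => u.
    have [v <-] := proj1 gP _ _ p u (cokernel_epi (proj2 se)).
    by have /E0 := e; apply.
  - move=> x y z i p phi se e.
    have [] := @functional_factor k (hom P y) (hom P z) (fun u => p ∘ u)
      (sval (phi : {phi | _})) (fdA _ _) (fdA _ _).
    + exact: comp_linearr.
    + exact: (svalP (phi : {phi | _})).
    + move=> v /(kernel_lift (proj1 se)) [u <-]; have /E0 := e; exact.
    + move=> psi [fpsi psiE]; exists (exist _ psi fpsi : Phi z).
      by apply: dual_inj => u; apply: psiE.
  - exact: dual_fd.
exists I; split.
- move=> y x i f mi.
  have {}mi : @mono _ A _ _ i by move=> w g h e; apply: mi.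
  have [] := @functional_factor k (hom P x) (hom P y) (fun u => (i : @hom _ A _ _) ∘ u)
    (sval (res x I f xi : {phi | _})) (fdA _ _) (fdA _ _).
  + exact: comp_linearr.
  + exact: (svalP (res x I f xi : {phi | _})).
  + by move=> v e; rewrite [v](mi _ _ 0) ?comp0r ?functional0 //;
      apply: (svalP (res x I f xi : {phi | _})).
  + move=> psi [fpsi psiE]; have [g [gE _]] := U y (exist _ psi fpsi : Phi y).
    exists g; have [f' [_ Uf]] := U x (res x I f xi).
    rewrite -(Uf f) //; apply: esym; apply: Uf; apply: dual_inj => u.
    rewrite -psiE; have := congr1 (fun phi : Phi y =>
      sval (phi : {phi | _}) ((i : @hom _ A _ _) ∘ u)) gE; rewrite /= => <-.
    by rewrite compA.
- move=> y x f h; apply: (proj2 gP) => u; apply: functional_separate => // phi fphi.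
  have [g [gE _]] := U y (exist _ phi fphi : Phi y).
  have := congr1 (fun phi : Phi y => sval (phi : {phi | _}) ((f : @hom _ A x y) ∘ u)) gE.
  move=> /= <-; have := h g; rewrite /= => e; rewrite compA e comp0l.
  exact: functional0 (svalP (xi : {phi | _})).
Qed.

End FiniteCategories.

(** * Schur's lemma and projective covers over an algebraically closed field *)

Lemma eigenvector_ex (k : closedFieldType) (V : lmodType k) (phi : V -> V) (v0 : V) :
  finite_dimensional V -> linear phi -> v0 <> 0 ->
  exists a v, v <> 0 /\ phi v = a *: v.
Proof.
move=> /fd_basis [[|n] [b [sb ib]]] lphi nz.
  by case: nz; have [c ->] := sb v0; rewrite big_ord0.
have [A AE] := choice (fun i => sb (phi (b i))).
pose B := \matrix_(i < n.+1, j < n.+1) A i j.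
have [a ra] : exists a, root (char_poly B) a.
  by apply/closed_rootP; rewrite size_char_poly.
have : eigenvalue B a by rewrite eigenvalue_root_char.
case/eigenvalueP => u uB nu; exists a, (\sum_i u 0 i *: b i); split.
  by move=> /ib u0; case/eqP: nu; apply/rowP => i; rewrite u0 mxE.
rewrite (lin_sum lphi); under eq_bigr do rewrite (linZ lphi) AE scaler_sumr.
rewrite exchange_big scaler_sumr; apply: eq_bigr => j _.
under eq_bigr do rewrite scalerA; rewrite -scaler_suml scalerA.
have := congr1 (fun C : 'rV_n.+1 => C 0 j) uB; rewrite !mxE => <-.
by congr (_ *: _); apply: eq_bigr => i _; rewrite mxE.
Qed.

Section ProjectiveCovers.
Variables (k : closedFieldType) (A : category k).
Hypothesis fA : finite_category A.
Implicit Types x y s : A.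

Let abA : abelian_category A. Proof. by case: fA. Qed.
Let fdA : fd_homs A. Proof. by case: fA. Qed.

Lemma simple_iso x y (f : hom x y) : simple_object x -> simple_object y ->
  f <> 0 -> is_iso f.
Proof.
by move=> sx sy nf; apply: mono_epi_iso; [|apply: simple_mono|apply: simple_epi].
Qed.

(** An eigenvector [v] of left composition with [f] is a nonzero endomorphism of a simple object,
    hence invertible, and cancelling it from [f ∘ v = a *: v] gives the scalar. *)
Lemma schur s (f : hom s s) : simple_object s -> exists a, f = a *: idm s.
Proof.
move=> ss; have n1 : idm s <> 0 by case: ss.
have [a [v [nv e]]] := eigenvector_ex (fdA s s) (comp_linearr f) n1.
exists a; apply/eqP; rewrite -subr_eq0; apply/eqP.
have [w [_ vw]] := simple_iso ss ss nv.
by apply: (retract_epi vw); rewrite compBl compZl comp1m e subrr comp0l.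
Qed.

Definition cover x s (e : hom x s) : Prop :=
  [/\ projective x, epi e & forall g : hom x x, e ∘ g = e -> epi g].

Fixpoint endo_iter x (g : hom x x) n : hom x x :=
  if n is m.+1 then endo_iter g m ∘ g else idm x.

Lemma endo_iterD x (g : hom x x) m n :
  endo_iter g (m + n) = endo_iter g m ∘ endo_iter g n.
Proof. by elim: n => [|n IH]; rewrite ?addn0 ?compm1 // addnS /= IH compA. Qed.

(* A projective object above [s] of minimal size is a projective cover: by
   Fitting's lemma an endomorphism over [s] is invertible on a direct summand
   which still maps onto [s]. *)
Lemma cover_ex s : exists x (e : hom x s), cover e.
Proof.
have [G gG] := finite_generator fA.
pose size_le n x := exists r (b : 'I_r -> hom G x), (r <= n)%N /\ spans b.
have size_ex x : exists n, size_le n x.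
  by have [n [b sb]] := fdA G x; exists n, n, b.
have sub_size n x y (f : hom x y) : mono f -> size_le n y ->
    (forall m, size_le m x -> (n <= m)%N) -> epi f.
  move=> mf [r [b [ler sb]]] min; apply: (gen_epi gG) => u.
  apply: contrapT => /forallNP nu.
  case: r b ler sb => [|r] b ler sb.
    by case: (nu 0); have [c ->] := sb u; rewrite big_ord0 comp0r.
  have [m [c [lem sc]]] :=
    spans_proper (comp_linearr f) (fun g h => @mf _ g h) nu sb.
  have /min : size_le m x by exists m, c.
  by move=> /(leq_trans ler); rewrite ltnNge lem.
pose Q n := `[< exists x (e : hom x s), [/\ projective x, epi e & size_le n x] >].
have exQ : exists n, Q n.
  case: fA => _ _ _ ep _; have [x [e [px ee]]] := ep s; have [n sn] := size_ex x.
  by exists n; apply/asboolP; exists x, e.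
case: (ex_minnP exQ) => n /asboolP [x [e [px ee sx]]] min.
exists x, e; split=> // g eg.
pose R m := `[< exists N I (i : hom I x) (q : hom x I),
  [/\ mono i, epi q, i ∘ q = endo_iter g N.+1 & size_le m I] >].
have exR : exists m, R m.
  have [I [i [q [mi eq E]]]] := image_ex abA (endo_iter g 1).
  by have [m sm] := size_ex I; exists m; apply/asboolP; exists 0%N, I, i, q.
case: (ex_minnP exR) => m /asboolP [N [I [i [q [mi eq iq sI]]]]] minR.
have eiter l : e ∘ endo_iter g l = e.
  by elim: l => [|l IH] /=; rewrite ?compm1 // compA IH.
(* The image of the square of the chosen iterate embeds into [I], and by minimality of [m] it cannot
   be smaller. *)
have eqi : epi (q ∘ i).
  have [J [j [p [mj ep E]]]] := image_ex abA (q ∘ i).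
  have ej : epi j.
    apply: (sub_size m) => // m' sJ; apply: minR; apply/asboolP.
    exists (N + N.+1)%N, J, (i ∘ j), (p ∘ q); split=> //.
    - exact: mono_comp.
    - exact: epi_comp.
    - by rewrite -addSn endo_iterD -iq !compA -(compA i j) -E !compA.
  by rewrite E; apply: epi_comp.
(* A surjective endomorphism of the finite-dimensional space Hom(G, I) is injective: a kernel vector
   would let one spanning vector be dropped. *)
have mqi : mono (q ∘ i).
  apply: (gen_mono gG) => u qiu; apply: contrapT => nu.
  have [r [b [ler sb]]] := sI; have [d uE] := sb u.
  have [j dj] : exists j, d j != 0.
    apply: contrapT => h; apply: nu; rewrite uE big1 // => l _.
    by have [->|dl] := eqVneq (d l) 0; [rewrite scale0r|case: h; exists l].
  have sc : spans (fun j => q ∘ i ∘ b j).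
    move=> v; have [v' <-] := proj1 gG _ _ _ v eqi; have [a ->] := sb v'.
    by exists a; rewrite comp_sumr; apply: eq_bigr => l _; rewrite compZr.
  have rel : \sum_l d l *: (q ∘ i ∘ b l) = 0.
    by under eq_bigr do rewrite -compZr; rewrite -comp_sumr -uE.
  case: r b ler sb d j uE dj sc rel => [|r] b ler sb d j; first by case: j.
  move=> uE dj sc rel; have := spans_drop sc rel dj => sd.
  suff /minR : R r by move/(leq_trans ler); rewrite ltnn.
  apply/asboolP; exists N, I, i, q; split=> //.
  by exists r; eexists; split; last exact: sd.
have [w [wqi _]] := mono_epi_iso abA mqi eqi.
have pI : projective I by apply: (projective_retract (r := w ∘ q) (i := i)); rewrite ?compA -?compA.
have ei : epi (e ∘ i) by apply: (epi_cancel (f := q)); rewrite -compA iq eiter.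
(* [I] is a direct summand of [x] that still maps onto [s], so by minimality of [n] it is all of
   [x]. *)
have : epi i.
  by apply: (sub_size n) => // m' sm'; apply: min; apply/asboolP; exists I, (e ∘ i).
move=> epi_i; have : epi (endo_iter g N.+1) by rewrite -iq; apply: epi_comp.
by rewrite -addn1 addnC endo_iterD /= comp1m; apply: epi_cancel.
Qed.

(** Let K be the kernel of a nonzero [f]. Either [e] kills K and then factors through [f], giving an
    isomorphism between the two simple objects; or K still maps onto [s], and lifting [e] to K gives
    an endomorphism over [s] that is epi yet killed by [f]. *)
Lemma cover_factor x s s' (e : hom x s) (f : hom x s') :
  simple_object s -> simple_object s' -> cover e -> exists phi, f = phi ∘ e.
Proof.
move=> ss ss' [px ee min]; have [->|nf] := EM (f = 0).
  by exists 0; rewrite comp0l.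
have ef := simple_epi abA ss' nf; have [K [i se]] := epi_short_exact abA ef.
have [ei|nei] := EM (e ∘ i = 0).
  have [psi psif] := cokernel_desc (proj2 se) ei.
  have npsi : psi <> 0.
    by move=> p0; case: ss => nz _; apply: nz; apply: (zero_epi ee); rewrite -psif p0 comp0l.
  have [phi [phipsi _]] := simple_iso ss' ss npsi.
  by exists phi; rewrite -psif compA phipsi comp1m.
have [t et] := px _ _ _ e (simple_epi abA ss nei).
have : epi (i ∘ t) by apply: min; rewrite compA.
move=> eit; case: nf; apply: eit; rewrite compA comp0l.
by case: se => -[-> _] _; rewrite comp0l.
Qed.

Lemma simple_reps : exists n (s : 'I_n -> A),
  [/\ forall i, simple_object (s i), forall i j, isomorphic (s i) (s j) -> i = j
    & forall x, simple_object x -> exists i, isomorphic x (s i)].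
Proof.
case: fA => _ _ _ _ [n [t tE]].
suff [m [s [s1 s2 s3]]] : exists m (s : 'I_m -> A),
    [/\ forall i, simple_object (s i), forall i j, isomorphic (s i) (s j) -> i = j
      & forall x i, simple_object x -> isomorphic x (t i) -> exists j, isomorphic x (s j)].
  by exists m, s; split=> // x sx; have [i xi] := tE x sx; apply: s3 xi.
elim: n t {tE} => [|n IH] t; first by exists 0%N, t; split=> [[]|[]|x []].
have [m [s [s1 s2 s3]]] := IH (fun i => t (lift ord0 i)).
have [[st nst]|h] := EM (simple_object (t ord0) /\ forall j, ~ isomorphic (t ord0) (s j)).
- exists m.+1, (fun j => if unlift ord0 j is Some l then s l else t ord0); split.
  + by move=> i; case: (unliftP ord0 i).
  + move=> i j; case: (unliftP ord0 i) => [i' ->|->]; case: (unliftP ord0 j) => [j' ->|->] //.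
    * by move/s2 => ->.
    * by case=> g; case: (nst i'); split; apply: iso_inv.
    * by move/nst.
  + move=> x i sx xi; case: (unliftP ord0 i) xi => [i' ->|->] xi; last first.
      by exists ord0; rewrite unlift_none.
    by have [j xj] := s3 x i' sx xi; exists (lift ord0 j); rewrite liftK.
- exists m, s; split=> // x i sx xi.
  case: (unliftP ord0 i) xi => [i' ->|->] xi; first exact: s3 xi.
  case: (xi) => g; apply: contrapT => nx; apply: h; split.
    case: sx => nz sub; split.
      move=> zt; apply: nz; rewrite /is_zero -(fwdK g).
      by rewrite (proj2 (is_zeroP zt) _ (fwd g)) comp0r.
    move=> w j mj; case: (sub w (bwd g ∘ j)).
    + by apply: mono_comp mj; apply: (iso_mono (iso_inv g)).
    + by left.
    + move=> [r [r1 r2]]; right; exists (r ∘ bwd g); split; first by rewrite -compA.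
      by apply: (iso_mono (iso_inv g)); rewrite !compA r2 compm1 comp1m.
  by move=> j [h]; apply: nx; exists j; split; apply: iso_comp h g.
Qed.

(** Representatives [s j] of the simple objects with projective covers [e j]. *)
Definition simple_covers n (s P : 'I_n -> A) (e : forall j, hom (P j) (s j)) : Prop :=
  [/\ forall j, projective (P j), forall j, epi (e j),
      forall j (f : hom (P j) (s j)), exists a, f = a *: e j,
      forall j l (f : hom (P j) (s l)), j <> l -> f = 0
    & forall x, simple_object x -> exists i, isomorphic x (s i)].

Lemma simple_covers_ex : exists n (s P : 'I_n -> A) e,
  (forall j, simple_object (s j)) /\ @simple_covers n s P e.
Proof.
have [n [s [s1 s2 s3]]] := simple_reps.
have [P PE] := choice (fun j => cover_ex (s j)); have [e eE] := dep_choice PE.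
exists n, s, P, e; split=> //; split=> //.
- by move=> j; case: (eE j).
- by move=> j; case: (eE j).
- move=> j f; have [phi ->] := cover_factor f (s1 j) (s1 j) (eE j).
  by have [a ->] := schur phi (s1 j); exists a; rewrite compZl comp1m.
- move=> j l f njl; have [phi ->] := cover_factor f (s1 j) (s1 l) (eE j).
  have [->|nphi] := EM (phi = 0); first by rewrite comp0l.
  have [g _] := is_iso_iso (simple_iso (s1 j) (s1 l) nphi).
  by case: njl; apply: s2.
Qed.

End ProjectiveCovers.

(** * Exact functors free on sections over the simple objects *)

Section FreeFunctors.
Variables (k : closedFieldType) (M N : category k) (n : nat) (s P : 'I_n -> M).
Variable e : forall j, hom (P j) (s j).
Hypotheses (abM : abelian_category M) (flM : forall x : M, finite_length x).
Hypothesis sc : simple_covers e.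
Variables (T : functor M N).
Hypotheses (abN : abelian_category N) (eT : exact_functor T).
Variable tau : forall j, hom (T (s j)) (T (P j)).
Hypothesis tauE : forall j, fhom T (e j) ∘ tau j = idm (T (s j)).

(* [T] is the direct sum of the functors [Hom (P j) x ⊗ T (s j)], hence freely
   generated by the sections [tau j]. *)
Lemma free_functor (x : M) :
  exists L : seq {j : 'I_n & (hom (P j) x * hom (T x) (T (s j)))%type},
  \sum_(u <- L) (fhom T (tagged u).1 ∘ tau (tag u) ∘ (tagged u).2) = idm (T x) /\
  forall (N' : category k) (R : functor N N') (G : functor M N')
    (l : forall j, hom (R (T (s j))) (G (P j))) j (f : hom (P j) x),
  (\sum_(u <- L) (fhom G (tagged u).1 ∘ l (tag u) ∘ fhom R (tagged u).2))
    ∘ fhom R (fhom T f ∘ tau j) = fhom G f ∘ l j.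
Proof.
elim: (flM x) => {x} [x zx|x y z i p se _ [L [L1 L2]] sz].
  exists [::]; rewrite big_nil; split; first by rewrite (fhom_zero T zx).
  move=> N' R G l j f; rewrite big_nil comp0l.
  by rewrite (proj2 (is_zeroP zx) _ f) fhom0 comp0l.
case: (sc) => prP epe hom1 hom0 allS.
have [j0 [g]] := allS z sz; have seT := eT se.
have ep := cokernel_epi (proj2 se); have pi : p ∘ i = 0 by case: se => -[].
have [ez ezE] := prP j0 _ _ p (bwd g ∘ e j0) ep.
(* Pushing [tau j0] along the lift [ez] splits the image under [T] of the projection onto the simple
   quotient, so [T y] is [T x] plus one copy of [T (s j0)]. *)
have [sg sgE] : exists sg, sg = fhom T ez ∘ tau j0 by eexists.
have psg : fhom T g ∘ fhom T p ∘ sg = idm _.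
  rewrite sgE !compA -!fhomM -compA ezE compA bwdK comp1m; exact: tauE.
have psg' : fhom T p ∘ (sg ∘ fhom T g) = idm _.
  apply: (iso_monic (fiso T g)); rewrite /= !compA psg comp1m compm1 //.
have [r [ri rs E]] := short_exact_split seT psg'.
have rsg : r ∘ sg = 0.
  by apply: (iso_epic (fiso T g)); rewrite /= -compA rs comp0l.
pose u0 : {j : 'I_n & (hom (P j) y * hom (T y) (T (s j)))%type} :=
  existT _ j0 (ez, fhom T g ∘ fhom T p).
pose up (u : {j : 'I_n & (hom (P j) x * hom (T x) (T (s j)))%type}) :
    {j : 'I_n & (hom (P j) y * hom (T y) (T (s j)))%type} :=
  existT _ (tag u) (i ∘ (tagged u).1, (tagged u).2 ∘ r).
exists (u0 :: map up L); rewrite big_cons big_map /=; split.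
  rewrite -E addrC -compA; congr (_ + _); last by rewrite sgE !compA.
  rewrite -[fhom T i]compm1 -L1 comp_sumr comp_suml.
  by apply: eq_bigr => u _; rewrite fhomM !compA.
move=> N' R G l j f; rewrite big_cons big_map /=.
have key (f' : hom (P j) x) :
    (fhom G ez ∘ l j0 ∘ fhom R (fhom T g ∘ fhom T p) + \sum_(u <- L)
     (fhom G (i ∘ (tagged u).1) ∘ l (tag u) ∘ fhom R ((tagged u).2 ∘ r)))
    ∘ fhom R (fhom T (i ∘ f') ∘ tau j) = fhom G (i ∘ f') ∘ l j.
  have z0 : fhom T g ∘ fhom T p ∘ (fhom T (i ∘ f') ∘ tau j) = 0.
    by rewrite -fhomM compA -fhomM -(compA g) (compA p) pi comp0l comp0r fhom0 comp0l.
  rewrite compDl -compA -fhomM z0 fhom0 comp0r add0r.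
  rewrite (fhomM G) -compA -(L2 _ R G l j f') !comp_suml comp_sumr.
  apply: eq_bigr => u _.
  by rewrite (fhomM G) (fhomM T) -!compA -!fhomM -!compA (compA r) ri comp1m.
have [e0|njj] := EM (j = j0); last first.
  have [f' <-] : exists f', i ∘ f' = f.
    apply: (kernel_lift (proj1 se)); apply: (iso_monic g).
    by rewrite comp0r; apply: hom0.
  exact: key.
subst j0.
(* Since Hom(P j, s j) is spanned by [e j], the map [f] differs from a multiple of [ez] by a map
   into the subobject [x], where the induction hypothesis applies. *)
have [a aE] := hom1 j (g ∘ (p ∘ f)).
have [f' f'E] : exists f', i ∘ f' = f - a *: ez.
  apply: (kernel_lift (proj1 se)); apply: (iso_monic g); rewrite comp0r.
  by rewrite compBr compZr ezE compBr aE compZr compA bwdK comp1m subrr.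
have comb S : (forall f', S ∘ fhom R (fhom T (i ∘ f') ∘ tau j) = fhom G (i ∘ f') ∘ l j) ->
    S ∘ fhom R (fhom T ez ∘ tau j) = fhom G ez ∘ l j ->
    S ∘ fhom R (fhom T f ∘ tau j) = fhom G f ∘ l j.
  move=> h1 h2; rewrite -[f](subrK (a *: ez)) -f'E.
  by rewrite !(fhomD, fhomZ, compDl, compZl, compDr, compZr) h1 h2.
apply: comb key _; rewrite -sgE compDl -compA -fhomM psg fhom1 compm1 comp_suml.
rewrite big1 ?addr0 // => u _.
by rewrite -compA -fhomM -(compA _ r) rsg comp0r fhom0 comp0r.
Qed.

End FreeFunctors.

(** * Adjunctions and the action of dual objects *)

Section Adjunctions.
Variables (k : fieldType) (A B : category k).

Definition adjunction (F : functor A B) (G : functor B A)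
    (eta : forall x, hom x (G (F x))) (eps : forall y, hom (F (G y)) y) : Prop :=
  [/\ forall x y (f : hom x y), eta y ∘ f = fhom G (fhom F f) ∘ eta x,
      forall x y (f : hom x y), eps y ∘ fhom F (fhom G f) = f ∘ eps x,
      forall x, eps (F x) ∘ fhom F (eta x) = idm (F x)
    & forall y, fhom G (eps y) ∘ eta (G y) = idm (G y)].

Definition adjoint (F : functor A B) (G : functor B A) : Prop :=
  exists eta eps, @adjunction F G eta eps.

Lemma adj_cokernel (F : functor A B) (G : functor B A) : adjoint F G ->
  forall x y z (f : hom x y) (p : hom y z),
  is_cokernel f p -> is_cokernel (fhom F f) (fhom F p).
Proof.
move=> [eta [eps [nE nP T1 T2]]] x y z f p cp; have [pf _] := cp.
have tr u w (g : hom (F u) w) : g = eps w ∘ fhom F (fhom G g ∘ eta u).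
  by rewrite fhomM compA nP -compA T1 compm1.
apply: is_cokernelP.
- apply/epiP => w g gp; rewrite (tr _ _ g).
  suff -> : fhom G g ∘ eta z = 0 by rewrite fhom0 comp0r.
  apply: (cokernel_epi cp).
  by rewrite comp0l -compA nE compA -fhomM gp fhom0 comp0l.
- by rewrite -fhomM pf fhom0.
- move=> w g gf; have [|u up] := cokernel_desc (g := fhom G g ∘ eta y) cp.
    by rewrite -compA nE compA -fhomM gf fhom0 comp0l.
  by exists (eps w ∘ fhom F u); rewrite -compA -fhomM up -tr.
Qed.

Lemma adj_kernel (F : functor A B) (G : functor B A) : adjoint F G ->
  forall x y z (f : hom x y) (p : hom y z),
  is_kernel f p -> is_kernel (fhom G f) (fhom G p).
Proof.
move=> [eta [eps [nE nP T1 T2]]] x y z f p cp; have [pf _] := cp.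
have tr u w (g : hom u (G w)) : g = fhom G (eps w ∘ fhom F g) ∘ eta u.
  by rewrite fhomM -compA -nE compA T2 comp1m.
apply: is_kernelP.
- apply/monoP => w g gp; rewrite (tr _ _ g).
  suff -> : eps x ∘ fhom F g = 0 by rewrite fhom0 comp0l.
  apply: (kernel_mono cp).
  by rewrite comp0r compA -nP -compA -fhomM gp fhom0 comp0r.
- by rewrite -fhomM pf fhom0.
- move=> w g gf; have [|u up] := kernel_lift (g := eps y ∘ fhom F g) cp.
    by rewrite compA -nP -compA -fhomM gf fhom0 comp0r.
  by exists (fhom G u ∘ eta w); rewrite compA -fhomM up -tr.
Qed.

Lemma adj_projective (F : functor A B) (G : functor B A) : adjoint F G ->
  (forall x y (f : hom x y), epi f -> epi (fhom G f)) ->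
  forall p, projective p -> projective (F p).
Proof.
move=> [eta [eps [nE nP T1 T2]]] eG p pp y z e f ee.
have [g ge] := pp _ _ _ (fhom G f ∘ eta p) (eG _ _ _ ee).
exists (eps y ∘ fhom F g).
by rewrite compA -nP -compA -fhomM ge fhomM compA nP -compA T1 compm1.
Qed.

End Adjunctions.

Section ActionLinear.
Variables (k : fieldType) (C : monoidal k) (M : modcat C).
Implicit Types (x y : C) (m n : M).

Lemma ahom0l x y m n (g : hom m n) : (0 : hom x y) ▷' g = 0.
Proof. exact: lin0 (@ahom_linearl _ _ M x y m n g). Qed.
Lemma ahomDl x y m n (f f' : hom x y) (g : hom m n) :
  (f + f') ▷' g = f ▷' g + f' ▷' g.
Proof. exact: linD (@ahom_linearl _ _ M x y m n g) f f'. Qed.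
Lemma ahomBl x y m n (f f' : hom x y) (g : hom m n) :
  (f - f') ▷' g = f ▷' g - f' ▷' g.
Proof. exact: linB (@ahom_linearl _ _ M x y m n g) f f'. Qed.
Lemma ahomZl x y m n a (f : hom x y) (g : hom m n) : (a *: f) ▷' g = a *: (f ▷' g).
Proof. exact: linZ (@ahom_linearl _ _ M x y m n g) a f. Qed.
Lemma ahom_suml x y m n (I : Type) (r : seq I) (f : I -> hom x y) (g : hom m n) :
  (\sum_(i <- r) f i) ▷' g = \sum_(i <- r) (f i ▷' g).
Proof. exact: (lin_sum (@ahom_linearl _ _ M x y m n g)). Qed.
Lemma ahomDr x y m n (f : hom x y) (g g' : hom m n) :
  f ▷' (g + g') = f ▷' g + f ▷' g'.
Proof. exact: linD (@ahom_linearr _ _ M x y m n f) g g'. Qed.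
Lemma ahomBr x y m n (f : hom x y) (g g' : hom m n) :
  f ▷' (g - g') = f ▷' g - f ▷' g'.
Proof. exact: linB (@ahom_linearr _ _ M x y m n f) g g'. Qed.
Lemma ahomZr x y m n a (f : hom x y) (g : hom m n) : f ▷' (a *: g) = a *: (f ▷' g).
Proof. exact: linZ (@ahom_linearr _ _ M x y m n f) a g. Qed.
Lemma ahom_sumr x y m n (I : Type) (r : seq I) (f : hom x y) (g : I -> hom m n) :
  f ▷' (\sum_(i <- r) g i) = \sum_(i <- r) (f ▷' g i).
Proof. exact: (lin_sum (@ahom_linearr _ _ M x y m n f)). Qed.

Lemma ahom_swap x y m n (f : hom x y) (g : hom m n) :
  (idm y ▷' g) ∘ (f ▷' idm m) = (f ▷' idm n) ∘ (idm x ▷' g).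
Proof. by rewrite -ahom_lr -ahom_rl. Qed.

Lemma bwd_aassoc_natural x x' y y' m m' (f : hom x x') (g : hom y y') (h : hom m m') :
  bwd (aassoc x' y' m') ∘ (f ▷' (g ▷' h)) = (f ⊗' g ▷' h) ∘ bwd (aassoc x y m).
Proof.
apply: (iso_monic (aassoc x' y' m')); apply: (iso_epic (aassoc x y m)).
by rewrite !compA bwdK comp1m isoVK aassoc_natural.
Qed.

Lemma bwd_aunit_natural m n (f : hom m n) :
  bwd (aunit n) ∘ f = (idm tunit ▷' f) ∘ bwd (aunit m).
Proof.
apply: (iso_monic (aunit n)); apply: (iso_epic (aunit m)).
by rewrite !compA bwdK comp1m isoVK aunit_natural.
Qed.

End ActionLinear.

(* Locked so that rewriting with [compA] does not see through the definitions. *)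
Fact act_key : Datatypes.unit. Proof. exact: tt. Qed.

Section DualActions.
Variables (k : fieldType) (C : monoidal k) (M : modcat C).
Implicit Types m n : M.

Definition act_ev (x y : C) (ev : hom (y ⊗ x) tunit) m : hom (y ▷ (x ▷ m)) m :=
  locked_with act_key (aunit m ∘ (ev ▷' idm m) ∘ bwd (aassoc y x m)).

Definition act_coev (x y : C) (coev : hom tunit (x ⊗ y)) m : hom m (x ▷ (y ▷ m)) :=
  locked_with act_key (aassoc x y m ∘ (coev ▷' idm m) ∘ bwd (aunit m)).

Lemma act_ev_natural x y ev m n (f : hom m n) :
  @act_ev x y ev n ∘ (idm y ▷' (idm x ▷' f)) = f ∘ act_ev ev m.
Proof.
rewrite /act_ev !unlock -!compA bwd_aassoc_natural thom1 (compA (ev ▷' _)) -ahom_swap.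
by rewrite -!compA (compA (aunit n)) aunit_natural -!compA.
Qed.

Lemma act_coev_natural x y coev m n (f : hom m n) :
  @act_coev x y coev n ∘ f = (idm x ▷' (idm y ▷' f)) ∘ act_coev coev m.
Proof.
rewrite /act_coev !unlock -!compA bwd_aunit_natural (compA (coev ▷' _)) -ahom_swap.
by rewrite !compA -aassoc_natural thom1 -!compA.
Qed.

Lemma act_zigzag1 x y ev coev m :
  runit x ∘ (idm x ⊗' ev) ∘ assoc x y x ∘ (coev ⊗' idm x) = lunit x ->
  (idm x ▷' act_ev ev m) ∘ act_coev coev (x ▷ m) = idm (x ▷ m).
Proof.
move=> E; apply: (iso_epic (aunit (x ▷ m))); apply: (iso_epic (aassoc tunit x m)).
rewrite comp1m aunit_assoc -E !ahomMr -atriangle /act_ev /act_coev !unlock !compA isoVK.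
rewrite !ahomMl; rewrite -[LHS]compA -aassoc_nat_id.
rewrite -!compA; congr (_ ∘ _).
rewrite (compA (aassoc x tunit m)) (aassoc_natural (idm x) ev (idm m)) -!compA.
congr (_ ∘ _); rewrite !compA; congr (_ ∘ _).
apply: (iso_monic (fiso (act_left M x) (aassoc y x m))) => /=.
by rewrite !compA -ahomMl bwdK ahom1 comp1m apentagon.
Qed.

Lemma act_zigzag2 x y ev coev m :
  lunit y ∘ (ev ⊗' idm y) ∘ bwd (assoc y x y) ∘ (idm y ⊗' coev) = runit y ->
  act_ev ev (y ▷ m) ∘ (idm y ▷' act_coev coev m) = idm (y ▷ m).
Proof.
move=> E; apply: (iso_epic (fiso (act_left M y) (aunit m))).
apply: (iso_epic (aassoc y tunit m)) => /=.
rewrite comp1m atriangle -E !ahomMr -aunit_assoc /act_ev /act_coev !unlock !ahomMl.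
rewrite -!compA (compA (idm y ▷' bwd (aunit m))) -ahomMl fwdK ahom1 comp1m.
congr (_ ∘ _); rewrite -(aassoc_natural (idm y) coev (idm m)).
rewrite [RHS]compA aassoc_nat_id -!compA; congr (_ ∘ _); rewrite !compA; congr (_ ∘ _).
apply: (iso_monic (aassoc y x (y ▷ m))); rewrite !compA bwdK comp1m apentagon.
by rewrite -!compA -ahomMr bwdK ahom1 compm1.
Qed.

Lemma left_dual_adj (x y : C) : left_dual x y -> adjoint (act_left M y) (act_left M x).
Proof.
move=> [ev [coev [E1 E2]]]; exists (fun m => act_coev coev m), (fun m => act_ev ev m).
split=> [m n f|m n f|m|m].
- exact: act_coev_natural.
- exact: act_ev_natural.
- exact: act_zigzag2.
- exact: act_zigzag1.
Qed.

(** The actions of the two duals of [x] are a left and a right adjoint of the action of [x]. *)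
Lemma rigid_act_exact : rigid C -> abelian_category M ->
  forall x, exact_functor (act_left M x).
Proof.
move=> rC abM x a b c i p [ki cp]; have [[y dy] [z dz]] := rC x.
apply/(short_exactP abM); split; first exact: (adj_kernel (left_dual_adj dy)).
exact: cokernel_epi (adj_cokernel (left_dual_adj dz) cp).
Qed.

End DualActions.

Arguments act_ev {k C M x y} ev m.
Arguments act_coev {k C M x y} coev m.

Section ModuleFunctorDuals.
Variables (k : fieldType) (C : monoidal k) (M N : modcat C).
Variables (F : functor M N) (s : str F).
Hypothesis sP : is_modfun s.

Lemma modfun_ev x y (ev : hom (y ⊗ x) tunit) m :
  fhom F (act_ev ev m) = act_ev ev (F m) ∘ (idm y ▷' s x m) ∘ s y (x ▷ m).
Proof.
case: sP => sN s2 s1; rewrite /act_ev !unlock.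
apply: (iso_epic (fiso F (aassoc y x m))) => /=.
rewrite !fhomM -!compA -fhomM fwdK fhom1 compm1.
rewrite (compA (idm y ▷' s x m)) -s2 (compA (bwd _)) fwdK comp1m.
by rewrite -s1 -!compA sN fhom1.
Qed.

Lemma modfun_coev x y (coev : hom tunit (x ⊗ y)) m :
  (idm x ▷' s y m) ∘ s x (y ▷ m) ∘ fhom F (act_coev coev m) = act_coev coev (F m).
Proof.
case: sP => sN s2 s1; rewrite /act_coev !unlock !fhomM !compA -s2.
rewrite -(compA _ _ (fhom F (coev ▷' _))) sN fhom1 !compA.
rewrite -!compA; do 2 congr (_ ∘ _); apply: (iso_monic (aunit (F m))).
by rewrite compA s1 -fhomM !bwdK fhom1.
Qed.

(* Over a rigid category lax module functors are strong. *)
Lemma lax_strong : rigid C -> forall x m, is_iso (s x m).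
Proof.
move=> rC x m; have [[y [ev [coev [E1 E2]]]] [z [ev' [coev' [F1 F2]]]]] := rC x.
case: (sP) => sN _ _.
pose t : hom (x ▷ F m) (F (x ▷ m)) :=
  act_ev ev' (F (x ▷ m)) ∘ (idm x ▷' (s z (x ▷ m) ∘ fhom F (act_coev coev' m))).
exists t; split.
- have e : t ∘ s x m = act_ev ev' (F (x ▷ m)) ∘ (idm x ▷' s z (x ▷ m))
      ∘ s x (z ▷ (x ▷ m)) ∘ fhom F (idm x ▷' act_coev coev' m).
    rewrite /t ahomMl -!compA; do 2 congr (_ ∘ _).
    by rewrite sN.
  by rewrite e -modfun_ev -fhomM act_zigzag2 // fhom1.
- rewrite /t compA -[s x m ∘ _]act_ev_natural -compA -ahomMl compA.
  by rewrite modfun_coev act_zigzag2.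
Qed.

End ModuleFunctorDuals.

(** * Tensoring on the right *)

Section Reverse.
Variables (k : fieldType) (C : monoidal k).

(** Reversing the tensor product turns right multiplication into a left action, so exactness of
    [- ⊗ m] comes from the same adjunction argument as exactness on the left. *)
Definition rev : monoidal k.
Proof.
apply: (@Monoidal k C tunit (fun x y => y ⊗ x) (fun x x' y y' f g => g ⊗' f) _ _ _ _
  (fun x y z => iso_inv (assoc z y x)) (fun x => runit x) (fun x => lunit x)).
- by move=> x y; apply: thom1.
- by move=> *; apply: thomM.
- by move=> x x' y y' g; apply: thom_linearr.
- by move=> x x' y y' g; apply: thom_linearl.
- move=> x x' y y' z z' f g h; exact: (@bwd_aassoc_natural k C (regular C)).
- by move=> x y f; apply: runit_natural.
- by move=> x y f; apply: lunit_natural.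
- move=> w x y z /=.
  apply: (iso_monic (iso_comp (assoc z y (x ⊗ w)) (assoc (z ⊗ y) x w))).
  rewrite /= !compA isoK bwdK.
  rewrite pentagon -!compA (compA (assoc z y x ⊗' _)) -thomM bwdK comp1m thom1 comp1m.
  by rewrite (compA (assoc z (y ⊗ x) w)) bwdK comp1m -thomM bwdK comp1m thom1.
- move=> x y /=; apply: (iso_epic (assoc y tunit x)); rewrite isoVK.
  by rewrite triangle.
Defined.

Lemma left_dual_rev (x y : C) : left_dual x y -> @left_dual k rev y x.
Proof. by move=> [ev [coev [E1 E2]]]; exists ev, coev. Qed.

Lemma rigid_rev : rigid C -> rigid rev.
Proof.
move=> rC x; have [[y dy] [z dz]] := rC x; split.
  by exists z; apply: left_dual_rev.
by exists y; apply: left_dual_rev.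
Qed.

Lemma regular_exact : rigid C -> finite_category C -> is_module_category (regular C).
Proof.
move=> rC fC; have [abC _ _ _ _] := fC; split=> // [x|m].
  exact: (@rigid_act_exact k C (regular C)).
by move=> x y z i p; apply: (@rigid_act_exact k rev (regular rev) (rigid_rev rC) abC m).
Qed.

End Reverse.

(** * Simplicity of the unit object *)

Section SimpleUnit.
Variables (k : fieldType) (C : monoidal k).
Hypotheses (rC : rigid C) (fC : finite_category C).
Let R := regular C.
Let abC : abelian_category R. Proof. by case: fC. Qed.
Let eR : is_module_category R. Proof. exact: regular_exact. Qed.

Section Subobject.
Variables (I J I' : C) (i : hom I tunit) (q : hom tunit J).
Variables (ev : hom (I' ⊗ I) tunit) (coev : hom tunit (I ⊗ I')).
Hypotheses (mi : mono i) (cq : is_cokernel i q).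
Hypotheses (E1 : runit I ∘ (idm I ⊗' ev) ∘ assoc I I' I ∘ (coev ⊗' idm I) = lunit I)
  (E2 : lunit I' ∘ (ev ⊗' idm I') ∘ bwd (assoc I' I I') ∘ (idm I' ⊗' coev) = runit I').
Implicit Types m n y : R.

Definition sub_act m : hom (I ▷ m) m := aunit m ∘ (i ▷' idm m).
Definition quot_act m : hom m (J ▷ m) := (q ▷' idm m) ∘ bwd (aunit m).

Let sub_natural m n (f : hom m n) : sub_act n ∘ (idm I ▷' f) = f ∘ sub_act m.
Proof. by rewrite /sub_act -compA -ahom_swap !compA aunit_natural. Qed.

Let sub_mono m : mono (sub_act m).
Proof.
case: eR => _ _ er; apply: mono_comp; first exact: iso_mono.
exact: (exact_mono abC (er m)).
Qed.

Let cok m : is_cokernel (sub_act m) (quot_act m).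
Proof.
case: eR => _ _ er; have c := exact_cokernel abC (er m) cq.
apply: is_cokernelP.
- exact: epi_comp (cokernel_epi c) (iso_epi (iso_inv (aunit m))).
- have -> : quot_act m ∘ sub_act m = (q ▷' idm m) ∘ (i ▷' idm m).
    by rewrite /sub_act /quot_act -compA (compA (bwd _)) fwdK comp1m.
  by have [] := c.
- move=> w g gi; have [|u uE] := cokernel_desc (g := g ∘ aunit m) c.
    by rewrite -compA.
  by exists u; move: uE; rewrite /quot_act compA /= => ->; rewrite isoK.
Qed.

(** The dual of [i], a map from the unit to [I'], acting on [n]. It is epi because [i] is mono. *)
Definition mate_act n : hom n (I' ▷ n) := sub_act (I' ▷ n) ∘ act_coev coev n.

Let mate_natural m n (f : hom m n) : mate_act n ∘ f = (idm I' ▷' f) ∘ mate_act m.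
Proof. by rewrite /mate_act -compA act_coev_natural [LHS]compA sub_natural -compA. Qed.

Let mate_epi n : epi (mate_act n).
Proof.
apply/epiP => y g; rewrite /mate_act compA -sub_natural -compA => h.
have {}h : (idm I ▷' g) ∘ act_coev coev n = 0.
  by apply: (@sub_mono y); rewrite h comp0r.
rewrite -[g]compm1 -(act_zigzag2 n E2) compA -act_ev_natural -compA -ahomMl h.
by rewrite [X in _ ∘ X]ahom0r comp0r.
Qed.

Let ev_mate m : act_ev ev m ∘ mate_act (I ▷ m) = sub_act m.
Proof. by rewrite /mate_act compA -sub_natural -compA act_zigzag1 // compm1. Qed.

Let mate_iso m : is_iso (mate_act (I ▷ m)).
Proof.
apply: (mono_epi_iso abC); last exact: mate_epi.
apply: (@mono_cancel _ _ _ _ _ (act_ev ev m)); rewrite ev_mate; exact: sub_mono.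
Qed.

Let Isub_epi m : epi (idm I ▷' sub_act m : hom _ (I ▷ m)).
Proof.
have [w [_ iw]] := mate_iso m.
have evE : act_ev ev m = sub_act m ∘ w by rewrite -ev_mate -compA iw compm1.
apply: (@retract_epi _ _ _ _ _ ((idm I ▷' w) ∘ act_coev coev (I ▷ m))).
by rewrite compA -ahomMl -evE act_zigzag1.
Qed.

Let exl x : exact_functor (act_left R x). Proof. by case: eR. Qed.

Let IJ_zero m : is_zero (I ▷ (J ▷ m)).
Proof.
have e : idm I ▷' quot_act m = 0.
  by apply: (Isub_epi (m := m)); rewrite comp0l -ahomMl (proj1 (cok m)) ahom0r.
exact: (zero_epi (exact_epi abC (exl I) (cokernel_epi (cok m))) e).
Qed.

Let JI_zero m : is_zero (J ▷ (I ▷ m)).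
Proof.
have e : sub_act (I ▷ m) = idm I ▷' sub_act m.
  by apply: (@sub_mono m); rewrite sub_natural.
apply: (zero_epi (cokernel_epi (cok (I ▷ m)))).
by apply: (Isub_epi (m := m)); rewrite comp0l -e; case: (cok (I ▷ m)).
Qed.

Let hom_JI m y (g : hom (J ▷ m) (I ▷ y)) : g = 0.
Proof.
(* The image is a quotient of an object killed by [I] and a subobject of one killed by [J]. Being an
   extension of [J ▷ z] by [I ▷ z], it is zero. *)
have [z [j [e [mj ee ->]]]] := image_ex abC g.
have Iz : is_zero (I ▷ z).
  apply: (zero_epi (exact_epi abC (exl I) ee)).
  exact: (proj1 (is_zeroP (IJ_zero m))).
have Jz : is_zero (J ▷ z).
  apply: (zero_mono (exact_mono abC (exl J) mj)).
  exact: (proj2 (is_zeroP (JI_zero y))).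
have [|u uE] := cokernel_desc (g := idm z) (cok z).
  exact: (proj1 (is_zeroP Iz)).
have -> : e = 0 by rewrite -[e]comp1m -uE (proj1 (is_zeroP Jz) _ u) comp0l comp0l.
exact: comp0r.
Qed.

Let I'J_zero m : is_zero (I' ▷ (J ▷ m)).
Proof.
rewrite /is_zero -(act_zigzag2 (J ▷ m) E2) [act_coev _ _]hom_JI.
by rewrite [X in _ ∘ X]ahom0r comp0r.
Qed.

Let sub_retract m : exists r, r ∘ sub_act m = idm (I ▷ m).
Proof.
have e1 : is_iso (idm I' ▷' sub_act m : hom _ (I' ▷ m)).
  apply: (mono_epi_iso abC); first exact: (exact_mono abC (exl I') (sub_mono (m := m))).
  apply: (cokernel_zero_epi (exact_cokernel abC (exl I') (cok m))).
  exact: I'J_zero.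
(* Naturality of the mate moves [sub_act] into the scope of [I'], where it is invertible; undoing
   the mate on [I ▷ m] then gives the retraction. *)
have [a [a1 _]] := e1; have [b [b1 _]] := mate_iso m.
exists (b ∘ a ∘ mate_act m).
by rewrite -compA mate_natural -!compA (compA a) a1 comp1m b1.
Qed.

(** On [I ▷ m] the mate is invertible, since it is epi and the inclusion [sub_act] factors through
    it; hence [I] absorbs itself and both composites of [I] with [J] vanish. It follows that there
    is no nonzero map from [J ▷ m] to [I ▷ y], then that [I'] kills [J ▷ m], and finally that the
    inclusion of [I] is split. The resulting idempotent of the unit is a scalar: if it is zero so is
    [I], and otherwise [i] is epi. *)
Lemma sub_unit : bijective (fun a : k => a *: idm tunit : hom (tunit : C) tunit) ->
  is_zero I \/ is_iso i.
Proof.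
move=> [sc scK Ksc]; have [r ri] := sub_retract tunit.
have e := Ksc (sub_act tunit ∘ r); set a := sc _ in e.
have [a0|na] := eqVneq a 0.
- left; have z : sub_act tunit = 0.
    by rewrite -[sub_act _]compm1 -ri compA -e a0 scale0r comp0l.
  have zz := zero_mono (sub_mono (m := tunit)) z.
  rewrite /is_zero -[idm I](isoK (runit I)) (proj2 (is_zeroP zz) _ (bwd (runit I))).
  by rewrite comp0r.
- right; apply: (mono_epi_iso abC) => //.
  apply: (@epi_cancel _ _ _ _ _ _ (runit I)).
  have -> : i ∘ runit I = runit tunit ∘ bwd (lunit tunit) ∘ sub_act tunit.
    by rewrite /sub_act compA isoVK runit_natural.
  apply: epi_comp; first exact: (iso_epi (iso_comp (runit _) (iso_inv (lunit _)))).
  apply: (@epi_cancel _ _ _ _ _ _ r); rewrite -e => w g h.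
  by rewrite !compZr !compm1 => /(scalerI na).
Qed.

End Subobject.
End SimpleUnit.

Section FiniteTensor.
Variables (k : fieldType) (C : monoidal k).
Hypothesis tC : finite_tensor C.

Lemma unit_scalar (f : hom (tunit : C) tunit) : exists a, f = a *: idm tunit.
Proof. by case: tC => _ [sc _ Ksc]; exists (sc f); rewrite Ksc. Qed.

Lemma unit_simple : simple_object (tunit : C).
Proof.
case: tC => [[fC rC] bij]; split.
  case: bij => sc scK _ z; have /eqP : (1 : k) = 0.
    by rewrite -[1]scK -[0]scK z !scaler0.
  by rewrite oner_eq0.
move=> I i mi; case: (fC) => abC _ _ _ _.
have [J [q cq]] := cokernel_ex abC i.
have [[I' [ev [coev [E1 E2]]]] _] := rC I.
exact: (sub_unit rC fC mi cq E1 E2).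
Qed.

(** A map to the simple unit is epi or zero, and a zero evaluation would annihilate [x] by the
    zigzag identity. Evaluations thus provide epis onto the unit. *)
Lemma dual_ev_epi (x y : C) (ev : hom (y ⊗ x) tunit) coev :
  runit x ∘ (idm x ⊗' ev) ∘ assoc x y x ∘ (coev ⊗' idm x) = lunit x ->
  ~ is_zero x -> epi ev.
Proof.
move=> E nx; case: tC => [[[abC _ _ _ _] _] _].
apply: (simple_epi abC unit_simple) => ev0; apply: nx.
have l0 : fwd (lunit x) = 0.
  rewrite -E ev0 (lin0 (@thom_linearr _ C _ _ _ _ _)).
  by rewrite comp0r !comp0l.
by rewrite /is_zero -(bwdK (lunit x)) l0 comp0l.
Qed.

End FiniteTensor.

(** By induction the remaining maps embed a sum of copies of [s] into [a]. Composed with the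
    cokernel of that embedding, [f ord0] is either zero, hence a scalar combination of the others
    against independence, or mono, which forces its coefficient to vanish. *)
Lemma simple_joint_mono (k : fieldType) (A : category k) (s a : A) n
    (f : 'I_n -> hom s a) (abA : abelian_category A) :
  simple_object s -> (forall g : hom s s, exists c, g = c *: idm s) ->
  independent f -> forall w (c : 'I_n -> hom w s),
  \sum_l f l ∘ c l = 0 -> forall l, c l = 0.
Proof.
move=> ss sc; elim: n f => [|n IH] f indf w c e; first by case.
have ind' : independent (fun l => f (lift ord0 l)).
  move=> d e' l; have := indf (fun j => if unlift ord0 j is Some l then d l else 0).
  rewrite big_ord_recl unlift_none scale0r add0r.
  by under eq_bigr do rewrite liftK; move=> /(_ e' (lift ord0 l)); rewrite liftK.
have {}IH := IH _ ind'.
suff c0 : c ord0 = 0.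
  move: e; rewrite big_ord_recl c0 comp0r add0r => /IH e l.
  by case: (unliftP ord0 l) => [l' ->|->].
have [t [i [p bs]]] := bigsum_ex abA (fun _ : 'I_n => s).
pose m := \sum_l f (lift ord0 l) ∘ p l.
have mE l : m ∘ i l = f (lift ord0 l).
  exact: (bigsum_in (fun l => f (lift ord0 l)) l bs).
have mm : mono m.
  apply/monoP => v g mg; case: (bs) => _ [_ sE].
  rewrite -[g]comp1m -sE comp_suml big1 // => l _.
  rewrite -compA (IH _ (fun l => p l ∘ g)) ?comp0r //.
  by rewrite -[RHS]mg /m comp_suml; apply: eq_bigr => j _; rewrite compA.
have [z [q se]] := mono_short_exact abA mm.
have [qf|nqf] := EM (q ∘ f ord0 = 0).
  have [g gE] := kernel_lift (proj1 se) qf.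
  have [a' aE] := choice (fun l => sc (p l ∘ g)).
  have := indf (fun j => if unlift ord0 j is Some l then - a' l else 1).
  rewrite big_ord_recl unlift_none scale1r; under eq_bigr do rewrite liftK.
  have -> : f ord0 + \sum_l - a' l *: f (lift ord0 l) = 0.
    rewrite -gE -[g]comp1m; case: (bs) => _ [_ <-].
    rewrite comp_suml comp_sumr -big_split big1 //= => l _.
    by rewrite -compA aE compZr compm1 compZr mE scaleNr subrr.
  by move=> /(_ erefl ord0); rewrite unlift_none => /eqP; rewrite oner_eq0.
apply: (simple_mono abA ss nqf); rewrite comp0r -compA.
have -> : f ord0 ∘ c ord0 = - (m ∘ \sum_l i l ∘ c (lift ord0 l)).
  apply/eqP; rewrite -addr_eq0 -e big_ord_recl comp_sumr.
  by under eq_bigr do rewrite compA mE.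
by rewrite compNr compA; case: se => -[-> _] _; rewrite comp0l oppr0.
Qed.

(** * Internal Homs and free module functors *)

Section ModuleFunctorRules.
Variables (k : fieldType) (C : monoidal k) (M N : modcat C) (K : modfun M N).

Lemma mstr_nat x y m n (f : hom x y) (g : hom m n) :
  mstr K y n ∘ fhom K (f ▷' g) = (f ▷' fhom K g) ∘ mstr K x m.
Proof. by case: (mstrP K). Qed.

Lemma mstr_hex x y m : aassoc x y (K m) ∘ mstr K (x ⊗ y) m =
  (idm x ▷' mstr K y m) ∘ mstr K x (y ▷ m) ∘ fhom K (aassoc x y m).
Proof. by case: (mstrP K). Qed.

Lemma mstr_unit m : aunit (K m) ∘ mstr K tunit m = fhom K (aunit m).
Proof. by case: (mstrP K). Qed.

Lemma mstr_natl x y m (f : hom x y) :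
  mstr K y m ∘ fhom K (f ▷' idm m) = (f ▷' idm (K m)) ∘ mstr K x m.
Proof. by rewrite mstr_nat fhom1. Qed.

End ModuleFunctorRules.

Section ActRight.
Variables (k : fieldType) (C : monoidal k) (M : modcat C) (m : M).

Lemma act_right_modfun :
  @is_modfun k C (regular C) M (act_right m) (fun x c => aassoc x c m).
Proof.
split=> [x y c d f g|x y c|c].
- exact: aassoc_natural.
- exact: apentagon.
- exact: aunit_assoc.
Qed.

Definition act_right_mod : modfun (regular C) M :=
  @Modfun k C (regular C) M (act_right m) (fun x c => aassoc x c m) act_right_modfun.

Lemma act_ev_right x y (ev : hom (y ⊗ x) tunit) (c : C) :
  act_ev (M := regular C) ev c ▷' idm m =
  act_ev ev (c ▷ m) ∘ (idm y ▷' aassoc x c m) ∘ aassoc y (x ⊗ c) m.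
Proof. exact: (modfun_ev act_right_modfun ev c). Qed.

Lemma act_coev_right x y (coev : hom tunit (x ⊗ y)) (c : C) :
  (idm x ▷' aassoc y c m) ∘ aassoc x (y ⊗ c) m
    ∘ (act_coev (M := regular C) coev c ▷' idm m) = act_coev coev (c ▷ m).
Proof. exact: (modfun_coev act_right_modfun coev c). Qed.

End ActRight.

Section InternalHom.
Variables (k : fieldType) (C : monoidal k) (M : modcat C) (m : M).

Definition is_ihom (x : M) (h : C) (e : hom (h ▷ m) x) : Prop :=
  forall c (f : hom (c ▷ m) x), exists! u : hom c h, e ∘ (u ▷' idm m) = f.

Lemma ihom_ex (x : M) : finite_category C -> is_module_category M ->
  exists h e, @is_ihom x h e.
Proof.
move=> fC [fM _ er]; have [P gP] := finite_generator fC.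
case: fC => abC fdC _ _ _; case: fM => abM fdM _ _ _.
apply: (@representable k C P abC gP (fun c => fdC P c) (fun c => hom (c ▷ m) x)
  (fun c d f g => g ∘ (f ▷' idm m))) => //.
- by move=> c d f; apply: comp_linearl.
- by move=> c d g a f f'; rewrite ahomDl ahomZl compDr compZr.
- by move=> c g; rewrite ahom1 compm1.
- by move=> c d d' g f h; rewrite ahomMr compA.
- move=> c d d' i p g [ki /cokernel_epi ep] e.
  by apply: (exact_epi abC (er m) ep); rewrite comp0l.
- move=> c d d' i p g /(er m) [_ cp] e.
  exact: (cokernel_desc cp e).
Qed.

(** Moving [y] across by its dual [z] on both sides reduces maps into [y ▷ x] to maps into [x]. This
    makes the internal Hom a module functor. *)
Lemma ihom_tensor (x : M) h e (y : C) : rigid C -> @is_ihom x h e ->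
  @is_ihom (y ▷ x) (y ⊗ h) ((idm y ▷' e) ∘ aassoc y h m).
Proof.
move=> rC hP; have [[z [ev [coev [E1 E2]]]] _] := rC y => c f.
have [u [uE uU]] := hP _ (act_ev ev x ∘ (idm z ▷' f) ∘ aassoc z c m).
have ex1 (v : hom c (y ⊗ h)) : (idm y ▷' e) ∘ aassoc y h m ∘ (v ▷' idm m) = f ->
    act_ev (M := regular C) ev h ∘ (idm z ⊗' v) = u.
  move=> vE; apply: esym; apply: uU; rewrite ahomMr act_ev_right.
  rewrite -!compA aassoc_natural (compA (idm z ▷' aassoc y h m)) -ahomMl compA.

  rewrite -act_ev_natural -compA; congr (_ ∘ _); rewrite compA -ahomMl.
  by rewrite compA vE.
have zz (v : hom c (y ⊗ h)) : v = (idm y ⊗' (act_ev (M := regular C) ev h ∘ (idm z ⊗' v)))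
    ∘ act_coev (M := regular C) coev c.
  have := @ahomMl k C (regular C) y _ _ _ (act_ev (M := regular C) ev h) (idm z ⊗' v) => /= ->.
  rewrite -compA; have := @act_coev_natural k C (regular C) y z coev _ _ v => /= <-.
  have := @act_zigzag1 k C (regular C) y z ev coev h E1 => /= e1.
  by rewrite compA e1 comp1m.
exists ((idm y ⊗' u) ∘ act_coev (M := regular C) coev c); split.
- rewrite ahomMr compA -(compA (idm y ▷' e)) aassoc_natural compA -ahomMl uE.
  rewrite ahomMl -!compA (compA (idm y ▷' aassoc z c m)) act_coev_right.
  by rewrite ahomMl -compA -act_coev_natural compA act_zigzag1 // comp1m.
- by move=> v vE; rewrite [RHS]zz ex1.
Qed.

Arguments ihom_tensor [x h e] y _ _.

Variables (h : M -> C) (e : forall x, hom (h x ▷ m) x).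
Hypothesis hP : forall x, is_ihom (e x).
Arguments e {x}.

Definition tr c x (f : hom (c ▷ m) x) : hom c (h x) := projT1 (cid (hP f)).

Lemma trE c x (f : hom (c ▷ m) x) : e ∘ (tr f ▷' idm m) = f.
Proof. by rewrite /tr; case: cid => u []. Qed.

Lemma tr_uniq x (h' : C) (e' : hom (h' ▷ m) x) (P' : is_ihom e') c (u v : hom c h') :
  e' ∘ (u ▷' idm m) = e' ∘ (v ▷' idm m) -> u = v.
Proof. by move=> E; have [w [_ U]] := P' _ (e' ∘ (v ▷' idm m)); rewrite -(U u) // -(U v). Qed.

Lemma tr_comp c d x (f : hom (c ▷ m) x) (g : hom d c) :
  tr f ∘ g = tr (f ∘ (g ▷' idm m)).
Proof. by apply: (tr_uniq (hP (x := x))); rewrite ahomMr compA !trE. Qed.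

Definition ihom_functor : functor M C.
Proof.
exists h (fun x y f => tr (f ∘ e)).
- by move=> x; apply: (tr_uniq (hP (x := x))); rewrite trE ahom1 comp1m compm1.
- by move=> x y z g f; apply: (tr_uniq (hP (x := z))); rewrite ahomMr compA !trE -!compA trE.
- move=> x y a f g; apply: (tr_uniq (hP (x := y))).
  by rewrite ahomDl ahomZl compDr compZr !trE compDl compZl.
Defined.

Lemma ihom_fhomE x y (f : hom x y) : e ∘ (fhom ihom_functor f ▷' idm m) = f ∘ e.
Proof. exact: trE. Qed.

Lemma tr_post c x y (f : hom (c ▷ m) x) (g : hom x y) :
  fhom ihom_functor g ∘ tr f = tr (g ∘ f).
Proof. by apply: (tr_uniq (hP (x := y))); rewrite ahomMr compA !trE -!compA trE. Qed.

Hypothesis rC : rigid C.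

Lemma ihom_str_ex (y : C) (x : M) : exists s : iso (h (y ▷ x)) (y ⊗ h x),
  (idm y ▷' e) ∘ aassoc y (h x) m ∘ (s ▷' idm m) = e.
Proof.
have P' := ihom_tensor y rC (hP (x := x)).
have [u [uE _]] := P' _ e.
pose v := tr ((idm y ▷' e) ∘ aassoc y (h x) m).
have vu : v ∘ u = idm _.
  by apply: (tr_uniq (hP (x := y ▷ x))); rewrite ahomMr ahom1 compm1 compA trE.
have uv : u ∘ v = idm _.
  by apply: (tr_uniq P'); rewrite ahomMr ahom1 compm1 compA uE trE.
by exists (Iso vu uv).
Qed.

Definition ihom_str (y : C) (x : M) : iso (h (y ▷ x)) (y ⊗ h x) :=
  projT1 (cid (ihom_str_ex y x)).

Lemma ihom_strE y x :
  (idm y ▷' e) ∘ aassoc y (h x) m ∘ (ihom_str y x ▷' idm m) = e.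
Proof. by rewrite /ihom_str; case: cid. Qed.

Lemma ihom_modfun :
  @is_modfun k C M (regular C) ihom_functor (fun y x => ihom_str y x).
Proof.
split.
- move=> x y a b f g; apply: (tr_uniq (ihom_tensor y rC (hP (x := b)))).
  rewrite (ahomMr _ (ihom_str y b)) (ahomMr _ (f ⊗' _)) [LHS]compA ihom_strE ihom_fhomE.
  have -> : (idm y ▷' e) ∘ aassoc y (h b) m
      ∘ ((f ⊗' fhom ihom_functor g ▷' idm m) ∘ (ihom_str x a ▷' idm m)) =
      (f ▷' g) ∘ ((idm x ▷' e) ∘ aassoc x (h a) m ∘ (ihom_str x a ▷' idm m)).
    rewrite !compA -(compA (idm y ▷' e)) aassoc_natural !compA -!ahomM comp1m.
    by rewrite ihom_fhomE compm1.
  by rewrite ihom_strE.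
- move=> x y a.
  have P2 := ihom_tensor x rC (ihom_tensor y rC (hP (x := a))).
  apply: (tr_uniq P2).
  rewrite (ahomMr _ (assoc x y (h a))) !(ahomMr _ (_ ∘ _)) (ahomMr _ (idm x ⊗' _)).
  have -> : (idm x ▷' ((idm y ▷' e) ∘ aassoc y (h a) m)) ∘ aassoc x (y ⊗ h a) m
      ∘ ((assoc x y (h a) ▷' idm m) ∘ (ihom_str (x ⊗ y) a ▷' idm m)) =
      aassoc x y a ∘ ((idm (x ⊗ y) ▷' e) ∘ aassoc (x ⊗ y) (h a) m
      ∘ (ihom_str (x ⊗ y) a ▷' idm m)).
    rewrite ahomMl !compA -thom1 aassoc_natural -!compA; congr (_ ∘ _).
    by rewrite !compA apentagon.
  rewrite ihom_strE.
  have -> : (idm x ▷' ((idm y ▷' e) ∘ aassoc y (h a) m)) ∘ aassoc x (y ⊗ h a) m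
      ∘ ((idm x ⊗' ihom_str y a ▷' idm m) ∘ (ihom_str x (y ▷ a) ▷' idm m)
         ∘ (fhom ihom_functor (aassoc x y a) ▷' idm m)) =
      (idm x ▷' ((idm y ▷' e) ∘ aassoc y (h a) m ∘ (ihom_str y a ▷' idm m)))
      ∘ aassoc x (h (y ▷ a)) m ∘ (ihom_str x (y ▷ a) ▷' idm m)
         ∘ (fhom ihom_functor (aassoc x y a) ▷' idm m).
    rewrite !compA -(compA _ (aassoc x (y ⊗ h a) m)) aassoc_natural !compA.
    by rewrite -ahomMl.
  by rewrite !ihom_strE ihom_fhomE.
- move=> a; apply: (tr_uniq (hP (x := a))); rewrite ihom_fhomE (ahomMr _ (lunit (h a))).
  by rewrite -aunit_assoc !compA -aunit_natural -!compA (compA (idm tunit ▷' e)) ihom_strE.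
Qed.

Definition ihom_mod : modfun M (regular C) :=
  @Modfun k C M (regular C) ihom_functor (fun y x => ihom_str y x) ihom_modfun.

Variables (N N' : modcat C) (n : N').

(** The module functor [Hom(m, -) ▷ n]. *)
Definition ihom_act : modfun M N' := modfun_comp (act_right_mod n) ihom_mod.

Definition ihom_unit : hom n (ihom_act m) :=
  (tr (aunit m) ▷' idm n) ∘ bwd (aunit n).

Variables (K : modfun N' N) (G : modfun M N).

(** Inverse of evaluation at the generator: transformations from K(Hom(m, -) ▷ n) to G correspond to
    maps K n -> G m, by acting with Hom(m, x) on such a map and then evaluating. The two inverse
    laws are [yoneda_eval] and [yoneda_uniq]. *)
Definition yoneda (s : hom (K n) (G m)) x : hom (K (h x ▷ n)) (G x) :=
  fhom G e ∘ bwd (mstr G (h x) m) ∘ (idm (h x) ▷' s) ∘ mstr K (h x) n.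

Lemma bwd_mstr_natl (H : modfun M N) x y a (f : hom x y) :
  bwd (mstr H y a) ∘ (f ▷' idm (H a)) = fhom H (f ▷' idm a) ∘ bwd (mstr H x a).
Proof.
apply: (iso_monic (mstr H y a)); apply: (iso_epic (mstr H x a)).
by rewrite !compA bwdK comp1m isoVK mstr_natl.
Qed.

Lemma yoneda_natural s x y (f : hom x y) :
  yoneda s y ∘ fhom K (fhom ihom_functor f ▷' idm n) = fhom G f ∘ yoneda s x.
Proof.
rewrite /yoneda -!compA mstr_natl (compA (idm (h y) ▷' s)) ahom_swap !compA.
by rewrite -(compA (fhom G e)) bwd_mstr_natl !compA -!fhomM ihom_fhomE.
Qed.

Lemma yoneda_str s y x : mstr G y x ∘ yoneda s (y ▷ x) =
  (idm y ▷' yoneda s x) ∘ (mstr K y (h x ▷ n) ∘ fhom K (aassoc y (h x) n)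
    ∘ fhom K (ihom_str y x ▷' idm n)).
Proof.
have G1 : mstr G y x ∘ fhom G e ∘ bwd (mstr G (h (y ▷ x)) m) =
    (idm y ▷' (fhom G e ∘ bwd (mstr G (h x) m))) ∘ aassoc y (h x) (G m)
      ∘ (ihom_str y x ▷' idm (G m)).
  apply: (iso_epic (mstr G (h (y ▷ x)) m)).
  rewrite isoVK -ihom_strE !fhomM !compA mstr_nat -!compA -mstr_natl !compA.
  rewrite ahomMl -(compA _ _ (aassoc y (h x) (G m))).
  rewrite -(compA _ (_ ∘ _) (mstr G _ _)) -(compA (_ ▷' bwd _)) mstr_hex !compA.
  by rewrite -(compA _ _ (idm y ▷' mstr G _ _)) -ahomMl fwdK ahom1 compm1.
rewrite /yoneda !compA G1 ahomMl.
rewrite -(compA _ (ihom_str y x ▷' _)) -ahom_swap !compA.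
rewrite -(compA _ (aassoc _ _ _)) -thom1 aassoc_natural !compA -ahomMl.
by rewrite -!compA -mstr_natl (compA (aassoc _ _ _)) mstr_hex !ahomMl -!compA.
Qed.

Definition yoneda_nat (s : hom (K n) (G m)) : modnat (modfun_comp K ihom_act) G.
Proof.
exists (yoneda s); first exact: yoneda_natural.
move=> y x; rewrite [LHS]yoneda_str; congr (_ ∘ _).
by rewrite /= /str_comp /= fhomM !compA.
Defined.

Lemma yoneda_eval s : yoneda s m ∘ fhom K ihom_unit = s.
Proof.
rewrite /yoneda /ihom_unit fhomM compA -(compA _ (mstr K (h m) n)) mstr_natl.
rewrite compA -(compA _ (idm (h m) ▷' s)) ahom_swap !compA.
rewrite -(compA (fhom G e)) bwd_mstr_natl !compA -fhomM trE -mstr_unit.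
rewrite isoK; apply: (iso_epic (fiso K (aunit n))) => /=.
by rewrite -compA -fhomM fwdK fhom1 compm1 aunit_natural -compA mstr_unit.
Qed.

Lemma yoneda_uniq (z : modnat (modfun_comp K ihom_act) G) x :
  z x = yoneda (z m ∘ fhom K ihom_unit) x.
Proof.
(* By the triangle identity for the internal Hom adjunction, [z x] is recovered from [z] at
   [h x ▷ m], where linearity reduces it to [z m]. *)
pose d := tr (idm (h x ▷ m)).
have dE : fhom ihom_functor e ∘ d = idm (h x).
  by apply: (tr_uniq (hP (x := x))); rewrite ahomMr compA ihom_fhomE -compA trE compm1 ahom1 compm1.
have sd : ihom_str (h x) m ∘ d = (idm (h x) ⊗' tr (aunit m)) ∘ bwd (runit (h x)).
  apply: (tr_uniq (ihom_tensor (h x) rC (hP (x := m)))).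
  rewrite (ahomMr _ (ihom_str _ _)) compA ihom_strE trE.
  rewrite ahomMr compA -(compA (idm (h x) ▷' e)) aassoc_natural compA -ahomMl trE.
  by rewrite atriangle -ahomMr bwdK ahom1.
have zm : mstr G (h x) m ∘ z (h x ▷ m) = (idm (h x) ▷' z m) ∘ (mstr K (h x) (h m ▷ n)
    ∘ fhom K (aassoc (h x) (h m) n) ∘ fhom K (ihom_str (h x) m ▷' idm n)).
  by rewrite [LHS](nt_mod z (h x) m) /= /str_comp /= fhomM !compA.
have zn : z x ∘ fhom K (fhom ihom_functor e ▷' idm n) = fhom G e ∘ z (h x ▷ m).
  exact: (nt_natural z (e (x := x))).
have zx : z x = z x ∘ fhom K (fhom ihom_functor e ▷' idm n) ∘ fhom K (d ▷' idm n).
  by rewrite -compA -fhomM -ahomMr dE ahom1 fhom1 compm1.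
have zh : z (h x ▷ m) = bwd (mstr G (h x) m) ∘ (mstr G (h x) m ∘ z (h x ▷ m)).
  by rewrite compA fwdK comp1m.
rewrite zx zn zh zm /yoneda -!compA -fhomM -ahomMr sd; do 2 congr (_ ∘ _).
rewrite ahomMl -compA; congr (_ ∘ _).
rewrite -mstr_nat; congr (_ ∘ _); rewrite -fhomM; congr (fhom K _).
rewrite /ihom_unit ahomMr compA aassoc_natural ahomMl -compA; congr (_ ∘ _).
apply: (iso_monic (fiso (act_left N' (h x)) (aunit n))) => /=.
by rewrite compA atriangle -ahomMr -ahomMl !bwdK !ahom1.
Qed.

Lemma yoneda_ext (z w : modnat (modfun_comp K ihom_act) G) :
  z m ∘ fhom K ihom_unit = w m ∘ fhom K ihom_unit -> forall x, z x = w x.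
Proof. by move=> E x; rewrite yoneda_uniq E -yoneda_uniq. Qed.

End InternalHom.

(** * Exactness of module functors *)

Section Reflection.
Variables (k : fieldType) (A B : category k).
Hypotheses (abA : abelian_category A) (abB : abelian_category B).

Lemma short_exact_iso x y z x' y' z' (f : hom x y) (g : hom y z)
    (f' : hom x' y') (g' : hom y' z') (a : iso x x') (b : iso y y') (c : iso z z') :
  f' ∘ a = b ∘ f -> g' ∘ b = c ∘ g -> short_exact (A := A) f g -> short_exact f' g'.
Proof.
move=> e1 e2 /(short_exactP abA) [kf eg]; apply/(short_exactP abA).
have f'E : f' = b ∘ f ∘ bwd a by rewrite -e1 isoK.
have g'E : g' = c ∘ g ∘ bwd b by rewrite -e2 isoK.
split; last first.
  rewrite g'E; apply: epi_comp; last exact: (iso_epi (iso_inv b)).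
  by apply: epi_comp => //; apply: iso_epi.
apply: is_kernelP.
- rewrite f'E; apply: mono_comp; last exact: (iso_mono (iso_inv a)).
  by apply: mono_comp; [apply: iso_mono|apply: kernel_mono kf].
- by rewrite f'E g'E !compA isoVK -(compA c) (proj1 kf) comp0r comp0l.
- move=> w h; rewrite g'E -!compA => e.
  have [|u uE] := kernel_lift (g := bwd b ∘ h) kf.
    by apply: (iso_mono c); rewrite e comp0r.
  exists (a ∘ u); rewrite f'E -!compA (compA (bwd a)) fwdK comp1m uE.
  by rewrite compA bwdK comp1m.
Qed.

Variable G : functor A B.
Hypotheses (eG : exact_functor G) (rG : forall x, is_zero (G x) -> is_zero x).

Lemma reflect_mono x y (f : hom x y) : mono (fhom G f) -> mono f.
Proof.
move=> m; have [w [i ki]] := kernel_ex abA f; apply: (kernel_zero_mono ki).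
apply: rG; apply: (zero_mono (exact_mono abA eG (kernel_mono ki))).
by apply: m; rewrite comp0r -fhomM (proj1 ki) fhom0.
Qed.

Lemma reflect_epi x y (f : hom x y) : epi (fhom G f) -> epi f.
Proof.
move=> m; have [w [i ki]] := cokernel_ex abA f; apply: (cokernel_zero_epi ki).
apply: rG; apply: (zero_epi (exact_epi abA eG (cokernel_epi ki))).
by apply: m; rewrite comp0l -fhomM (proj1 ki) fhom0.
Qed.

Lemma reflect_short_exact x y z (f : hom x y) (g : hom y z) :
  g ∘ f = 0 -> short_exact (fhom G f) (fhom G g) -> short_exact f g.
Proof.
move=> gf /(short_exactP abB) [kf eg]; apply/(short_exactP abA).
split; last exact: reflect_epi.
have [w [i ki]] := kernel_ex abA g; have [u uE] := kernel_lift ki gf.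
have eu : epi u.
  apply: reflect_epi; have kGi := exact_kernel abA eG ki.
  have [v vE] := kernel_lift kf (proj1 kGi).
  apply: (retract_epi (i := v)); apply: (kernel_mono kGi).
  by rewrite compA -fhomM uE vE compm1.
have mf : mono f by apply: reflect_mono; apply: kernel_mono kf.
have [|j [ju uj]] := mono_epi_iso abA _ eu; first by apply: (mono_cancel (g := i)); rewrite uE.
apply: is_kernelP => // v h gh; have [h' <-] := kernel_lift ki gh.
by exists (j ∘ h'); rewrite -uE -compA (compA u) uj comp1m.
Qed.

End Reflection.

Section ModuleFunctorExact.
Variables (k : fieldType) (C : monoidal k) (M N : modcat C) (p : C).
Hypotheses (abM : abelian_category M) (abN : abelian_category N).
Hypotheses (eM : exact_functor (act_left M p)) (eN : exact_functor (act_left N p)).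
Hypotheses (pM : forall m : M, projective (p ▷ m))
  (rN : forall n : N, is_zero (p ▷ n) -> is_zero n).

(* Acting by [p] splits every short exact sequence of [M], and it reflects
   short exact sequences of [N]. *)
Lemma modfun_exact (F : modfun M N) : exact_functor F.
Proof.
move=> x y z i q se; have se' := eM se.
have [s sE] := projective_split (@pM z) (cokernel_epi (proj2 se')).
have [r [ri _ E]] := short_exact_split se' sE.
have seF := fhom_split F abN ri sE (proj1 (proj2 se')) E.
apply: (reflect_short_exact abN abN eN rN).
  by rewrite -fhomM (proj1 (proj2 se)) fhom0.
by apply: (short_exact_iso abN _ _ seF (a := mstr F p x) (b := mstr F p y) (c := mstr F p z));
  rewrite /= mstr_nat.
Qed.

End ModuleFunctorExact.

(** * Abelian structure on categories of module functors *)

Section ModuleFunctorAbelian.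
Variables (k : fieldType) (C : monoidal k) (M N : modcat C).
Hypotheses (abN : abelian_category N) (eN : forall x, exact_functor (act_left N x)).
Implicit Types F G H : modfun M N.

Lemma modnatP F G (t u : @hom _ (modfun_cat M N) F G) :
  (forall m, (t : modnat _ _) m = (u : modnat _ _) m) -> t = u.
Proof. exact: modnat_eq. Qed.

(** Kernels are formed pointwise. Because each action functor of [N] preserves them, the structure
    isomorphisms of [F] restrict, and every axiom is checked after the mono into [F]. *)
Lemma modfun_kernel F G (t : modnat F G) :
  exists H (j : modnat H F), forall m, is_kernel (j m) (t m).
Proof.
have [K KE] := choice (fun m => kernel_ex abN (t m)); have [i iK] := dep_choice KE.
have mi m : mono (i m) := kernel_mono (iK m).
have lif (a : {ab : M * M & hom ab.1 ab.2}) :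
    exists u, i (tag a).2 ∘ u = fhom F (tagged a) ∘ i (tag a).1.
  case: a => -[a b] /= f; apply: (kernel_lift (iK b)).
  by rewrite compA nt_natural -compA (proj1 (iK a)) comp0r.
have [l lE] := dep_choice lif.
pose l' a b (f : hom a b) : hom (K a) (K b) := l (existT _ (a, b) f).
have l'E a b (f : hom a b) : i b ∘ l' a b f = fhom F f ∘ i a := lE (existT _ (a, b) f).
have L1 a : l' a a (idm a) = idm (K a) by apply: mi; rewrite l'E fhom1 comp1m compm1.
have LM a b c (g : hom b c) (f : hom a b) : l' a c (g ∘ f) = l' b c g ∘ l' a b f.
  by apply: mi; rewrite l'E compA l'E fhomM -!compA l'E.
have Ll a b : linear (l' a b).
  move=> c f g; apply: mi; rewrite l'E compDr compZr !l'E.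
  by rewrite fhom_linear compDl compZl.
pose H0 := @Functor _ M N K l' L1 LM Ll.
have mxi x m : mono (idm x ▷' i m) := exact_mono abN (eN x) (mi m).
have st (a : (C * M)%type) : exists s : iso (K (a.1 ▷ a.2)) (a.1 ▷ K a.2),
    (idm a.1 ▷' i a.2) ∘ s = mstr F a.1 a.2 ∘ i (a.1 ▷ a.2).
  case: a => x m /=.
  have kx : is_kernel (idm x ▷' i m) (idm x ▷' t m) := exact_kernel abN (@eN x) (iK m).
  have [s sE] : exists s, (idm x ▷' i m) ∘ s = mstr F x m ∘ i (x ▷ m).
    apply: (kernel_lift kx); rewrite compA -nt_mod -compA (proj1 (iK _)).
    exact: comp0r.
  have [r rE] : exists r, i (x ▷ m) ∘ r = bwd (mstr F x m) ∘ (idm x ▷' i m).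
    apply: (kernel_lift (iK _)); apply: (iso_mono (mstr G x m)).
    by rewrite comp0r !compA nt_mod isoK (proj1 kx).
  have rs : r ∘ s = idm _.
    by apply: mi; rewrite compA rE -compA sE compA fwdK comp1m compm1.
  have sr : s ∘ r = idm _.
    by apply: mxi; rewrite compA sE -compA rE compA bwdK comp1m compm1.
  by exists (Iso rs sr).
have [s sE] := dep_choice st.
pose s' x m : iso (H0 (x ▷ m)) (x ▷ H0 m) := s (x, m).
have s'E x m : (idm x ▷' i m) ∘ s' x m = mstr F x m ∘ i (x ▷ m) := sE (x, m).
have sP : is_modfun (F := H0) (fun x m => s' x m).
  split.
  - move=> x y m n f g /=; apply: mxi.
    rewrite !compA s'E -compA l'E compA mstr_nat -!compA -s'E !compA -!ahomM.
    by rewrite comp1m l'E compm1.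
  - move=> x y m; apply: (exact_mono abN (@eN x) (mxi y m)) => /=.
    rewrite !compA -aassoc_natural thom1 -(compA (aassoc _ _ _)) s'E compA mstr_hex.
    rewrite -(compA _ (fhom F _)) -l'E !compA -!ahomMl s'E !ahomMl -!compA.
    by rewrite (compA (idm x ▷' i _)) s'E !compA.
  - move=> m /=; apply: mi; rewrite compA -aunit_natural -compA s'E compA mstr_unit.
    by rewrite -l'E.
exists (Modfun sP), (@Modnat _ _ _ _ (Modfun sP) F i l'E (fun x m => esym (s'E x m))).
exact: iK.
Qed.

Lemma modfun_cokernel F G (t : modnat F G) :
  exists H (j : modnat G H), forall m, is_cokernel (t m) (j m).
Proof.
have [K KE] := choice (fun m => cokernel_ex abN (t m)); have [i iK] := dep_choice KE.
have mi m : epi (i m) := cokernel_epi (iK m).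
have lif (a : {ab : M * M & hom ab.1 ab.2}) :
    exists u, u ∘ i (tag a).1 = i (tag a).2 ∘ fhom G (tagged a).
  case: a => -[a b] /= f; apply: (cokernel_desc (iK a)).
  by rewrite -compA -nt_natural compA (proj1 (iK b)) comp0l.
have [l lE] := dep_choice lif.
pose l' a b (f : hom a b) : hom (K a) (K b) := l (existT _ (a, b) f).
have l'E a b (f : hom a b) : l' a b f ∘ i a = i b ∘ fhom G f := lE (existT _ (a, b) f).
have L1 a : l' a a (idm a) = idm (K a) by apply: mi; rewrite l'E fhom1 comp1m compm1.
have LM a b c (g : hom b c) (f : hom a b) : l' a c (g ∘ f) = l' b c g ∘ l' a b f.
  by apply: mi; rewrite l'E -compA l'E fhomM !compA l'E.
have Ll a b : linear (l' a b).
  move=> c f g; apply: mi; rewrite l'E compDl compZl !l'E.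
  by rewrite fhom_linear compDr compZr.
pose H0 := @Functor _ M N K l' L1 LM Ll.
have mxi x m : epi (idm x ▷' i m) := exact_epi abN (eN x) (mi m).
have st (a : (C * M)%type) : exists s : iso (K (a.1 ▷ a.2)) (a.1 ▷ K a.2),
    s ∘ i (a.1 ▷ a.2) = (idm a.1 ▷' i a.2) ∘ mstr G a.1 a.2.
  case: a => x m /=.
  have kx : is_cokernel (idm x ▷' t m) (idm x ▷' i m) := exact_cokernel abN (@eN x) (iK m).
  have [s sE] : exists s, s ∘ i (x ▷ m) = (idm x ▷' i m) ∘ mstr G x m.
    apply: (cokernel_desc (iK _)); rewrite -compA nt_mod compA (proj1 kx).
    exact: comp0l.
  have [r rE] : exists r, r ∘ (idm x ▷' i m) = i (x ▷ m) ∘ bwd (mstr G x m).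
    apply: (cokernel_desc kx); apply: (iso_epi (mstr F x m)).
    by rewrite comp0l -!compA -nt_mod (compA (bwd _)) fwdK comp1m (proj1 (iK _)).
  have rs : r ∘ s = idm _.
    by apply: mi; rewrite -compA sE compA rE isoVK comp1m.
  have sr : s ∘ r = idm _.
    by apply: mxi; rewrite -compA rE compA sE isoK comp1m.
  by exists (Iso rs sr).
have [s sE] := dep_choice st.
pose s' x m : iso (H0 (x ▷ m)) (x ▷ H0 m) := s (x, m).
have s'E x m : s' x m ∘ i (x ▷ m) = (idm x ▷' i m) ∘ mstr G x m := sE (x, m).
have sP : is_modfun (F := H0) (fun x m => s' x m).
  split.
  - move=> x y m n f g /=; apply: mi.
    rewrite -!compA l'E s'E !compA s'E -compA mstr_nat !compA -!ahomM.
    by rewrite comp1m l'E compm1.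
  - move=> x y m /=; apply: mi.
    rewrite -!compA s'E l'E compA -thom1 aassoc_natural -!compA mstr_hex.
    by rewrite (compA (s' x _)) s'E !compA -!ahomMl s'E.
  - by move=> m /=; apply: mi; rewrite -compA s'E compA aunit_natural -compA mstr_unit l'E.
exists (Modfun sP), (@Modnat _ _ _ _ G (Modfun sP) i (fun a b f => esym (l'E a b f)) s'E).
exact: iK.
Qed.

Lemma modfun_biproduct F G : exists H (i1 : modnat F H) (i2 : modnat G H)
    (p1 : modnat H F) (p2 : modnat H G),
  forall m, is_biproduct (i1 m) (i2 m) (p1 m) (p2 m).
Proof.
have bi m : exists a : {s : N & (hom (F m) s * hom (G m) s) * (hom s (F m) * hom s (G m))}%type,
    is_biproduct (tagged a).1.1 (tagged a).1.2 (tagged a).2.1 (tagged a).2.2.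
  case: abN => _ bi _ _ _; have [s [i1 [i2 [p1 [p2 h]]]]] := bi (F m) (G m).
  by exists (existT _ s ((i1, i2), (p1, p2))).
have [a aE] := dep_choice bi.
pose K m := tag (a m); pose i1 m : hom (F m) (K m) := (tagged (a m)).1.1.
pose i2 m : hom (G m) (K m) := (tagged (a m)).1.2.
pose p1 m : hom (K m) (F m) := (tagged (a m)).2.1.
pose p2 m : hom (K m) (G m) := (tagged (a m)).2.2.
have e1 m : p1 m ∘ i1 m = idm _ by case: (aE m).
have e2 m : p2 m ∘ i2 m = idm _ by case: (aE m).
have e3 m : p1 m ∘ i2 m = 0 by case: (aE m).
have e4 m : p2 m ∘ i1 m = 0 by case: (aE m).
have e5 m : i1 m ∘ p1 m + i2 m ∘ p2 m = idm _ by case: (aE m).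
have bE m : is_biproduct (i1 m) (i2 m) (p1 m) (p2 m) := aE m.
clearbody K i1 i2 p1 p2; clear a aE bi.
have ext m n (u v : hom (K m) n) : u ∘ i1 m = v ∘ i1 m -> u ∘ i2 m = v ∘ i2 m -> u = v.
  by move=> h1 h2; rewrite -[u]compm1 -[v]compm1 -e5 !compDr !compA h1 h2.
pose l a b (f : hom a b) : hom (K a) (K b) :=
  i1 b ∘ fhom F f ∘ p1 a + i2 b ∘ fhom G f ∘ p2 a.
have l1 a b f : l a b f ∘ i1 a = i1 b ∘ fhom F f.
  by rewrite compDl -!(compA _ _ (i1 a)) e1 e4 compm1 comp0r addr0.
have l2 a b f : l a b f ∘ i2 a = i2 b ∘ fhom G f.
  by rewrite compDl -!(compA _ _ (i2 a)) e2 e3 compm1 comp0r add0r.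
have q1 a b f : p1 b ∘ l a b f = fhom F f ∘ p1 a.
  by rewrite compDr !compA e1 e3 comp1m !comp0l addr0.
have q2 a b f : p2 b ∘ l a b f = fhom G f ∘ p2 a.
  by rewrite compDr !compA e2 e4 comp1m !comp0l add0r.
clearbody l.
have L1 a : l a a (idm a) = idm (K a).
  by apply: ext; rewrite ?l1 ?l2 fhom1 comp1m compm1.
have LM a b c (g : hom b c) (f : hom a b) : l a c (g ∘ f) = l b c g ∘ l a b f.
  by apply: ext; rewrite -compA ?l1 ?l2 fhomM !compA ?l1 ?l2.
have Ll a b : linear (l a b).
  by move=> c f g; apply: ext; rewrite compDl compZl ?l1 ?l2 fhom_linear compDr compZr.
pose H0 := @Functor _ M N K l L1 LM Ll.
pose s x m : hom (K (x ▷ m)) (x ▷ K m) := (idm x ▷' i1 m) ∘ mstr F x m ∘ p1 _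
  + (idm x ▷' i2 m) ∘ mstr G x m ∘ p2 _.
have s1 x m : s x m ∘ i1 _ = (idm x ▷' i1 m) ∘ mstr F x m.
  by rewrite compDl -!(compA _ _ (i1 _)) e1 e4 compm1 comp0r addr0.
have s2 x m : s x m ∘ i2 _ = (idm x ▷' i2 m) ∘ mstr G x m.
  by rewrite compDl -!(compA _ _ (i2 _)) e2 e3 compm1 comp0r add0r.
have t1 x m : (idm x ▷' p1 m) ∘ s x m = mstr F x m ∘ p1 _.
  by rewrite compDr !compA -!ahomMl e1 e3 ahom1 comp1m ahom0r !comp0l addr0.
have t2 x m : (idm x ▷' p2 m) ∘ s x m = mstr G x m ∘ p2 _.
  by rewrite compDr !compA -!ahomMl e2 e4 ahom1 comp1m ahom0r !comp0l add0r.
pose r x m : hom (x ▷ K m) (K (x ▷ m)) := i1 _ ∘ bwd (mstr F x m) ∘ (idm x ▷' p1 m)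
  + i2 _ ∘ bwd (mstr G x m) ∘ (idm x ▷' p2 m).
have rs x m : r x m ∘ s x m = idm _.
  by rewrite compDl -!compA t1 t2 !(compA (bwd _)) !fwdK !comp1m e5.
have sr x m : s x m ∘ r x m = idm _.
  by rewrite compDr !compA s1 s2 !isoK -!ahomMl -ahomDr e5 ahom1.
clearbody s r.
have sP : is_modfun (F := H0) (fun x m => Iso (rs x m) (sr x m)).
  split.
  - move=> x y m n f g /=; apply: ext; rewrite -!compA ?l1 ?l2 ?s1 ?s2 !compA ?s1 ?s2.
      by rewrite -compA mstr_nat !compA -!ahomM comp1m compm1 l1.
    by rewrite -compA mstr_nat !compA -!ahomM comp1m compm1 l2.
  - move=> x y m /=; apply: ext; rewrite -!compA ?l1 ?l2 ?s1 ?s2.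
      rewrite compA -thom1 aassoc_natural -!compA mstr_hex.
      by rewrite (compA (s x _)) s1 !compA -!ahomMl s1.
    rewrite compA -thom1 aassoc_natural -!compA mstr_hex.
    by rewrite (compA (s x _)) s2 !compA -!ahomMl s2.
  - move=> m /=; apply: ext; rewrite -!compA ?l1 ?l2 ?s1 ?s2 compA aunit_natural -compA.
      by rewrite mstr_unit.
    by rewrite mstr_unit.
exists (Modfun sP), (@Modnat _ _ _ _ F (Modfun sP) i1 (fun a b f => esym (l1 a b f)) s1),
  (@Modnat _ _ _ _ G (Modfun sP) i2 (fun a b f => esym (l2 a b f)) s2),
  (@Modnat _ _ _ _ (Modfun sP) F p1 q1 (fun x m => esym (t1 x m))),
  (@Modnat _ _ _ _ (Modfun sP) G p2 q2 (fun x m => esym (t2 x m))).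
exact: bE.
Qed.

End ModuleFunctorAbelian.

Section ModuleFunctorCategoryAbelian.
Variables (k : fieldType) (C : monoidal k) (M N : modcat C).
Hypotheses (abN : abelian_category N) (eN : forall x, exact_functor (act_left N x)).
Let MC := modfun_cat M N.
Implicit Types F G H : modfun M N.

Lemma modnat_is_kernel F G H (j : modnat H F) (t : modnat F G) :
  (forall m, is_kernel (j m) (t m)) -> @is_kernel k MC H F G j t.
Proof.
move=> kj; have mj m := kernel_mono (kj m).
apply: (@is_kernelP k MC H F G j t).
- by move=> E u v e; apply: modnatP => m; apply: mj; exact: (congr1 (fun w : modnat E F => w m) e).
- by apply: modnatP => m; apply: (proj1 (kj m)).
- move=> E g tg; have tgm m : t m ∘ (g : modnat _ _) m = 0.
    exact: (congr1 (fun w : modnat E G => w m) tg).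
  have [u uE] := dep_choice (fun m => kernel_lift (kj m) (tgm m)).
  have uN m n (f : hom m n) : u n ∘ fhom E f = fhom H f ∘ u m.
    by apply: mj; rewrite !compA nt_natural uE -compA uE nt_natural.
  have uM : is_modnat (fun x m => mstr E x m) (fun x m => mstr H x m) u.
    move=> x m; apply: (exact_mono abN (eN x) (mj m)) => /=.
    by rewrite !compA -nt_mod -compA uE nt_mod -ahomMl uE.
  by exists (Modnat uN uM); apply: modnatP => m; apply: uE.
Qed.

Lemma modnat_is_cokernel F G H (j : modnat G H) (t : modnat F G) :
  (forall m, is_cokernel (t m) (j m)) -> @is_cokernel k MC F G H t j.
Proof.
move=> kj; have mj m := cokernel_epi (kj m).
apply: (@is_cokernelP k MC F G H t j).
- by move=> E u v e; apply: modnatP => m; apply: mj; exact: (congr1 (fun w : modnat G E => w m) e).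
- by apply: modnatP => m; apply: (proj1 (kj m)).
- move=> E g tg; have tgm m : (g : modnat _ _) m ∘ t m = 0.
    exact: (congr1 (fun w : modnat F E => w m) tg).
  have [u uE] := dep_choice (fun m => cokernel_desc (kj m) (tgm m)).
  have uN m n (f : hom m n) : u n ∘ fhom H f = fhom E f ∘ u m.
    by apply: mj; rewrite -!compA -nt_natural uE compA uE nt_natural.
  have uM : is_modnat (fun x m => mstr H x m) (fun x m => mstr E x m) u.
    move=> x m; apply: mj.
    by rewrite -!compA uE (nt_mod j) compA -ahomMl uE nt_mod.
  by exists (Modnat uN uM); apply: modnatP => m; apply: uE.
Qed.

(** The pointwise kernel is itself a module functor, so a mono of module functors kills its
    inclusion and the kernel vanishes at every object. *)
Lemma modnat_mono F G (t : modnat F G) :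
  @mono k MC F G t -> forall m, mono (t m).
Proof.
move=> mt; have [H [j jK]] := modfun_kernel abN eN t => m.
apply: (kernel_zero_mono (jK m)); apply: (zero_mono (kernel_mono (jK m))).
have j0 : (j : @hom k MC H F) = 0.
  by apply: mt; rewrite comp0r; apply: modnatP => n; apply: (proj1 (jK n)).
by rewrite [j]j0.
Qed.

Lemma modnat_epi F G (t : modnat F G) :
  @epi k MC F G t -> forall m, epi (t m).
Proof.
move=> mt; have [H [j jK]] := modfun_cokernel abN eN t => m.
apply: (cokernel_zero_epi (jK m)); apply: (zero_epi (cokernel_epi (jK m))).
have j0 : (j : @hom k MC G H) = 0.
  by apply: mt; rewrite comp0l; apply: modnatP => n; apply: (proj1 (jK n)).
by rewrite [j]j0.
Qed.

Lemma modnat_epi_of F G (t : modnat F G) :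
  (forall m, epi (t m)) -> @epi k MC F G t.
Proof.
move=> et E u v e; apply: modnatP => m; apply: et.
exact: (congr1 (fun w : modnat F E => w m) e).
Qed.

Lemma modfun_cat_abelian : abelian_category MC.
Proof.
split.
- have [z zz] : exists z : N, is_zero z by case: abN.
  have zl n (f : hom n z) : f = 0 := proj2 (is_zeroP zz) n f.
  have zr n (f : hom z n) : f = 0 := proj1 (is_zeroP zz) n f.
  pose Z0 := @Functor _ M N (fun => z) (fun _ _ _ => idm z) (fun => erefl)
    (fun _ _ _ _ _ => esym (comp1m _)) (fun _ _ _ _ _ => etrans (zl _ _) (esym (zl _ _))).
  have zx x : is_zero (x ▷ z) := fhom_zero (act_left N x) zz.
  pose s x (m : M) : iso (Z0 (x ▷ m)) (x ▷ Z0 m) :=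
    @Iso k N z (x ▷ z) 0 0 (etrans (zl _ _) (esym (zl _ _)))
     (etrans (comp0l _ _) (esym (zx x))).
  have sP : is_modfun (F := Z0) (fun x m => s x m).
    by split=> *; exact: etrans (zr _ _) (esym (zr _ _)).
  by exists (Modfun sP); apply: modnatP => m; exact: zl.
- move=> F G; have [H [i1 [i2 [p1 [p2 bE]]]]] := modfun_biproduct abN F G.
  exists H, i1, i2, p1, p2; split; apply: modnatP => m; case: (bE m) => //= e1 e2 e3 e4 e5.
  by rewrite !scale1r.
- move=> F G t; split.
    have [H [j jK]] := modfun_kernel abN eN t.
    by exists H, j; apply: modnat_is_kernel.
  have [H [j jK]] := modfun_cokernel abN eN t.
  by exists H, j; apply: modnat_is_cokernel.
- move=> F G t mt; have [H [j jK]] := modfun_cokernel abN eN t.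
  exists H, j; apply: modnat_is_kernel => m.
  by apply: mono_kernel_cokernel => //; apply: modnat_mono.
- move=> F G t mt; have [H [j jK]] := modfun_kernel abN eN t.
  exists H, j; apply: modnat_is_cokernel => m.
  by apply: epi_cokernel_kernel => //; apply: modnat_epi.
Qed.

Lemma modnat_short_exact F G H (i : modnat F G) (p : modnat G H) :
  @short_exact k MC F G H i p <-> forall m, short_exact (i m) (p m).
Proof.
split=> [[ki cp] m|h].
  have [K [j jK]] := modfun_kernel abN eN p; have kj := modnat_is_kernel jK.
  have [u uE] := kernel_lift ki (proj1 kj); have [v vE] := kernel_lift kj (proj1 ki).
  have vE' n : j n ∘ (v : modnat _ _) n = i n := congr1 (fun w : modnat F G => w n) vE.
  have uE' n : i n ∘ (u : modnat _ _) n = j n := congr1 (fun w : modnat K G => w n) uE.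
  apply/(short_exactP abN); split; last first.
    by apply: modnat_epi; apply: cokernel_epi cp.
  apply: is_kernelP.
  - by apply: modnat_mono; apply: kernel_mono ki.
  - by rewrite -vE' compA (proj1 (jK m)) comp0l.
  - move=> w g pg; have [w' <-] := kernel_lift (jK m) pg.
    by exists ((u : modnat _ _) m ∘ w'); rewrite compA uE'.
split.
  by apply: modnat_is_kernel => m; case: (h m).
by apply: modnat_is_cokernel => m; case: (h m).
Qed.

Section Generator.
Variables (m0 : M).
Hypotheses (abM : abelian_category M) (gM : generator m0) (fdM : fd_homs M).

Lemma modnat_gen_eq F G (t u : modnat F G) : exact_functor F ->
  t m0 = u m0 -> forall m, t m = u m.
Proof.
move=> eF tu m; have [n [s [i [p [e [[_ [_ bs]] _ ee]]]]]] := gen_cover abM gM fdM m.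
apply: (exact_epi abM eF ee); rewrite !nt_natural; congr (_ ∘ _).
rewrite -[t s]compm1 -[u s]compm1 -!fhom1 -bs !fhom_sum !comp_sumr.
by apply: eq_bigr => j _; rewrite !fhomM !compA !nt_natural tu.
Qed.

Lemma modnat_fd F G : exact_functor F -> finite_dimensional (hom (F m0) (G m0)) ->
  finite_dimensional (@hom k MC F G).
Proof.
move=> eF fdN; apply: (@fd_inj k (@hom k MC F G) (hom (F m0) (G m0))
  (fun t : modnat F G => t m0) _ _ fdN).
- by move=> a t u /=; rewrite !scale1r !addr0.
- by move=> t u e; apply: modnatP => m; apply: modnat_gen_eq.
Qed.

Lemma modnat_gen_epi F G (t : modnat F G) : exact_functor G ->
  epi (t m0) -> forall m, epi (t m).
Proof.
move=> eF et m; have [n [s [i [p [e [bs _ ee]]]]]] := gen_cover abM gM fdM m.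
have ets : epi (t s).
  apply/epiP => w g gt; rewrite -[g]compm1 -fhom1; case: bs => _ [_ <-].
  rewrite fhom_sum comp_sumr big1 // => j _; rewrite fhomM compA.
  suff -> : g ∘ fhom G (i j) = 0 by rewrite comp0l.
  by apply: et; rewrite comp0l -compA -nt_natural compA gt comp0l.
apply: (epi_cancel (f := fhom F e)); rewrite nt_natural.
by apply: epi_comp ets; apply: (exact_epi abM eF ee).
Qed.

End Generator.
End ModuleFunctorCategoryAbelian.

(** * Finiteness of categories of module functors *)

Section LeftUnit.
Variables (k : fieldType) (C : monoidal k) (M N : modcat C) (Q G : modfun M N).

Lemma id_comp_mod (z : forall m, hom (Q m) (G m)) :
  is_modnat (fun x m => mstr Q x m) (fun x m => mstr G x m) z <->
  is_modnat (fun x m => mstr (modfun_comp (modfun_id N) Q) x m) (fun x m => mstr G x m) z.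
Proof.
have E x m : fwd (mstr (modfun_comp (modfun_id N) Q) x m) = mstr Q x m by apply: comp1m.
by split=> h x m; have := h x m; rewrite E.
Qed.

Definition of_id_comp (z : modnat (modfun_comp (modfun_id N) Q) G) : modnat Q G :=
  @Modnat k C M N Q G z (nt_natural z) (proj2 (id_comp_mod z) (nt_mod z)).

Definition to_id_comp (z : modnat Q G) : modnat (modfun_comp (modfun_id N) Q) G :=
  @Modnat k C M N (modfun_comp (modfun_id N) Q) G z (nt_natural z)
    (proj1 (id_comp_mod z) (nt_mod z)).

End LeftUnit.

Record ihoms (k : fieldType) (C : monoidal k) (M : modcat C) := Ihoms {
  ih : M -> M -> C;
  ih_ev : forall m x, hom (ih m x ▷ m) x;
  ihP : forall m x, is_ihom (ih_ev m x) }.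
Arguments ih_ev {k C M} i m x.

Section ModuleCategories.
Variables (k : fieldType) (C : monoidal k).
Hypotheses (rC : rigid C) (fC : finite_category C).
Implicit Types M N : modcat C.

Lemma ihoms_ex M : is_module_category M -> inhabited (ihoms M).
Proof.
move=> mM; have [h hE] := dep_choice (fun a : M * M => ihom_ex a.1 a.2 fC mM).
have [e eP] := dep_choice hE; split.
by apply: (@Ihoms k C M (fun m x => h (m, x)) (fun m x => e (m, x))) => m x; apply: (eP (m, x)).
Qed.

Lemma proj_unit_ex : exists (p : C) (e : hom p tunit), projective p /\ epi e.
Proof. by case: fC => _ _ _ ep _; apply: ep. Qed.

Lemma act_reflects_zero M (p : C) (e : hom p tunit) : is_module_category M -> epi e ->
  forall m : M, is_zero (p ▷ m) -> is_zero m.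
Proof.
move=> [_ _ er] ee m zp; case: fC => abC _ _ _ _.
have e0 : e ▷' idm m = 0 by apply: (proj1 (is_zeroP zp)).
have := zero_epi (exact_epi abC (er m) ee) e0.
by move/(fhom_zero (functor_id M)) => z1; rewrite /is_zero -(bwdK (aunit m))
  (proj1 (is_zeroP z1) _ (fwd (aunit m))) comp0l.
Qed.

(** A projective [p] with an epi to the unit meets the hypotheses of [modfun_exact]: it makes the
    objects of [M] projective and is seen faithfully by those of [N]. *)
Lemma exact_module_exact M N (F : modfun M N) :
  exact_module M -> is_module_category N -> exact_functor F.
Proof.
move=> [mM pM] mN; have [p [e [pp ee]]] := proj_unit_ex.
case: (mM) (mN) => -[abM _ _ _ _] el _ [[abN _ _ _ _] elN _].
have rN (n : N) : is_zero (p ▷ n) -> is_zero n by apply: act_reflects_zero ee n.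
exact: (@modfun_exact k C M N p abN (el p) (elN p) (fun m => pM p m pp) rN F).
Qed.

Section Free.
Variables (M N : modcat C) (IM : ihoms M).

(** The module functor [Hom(m, -) ▷ n], free on a generator [n] at [m]. *)
Definition free_mod (m : M) (n : N) : modfun M N :=
  ihom_act (@ihP k C M IM m) rC n.

Definition free_unit (m : M) (n : N) : hom n (free_mod m n m) :=
  ihom_unit (@ihP k C M IM m) rC n.

Definition free_map (m : M) (n : N) (G : modfun M N) (s : hom n (G m)) :
    modnat (free_mod m n) G :=
  of_id_comp (yoneda_nat (@ihP k C M IM m) rC (K := modfun_id N) (G := G) s).

Lemma free_map_unit m n (G : modfun M N) (s : hom n (G m)) :
  free_map s m ∘ free_unit m n = s.
Proof. exact: (yoneda_eval (@ihP k C M IM m) rC (K := modfun_id N) (G := G)). Qed.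

Lemma free_ext m n (G : modfun M N) (z w : modnat (free_mod m n) G) :
  z m ∘ free_unit m n = w m ∘ free_unit m n -> forall x, z x = w x.
Proof.
move=> E x; exact: (yoneda_ext (hP := @ihP k C M IM m)
  (z := to_id_comp z) (w := to_id_comp w) E x).
Qed.

Lemma free_projective m n : is_module_category N -> projective n ->
  @projective k (modfun_cat M N) (free_mod m n).
Proof.
move=> [[abN _ _ _ _] eN _] pn F G t z /(modnat_epi abN eN) et.
have [s sE] := pn _ _ (t m : hom (F m) (G m)) (z m ∘ free_unit m n) (et m).
exists (free_map s); apply: modnatP; apply: free_ext => /=.
by rewrite -compA free_map_unit.
Qed.

(** Maps from the free functor to [F] are maps from [n0] to [F m0]. They detect zero because [n0]
    generates [N] and transformations are determined at [m0]. *)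
Lemma free_generator (m0 : M) (n0 : N) : exact_module M -> is_module_category N ->
  generator m0 -> generator n0 -> @generator k (modfun_cat M N) (free_mod m0 n0).
Proof.
move=> xM mN gM gN; split; first by apply: free_projective => //; case: gN.
move=> F G t h; case: (xM) => -[[abM fdM _ _ _] _ _] _.
apply: modnatP; apply: (modnat_gen_eq abM gM fdM).
  exact: exact_module_exact.
apply: (proj2 gN) => s; have := congr1 (fun z : modnat _ _ => z m0 ∘ free_unit m0 n0) (h (free_map s)).
by rewrite /= comp0l -compA free_map_unit.
Qed.

End Free.

Lemma modfun_cat_finite M N : exact_module M -> is_module_category N ->
  finite_category (modfun_cat M N).
Proof.
move=> xM mN; case: (xM) => mM _; have [IM] := ihoms_ex mM.
case: (mM) (mN) => fM _ _ [fN eN _].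
have [m0 gM] := finite_generator fM; have [n0 gN] := finite_generator fN.
case: (fM) (fN) => abM fdM _ _ _ [abN fdN _ _ _].
apply: (@finite_of_generator k (modfun_cat M N) (free_mod IM m0 n0)).
- exact: modfun_cat_abelian.
- exact: free_generator.
- move=> F G; apply: (modnat_fd abM gM fdM) => //.
  exact: exact_module_exact.
Qed.

End ModuleCategories.

(** * Induction to the centre *)

Section TensorRules.
Variables (k : fieldType) (C : monoidal k).
Implicit Types x y z w : C.

Lemma thomMl x y z w (g : hom z w) (f : hom y z) :
  idm x ⊗' (g ∘ f) = (idm x ⊗' g) ∘ (idm x ⊗' f).
Proof. exact: (@ahomMl k C (regular C)). Qed.

Lemma thomMr x y z w (g : hom y z) (f : hom x y) :
  (g ∘ f) ⊗' idm w = (g ⊗' idm w) ∘ (f ⊗' idm w).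
Proof. exact: (@ahomMr k C (regular C)). Qed.

Lemma thom_swap x y z w (f : hom x y) (g : hom z w) :
  (idm y ⊗' g) ∘ (f ⊗' idm z) = (f ⊗' idm w) ∘ (idm x ⊗' g).
Proof. exact: (@ahom_swap k C (regular C)). Qed.

Lemma thom0r x y z w (f : hom x y) : f ⊗' (0 : hom z w) = 0.
Proof. exact: (@ahom0r k C (regular C)). Qed.

Lemma thom0l x y z w (g : hom z w) : (0 : hom x y) ⊗' g = 0.
Proof. exact: (@ahom0l k C (regular C)). Qed.

End TensorRules.

Section NaturalBraidings.
Variables (k : fieldType) (C : monoidal k) (q : C).
Hypotheses (rC : rigid C) (fC : finite_category C).

Definition nat_br (b : C) (t : forall x, hom (q ⊗ x) (x ⊗ b)) : Prop :=
  forall x y (f : hom x y), t y ∘ (idm q ⊗' f) = (f ⊗' idm b) ∘ t x.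

Record natbr (b : C) := Natbr {
  nb :> forall x, hom (q ⊗ x) (x ⊗ b);
  nbP : nat_br nb }.

Lemma natbr_eq b (s t : natbr b) : (forall x, s x = t x) -> s = t.
Proof.
case: s t => [s sP] [t tP] /= e.
have {}e : s = t by apply: functional_extensionality_dep.
by case: _ / e in tP *; congr Natbr; apply: Prop_irrelevance.
Qed.

Definition natbr0 b : natbr b.
Proof. by exists (fun x => 0) => x y f; rewrite comp0l comp0r. Defined.

Definition natbr_lin b (a : k) (s t : natbr b) : natbr b.
Proof.
exists (fun x => a *: s x + t x) => x y f.
by rewrite compDl compZl !nbP compDr compZr.
Defined.

Definition natbr_lmod b : lmodType k :=
  @sub_lmod k C (fun x => hom (q ⊗ x) (x ⊗ b)) (natbr b) (@nb b)
    (@natbr_eq b) (natbr0 b) (@natbr_lin b) (fun x => erefl) (fun a s t x => erefl).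

Definition natbr_post b b' (g : hom b b') (t : natbr b) : natbr b'.
Proof.
exists (fun x => (idm x ⊗' g) ∘ t x) => x y f.
by rewrite -compA nbP !compA thom_swap.
Defined.

(** Sending b to the natural families from q ⊗ x to x ⊗ b is left exact in b, because tensoring is
    exact, and finite-dimensional. It is therefore corepresented by an object, obtained from
    [representable] in the opposite category with an injective cogenerator as generator; this is the
    coend that carries the left adjoint of the forgetful functor from the centre. *)
Lemma induction_ex : exists (L : C) (lam : natbr L),
  forall b (t : natbr b), exists! g : hom L b, forall x, (idm x ⊗' g) ∘ lam x = t x.
Proof.
have [I gI] := injective_cogenerator fC; have [P gP] := finite_generator fC.
case: (fC) => abC fdC _ _ _; have [_ eR _] := regular_exact rC fC.
have [|||||||L [lam lamP]] := @representable k (op C) I (op_abelian abC) gI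
  (fun x => fdC x I) natbr_lmod (fun b b' g t => natbr_post g t).
- move=> b b' g a s t; apply: natbr_eq => x /=.
  by rewrite !(scale1r, addr0) compDr compZr.
- move=> b b' t a g g'; apply: natbr_eq => x /=.
  rewrite !(scale1r, addr0) -compZl -compDl; congr (_ ∘ _).
  exact: thom_linearr.
- by move=> b t; apply: natbr_eq => x /=; rewrite thom1 comp1m.
- by move=> b b' b'' g f t; apply: natbr_eq => x /=; rewrite compA -thomMl.
- move=> b b' b'' i p t [_ cp] e; apply: natbr_eq => x.
  have mp : mono (p : hom (c := C) b'' b').
    move=> w g h; exact: (cokernel_epi cp).
  apply: (exact_mono abC (eR x) mp); rewrite [RHS]comp0r.
  exact: (congr1 (fun s : natbr _ => s x) e).
- move=> b b' b'' i p t [_ [pi cp]] e.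
  have kp : is_kernel (p : hom (c := C) b'' b') (i : hom (c := C) b' b).
    by split.
  have kx x := exact_kernel abC (eR x) kp.
  have [u uE] := dep_choice (fun x => kernel_lift (kx x) (congr1 (fun s : natbr _ => s x) e)).
  have uN : nat_br u.
    move=> x y f; apply: (kernel_mono (kx y)).
    rewrite compA uE nbP -uE !compA; congr (_ ∘ _).
    exact: (esym (@thom_swap k C x y b'' b' f p)).
  by exists (Natbr uN); apply: natbr_eq => x; apply: uE.
(* Covering every object by copies of the generator [P] shows that a natural family is determined by
   its component at [P]. *)
- apply: (@fd_inj k (natbr_lmod I) (hom (q ⊗ P) (P ⊗ I : C)) (fun t : natbr I => t P) _ _ (fdC _ _)).
    by move=> a s t /=; rewrite !(scale1r, addr0).
  move=> s t e; apply: natbr_eq => x.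
  have [n [z [i [p [r [[_ [_ bs]] _ er]]]]]] := gen_cover abC gP fdC x.
  apply: (exact_epi abC (eR q) er) => /=; rewrite !nbP; congr (_ ∘ _).
  rewrite -[s z]compm1 -[t z]compm1 -!thom1 -bs.
  rewrite !(lin_sum (@thom_linearr k C _ _ _ _ _)) !comp_sumr.
  by apply: eq_bigr => j _; rewrite !thomMl !compA !nbP e.
exists L, lam => b t; have [g [gE gU]] := lamP b t; exists g; split.
  by move=> x; rewrite -gE.
by move=> g' g'E; apply: gU; apply: natbr_eq => x; apply: g'E.
Qed.

End NaturalBraidings.

Section Induction.
Variables (k : fieldType) (C : monoidal k) (q L : C) (lam : natbr q L).
Hypotheses (rC : rigid C) (fC : finite_category C).
Hypothesis lamP : forall b (t : natbr q b),
  exists! g : hom L b, forall x, (idm x ⊗' g) ∘ lam x = t x.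

Section Act.
Variable N : modcat C.
Implicit Types n b : N.

Definition ind_act x n : hom (q ▷ (x ▷ n)) (x ▷ (L ▷ n)) :=
  locked_with act_key (aassoc x L n ∘ (lam x ▷' idm n) ∘ bwd (aassoc q x n)).

Lemma ind_actE x n :
  ind_act x n ∘ aassoc q x n = aassoc x L n ∘ (lam x ▷' idm n).
Proof. by rewrite /ind_act unlock isoVK. Qed.

Lemma ind_act_natural x y m n (f : hom x y) (g : hom m n) :
  ind_act y n ∘ (idm q ▷' (f ▷' g)) = (f ▷' (idm L ▷' g)) ∘ ind_act x m.
Proof.
apply: (iso_epic (aassoc q x m)).
rewrite -!compA ind_actE -aassoc_natural compA ind_actE -compA -ahomM nbP.
by rewrite compA -aassoc_natural -compA -ahomM comp1m compm1.
Qed.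

Definition nat_act n b (t : forall x, hom (q ▷ (x ▷ n)) (x ▷ b)) : Prop :=
  forall x y (f : hom x y),
    t y ∘ (idm q ▷' (f ▷' idm n)) = (f ▷' idm b) ∘ t x.

(** The universal property of [L] carries over to any module category with internal Homs: a natural
    family into [x ▷ b] is turned into one into x ⊗ Hom(n, b). *)
Lemma ind_act_univ n b (t : forall x, hom (q ▷ (x ▷ n)) (x ▷ b)) : ihoms N ->
  nat_act t -> exists! u : hom (L ▷ n) b, forall x, (idm x ▷' u) ∘ ind_act x n = t x.
Proof.
move=> IN tN; have P' x := ihom_tensor (y := x) rC (@ihP k C N IN n b).
have [t' tE] := dep_choice (fun x => P' x _ (t x ∘ aassoc q x n)).
have t'N : nat_br t'.
  move=> x y f; apply: (tr_uniq (P' y)).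
  rewrite !ahomMr [LHS]compA; have [-> _] := tE y.
  have -> : (idm y ▷' ih_ev IN n b) ∘ aassoc y (ih IN n b) n
      ∘ (((f ⊗' idm (ih IN n b)) ▷' idm n) ∘ (t' x ▷' idm n)) =
      (f ▷' idm b) ∘ ((idm x ▷' ih_ev IN n b) ∘ aassoc x (ih IN n b) n ∘ (t' x ▷' idm n)).
    rewrite !compA -(compA _ _ ((f ⊗' _) ▷' _)) aassoc_nat_id !compA.
    by rewrite ahom_swap.
  have [-> _] := tE x.
  by rewrite -compA aassoc_natural compA tN !compA.
have [g [gE gU]] := lamP (Natbr t'N).
exists (ih_ev IN n b ∘ (g ▷' idm n)); split.
  move=> x; apply: (iso_epic (aassoc q x n)); rewrite -compA ind_actE ahomMl.
  rewrite compA -(compA _ _ (fwd _)) -aassoc_natural !compA -(compA _ _ (_ ▷' _)).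
  by rewrite -ahomMr gE; case: (tE x).
move=> u uE; have [v [vE _]] := ihP IN (m := n) (x := b) u.
suff -> : g = v by rewrite vE.
apply: gU => x; apply: (tr_uniq (P' x)); have [/= -> _] := tE x.
rewrite -uE -vE ahomMl -!compA ind_actE ahomMr !compA.
by rewrite -(compA _ _ (fwd _)) -aassoc_natural !compA.
Qed.

Lemma ind_act_ext n b (u v : hom (L ▷ n) b) : ihoms N ->
  (forall x, (idm x ▷' u) ∘ ind_act x n = (idm x ▷' v) ∘ ind_act x n) -> u = v.
Proof.
move=> IN e; have [|w [_ wU]] := @ind_act_univ n b (fun x => (idm x ▷' v) ∘ ind_act x n) IN.
  by move=> x y f; rewrite -compA ind_act_natural ahom1 !compA ahom_swap.
by rewrite -(wU u) // -(wU v).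
Qed.

End Act.

Let R := regular C.

(** The hexagon forces the half-braiding: together with [lam x] it must produce [lam] at [x ⊗ y],
    and the universal property of [L ▷ y] provides exactly one such map. *)
Lemma ind_br_ex (y : C) : exists nu : hom (L ⊗ y) (y ⊗ L),
  forall x, (idm x ⊗' nu) ∘ (assoc x L y ∘ (lam x ⊗' idm y)) =
    assoc x y L ∘ lam (x ⊗ y) ∘ assoc q x y.
Proof.
have [IR] := ihoms_ex fC (regular_exact rC fC).
have [|nu [nuE _]] := @ind_act_univ R y (y ⊗ L)
   (fun x => assoc x y L ∘ lam (x ⊗ y)) IR.
  move=> x x' f /=.
  by rewrite -compA nbP !compA assoc_natural thom1.
exists nu => x; apply: (iso_epic (iso_inv (assoc q x y))) => /=.
by rewrite -nuE /ind_act unlock /= -!compA bwdK compm1.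
Qed.

Section Braiding.
Variable nu : forall y, hom (L ⊗ y) (y ⊗ L).
Hypothesis nuE : forall y x, (idm x ⊗' nu y) ∘ (assoc x L y ∘ (lam x ⊗' idm y)) =
    assoc x y L ∘ lam (x ⊗ y) ∘ assoc q x y.
Variable N : modcat C.

Definition ind_str y (n : N) : hom (L ▷ (y ▷ n)) (y ▷ (L ▷ n)) :=
  locked_with act_key (aassoc y L n ∘ ((nu y ▷' idm n) ∘ bwd (aassoc L y n))).

Lemma ind_strE y n : ind_str y n ∘ aassoc L y n = aassoc y L n ∘ (nu y ▷' idm n).
Proof. by rewrite /ind_str unlock compA isoVK. Qed.

Lemma ind_hex x y n : (idm x ▷' ind_str y n) ∘ ind_act x (y ▷ n) ∘ (idm q ▷' aassoc x y n) =
  aassoc x y (L ▷ n) ∘ ind_act (x ⊗ y) n.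
Proof.
apply: (iso_epic (aassoc q (x ⊗ y) n)).
apply: (iso_epic (fiso (act_right n) (assoc q x y))) => /=.
rewrite -(compA _ (ind_act (x ⊗ y) n)) ind_actE.
rewrite -(compA _ (idm q ▷' _)) -(compA _ (_ ∘ _) (_ ▷' idm n)) -apentagon.
rewrite compA -(compA _ (ind_act x (y ▷ n))) ind_actE !compA.
rewrite -(compA _ _ (fwd (aassoc (q ⊗ x) y n))) -aassoc_nat_id !compA.
rewrite -(compA _ _ (fwd (aassoc (x ⊗ L) y n))) apentagon !compA -ahomMl ind_strE ahomMl.
rewrite -(compA _ _ (fwd (aassoc x (L ⊗ y) n))) -aassoc_natural !compA.
rewrite -(compA _ (_ ▷' idm n)) -ahomMr -(compA _ (_ ▷' idm n)) -ahomMr.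
rewrite nuE !ahomMr !compA.
by rewrite -apentagon.
Qed.

Lemma ind_modfun : ihoms N -> is_modfun (F := act_left N L) (fun y n => ind_str y n).
Proof.
move=> IN; split.
- move=> x y m n f g; apply: (ind_act_ext IN) => z.
  apply: (iso_epic (fiso (act_left N q) (aassoc z x m))) => /=.
  have hl : (idm z ▷' (ind_str y n ∘ (idm L ▷' (f ▷' g)))) ∘ ind_act z (x ▷ m) =
      (idm z ▷' ind_str y n) ∘ ind_act z (y ▷ n) ∘ (idm q ▷' (idm z ▷' (f ▷' g))).
    by rewrite ahomMl -!compA ind_act_natural.
  rewrite hl -(compA _ (idm q ▷' _)) -ahomMl -aassoc_natural ahomMl compA ind_hex.
  rewrite -compA ind_act_natural ahomMl -(compA (idm z ▷' (f ▷' _))).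
  rewrite -(compA (idm z ▷' (f ▷' _))) ind_hex.
  by rewrite !compA aassoc_natural.
- move=> x y m; apply: (ind_act_ext IN) => z.
  apply: (iso_epic (fiso (act_left N q) (aassoc z (x ⊗ y) m))) => /=.
  apply: (iso_epic (fiso (act_left N q) (fiso (act_right m) (assoc z x y)))) => /=.
  rewrite ahomMl -(compA (idm z ▷' aassoc x y _)) -(compA (idm z ▷' aassoc x y _)) ind_hex.
  rewrite !compA -(compA _ (ind_act (z ⊗ _) m)) ind_act_natural ahom1 !compA -apentagon.
  have hr : (idm z ▷' ((idm x ▷' ind_str y m) ∘ ind_str x (y ▷ m) ∘ (idm L ▷' aassoc x y m)))
        ∘ ind_act z ((x ⊗ y) ▷ m) =
      (idm z ▷' (idm x ▷' ind_str y m)) ∘ ((idm z ▷' ind_str x (y ▷ m)) ∘ ind_act z _)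
        ∘ (idm q ▷' (idm z ▷' aassoc x y m)).
    by rewrite !ahomMl -!compA ind_act_natural.
  rewrite hr -(compA _ (idm q ▷' (idm z ▷' _))) -ahomMl -(compA _ _ (idm q ▷' (_ ▷' _))) -ahomMl.
  rewrite -apentagon ahomMl !compA -(compA (idm z ▷' (idm x ▷' _))) -(compA (idm z ▷' (idm x ▷' _))).
  rewrite ind_hex !compA -aassoc_natural thom1.
  by rewrite -!(compA (aassoc z x _)) ind_hex.
- move=> m; apply: (ind_act_ext IN) => z.
  apply: (iso_epic (fiso (act_left N q) (aassoc z tunit m))) => /=.
  rewrite ahomMl -!(compA (idm z ▷' aunit _)) ind_hex compA atriangle.
  by rewrite -[idm (L ▷ m)]ahom1 -ind_act_natural -ind_act_natural -compA -ahomMl atriangle.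
Qed.

End Braiding.

Lemma ind_center_ex : exists nu : forall y, iso (L ⊗ y) (y ⊗ L), half_braiding nu /\
  forall y x, (idm x ⊗' nu y) ∘ (assoc x L y ∘ (lam x ⊗' idm y)) =
    assoc x y L ∘ lam (x ⊗ y) ∘ assoc q x y.
Proof.
have [nu nuE] := dep_choice ind_br_ex.
have [IR] := ihoms_ex fC (regular_exact rC fC).
have mf := ind_modfun nuE IR.
have isoN y : exists i : iso (L ⊗ y) (y ⊗ L), fwd i = nu y.
  have [g [g1 g2]] := lax_strong mf rC y (tunit : R).
  pose u : hom (y ⊗ L) (L ⊗ y) := runit _ ∘ (bwd (assoc L y tunit) ∘ g ∘ assoc y L tunit) ∘ bwd (runit _).
  have nE : nu y = runit _ ∘ (bwd (assoc y L tunit) ∘ ind_str nu y (tunit : R) ∘ assoc L y tunit)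
      ∘ bwd (runit _).
    rewrite /ind_str unlock /= !compA -(compA (runit _)) fwdK compm1.
    rewrite -(compA _ (bwd (assoc L y tunit))) fwdK compm1.
    by rewrite [X in X ∘ _](runit_natural (nu y)) isoK.
  have un : u ∘ nu y = idm _.
    rewrite nE /u !compA isoVK -(compA _ (fwd (assoc y L tunit))) bwdK compm1.
    by rewrite -(compA _ g) g1 compm1 -(compA _ (bwd (assoc L y tunit))) fwdK compm1 bwdK.
  have nu' : nu y ∘ u = idm _.
    rewrite nE /u !compA isoVK -(compA _ (fwd (assoc L y tunit))) bwdK compm1.
    by rewrite -(compA _ _ g) g2 compm1 -(compA _ (bwd (assoc y L tunit))) fwdK compm1 bwdK.
  by exists (Iso un nu').
have [nu' nu'E] := dep_choice isoN; exists nu'; split; last by move=> y x; rewrite nu'E.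
apply: half_braiding_regular; case: mf => s1 s2 s3.
have E y (n : R) : fwd (act_str nu' y n) = ind_str nu y n.
  by rewrite /ind_str unlock /= nu'E.
by split=> *; rewrite !E.
Qed.

End Induction.

(** The value at [q] of the left adjoint of the forgetful functor from the centre. *)
Record induced (k : fieldType) (C : monoidal k) (q : C) := Induced {
  ind_ob :> center_ob C;
  ind_nat : natbr q (cob ind_ob);
  ind_univ : forall b (t : natbr q b),
    exists! g : hom (cob ind_ob) b, forall x, (idm x ⊗' g) ∘ ind_nat x = t x;
  ind_br : forall y x, (idm x ⊗' hbr ind_ob y) ∘ (assoc x _ y ∘ (ind_nat x ⊗' idm y)) =
    assoc x y _ ∘ ind_nat (x ⊗ y) ∘ assoc q x y }.

Section Induced.
Variables (k : fieldType) (C : monoidal k).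
Hypotheses (rC : rigid C) (fC : finite_category C).

Lemma induced_ex (q : C) : inhabited (induced q).
Proof.
have [L [lam lamP]] := induction_ex q rC fC.
have [nu [nuP nuE]] := ind_center_ex rC fC lamP.
by split; apply: (@Induced k C q (CenterOb nuP) lam lamP nuE).
Qed.

Variables (q : C) (L : induced q).
Let lam := ind_nat L.

(** The family classified by the lift is [e] followed by the half-braiding of [z]. Both sides of the
    compatibility with half-braidings agree after [ind_act], by the hexagon in [z]. *)
Lemma ind_lift (z : center_ob C) (e : hom q (cob z)) :
  exists g : center_hom L z, forall x, (idm x ⊗' g) ∘ lam x = hbr z x ∘ (e ⊗' idm x).
Proof.
have [nN n2 n1] := hbrP z.
have tN : nat_br (fun x => hbr z x ∘ (e ⊗' idm x)).
  by move=> x y f; rewrite -compA -thom_swap !compA nN.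
have [g [gE _]] := ind_univ L (Natbr tN).
have [IR] := ihoms_ex fC (regular_exact rC fC).
suff gP y : hbr z y ∘ (g ⊗' idm y) = (idm y ⊗' g) ∘ hbr L y by exists (CenterHom gP).
apply: (ind_act_ext rC (ind_univ L) IR) => x; rewrite /ind_act unlock /= !compA.
congr (_ ∘ _); rewrite !thomMl -!compA ind_br.
have gE' := gE x; rewrite /= in gE'.
rewrite (compA (idm x ⊗' (g ⊗' _))) -assoc_natural -compA -thomMr gE' thomMr.
rewrite !compA -n2 -!compA assoc_natural !compA thom1.
rewrite -assoc_natural thom1 -(compA (assoc x y _) (idm (x ⊗ y) ⊗' g)) (gE (x ⊗ y)) /=.
by rewrite !compA.
Qed.

Variables (M N : modcat C) (IN : ihoms N).

Definition ind_in (n : N) : hom (q ▷ n) (L ▷ n) :=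
  locked_with act_key (aunit _ ∘ ind_act lam tunit n ∘ (idm q ▷' bwd (aunit n))).

Lemma ind_hexE x y (n : N) : (idm x ▷' act_str (hbr L) y n) ∘ ind_act lam x (y ▷ n)
    ∘ (idm q ▷' aassoc x y n) = aassoc x y (L ▷ n) ∘ ind_act lam (x ⊗ y) n.
Proof.
rewrite -(ind_hex (nu := fun y => hbr L y) (ind_br L)).
by rewrite /ind_str unlock.
Qed.

Lemma ind_in_natural (m n : N) (f : hom m n) :
  ind_in n ∘ (idm q ▷' f) = (idm L ▷' f) ∘ ind_in m.
Proof.
rewrite /ind_in !unlock -!compA -ahomMl bwd_aunit_natural ahomMl (compA (ind_act _ _ _)).
by rewrite ind_act_natural !compA aunit_natural.
Qed.

Lemma ind_in_str x (n : N) : act_str (hbr L) x n ∘ ind_in (x ▷ n) = ind_act lam x n.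
Proof.
have /= hx := ind_hexE tunit x n; rewrite !compA in hx.
rewrite /ind_in !unlock.
apply: (iso_epic (fiso (act_left N q) (aunit (x ▷ n)))) => /=.
rewrite -!compA -ahomMl fwdK ahom1 compm1.
apply: (iso_epic (fiso (act_left N q) (aassoc tunit x n))) => /=.
rewrite -[RHS]compA -ahomMl aunit_assoc !compA -aunit_natural.
rewrite -(compA (aunit _)) -(compA (aunit _)) hx compA aunit_assoc.
by have := ind_act_natural lam (lunit x) (idm n); rewrite ahom1 => <-.
Qed.

Definition ind_unit : hom q (cob L) := lunit _ ∘ lam tunit ∘ bwd (runit q).

Lemma ind_inE (n : N) : ind_in n = ind_unit ▷' idm n.
Proof.
rewrite /ind_in unlock.
apply: (iso_epic (fiso (act_left N q) (aunit n))) => /=.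
rewrite -!compA -ahomMl fwdK ahom1 compm1.
apply: (iso_epic (aassoc q tunit n)).
rewrite -!compA ind_actE compA aunit_assoc -ahomMr atriangle -ahomMr.
by rewrite /ind_unit isoVK.
Qed.

Variables (F H : modfun M N).

(** The hypothesis on [zeta] is naturality alone, with no compatibility with the action of C. The
    failure of [q] to carry a half-braiding is absorbed by passing to [L], so every plain
    transformation out of [q ▷ F] becomes a unique module transformation out of [L ▷ F]. *)
Lemma ind_act_adj (zeta : forall m, hom (q ▷ F m) (H m)) :
  (forall m n (f : hom m n), zeta n ∘ (idm q ▷' fhom F f) = fhom H f ∘ zeta m) ->
  exists! r : modnat (fun_act L F) H, forall m, r m ∘ ind_in (F m) = zeta m.
Proof.
move=> zN.
(* For fixed [m], the components of [zeta] at all [x ▷ m], transported along the structures of [F]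
   and [H], form the natural family in [x] that [L] classifies. *)
pose t m x := mstr H x m ∘ zeta (x ▷ m) ∘ (idm q ▷' bwd (mstr F x m)).
have tE m x : t m x ∘ (idm q ▷' mstr F x m) = mstr H x m ∘ zeta (x ▷ m).
  by rewrite /t -compA -ahomMl fwdK ahom1 compm1.
have tN m : nat_act (t m).
  move=> x y f; apply: (iso_epic (fiso (act_left N q) (mstr F x m))) => /=.
  rewrite -[RHS]compA tE -compA -ahomMl -mstr_natl ahomMl compA tE.
  by rewrite -compA zN !compA mstr_natl.
clearbody t.
have [r rE] := dep_choice (fun m => ind_act_univ rC (ind_univ L) IN (tN m)).
have {}rE m x : (idm x ▷' r m) ∘ ind_act lam x (F m) = t m x by case: (rE m).
have rN m n (f : hom m n) : r n ∘ (idm L ▷' fhom F f) = fhom H f ∘ r m.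
  apply: (ind_act_ext rC (ind_univ L) IN) => x.
  rewrite !ahomMl -[LHS]compA -ind_act_natural compA rE -[RHS]compA rE.
  apply: (iso_epic (fiso (act_left N q) (mstr F x m))) => /=.
  rewrite -[RHS]compA tE -compA -ahomMl -mstr_nat ahomMl compA tE.
  by rewrite -compA zN !compA mstr_nat.
have rM : is_modnat (fun x m => mstr (fun_act L F) x m) (fun x m => mstr H x m) r.
  move=> y m; have [S SE] : exists S, S = fwd (act_str (hbr L) y (F m)) by eexists.
  change (mstr H y m ∘ r (y ▷ m) =
    (idm y ▷' r m) ∘ (fwd (act_str (hbr L) y (F m)) ∘ (idm L ▷' mstr F y m))).
  rewrite -SE; apply: (ind_act_ext rC (ind_univ L) IN) => x.
  have hx := ind_hexE x y (F m); rewrite -SE in hx.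
  apply: (iso_epic (fiso (act_left N q) (mstr F x (y ▷ m)))).
  apply: (iso_epic (fiso (act_left N q) (fiso F (aassoc x y m)))) => /=.
  rewrite ahomMl -(compA (_ ▷' fwd (mstr H y m))) rE -(compA (_ ▷' fwd (mstr H y m))) tE.
  rewrite -!compA zN !compA -mstr_hex.
  have -> : (idm x ▷' ((idm y ▷' r m) ∘ S ∘ (idm L ▷' mstr F y m)))
      ∘ ind_act (ind_nat L) x (F (y ▷ m)) = (idm x ▷' (idm y ▷' r m)) ∘
      ((idm x ▷' S) ∘ ind_act lam x (y ▷ F m)) ∘ (idm q ▷' (idm x ▷' mstr F y m)).
    by rewrite !ahomMl -!compA ind_act_natural.
  rewrite -(compA _ (idm q ▷' (idm x ▷' _))) -ahomMl -(compA _ _ (idm q ▷' fhom F _)) -ahomMl.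
  rewrite -mstr_hex.
  rewrite ahomMl compA -(compA _ _ (idm q ▷' aassoc _ _ _)) hx !compA -aassoc_natural thom1.
  by rewrite -(compA _ _ (ind_act _ _ _)) rE -(compA _ _ (idm q ▷' _)) tE compA.
exists (@Modnat _ _ _ _ (fun_act L F) H r rN rM); split.
  move=> m /=; rewrite /ind_in unlock !compA -aunit_natural -(compA (aunit _)) rE.
  apply: (iso_epic (fiso (act_left N q) (aunit (F m)))) => /=.
  rewrite -compA -ahomMl fwdK ahom1 compm1.
  apply: (iso_epic (fiso (act_left N q) (mstr F tunit m))) => /=.
  by rewrite -!compA tE -ahomMl mstr_unit zN !compA mstr_unit.
move=> r' r'E; apply: modnat_eq => m /=.
apply: (ind_act_ext rC (ind_univ L) IN) => x; rewrite rE.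
apply: (iso_epic (fiso (act_left N q) (mstr F x m))) => /=.
have h : mstr H x m ∘ r' (x ▷ m) = (idm x ▷' r' m) ∘ (fwd (act_str (hbr L) x (F m)) ∘ (idm L ▷' mstr F x m)).
  exact: (nt_mod r' x m).
by rewrite tE -r'E compA h -!compA -ind_in_natural -ind_in_str -!compA.
Qed.

End Induced.

(** * The functor category is exact over the centre *)

Section FreeFunctors.
Variables (k : closedFieldType) (M N : category k) (n : nat) (s P : 'I_n -> M).
Variables (e : forall j, hom (P j) (s j)).
Hypothesis flM : forall x : M, finite_length x.
Hypothesis sc : simple_covers e.
Variables (T : functor M N) (tau : forall j, hom (T (s j)) (T (P j))).
Hypotheses (eT : exact_functor T) (tauE : forall j, fhom T (e j) ∘ tau j = idm (T (s j))).

(** The elements [fhom T h ∘ tau j] are jointly epi, so a map out of [T x] is determined on them,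
    and values chosen on the generators extend to a transformation that is automatically natural. *)
Lemma free_functor_family :
  exists L : forall x : M, seq {j : 'I_n & (hom (P j) x * hom (T x) (T (s j)))%type},
    (forall x, \sum_(u <- L x) fhom T (tagged u).1 ∘ tau (tag u) ∘ (tagged u).2 = idm (T x)) /\
    (forall x y (f g : hom (T x) y),
      (forall j (h : hom (P j) x), f ∘ (fhom T h ∘ tau j) = g ∘ (fhom T h ∘ tau j)) -> f = g) /\
    forall (N' : category k) (R : functor N N') (G : functor M N')
      (l : forall j, hom (R (T (s j))) (G (P j))) (zeta : forall x, hom (R (T x)) (G x)),
      (forall x, zeta x = \sum_(u <- L x) fhom G (tagged u).1 ∘ l (tag u) ∘ fhom R (tagged u).2) ->
      (forall x j (f : hom (P j) x), zeta x ∘ fhom R (fhom T f ∘ tau j) = fhom G f ∘ l j) /\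
      forall x y (f : hom x y), zeta y ∘ fhom R (fhom T f) = fhom G f ∘ zeta x.
Proof.
have [L LE] := dep_choice (free_functor flM sc eT tauE).
exists L; split; first by move=> x; have [] := LE x.
split.
  move=> x y f g E; have [l1 _] := LE x; rewrite -[f]compm1 -[g]compm1 -l1 !comp_sumr.
  by apply: eq_bigr => u _; rewrite (compA f) (compA g) E.
move=> N' R G l zeta zE.
have ev x j (f : hom (P j) x) : zeta x ∘ fhom R (fhom T f ∘ tau j) = fhom G f ∘ l j.
  by rewrite zE; have [_ ->] := LE x.
split=> // x y f; have [l1 _] := LE x.
rewrite -[LHS]compm1 -[RHS]compm1 -fhom1 -l1 !fhom_sum !comp_sumr.
apply: eq_bigr => u _; rewrite fhomM !compA; congr (_ ∘ _).
rewrite -[LHS]compA -[RHS]compA ev -fhomM compA -fhomM.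
by rewrite ev fhomM compA.
Qed.

End FreeFunctors.

Section CenterExact.
Variables (k : fieldType) (C : monoidal k).
Hypotheses (rC : rigid C) (fC : finite_category C).
Let Z := center_cat C.
Let abC : abelian_category C. Proof. by case: fC. Qed.

Lemma center_homE (c d : center_ob C) (f g : center_hom c d) :
  chom f = chom g -> (f : @hom k Z c d) = g.
Proof. exact: center_hom_eq. Qed.

Lemma ind_lift_unit (q : C) (L : induced q) (z : center_ob C) (e : hom q (cob z))
    (g : center_hom L z) :
  (forall x, (idm x ⊗' g) ∘ ind_nat L x = hbr z x ∘ (e ⊗' idm x)) ->
  g ∘ (lunit _ ∘ ind_nat L tunit ∘ bwd (runit q)) = e.
Proof.
move=> E; rewrite !compA -lunit_natural -(compA (lunit _)) E.
have [_ _ n1] := hbrP z; rewrite !compA n1.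
by rewrite runit_natural isoK.
Qed.

(** The forgetful functor has the left adjoint given by induction, hence preserves kernels: a map in
    C into [d] is tested on the object of the centre induced from its source. *)
Lemma center_kernel (c d e : center_ob C) (i : center_hom c d) (p : center_hom d e) :
  @is_kernel k Z c d e i p -> is_kernel (chom i) (chom p).
Proof.
move=> ki.
have lift w (g : hom w (cob d)) : chom p ∘ g = 0 -> exists u : hom w (cob c), i ∘ u = g.
  move=> pg; have [L] := induced_ex rC fC w; have [h hE] := ind_lift rC fC L g.
  have ph : (p : @hom k Z d e) ∘ (h : @hom k Z (ind_ob L) d) = 0.
    apply: center_homE.
    have [v [_ vU]] := ind_univ L (@natbr0 k C w (cob e)).
    transitivity v; last first.
      by apply: vU => x; rewrite [chom _]/= thom0r comp0l.
    apply: esym; apply: vU => x.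
    by rewrite thomMl -compA hE compA -chomP -compA -thomMr pg thom0l comp0r.
  have [u uE] := kernel_lift ki ph.
  exists (chom u ∘ (lunit _ ∘ ind_nat L tunit ∘ bwd (runit w))).
  by rewrite compA -[RHS](ind_lift_unit hE) -uE.
apply: is_kernelP.
- move=> w g h E.
  have [L] := induced_ex rC fC w.
  have [f fE] := ind_lift rC fC L (g - h).
  have f0 : (f : @hom k Z (ind_ob L) c) = 0.
    apply: (kernel_mono ki); apply: center_homE; rewrite comp0r /=.
    have [v [_ vU]] := ind_univ L (@natbr0 k C w (cob d)).
    transitivity v; last first.
      by apply: vU => x; rewrite thom0r comp0l.
    apply: esym; apply: vU => x.
    by rewrite thomMl -compA fE compA -chomP -compA -thomMr compBr E subrr thom0l comp0r.
  apply/eqP; rewrite -subr_eq0; apply/eqP; rewrite -(ind_lift_unit fE).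
  by rewrite f0 comp0l.
- exact: (congr1 (@chom k C c e) (proj1 ki)).
- exact: lift.
Qed.

Lemma center_epi_of (c d : center_ob C) (f : center_hom c d) :
  epi (chom f) -> @epi k Z c d f.
Proof.
move=> ef e g h E; apply: center_homE; apply: ef.
exact: (congr1 (@chom k C c e) E).
Qed.

Lemma center_cokernel_ex (c d : center_ob C) (i : center_hom c d) :
  exists (e : center_ob C) (p : center_hom d e), is_cokernel (chom i) (chom p).
Proof.
have [_ eL eR] := regular_exact rC fC.
have [K [p cp]] := cokernel_ex abC (chom i).
have cl x : is_cokernel (idm x ⊗' chom i) (idm x ⊗' p) := exact_cokernel abC (eL x) cp.
have cr x : is_cokernel (chom i ⊗' idm x) (p ⊗' idm x) := exact_cokernel abC (eR x) cp.
have st x : exists s : iso (K ⊗ x) (x ⊗ K), s ∘ (p ⊗' idm x) = (idm x ⊗' p) ∘ hbr d x.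
  have [|s sE] := cokernel_desc (g := (idm x ⊗' p) ∘ hbr d x) (cr x).
    by rewrite -compA chomP compA (proj1 (cl x)) comp0l.
  have [|r rE] := cokernel_desc (g := (p ⊗' idm x) ∘ bwd (hbr d x)) (cl x).
    apply: (iso_epi (hbr c x)); rewrite comp0l -!compA -chomP (compA (bwd _)) fwdK comp1m.
    exact: (proj1 (cr x)).
  have rs : r ∘ s = idm _.
    by apply: (cokernel_epi (cr x)); rewrite -compA sE compA rE isoVK comp1m.
  have sr : s ∘ r = idm _.
    by apply: (cokernel_epi (cl x)); rewrite -compA rE compA sE isoK comp1m.
  by exists (Iso rs sr).
have [s sE] := dep_choice st; have [n1 n2 n3] := hbrP d.
have ep x := cokernel_epi (cr x).
have sP : half_braiding s.
  split.
  - move=> x y f; apply: ep; rewrite -!compA thom_swap sE compA sE -compA n1.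
    by rewrite !compA thom_swap.
  - move=> x y.
    have ee : epi ((p ⊗' idm x) ⊗' idm y) := exact_epi abC (eR y) (ep x).
    apply: ee; rewrite -[LHS]compA assoc_natural thom1 compA -(compA (assoc x y K)) sE.
    rewrite !compA -[idm (x ⊗ y)]thom1 assoc_natural.
    rewrite -[LHS]compA -[LHS]compA (compA (assoc x y _)) n2.
    rewrite -[RHS]compA -thomMr sE thomMr -(compA _ _ (_ ∘ _)) (compA (assoc x K y)).
    rewrite assoc_natural !compA -!thomMl sE thomMl.
    by [].
  - apply: ep; rewrite -compA sE compA lunit_natural -compA n3.
    by rewrite runit_natural.
by exists (CenterOb sP), (@CenterHom k C d (CenterOb sP) p sE).
Qed.

(** Kernels are preserved by adjunction. Cokernels of C inherit a half-braiding because tensoring is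
    exact, and comparing the given cokernel with this one shows that the forgetful functor preserves
    it. *)
Lemma center_short_exact (c d e : center_ob C) (i : center_hom c d) (p : center_hom d e) :
  @short_exact k Z c d e i p -> short_exact (chom i) (chom p).
Proof.
move=> [ki cp]; apply/(short_exactP abC); split; first exact: center_kernel.
have [e' [p' cp']] := center_cokernel_ex i.
have [|u uE] := cokernel_desc (g := (p' : @hom k Z d e')) cp.
  by apply: center_homE; apply: (proj1 cp').
have [v vE] := cokernel_desc cp' (congr1 (@chom k C c e) (proj1 cp)).
have uE' : chom u ∘ chom p = chom p' := congr1 (@chom k C d e') uE.
have ep' := cokernel_epi cp'.
have vP x : hbr e x ∘ (v ⊗' idm x) = (idm x ⊗' v) ∘ hbr e' x.
  have [_ _ eR] := regular_exact rC fC.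
  apply: (exact_epi abC (eR x) ep').
  rewrite [fhom _ _]/= -!compA -thomMr vE !chomP compA -thomMl vE.
  by [].
have vu : (CenterHom vP : @hom k Z e' e) ∘ u = idm _.
  apply: (cokernel_epi cp); apply: center_homE.
  by rewrite /= comp1m -compA uE' vE.
apply/epiP => w g gp; rewrite -[g]compm1.
have -> : idm (cob e) = v ∘ chom u := esym (congr1 (@chom k C e e) vu).
suff gv : g ∘ v = 0 by rewrite compA gv comp0l.
apply: ep'; by rewrite -compA vE gp comp0l.
Qed.

End CenterExact.

Section ActSections.
Variables (k : fieldType) (M N : category k) (n : nat) (s P : 'I_n -> M).
Variables (e : forall j, hom (P j) (s j)) (T : functor M N).

Lemma sections_ex : (forall j, epi (fhom T (e j))) -> (forall j, projective (T (s j))) ->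
  exists tau : forall j, hom (T (s j)) (T (P j)), forall j, fhom T (e j) ∘ tau j = idm (T (s j)).
Proof. by move=> eT pT; exact: (dep_choice (fun j => pT j _ _ (fhom T (e j)) (idm _) (eT j))). Qed.

End ActSections.

Section FunctorModule.
Variables (k : closedFieldType) (C : monoidal k) (M N : modcat C).
Hypotheses (rC : rigid C) (fC : finite_category C).
Hypotheses (xM : exact_module M) (xN : exact_module N).
Let A := modfun_cat M N.
Let FM := fun_modcat M N.

(** A lifting problem out of [L ▷ F] is one for plain transformations out of [q ▷ F]. That functor
    is exact with projective values, hence free in the sense of [free_functor], and lifts exist. *)
Lemma ind_act_projective (q : C) (L : induced q) (F : modfun M N) :
  projective q -> @projective k A (fun_act L F).
Proof.
move=> pq G H t f et'.
case: (xM) (xN) => mM pM [mN pN]; case: (mM) (mN) => fM _ _ [fN eN _].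
have [IN] := ihoms_ex fC mN; have abN : abelian_category N by case: fN.
have et m : epi ((t : modnat _ _) m) by apply: modnat_epi et' m.
have eF : exact_functor F := exact_module_exact fC F xM mN.
pose T := functor_comp (act_left N q) F.
have eT : exact_functor T by move=> x y z i p h; apply: (eN q); apply: eF.
have [n [s [P [e [_ sc]]]]] := simple_covers_ex fM.
have abM : abelian_category M by case: fM.
have eE j : epi (e j) by case: sc => _ h _ _ _.
have pT x : projective (T x) by apply: pN.
have [tau tauE] := sections_ex (fun j => exact_epi abM eT (eE j)) (fun j => pT (s j)).
have flM : forall x : M, finite_length x by case: fM.
have [L' [_ [L1 L2]]] := free_functor_family flM sc eT tauE.
have [z zE] : exists z : forall m, hom (T m) (H m), z = fun m => (f : modnat _ _) m ∘ ind_in L (F m).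
  by eexists.
have zN m m' (g : hom m m') : z m' ∘ fhom T g = fhom H g ∘ z m.
  rewrite zE -compA ind_in_natural !compA; congr (_ ∘ _).
  exact: (nt_natural (f : modnat (fun_act L F) H) g).
(* Only the values on the generators have to be lifted: [T (s j)] is projective and [t] is epi at
   [P j]. *)
have [l lE] := dep_choice (fun j => pT (s j) _ _ _ (z (P j) ∘ tau j) (et (P j))).
have [zeta zetaE] : exists zeta : forall x, hom (T x) (G x), forall x,
    zeta x = \sum_(u <- L' x) fhom G (tagged u).1 ∘ l (tag u) ∘ fhom (functor_id N) (tagged u).2.
  by eexists.
have [L2e L2n] := L2 N (functor_id N) G l zeta zetaE.
have tz x : (t : modnat _ _) x ∘ zeta x = z x.
  apply: L1 => j h; rewrite -[LHS]compA; have := L2e x j h; rewrite /= => ->.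
  by rewrite compA nt_natural -compA lE !compA zN.
have [r [rE _]] := ind_act_adj rC L IN L2n.
have [r' [_ rU]] := ind_act_adj rC L IN zN.
exists r; transitivity r'.
  by apply: esym; apply: rU => m; rewrite -tz -rE /= compA.
by apply: rU => m; rewrite zE.
Qed.

Lemma center_cover (z : center C) : exists (q : C) (L : induced q) (g : center_hom L z),
  projective q /\ epi (chom g).
Proof.
have [q [e [pq ee]]] : exists (q : C) (e : hom q (cob z)), projective q /\ epi e.
  by case: fC => _ _ _ h _; apply: h.
have [L] := induced_ex rC fC q; have [g gE] := ind_lift rC fC L e.
exists q, L, g; split => //; apply: (epi_cancel (f := lunit _ ∘ ind_nat L tunit ∘ bwd (runit q))).
by rewrite (ind_lift_unit gE).
Qed.

(** Every projective object of the centre is a retract of an induced one, by lifting the identity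
    along [center_cover]. *)
Lemma fun_projective (z : center C) (F : modfun M N) :
  projective z -> @projective k A (fun_act z F).
Proof.
move=> pz; have [q [L [g [pq eg]]]] := center_cover z.
have [i gi] := pz _ _ (g : @hom k (center C) (ind_ob L) z) (idm z) (center_epi_of eg).
apply: (@projective_retract k A (fun_act z F) (fun_act L F)
   (fun_act_hom g (modnat_id F)) (fun_act_hom i (modnat_id F))).
- by rewrite -[LHS](@ahomMr k _ FM) gi; apply: (@ahom1 k _ FM).
- exact: ind_act_projective.
Qed.

Lemma fun_module : is_module_category FM.
Proof.
case: (xN) => mN _; case: (mN) => -[abN _ _ _ _] eN rN; split.
- exact: modfun_cat_finite.
- move=> z F G H i p /(modnat_short_exact abN eN) h.
  apply/(modnat_short_exact abN eN) => m.
  have := eN (cob z) _ _ _ _ _ (h m).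
  by rewrite /= !ahom1 !compm1.
- move=> F z y w i p /(center_short_exact rC fC) h.
  apply/(modnat_short_exact abN eN) => m.
  have := rN (F m) _ _ _ _ _ h.
  by rewrite /= !ahom1 !comp1m.
Qed.

Lemma fun_exact : exact_module FM.
Proof. by split; [apply: fun_module | move=> z F; apply: fun_projective]. Qed.

Lemma fun_center_cover : exists (q : C) (L : induced q) (g : center_hom L (center_unit C)),
   projective q /\ epi (chom g).
Proof. exact: center_cover. Qed.

(** The splitting argument of [modfun_exact] again, now over the centre: the object L(q), with q
    projective and L(q) mapping onto the unit, makes all objects projective and kills only zero. *)
Lemma fun_endo_exact (y : modfun FM FM) : exact_functor y.
Proof.
have [q [L [g [pq eg]]]] := fun_center_cover.
have [[abA _ _ _ _] eA _] := fun_module.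
apply: (@modfun_exact k (center C) FM FM (ind_ob L)) => //.
- by move=> F; apply: ind_act_projective.
- move=> F zF; case: (xN) => -[[abN _ _ _ _] eN rN] _.
  apply: modnatP => m; have abC : abelian_category C by case: fC.
  have w0 : fhom (act_right (F m)) (chom g) = 0.
    rewrite -[LHS]compm1.
    have -> : idm (act_right (F m) (cob L)) = 0 := congr1 (fun t : modnat _ _ => t m) zF.
    by rewrite comp0r.
  have z1 := zero_epi (exact_epi abC (rN (F m)) eg) w0.
  rewrite [LHS]/= -(bwdK (aunit (F m))).
  by rewrite (proj1 (is_zeroP z1) _ (fwd (aunit (F m)))) comp0l.
Qed.
End FunctorModule.

(** * Endofunctors of the form X H Y *)

Section CenterStructure.
Variables (k : fieldType) (C : monoidal k) (N N' : modcat C).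

(** The isomorphism from X(z ▷ -) to z ▷ X(-) respects the C-module structures that the
    half-braiding of [z] gives to both sides. This is what makes post-composition with [X] a functor
    over the centre. *)
Lemma center_str (X : modfun N N') (z : center_ob C) x n :
  act_str (hbr z) x (X n) ∘ (idm (cob z) ▷' mstr X x n) ∘ mstr X (cob z) (x ▷ n) =
  (idm x ▷' mstr X (cob z) n) ∘ mstr X x (cob z ▷ n) ∘ fhom X (act_str (hbr z) x n).
Proof.
have E1 := act_strE (N := N) (hbr z) x n; have E2 := act_strE (N := N') (hbr z) x (X n).
move: (fwd (act_str _ _ _)) E2 => S E2.
move: (fwd (act_str _ _ _)) E1 => S' E1.
apply: (iso_epic (fiso X (aassoc (cob z) x n))) => /=.
rewrite -2!(compA S) -mstr_hex compA E2 -!compA -mstr_natl.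
by rewrite -fhomM E1 fhomM !compA mstr_hex.
Qed.

End CenterStructure.

Section Bimodule.
Variables (k : fieldType) (C : monoidal k) (M N : modcat C).
Let A := modfun_cat M N.
Let FM := fun_modcat M N.

Lemma modnat_addE (F G : modfun M N) (s t : @hom k A F G) m :
  ((s + t : @hom k A F G) : modnat F G) m = (s : modnat _ _) m + (t : modnat _ _) m.
Proof. by rewrite /= scale1r. Qed.

Lemma modnat_scaleE (F G : modfun M N) a (s : @hom k A F G) m :
  ((a *: s : @hom k A F G) : modnat F G) m = a *: (s : modnat _ _) m.
Proof. by rewrite /= addr0. Qed.

Variables (X : modfun N N) (Y : modfun M M).

Definition bim_hom (F G : modfun M N) (t : modnat F G) :
  modnat (modfun_comp X (modfun_comp F Y)) (modfun_comp X (modfun_comp G Y)).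
Proof.
exists (fun m => fhom X (t (Y m))).
- by move=> m n f /=; rewrite -!fhomM nt_natural.
- apply: (is_modnat_whiskl (mstrP X)).
  exact: (is_modnat_whiskr _ (@nt_natural _ _ _ _ _ _ t) (nt_mod t)).
Defined.

Definition bim_functor : functor A A.
Proof.
exists (fun F => modfun_comp X (modfun_comp F Y)) (fun F G t => bim_hom t).
- by move=> F; apply: modnatP => m /=; rewrite fhom1.
- by move=> F G H t s; apply: modnatP => m /=; rewrite fhomM.
- move=> F G a s t; apply: modnatP => m /=.
  by rewrite !(scale1r, addr0) fhom_linear.
Defined.

Lemma bim_str_mod (z : center_ob C) (F : modfun M N) :
  is_modnat (fun x m => mstr (modfun_comp X (modfun_comp (fun_act z F) Y)) x m)
   (fun x m => mstr (fun_act z (modfun_comp X (modfun_comp F Y))) x m)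
   (fun m => mstr X (cob z) (F (Y m))).
Proof.
move=> x m; have cs := center_str X z x (F (Y m)).
have [S SE] : exists S, S = fwd (act_str (hbr z) x (X (F (Y m)))) by eexists.
have [S' S'E] : exists S', S' = fwd (act_str (hbr z) x (F (Y m))) by eexists.
rewrite -SE -S'E in cs.
have [w wE] : exists w, w = mstr F x (Y m) ∘ fhom F (mstr Y x m) by eexists.
change ((fwd (act_str (hbr z) x (X (F (Y m)))) ∘ (idm (cob z) ▷' (mstr X x (F (Y m))
   ∘ fhom X (mstr F x (Y m) ∘ fhom F (mstr Y x m)))))
   ∘ mstr X (cob z) (F (Y (x ▷ m))) = (idm x ▷' mstr X (cob z) (F (Y m))) ∘
   (mstr X x (cob z ▷ F (Y m)) ∘ fhom X ((fwd (act_str (hbr z) x (F (Y m))) ∘ (idm (cob z) ▷' mstr F x (Y m)))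
     ∘ (idm (cob z) ▷' fhom F (mstr Y x m))))).
rewrite -SE -S'E -(compA S' (_ ▷' fwd (mstr F x _))) -ahomMl -wE.
by rewrite ahomMl !fhomM !compA -cs -!compA mstr_nat.
Qed.

Definition bim_str (z : center_ob C) (F : modfun M N) :
  @iso k A (bim_functor (fun_act z F)) (fun_act z (bim_functor F)).
Proof.
apply: (@modnat_iso k C M N (bim_functor (fun_act z F)) (fun_act z (bim_functor F))
   (fun m => mstr X (cob z) (F (Y m)))); last exact: bim_str_mod.
by move=> m n f /=; rewrite mstr_nat.
Defined.

Lemma bim_modfun : @is_modfun k (center C) FM FM bim_functor (fun z F => bim_str z F).
Proof.
split.
- move=> z z' F G f t; apply: modnatP => m /=.
  rewrite fhomM compA mstr_nat -!compA; congr (_ ∘ _).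
  exact: mstr_natl.
- move=> z z' F; apply: modnatP => m /=.
  by rewrite ahom1 compm1 mstr_hex.
- by move=> F; apply: modnatP => m /=; rewrite mstr_unit.
Qed.

Definition bim : modfun FM FM := @Modfun k (center C) FM FM bim_functor bim_str bim_modfun.

End Bimodule.

Section EndoHom.
Variables (k : fieldType) (C : monoidal k) (M N : modcat C).
Let A := modfun_cat M N.
Let FM := fun_modcat M N.

Definition nat_at (F G : A) (t : hom F G) (m : M) :
  hom ((F : modfun M N) m) ((G : modfun M N) m) := (t : modnat F G) m.

Lemma nat_atP (F G : A) (s t : hom F G) : (forall m, nat_at s m = nat_at t m) -> s = t.
Proof. exact: modnatP. Qed.

Lemma nat_at_comp (F G H : A) (s : hom G H) (t : hom F G) m :
  nat_at (s ∘ t) m = nat_at s m ∘ nat_at t m.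
Proof. by []. Qed.

Lemma nat_at_lin (F G : A) m : linear (fun t : hom F G => nat_at t m).
Proof. by move=> a s t; rewrite /nat_at /= !(scale1r, addr0). Qed.

Variables y y' : modfun FM FM.

Definition endo_at (t : modnat y y') (H : A) (m : M) :
  hom ((y H : modfun M N) m) ((y' H : modfun M N) m) := nat_at (t H) m.

Lemma endo_atP (s t : modnat y y') : (forall H m, endo_at s H m = endo_at t H m) ->
  (s : @hom k (modfun_cat FM FM) y y') = t.
Proof. by move=> e; apply: modnatP => H; apply: nat_atP => m; apply: e. Qed.

Section Build.
Variable zeta : forall (H : A) (m : M), hom ((y H : modfun M N) m) ((y' H : modfun M N) m).
Hypothesis zeta_nat : forall (H : A) m n (f : hom m n),
  zeta H n ∘ fhom (y H : modfun M N) f = fhom (y' H : modfun M N) f ∘ zeta H m.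
Hypothesis zeta_mod : forall H : A, is_modnat (fun x m => mstr (y H : modfun M N) x m)
  (fun x m => mstr (y' H : modfun M N) x m) (zeta H).
Hypothesis zeta_natH : forall (H H' : A) (t : hom H H') m,
  zeta H' m ∘ nat_at (fhom y t) m = nat_at (fhom y' t) m ∘ zeta H m.
Hypothesis zeta_modZ : forall (z : center C) (H : A) m,
  nat_at (fwd (mstr y' z H)) m ∘ zeta (z ▷ (H : FM)) m =
  (idm (cob z) ▷' zeta H m) ∘ nat_at (fwd (mstr y z H)) m.

Definition endo_nat : modnat y y'.
Proof.
exists (fun H => Modnat (@zeta_nat H) (@zeta_mod H)).
- by move=> H H' t; apply: nat_atP => m; apply: zeta_natH.
- move=> z H; apply: nat_atP => m; rewrite !nat_at_comp.
  by rewrite [LHS]zeta_modZ /nat_at /= ahom1 compm1.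
Defined.

End Build.

Variable t : modnat y y'.

Lemma endo_nt (H : A) m n (f : hom m n) :
  endo_at t H n ∘ fhom (y H : modfun M N) f = fhom (y' H : modfun M N) f ∘ endo_at t H m.
Proof. exact: nt_natural. Qed.

Lemma endo_mod (H : A) x m : mstr (y' H : modfun M N) x m ∘ endo_at t H (x ▷ m) =
  (idm x ▷' endo_at t H m) ∘ mstr (y H : modfun M N) x m.
Proof. exact: nt_mod. Qed.

Lemma endo_ntH (H H' : A) (s : hom H H') m :
  endo_at t H' m ∘ nat_at (fhom y s) m = nat_at (fhom y' s) m ∘ endo_at t H m.
Proof. exact: (congr1 (fun w : hom _ _ => nat_at w m) (nt_natural t s)). Qed.

Lemma endo_modZ (z : center C) (H : A) m :
  nat_at (fwd (mstr y' z H)) m ∘ endo_at t (z ▷ (H : FM)) m =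
  (idm (cob z) ▷' endo_at t H m) ∘ nat_at (fwd (mstr y z H)) m.
Proof.
have := congr1 (fun w : hom _ _ => nat_at w m) (nt_mod t z H).
by rewrite !nat_at_comp => e; rewrite [LHS]e /nat_at /= ahom1 compm1.
Qed.

End EndoHom.

Section BimHom.
Variables (k : fieldType) (C : monoidal k) (M N : modcat C).
Let A := modfun_cat M N.
Let FM := fun_modcat M N.
Variables (X X' : modfun N N) (Y Y' : modfun M M).

Definition bim_nat (a : modnat X X') (b : modnat Y Y') :
  @modnat k (center C) FM FM (bim X Y) (bim X' Y').
Proof.
apply: (@endo_nat k C M N (bim X Y) (bim X' Y')
  (fun (H : A) m => fhom X' (fhom (H : modfun M N) (b m)) ∘ a ((H : modfun M N) (Y m)))).
- move=> H m n f /=; rewrite -compA nt_natural !compA -!fhomM.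
  by rewrite nt_natural.
- move=> H; apply: is_modnat_comp.
    exact: (is_modnat_whiskr (fun x m => mstr (modfun_comp (H : modfun M N) Y) x m)
       (@nt_natural _ _ _ _ _ _ a) (nt_mod a)).
  exact: (is_modnat_whiskl (mstrP X') (is_modnat_whiskl (mstrP (H : modfun M N)) (nt_mod b))).
- move=> H H' t m; rewrite /nat_at /= -compA nt_natural !compA -!fhomM.
  by rewrite nt_natural.
- move=> z H m; rewrite /nat_at /= !compA mstr_nat -!compA ahomMl -compA.
  by rewrite nt_mod.
Defined.

Lemma bim_natE a b (H : A) m : endo_at (bim_nat a b) H m =
  fhom X' (fhom (H : modfun M N) (b m)) ∘ a ((H : modfun M N) (Y m)).
Proof. by []. Qed.

End BimHom.

Section BimUnit.
Variables (k : fieldType) (C : monoidal k) (M N : modcat C).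
Let A := modfun_cat M N.
Let FM := fun_modcat M N.

Definition bim_unit : @modnat k (center C) FM FM (bim (modfun_id N) (modfun_id M)) (modfun_id FM).
Proof.
apply: (@endo_nat k C M N (bim (modfun_id N) (modfun_id M)) (modfun_id FM)
  (fun (H : A) m => idm ((H : modfun M N) m))).
- by move=> H m n f /=; rewrite comp1m compm1.
- move=> H x m /=; rewrite ahom1 compm1 /str_comp /= /str_id fhom1.
  by rewrite !(comp1m, compm1).
- by move=> H H' t m /=; rewrite comp1m compm1.
- by move=> z H m; rewrite /nat_at /= ahom1 !(comp1m, compm1).
Defined.

Definition bim_unit_inv : @modnat k (center C) FM FM (modfun_id FM) (bim (modfun_id N) (modfun_id M)).
Proof.
apply: (@endo_nat k C M N (modfun_id FM) (bim (modfun_id N) (modfun_id M))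
  (fun (H : A) m => idm ((H : modfun M N) m))).
- by move=> H m n f /=; rewrite comp1m compm1.
- move=> H x m /=; rewrite ahom1 comp1m /str_comp /= /str_id fhom1.
  by rewrite !(comp1m, compm1).
- by move=> H H' t m /=; rewrite comp1m compm1.
- by move=> z H m; rewrite /nat_at /= ahom1 !(comp1m, compm1).
Defined.

Variables (X : modfun N N) (Y : modfun M M).

Definition bim_to1 (a : modnat X (modfun_id N)) (b : modnat Y (modfun_id M)) :
  modnat (bim X Y) (modfun_id FM) := modnat_comp bim_unit (bim_nat a b).

Definition bim_of1 (a : modnat (modfun_id N) X) (b : modnat (modfun_id M) Y) :
  modnat (modfun_id FM) (bim X Y) := modnat_comp (bim_nat a b) bim_unit_inv.

Lemma bim_to1E a b (H : A) m : endo_at (bim_to1 a b) H m =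
  fhom (H : modfun M N) (b m) ∘ a ((H : modfun M N) (Y m)).
Proof. by rewrite /endo_at /nat_at /= comp1m. Qed.

Lemma bim_of1E a b (H : A) m : endo_at (bim_of1 a b) H m =
  fhom X (fhom (H : modfun M N) (b m)) ∘ a ((H : modfun M N) m).
Proof. by rewrite /endo_at /nat_at /= compm1. Qed.

End BimUnit.

(** * Functors over the centre see plain natural transformations *)

Section CenterRestriction.
Variables (k : fieldType) (C : monoidal k).

(** A module category over [C], acted on by the centre through the forgetful functor. *)
Definition center_res (N : modcat C) : modcat (center C).
Proof.
apply: (@Modcat k (center C) N (fun z n => cob z ▷ n)
  (fun z z' m n (f : center_hom z z') g => chom f ▷' g) _ _ _ _
  (fun z z' n => aassoc (cob z) (cob z') n) (fun n => aunit n)).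
- by move=> z n; apply: ahom1.
- by move=> *; apply: ahomM.
- move=> z z' m n g a f f' /=.
  by rewrite !(scale1r, addr0) ahom_linearl.
- by move=> *; apply: ahom_linearr.
- by move=> *; apply: aassoc_natural.
- by move=> *; apply: aunit_natural.
- by move=> *; apply: apentagon.
- by move=> *; apply: atriangle.
Defined.

Definition res_mod (N N' : modcat C) (X : modfun N N') :
  modfun (center_res N) (center_res N').
Proof.
apply: (@Modfun k (center C) (center_res N) (center_res N') X (fun z n => mstr X (cob z) n)).
split.
- by move=> z z' m n f g; exact: (mstr_nat X (chom (f : center_hom z z')) g).
- by move=> z z' m; exact: (mstr_hex X (cob z) (cob z') m).
- by move=> m; exact: (mstr_unit X m).
Defined.

Variables M N : modcat C.
Let A := modfun_cat M N.
Let FM := fun_modcat M N.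

Definition eval_functor (m : M) : functor A N.
Proof.
exists (fun H : A => (H : modfun M N) m) (fun F G t => nat_at t m) => //.
exact: (fun F G => @nat_at_lin k C M N F G m).
Defined.

Definition eval_mod (m : M) : modfun FM (center_res N).
Proof.
apply: (@Modfun k (center C) FM (center_res N) (eval_functor m) (fun z H => iso_id _)).
split.
- by move=> z z' F G f t; rewrite /= comp1m compm1 /nat_at /= -ahom_lr.
- by move=> z z' F; rewrite /= ahom1 !comp1m compm1.
- by move=> F; rewrite /= compm1.
Defined.

(** [H |-> (y H) m], as a functor over the centre. *)
Definition endo_eval (y : modfun FM FM) (m : M) : modfun FM (center_res N) :=
  modfun_comp (eval_mod m) y.

Definition post_eval (X : modfun N N) (m : M) : modfun FM (center_res N) :=
  modfun_comp (res_mod X) (eval_mod m).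

Lemma post_eval_str X m (z : center C) (H : modfun M N) :
  fwd (mstr (post_eval X m) z (H : FM)) = mstr X (cob z) (H m).
Proof. by rewrite /= fhom1 compm1. Qed.

End CenterRestriction.

(** The pasting of the five squares [s1], [s2], [s3], [s4'], [s5] in [transfer_natural], isolated in
    an arbitrary category. *)
Lemma comp_chain (k : fieldType) (B : category k) (x1 x2 x3 x4 x5 x6 x7 x8 x9 x10 x11 x12 : B)
   (a : hom x1 x2) (b : hom x3 x1) (c : hom x4 x3) (d : hom x5 x1) (e : hom x6 x5) (h : hom x4 x6)
   (D : hom x7 x2) (a2 : hom x5 x7) (m2 : hom x8 x6) (l : hom x9 x8) (m : hom x9 x4)
   (M : hom x10 x7) (as' : hom x8 x10) (G : hom x11 x9) (u : hom x12 x11) (R : hom x12 x10) :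
  b ∘ c = d ∘ e ∘ h -> a ∘ d = D ∘ a2 -> m2 ∘ l = h ∘ m -> a2 ∘ e ∘ m2 = M ∘ as' ->
  as' ∘ l ∘ G ∘ u = R -> a ∘ b ∘ (c ∘ m ∘ G ∘ u) = D ∘ M ∘ R.
Proof.
move=> e1 e2 e3 e4 e5; rewrite !compA -(compA a) e1 !compA e2 -(compA _ h) -e3 !compA.
by rewrite -(compA D a2) -(compA D) e4 -e5 !compA.
Qed.

Section Transfer.
Variables (k : fieldType) (C : monoidal k) (M N : modcat C).
Hypotheses (rC : rigid C) (fC : finite_category C).
Variables (IN : ihoms N) (Ls : forall q : C, induced q).
Let FM := fun_modcat M N.
Let NZ := center_res N.
Variables (F : modfun M N).

Definition plain_nat (q : C) (H : modfun M N) (zeta : forall m, hom (q ▷ F m) (H m)) :=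
  forall m n (f : hom m n), zeta n ∘ (idm q ▷' fhom F f) = fhom H f ∘ zeta m.

Lemma plain_adj_ex (q : C) (H : modfun M N) (zeta : forall m, hom (q ▷ F m) (H m)) :
  plain_nat zeta -> exists phi : modnat (fun_act (Ls q) F) H,
    forall m, phi m ∘ (ind_unit (Ls q) ▷' idm (F m)) = zeta m.
Proof.
move=> zN; have [phi [phiE _]] := ind_act_adj rC (Ls q) IN zN.
by exists phi => m; rewrite -ind_inE.
Qed.

Lemma plain_adj_ext (q : C) (L : induced q) (H : modfun M N) (phi psi : modnat (fun_act L F) H) :
  (forall m, phi m ∘ (ind_unit L ▷' idm (F m)) = psi m ∘ (ind_unit L ▷' idm (F m))) ->
  phi = psi.
Proof.
move=> E.
have zN : plain_nat (fun m => psi m ∘ (ind_unit L ▷' idm (F m))).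
  move=> m n f; rewrite -compA -ahom_swap !compA; congr (_ ∘ _).
  exact: (nt_natural psi f).
have [r [_ rU]] := ind_act_adj rC L IN zN.
transitivity r; first by apply: esym; apply: rU => m; rewrite ind_inE.
by apply: rU => m; rewrite ind_inE.
Qed.

Definition plain_adj q H zeta (zN : @plain_nat q H zeta) : modnat (fun_act (Ls q) F) H :=
  projT1 (cid (plain_adj_ex zN)).

Lemma plain_adjE q H zeta (zN : @plain_nat q H zeta) m :
  plain_adj zN m ∘ (ind_unit (Ls q) ▷' idm (F m)) = zeta m.
Proof. by rewrite /plain_adj; case: cid. Qed.

Variables (K : modfun FM NZ) (w : N) (g : hom w (K (F : FM) : N)).

(** A functor out of [FM] over the centre, with a map [w -> K F], receives a map
    [q ▷ w -> K H] from each natural transformation [q ▷ F -> H], [C]-linear or not: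
    such a transformation factors through the object of the centre induced by [q]. *)
Definition transfer q H zeta (zN : @plain_nat q H zeta) : hom (q ▷ w) (K (H : FM) : N) :=
  locked_with act_key (fhom K (plain_adj zN : @hom k FM (fun_act (Ls q) F) H)
    ∘ bwd (mstr K (ind_ob (Ls q) : center C) (F : FM))
    ∘ (idm (cob (Ls q)) ▷' g) ∘ (ind_unit (Ls q) ▷' idm w)).

(** Transfer respects the action of the centre and composition on both sides. The cases needed
    elsewhere are [z] equal to the unit ([transfer_post]) and [xi] the identity. *)
Lemma transfer_natural (q q' : C) (H H' : modfun M N) zeta zeta'
    (zN : @plain_nat q H zeta) (zN' : @plain_nat q' H' zeta')
    (z : center C) (f : hom q' (cob z ⊗ q)) (xi : modnat H' (fun_act z H)) :
  (forall m, xi m ∘ zeta' m = (idm (cob z) ▷' zeta m) ∘ aassoc (cob z) q (F m)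
     ∘ (f ▷' idm (F m))) ->
  fwd (mstr K z (H : FM)) ∘ fhom K (xi : @hom k FM H' (fun_act z H)) ∘ transfer zN' =
  (idm (cob z) ▷' transfer zN) ∘ aassoc (cob z) q w ∘ (f ▷' idm w).
Proof.
move=> E; pose L := Ls q; pose L' := Ls q'.
(* The map [f], followed by the unit of [L], goes from [q'] to an object of the centre, hence
   extends to the induced object [L']. *)
have [l lE] := ind_lift rC fC L' (z := center_tensor z L) ((idm (cob z) ⊗' ind_unit L) ∘ f).
have {}lE := ind_lift_unit lE; rewrite -/(ind_unit L') in lE.
pose phi := plain_adj zN; pose phi' := plain_adj zN'.
have lphi : (fun_act_hom (center_id z) phi : @hom k FM (fun_act z (fun_act L F)) _)
    ∘ fwd (fun_assoc z L F) ∘ fun_act_hom l (modnat_id F) =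
    (xi : @hom k FM H' _) ∘ (phi' : @hom k FM (fun_act L' F) H').
  apply: plain_adj_ext => m; rewrite /= ?ahom1 ?comp1m ?compm1.
  rewrite -[LHS]compA -ahomMr lE ahomMr -[RHS]compA plain_adjE E !compA.
  by rewrite -(compA _ (fwd (aassoc _ _ _))) aassoc_natural compA -ahomMl plain_adjE.
have s1 : fhom K (xi : @hom k FM H' (fun_act z H)) ∘ fhom K (phi' : @hom k FM (fun_act L' F) H') =
    fhom K (fun_act_hom (center_id z) phi : @hom k FM (fun_act z (fun_act L F)) _)
    ∘ fhom K (fwd (fun_assoc z L F)) ∘ fhom K (fun_act_hom l (modnat_id F) : @hom k FM _ _).
  by rewrite -!fhomM -lphi.
have s2 := mstr_nat K (center_id z : @hom k (center C) z z) (phi : @hom k FM (fun_act L F) H).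
have s3 := bwd_mstr_natl K (F : FM) (l : @hom k (center C) (ind_ob L') (center_tensor z L)).
have s4 := mstr_hex K z (ind_ob L : center C) (F : FM).
have s4' : fwd (mstr K z (fun_act L F : FM)) ∘ fhom K (fwd (fun_assoc z L F))
     ∘ bwd (mstr K (center_tensor z L : center C) (F : FM)) =
    (idm (cob z) ▷' bwd (mstr K (ind_ob L : center C) (F : FM)))
     ∘ aassoc (cob z) (cob L) (K (F : FM) : N).
  apply: (iso_epic (mstr K (center_tensor z L : center C) (F : FM))).
  rewrite isoVK; apply: (iso_monic (fiso (act_left N (cob z)) (mstr K (ind_ob L : center C) (F : FM)))).
  rewrite /= compA; apply: etrans (esym s4) _.
  by rewrite !compA -(@ahomMl k C N) bwdK (@ahom1 k C N) comp1m.
have s5 : aassoc (cob z) (cob L) (K (F : FM) : N) ∘ (chom l ▷' idm (K (F : FM) : N))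
     ∘ (idm (cob L') ▷' g) ∘ (ind_unit L' ▷' idm w) =
   (idm (cob z) ▷' (idm (cob L) ▷' g)) ∘ (idm (cob z) ▷' (ind_unit L ▷' idm w))
     ∘ aassoc (cob z) q w ∘ (f ▷' idm w).
  rewrite -(compA _ (_ ▷' idm _) (idm _ ▷' g)) -ahom_swap -compA -(compA _ _ (ind_unit L' ▷' _)).
  rewrite -ahomMr lE ahomMr !compA -thom1 aassoc_natural -(compA _ (fwd (aassoc _ _ _))).
  by rewrite aassoc_natural !compA.
rewrite /transfer !unlock; apply: etrans (comp_chain s1 s2 s3 s4' s5) _.
by rewrite !(@ahomMl k C N) !compA.
Qed.

Lemma transfer_post (q q' : C) (H H' : modfun M N) zeta zeta'
    (zN : @plain_nat q H zeta) (zN' : @plain_nat q' H' zeta') (f : hom q' q) (xi : modnat H' H) :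
  (forall m, xi m ∘ zeta' m = zeta m ∘ (f ▷' idm (F m))) ->
  fhom K (xi : @hom k FM H' H) ∘ transfer zN' = transfer zN ∘ (f ▷' idm w).
Proof.
move=> E; pose u := bwd (fun_unit H) : modnat H (fun_act (center_unit C) H).
have uE : (fwd (fun_unit H) : hom _ _) ∘ (u : @hom k FM _ _) = idm (H : FM) by apply: bwdK.
have un (m n : N) (h : hom m n) : (idm tunit ▷' h) ∘ bwd (aunit m) = bwd (aunit n) ∘ h.
  exact: esym (bwd_aunit_natural h).
have hyp m : modnat_comp u xi m ∘ zeta' m = (idm tunit ▷' zeta m) ∘ aassoc tunit q (F m)
     ∘ ((bwd (lunit q) ∘ f) ▷' idm (F m)).
  rewrite /= -compA E; apply: (iso_monic (aunit (H m))).
  rewrite !compA bwdK comp1m aunit_natural -(compA _ (aunit _)) aunit_assoc.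
  by rewrite -(compA _ (lunit q ▷' _)) -ahomMr compA bwdK comp1m.
have tn := transfer_natural zN zN' (z := center_unit C) (xi := modnat_comp u xi) hyp.
have tu := mstr_unit K (H : FM).
have tE : transfer zN ∘ (f ▷' idm w) = aunit (K (H : FM) : N) ∘ ((idm tunit ▷' transfer zN)
    ∘ aassoc tunit q w ∘ ((bwd (lunit q) ∘ f) ▷' idm w)).
  rewrite !compA aunit_natural -(compA _ (aunit _)) aunit_assoc.
  by rewrite -(compA _ (lunit q ▷' _)) -ahomMr compA bwdK comp1m.
rewrite tE -[X in _ = _ ∘ X]tn !compA [X in _ = X ∘ _ ∘ _]tu -fhomM; congr (fhom K _ ∘ _).
by rewrite -[LHS](comp1m (xi : @hom k FM H' H)) -uE -compA.
Qed.

Lemma transfer_unit (zeta : forall m, hom (tunit ▷ F m) (F m)) (zN : @plain_nat tunit F zeta) :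
  (forall m, zeta m = aunit (F m)) -> transfer zN = g ∘ aunit w.
Proof.
move=> zE; pose L := Ls tunit.
have [l lE] := ind_lift rC fC L (z := center_unit C) (idm tunit).
have {}lE := ind_lift_unit lE; rewrite -/(ind_unit L) in lE.
have pE : (plain_adj zN : @hom k FM (fun_act L F) F) =
    fwd (fun_unit F) ∘ (fun_act_hom l (modnat_id F) : @hom k FM (fun_act L F) (fun_act (center_unit C) F)).
  apply: plain_adj_ext => m; rewrite plain_adjE zE /= ahom1 comp1m.
  by rewrite -compA -ahomMr lE ahom1 compm1.
have s3 : bwd (mstr K (center_unit C : center C) (F : FM)) ∘ (chom l ▷' idm (K (F : FM) : N)) =
    fhom K (fun_act_hom l (modnat_id F) : @hom k FM (fun_act L F) (fun_act (center_unit C) F))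
     ∘ bwd (mstr K (ind_ob L : center C) (F : FM)).
  exact: (bwd_mstr_natl K (F : FM) (l : @hom k (center C) (ind_ob L) (center_unit C))).
have tu := mstr_unit K (F : FM).
rewrite /transfer !unlock pE fhomM -(compA (fhom K (fwd (fun_unit F)))) -[X in _ ∘ X ∘ _ ∘ _]s3.
have -> : fhom K (fwd (fun_unit F)) = aunit (K (F : FM) : N) ∘ mstr K (center_unit C : center C) (F : FM).
  exact: (esym tu).
rewrite !compA isoK -(compA _ (_ ▷' idm _) (idm _ ▷' g)) -ahom_swap -!compA -(@ahomMr k C N).
have -> : l ∘ ind_unit (Ls tunit) = idm tunit by [].
by rewrite (@ahom1 k C N) compm1 (@aunit_natural k C N).
Qed.

End Transfer.

Section TransferMap.
Variables (k : fieldType) (C : monoidal k) (M N : modcat C).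
Hypotheses (rC : rigid C).
Variables (IN : ihoms N) (Ls : forall q : C, induced q) (F : modfun M N).
Let FM := fun_modcat M N.
Let NZ := center_res N.

(** A transformation over the centre commutes with transfer, although the transferred transformation
    need not be a module map: its extension to the induced object is one. *)
Lemma transfer_map (K K' : modfun FM NZ) (s : modnat K K') (w : N) (g : hom w (K (F : FM) : N))
    q H zeta (zN : plain_nat (M := M) (F := F) (q := q) (H := H) zeta) :
  (s (H : FM) : hom (K (H : FM) : N) (K' (H : FM) : N)) ∘ transfer rC IN Ls (K := K) g zN =
  transfer rC IN Ls (K := K') ((s (F : FM) : hom (K (F : FM) : N) (K' (F : FM) : N)) ∘ g) zN.
Proof.
rewrite /transfer !unlock (@ahomMl k C N) !compA; congr (_ ∘ _ ∘ _).
have e1 := nt_natural s (plain_adj rC IN Ls zN : @hom k FM (fun_act (Ls q) F) H).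
have e2 := nt_mod s (ind_ob (Ls q) : center C) (F : FM).
have e3 : (s (fun_act (Ls q) F : FM) : hom (K _ : N) (K' _ : N)) ∘ bwd (mstr K (ind_ob (Ls q) : center C) (F : FM)) =
    bwd (mstr K' (ind_ob (Ls q) : center C) (F : FM)) ∘
    (idm (cob (Ls q)) ▷' (s (F : FM) : hom (K (F : FM) : N) (K' (F : FM) : N))).
  apply: (iso_monic (mstr K' (ind_ob (Ls q) : center C) (F : FM))).
  apply: (iso_epic (mstr K (ind_ob (Ls q) : center C) (F : FM))).
  by rewrite !compA isoVK [LHS]e2 bwdK comp1m.
apply: etrans (_ : fhom K' (plain_adj rC IN Ls zN : @hom k FM (fun_act (Ls q) F) H) ∘
  ((s (fun_act (Ls q) F : FM) : hom (K _ : N) (K' _ : N)) ∘ bwd (mstr K (ind_ob (Ls q) : center C) (F : FM))) = _).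
  by rewrite [RHS]compA; congr (_ ∘ _).
by rewrite e3 compA.
Qed.

End TransferMap.

(** * Transformations between evaluations decompose *)

Section FreeMaps.
Variables (k : fieldType) (C : monoidal k) (M N : modcat C) (IM : ihoms M).
Hypotheses (rC : rigid C).

Lemma free_mapE m n (G : modfun M N) (s : hom n (G m)) x : free_map rC IM s x =
  fhom G (ih_ev IM m x) ∘ bwd (mstr G (ih IM m x) m) ∘ (idm (ih IM m x) ▷' s).
Proof. by rewrite /free_map /= /yoneda /= compm1. Qed.

Lemma free_id m (n : N) x : fhom (free_mod rC IM m n) (ih_ev IM m x)
  ∘ bwd (mstr (free_mod rC IM m n) (ih IM m x) m) ∘ (idm (ih IM m x) ▷' free_unit rC IM m n) = idm _.
Proof.
rewrite -free_mapE; apply: (@free_ext k C rC M N IM m n _ (free_map rC IM (free_unit rC IM m n))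
  (modnat_id (free_mod rC IM m n))).
by rewrite free_map_unit /= comp1m.
Qed.

Lemma bwd_mstr_natr (X : modfun M N) y (a b : M) (f : hom a b) :
  bwd (mstr X y b) ∘ (idm y ▷' fhom X f) = fhom X (idm y ▷' f) ∘ bwd (mstr X y a).
Proof.
apply: (iso_monic (mstr X y b)); apply: (iso_epic (mstr X y a)).
by rewrite !compA bwdK comp1m isoVK mstr_nat.
Qed.

Lemma nt_mod_bwd (X X' : modfun M N) (a : modnat X X') y m :
  a (y ▷ m) ∘ bwd (mstr X y m) = bwd (mstr X' y m) ∘ (idm y ▷' a m).
Proof.
apply: (iso_monic (mstr X' y m)); apply: (iso_epic (mstr X y m)).
by rewrite !compA isoVK nt_mod bwdK comp1m.
Qed.

End FreeMaps.

Section Flat.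
Variables (k : fieldType) (C : monoidal k) (N N' : modcat C) (v v' : C).
Variables (ev : hom (v ⊗ v') tunit) (coev : hom tunit (v' ⊗ v)).
Hypothesis E1 : runit v' ∘ (idm v' ⊗' ev) ∘ assoc v' v v' ∘ (coev ⊗' idm v') = lunit v'.
Hypothesis E2 : lunit v ∘ (ev ⊗' idm v) ∘ bwd (assoc v v' v) ∘ (idm v ⊗' coev) = runit v.
Variables (X : modfun N N') (n : N').

(** The adjunct of [g] under the duality of [v] and [v'], with the action of [v'] pulled inside the
    module functor [X]. *)
Definition flat a (g : hom (v ▷ n) (X a)) : hom n (X (v' ▷ a)) :=
  locked_with act_key (bwd (mstr X v' a) ∘ (idm v' ▷' g) ∘ act_coev coev n).

Lemma flat_post a b (f : hom a b) (g : hom (v ▷ n) (X a)) :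
  flat (fhom X f ∘ g) = fhom X (idm v' ▷' f) ∘ flat g.
Proof. by rewrite /flat !unlock ahomMl !compA bwd_mstr_natr. Qed.

Lemma flat_surj a (h : hom n (X (v' ▷ a))) : exists g, flat g = h.
Proof.
exists (act_ev ev (X a) ∘ (idm v ▷' (mstr X v' a ∘ h))).
rewrite /flat unlock ahomMl -!compA -act_coev_natural (compA (idm v' ▷' act_ev _ _)).
by rewrite act_zigzag1 // comp1m compA fwdK comp1m.
Qed.

End Flat.

Section Kappa.
Variables (k : fieldType) (C : monoidal k) (M N : modcat C).
Hypotheses (rC : rigid C).
Variables (IN : ihoms N) (Ls : forall q : C, induced q) (F : modfun M N).
Variables (v v' : C) (coev : hom tunit (v' ⊗ v)) (n : N).

(** For a functor H |-> X(H P) the induced object drops out: since [X] is a module functor, transfer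
    just applies [X] to the plain transformation at [P]. *)
Lemma transfer_flat (X : modfun N N) (P : M) (g : hom (v ▷ n) (X (F P))) (c : C) (H : modfun M N)
    (theta : forall m, hom (c ▷ (v' ▷ F m)) (H m))
    (zN : plain_nat (F := F) (q := c ⊗ v') (fun m => theta m ∘ aassoc c v' (F m))) :
  transfer rC IN Ls (K := post_eval X P) g zN ∘ (bwd (aassoc c v' (v ▷ n)) ∘ (idm c ▷' act_coev coev n)) =
  fhom X (theta P) ∘ bwd (mstr X c (v' ▷ F P)) ∘ (idm c ▷' flat coev g).
Proof.
have pE := plain_adjE rC IN Ls zN P.
have [phi phiE] : exists phi, phi = plain_adj rC IN Ls zN P by eexists.
have tE : transfer rC IN Ls (K := post_eval X P) g zN = fhom X phi
   ∘ bwd (mstr X (cob (Ls (c ⊗ v'))) (F P)) ∘ (idm (cob (Ls (c ⊗ v'))) ▷' g) ∘ (ind_unit (Ls (c ⊗ v')) ▷' idm _).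
  by rewrite /transfer unlock phiE /= fhom1 comp1m.
rewrite tE; rewrite -phiE in pE.
rewrite -(compA _ _ (ind_unit _ ▷' _)) ahom_swap !compA.
rewrite -(compA _ (bwd (mstr X _ _)) (ind_unit _ ▷' _)) bwd_mstr_natl.
rewrite compA -fhomM pE.
have hx : fhom X (aassoc c v' (F P)) ∘ bwd (mstr X (c ⊗ v') (F P)) =
    bwd (mstr X c (v' ▷ F P)) ∘ (idm c ▷' bwd (mstr X v' (F P))) ∘ aassoc c v' (X (F P)).
  apply: (iso_epic (mstr X (c ⊗ v') (F P))); rewrite isoVK -compA mstr_hex !compA.
  by rewrite -(compA (bwd _)) -ahomMl fwdK ahom1 compm1 fwdK comp1m.
rewrite fhomM -(compA (fhom X (theta P))) hx /flat unlock !ahomMl !compA.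
rewrite -(compA _ (fwd (aassoc _ _ _))) -[idm (c ⊗ v')]thom1 aassoc_natural !compA.
by rewrite isoK.
Qed.

End Kappa.

Lemma delta_family (k : fieldType) (n : nat) (V : 'I_n -> lmodType k) (j : 'I_n) (x : V j) :
  exists l : forall i, V i, l j = x /\ forall i, i != j -> l i = 0.
Proof.
exists (fun i => match eqVneq i j with
  | EqNotNeq e => eq_rect j V x i (esym e) | NeqNotEq _ => 0 end).
split; first by case: eqVneq => [e|]; rewrite ?eqxx // (eq_irrelevance e erefl).
by move=> i; case: eqVneq.
Qed.

Section Decomposition.
Variables (k : fieldType) (C : monoidal k) (M N : modcat C).
Implicit Types (X : modfun N N) (P x : M).

(** The family [s] comes from an element of Hom(P, x) ⊗ Hom(X, X'), one and the same for all H. *)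
Definition decomposes X X' P x (s : forall H : modfun M N, hom (X (H P)) (X' (H x))) : Prop :=
  exists L : seq (hom P x * modnat X X')%type, forall H,
    s H = \sum_(u <- L) fhom X' (fhom H u.1) ∘ u.2 (H P).

Lemma decomposes_sum X X' P x (I : Type) (r : seq I)
    (s : I -> forall H : modfun M N, hom (X (H P)) (X' (H x))) t :
  (forall i, decomposes (s i)) -> (forall H, t H = \sum_(i <- r) s i H) -> decomposes t.
Proof.
move=> d e; elim: r t e => [|i r IH] t e.
  by exists [::] => H; rewrite e !big_nil.
have [|L LE] := IH (fun H => \sum_(i <- r) s i H); first by [].
have [L' LE'] := d i; exists (L' ++ L) => H.
by rewrite e big_cons big_cat LE' LE.
Qed.

Lemma decomposes_comp X X1 X' P P1 x (s : forall H : modfun M N, hom (X1 (H P1)) (X' (H x)))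
    (i : hom P P1) (a : modnat X X1) :
  decomposes s -> decomposes (fun H => s H ∘ a (H P1) ∘ fhom X (fhom H i)).
Proof.
move=> [L LE]; exists [seq (u.1 ∘ i, modnat_comp u.2 a) | u <- L] => H.
rewrite big_map LE !comp_suml; apply: eq_bigr => u _ /=.
by rewrite !fhomM -!compA (nt_natural a) (compA (u.2 _)) nt_natural -!compA.
Qed.

End Decomposition.

Section Core.
Variables (k : closedFieldType) (C : monoidal k) (M N : modcat C).
Hypotheses (rC : rigid C).
Variables (IN : ihoms N) (Ls : forall q : C, induced q) (F : modfun M N).
Variables (v v' : C) (ev : hom (v ⊗ v') tunit) (coev : hom tunit (v' ⊗ v)).
Hypothesis E1 : runit v' ∘ (idm v' ⊗' ev) ∘ assoc v' v v' ∘ (coev ⊗' idm v') = lunit v'.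
Variables (n : nat) (s P : 'I_n -> M) (e : forall j, hom (P j) (s j)).
Hypothesis flM : forall x : M, finite_length x.
Hypothesis sc : simple_covers e.
Let T : functor M N := functor_comp (act_left N v') F.
Variables (tau : forall j, hom (T (s j)) (T (P j))).
Hypotheses (eT : exact_functor T) (tauE : forall j, fhom T (e j) ∘ tau j = idm (T (s j))).

Section Free.
Variables (w : N) (j : 'I_n) (X : modfun N N) (u : hom w (X (T (s j)))).
Let a_ := ih IN (T (s j)).
Variable iota : forall y, hom (X y) (a_ y ▷ w).
Hypothesis idX : forall y, fhom X (ih_ev IN (T (s j)) y) ∘ bwd (mstr X (a_ y) (T (s j)))
  ∘ (idm (a_ y) ▷' u) ∘ iota y = idm (X y).
Hypothesis mapX : forall (X' : modfun N N) (g : hom w (X' (T (s j)))),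
  exists al : modnat X X', forall y, al y = fhom X' (ih_ev IN (T (s j)) y)
   ∘ bwd (mstr X' (a_ y) (T (s j))) ∘ (idm (a_ y) ▷' g) ∘ iota y.

(** Compatibility with transfer makes [sg H] determined by the single map [G], the value of [sg F]
    on the generator [g]. The adjunct of [G] lands in [T x], the sum of the Hom(P i, x) ⊗ T(s i);
    testing with a transformation supported on the generator [j] keeps the terms with i = j, and
    each of these is a map P j -> x times a map X -> X'. *)
Lemma core_decomposes (X' : modfun N N) (x : M)
    (sg : modnat (post_eval X (P j)) (post_eval X' x)) :
  decomposes (X := X) (X' := X') (P := P j) (x := x) (fun H : modfun M N => sg H).
Proof.
have [L [L1 [_ L2]]] := free_functor_family flM sc eT tauE.
(* [g] is chosen so that its adjunct is the generator [u] of [X] pushed along [tau j]. *)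
have [g gE] := @flat_surj k C N N v v' ev coev E1 X w _ (fhom X (tau j) ∘ u).
have [G GE] : exists G : hom (v ▷ w) (X' (F x)), G = (sg F : hom (X (F (P j))) (X' (F x))) ∘ g.
  by eexists.
pose I := {i : 'I_n & (hom (P i) x * hom (T x) (T (s i)))%type}.
have [w' w'E] : exists w' : forall t : I, hom w (X' (T (s (tag t)))),
  forall t, w' t = fhom X' (tagged t).2 ∘ flat coev G by eexists.
have flG : flat coev G = \sum_(t <- L x) fhom X' (fhom T (tagged t).1 ∘ tau (tag t)) ∘ w' t.
  rewrite -[LHS]comp1m -fhom1 -(L1 x) fhom_sum comp_suml.
  by apply: eq_bigr => t _; rewrite !fhomM w'E !compA.
(* The list has to be independent of [H]. It is therefore extracted from [L x] while [H] and the
   values [l] are still arbitrary, keeping only the indices equal to [j]. *)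
have [L' L'E] : exists L' : seq (hom (P j) x * modnat X X')%type, forall (H : modfun M N)
    (l : forall i, hom (a_ (H (P j)) ▷ T (s i)) (H (P i))),
    l j = ih_ev IN (T (s j)) (H (P j)) -> (forall i, i != j -> l i = 0) ->
    \sum_(t <- L x) fhom X' (fhom H (tagged t).1 ∘ l (tag t)) ∘ bwd (mstr X' (a_ (H (P j))) _)
       ∘ (idm _ ▷' w' t) ∘ iota _ = \sum_(t <- L') fhom X' (fhom H t.1) ∘ t.2 (H (P j)).
  elim: (L x) => [|[i [f p]] Lx [L' IH]]; first by exists [::] => *; rewrite !big_nil.
  have [eij|nij] := eqVneq i j; last first.
    exists L' => H l lj li; rewrite big_cons /= li // comp0r fhom0 !comp0l add0r.
    exact: IH.
  subst i; have [al alE] := mapX (w' (existT _ j (f, p))).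
  exists ((f, al) :: L') => H l lj li; rewrite !big_cons /= (IH H l) // lj fhomM alE.
  by rewrite !compA.
exists L' => H.
(* The test transformation is the evaluation of the internal Hom on the generator [j] and zero on
   all others. *)
have [l [lj li]] := @delta_family k n (fun i => hom (a_ (H (P j)) ▷ T (s i)) (H (P i))) j (ih_ev IN (T (s j)) (H (P j))).
rewrite -(L'E H l lj li); pose a := a_ (H (P j)).
have [theta thE] : exists theta : forall m, hom (a ▷ T m) (H m), forall m, theta m =
   \sum_(t <- L m) fhom H (tagged t).1 ∘ l (tag t) ∘ fhom (act_left N a) (tagged t).2 by eexists.
have [t1 t2] := L2 N (act_left N a) H l theta thE.
have zN : plain_nat (F := F) (q := a ⊗ v') (fun m => theta m ∘ aassoc a v' (F m)).
  move=> p q f; rewrite -compA -[idm (a ⊗ v')]thom1 aassoc_natural compA.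
  rewrite ?compA; congr (_ ∘ _); exact: (t2 _ _ f).
have k1 := @transfer_flat k C M N rC IN Ls F v v' coev w X (P j) g a H theta zN.
have k2 := @transfer_flat k C M N rC IN Ls F v v' coev w X' x G a H theta zN.
(* Here the hypothesis on [sg] enters: it carries the transfer of [g] to the transfer of [G], and
   [id1] recovers all of X(H(P j)) from the former. *)
have k3 := @transfer_map k C M N rC IN Ls F _ _ sg (v ▷ w) g _ H _ zN.
rewrite -GE in k3.
have id1 : fhom X (theta (P j)) ∘ bwd (mstr X a (v' ▷ F (P j))) ∘ (idm a ▷' flat coev g)
   ∘ iota (H (P j)) = idm _.
  have t1' := t1 _ _ (idm (P j)); rewrite fhom1 comp1m fhom1 comp1m lj in t1'.
  rewrite gE ahomMl !compA -(compA _ (bwd _)) bwd_mstr_natr compA -fhomM [X in fhom _ X]t1'.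
  exact: idX.
move: (bwd (aassoc a v' (v ▷ w)) ∘ (idm a ▷' act_coev coev w)) k1 k2 => lam k1 k2.
have k4 : (sg H : hom (X (H (P j))) (X' (H x))) =
    transfer rC IN Ls (K := post_eval X' x) G zN ∘ lam ∘ iota (H (P j)).
  rewrite -k3 -[LHS]compm1 -[X in _ ∘ X = _]id1 -k1.
  by rewrite !(compA (sg H : hom (X (H (P j))) (X' (H x)))).
rewrite [LHS]k4 k2 flG ahom_sumr comp_sumr comp_suml; apply: eq_bigr => t _.
rewrite ahomMl !compA -(compA _ (bwd _)) bwd_mstr_natr compA -fhomM.
by have := t1 _ _ (tagged t).1; rewrite [fhom (act_left _ _) _]/= => ->.
Qed.

End Free.

End Core.

Section ProjectiveRetract.
Variables (k : closedFieldType) (C : monoidal k) (M : modcat C).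
Hypotheses (fC : finite_category C) (xM : exact_module M).
Variables (n : nat) (s P : 'I_n -> M) (e : forall j, hom (P j) (s j)).
Hypothesis sc : simple_covers e.

(** For [p] projective and covering the unit, the functor [p ▷ -] is free on sections at the covers
    [P j]. So the map to [x] from the sum of covers used for [p ▷ x] becomes split epi after acting
    by [p], hence is epi, and it splits as [x] is projective. *)
Lemma projective_covers (x : M) : projective x ->
  exists L : seq {j : 'I_n & (hom (P j) x * hom x (P j))%type},
    \sum_(u <- L) (tagged u).1 ∘ (tagged u).2 = idm x.
Proof.
move=> px; have [p [q [pp eq]]] := proj_unit_ex fC.
case: (xM) => mM pM; case: (mM) => fM eM _; case: (fM) => abM _ flM _ _.
have eE j : epi (e j) by case: sc => _ h _ _ _.
have [tau tauE] := sections_ex (T := act_left M p) (fun j => exact_epi abM (eM p) (eE j))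
  (fun j => pM p (s j) pp).
have [L [L1 _]] := free_functor_family flM sc (eM p) tauE.
pose t := in_tuple (L x); pose D (i : 'I_(size (L x))) := P (tag (tnth t i)).
have [S [inS [pr bs]]] := bigsum_ex abM D.
pose q' : hom S x := \sum_i (tagged (tnth t i)).1 ∘ pr i.
have q'in i : q' ∘ inS i = (tagged (tnth t i)).1 by apply: bigsum_in.
have eq' : epi q'.
  apply: (reflect_epi abM (eM p)).
    exact: (act_reflects_zero fC mM eq).
  apply: (retract_epi (i := \sum_i fhom (act_left M p) (inS i) ∘ tau _ ∘ (tagged (tnth t i)).2)).
  rewrite comp_sumr -[RHS]L1 [RHS]big_tnth; apply: eq_bigr => i _.
  by rewrite !compA -fhomM q'in.
have [i iE] := px _ _ q' (idm x) eq'.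
exists [seq existT (fun j => (hom (P j) x * hom x (P j))%type) (tag (tnth t l))
  ((tagged (tnth t l)).1, pr l ∘ i) | l <- enum 'I_(size (L x))].
rewrite big_map big_enum /= -iE comp_suml; apply: eq_bigr => l _.
by rewrite compA.
Qed.

End ProjectiveRetract.

Section PostEvalNat.
Variables (k : fieldType) (C : monoidal k) (M N : modcat C).
Variables (X X1 : modfun N N) (P P1 : M) (a : modnat X X1) (f : hom P P1).
Let FM := fun_modcat M N.

Definition post_eval_nat : modnat (post_eval X P : modfun FM (center_res N)) (post_eval X1 P1).
Proof.
exists (fun H : modfun M N => fhom X1 (fhom H f) ∘ a (H P)).
- move=> H H' t /=; rewrite -compA nt_natural !compA -!fhomM.
  by rewrite (nt_natural (t : modnat H H')).
- move=> z H; rewrite /= !fhom1 !compm1 compA mstr_nat -!compA (@ahomMl k C N) -compA.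
  by rewrite nt_mod.
Defined.

End PostEvalNat.

Lemma finite_tensor_rigid (k : fieldType) (C : monoidal k) : finite_tensor C -> rigid C.
Proof. by case=> -[]. Qed.

Section CenterNatural.
Variables (k : closedFieldType) (C : monoidal k) (M N : modcat C).
Hypotheses (tC : finite_tensor C) (xM : exact_module M) (xN : exact_module N).
Let rC : rigid C := finite_tensor_rigid tC.
Let fC : finite_category C. Proof. by case: tC => -[]. Qed.
Variables (IM : ihoms M) (IN : ihoms N) (Ls : forall q : C, induced q).

Lemma ihom_simple (s : M) : simple_object s -> ~ is_zero (ih IM s s).
Proof.
move=> [ns _] zh; apply: ns; have [u [uE _]] := ihP IM (aunit s).
rewrite /is_zero -(bwdK (aunit s)) -uE.
by rewrite (proj2 (is_zeroP zh) _ u) ahom0l comp0r comp0l.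
Qed.

(** The evaluation of Hom(s, s) against its dual is epi because the unit is simple. Replacing the
    dual by a projective [v'] above it keeps an epi onto [t], which splits. *)
Lemma ihom_cover (s : M) (t : N) : simple_object s -> projective t ->
  exists (v v' : C) (ev : hom (v ⊗ v') tunit) (coev : hom tunit (v' ⊗ v))
    (p : hom (v' ▷ free_mod rC IM s t s) t) (i : hom t (v' ▷ free_mod rC IM s t s)),
  [/\ runit v' ∘ (idm v' ⊗' ev) ∘ assoc v' v v' ∘ (coev ⊗' idm v') = lunit v',
      projective v' & p ∘ i = idm t].
Proof.
move=> ss pt; have [[y [ev [coev [e1 e2]]]] _] := rC (ih IM s s).
have eev := dual_ev_epi tC e1 (ihom_simple ss).
have [v' [q [pv' eq]]] : exists (v' : C) (q : hom v' y), projective v' /\ epi q.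
  by case: fC => _ _ _ h _; apply: h.
have [[v [ev' [coev' [e1' e2']]]] _] := rC v'.
have abC : abelian_category C by case: fC.
case: (xN) => -[_ _ rN] _.
pose a := free_mod rC IM s t s.
have ep : epi (aunit t ∘ (ev ▷' idm t) ∘ bwd (aassoc y (ih IM s s) t) ∘ (q ▷' idm a)).
  apply: epi_comp; last exact: (exact_epi abC (rN a) eq).
  apply: epi_comp; last exact: (iso_epi (iso_inv _)).
  apply: epi_comp; first exact: iso_epi.
  exact: (exact_epi abC (rN t) eev).
have [i iE] := pt _ _ _ (idm t) ep.
by exists v, v', ev', coev', (aunit t ∘ (ev ▷' idm t) ∘ bwd (aassoc y (ih IM s s) t) ∘ (q ▷' idm a)), i.
Qed.

(** This reduces to [core_decomposes] by two retractions: the projective [P] is a retract of a sum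
    of covers P_j, and the functor free at [t] is a retract of the one free at [T (s j)]. *)
Lemma center_natural (t w : N) (P x : M) (X' : modfun N N)
    (sg : modnat (post_eval (free_mod rC IN t w) P) (post_eval X' x)) :
  projective t -> projective P ->
  decomposes (X := free_mod rC IN t w) (X' := X') (P := P) (x := x) (fun H : modfun M N => sg H).
Proof.
move=> pt pP; pose X := free_mod rC IN t w.
case: (xM) (xN) => mM pM [mN pN]; case: (mM) (mN) => fM _ _ [fN eN _].
have [n [s [Pj [e [ss sc]]]]] := simple_covers_ex fM.
have [L LE] := projective_covers fC xM sc pP.
have abM : abelian_category M by case: fM.
have flM : forall x : M, finite_length x by case: fM.
have eE j : epi (e j) by case: sc => _ h _ _ _.
apply: (@decomposes_sum k C M N X X' P x _ L (fun u (H : modfun M N) =>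
  (sg H : hom (X (H P)) (X' (H x))) ∘ fhom X (fhom H (tagged u).1) ∘ fhom X (fhom H (tagged u).2))).
  case=> j [f g] /=.
  have [v [v' [ev [coev [p [i [E1 pv' pi]]]]]]] := ihom_cover (ss j) pt.
  pose F := free_mod rC IM (s j) t; pose T : functor M N := functor_comp (act_left N v') F.
  have eF : exact_functor F := exact_module_exact fC F xM mN.
  have eT : exact_functor T by move=> a b c i0 p0 h; apply: (eN v'); apply: eF.
  have [tau tauE] := sections_ex (fun j => exact_epi abM eT (eE j)) (fun j => pN _ _ pv').
  pose Xj := free_mod rC IN (T (s j)) w.
  (* [A] and [B] are induced by the retraction of [T (s j)] onto [t] supplied by [ihom_cover]. *)
  pose A := free_map rC IN (fhom Xj p ∘ free_unit rC IN (T (s j)) w) : modnat X Xj.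
  pose B := free_map rC IN (fhom X i ∘ free_unit rC IN t w) : modnat Xj X.
  have hA : A t ∘ free_unit rC IN t w = fhom Xj p ∘ free_unit rC IN (T (s j)) w by apply: free_map_unit.
  have hB : B (T (s j)) ∘ free_unit rC IN (T (s j)) w = fhom X i ∘ free_unit rC IN t w.
    by apply: free_map_unit.
  have BA y : B y ∘ A y = idm (X y).
    apply: (@free_ext k C rC N N IN t w X (modnat_comp B A) (modnat_id X)).
    rewrite [LHS]/= -compA hA (compA (B t)) nt_natural -compA hB.
    by rewrite compA -fhomM pi fhom1.
  clearbody A B.
  have d := @core_decomposes k C M N rC IN Ls F v v' ev coev E1 n s Pj e flM sc tau eT tauE w j Xj
    (free_unit rC IN (T (s j)) w) (fun y => idm (Xj y)).
  have [||l lE] := d _ _ X' x (modnat_comp sg (post_eval_nat B f)).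
  - by move=> y; rewrite compm1; apply: free_id.
  - move=> X'' g'; exists (free_map rC IN g') => y.
    by rewrite compm1 free_mapE.
  have [l' l'E] := decomposes_comp g A (ex_intro _ l lE).
  exists l' => H; rewrite -l'E /= -!compA; congr (_ ∘ _); congr (_ ∘ _).
  by rewrite compA BA comp1m.
move=> H.
apply: (@etrans _ _ ((sg H : hom (X (H P)) (X' (H x))) ∘ fhom X (fhom H (idm P)))).
  by rewrite !fhom1 compm1.
rewrite -LE !fhom_sum comp_sumr; apply: eq_bigr => u _.
by rewrite -!compA -!fhomM.
Qed.

End CenterNatural.

(** [Y] is free on a generator [P] placed at [mu]: composites [K Y -> G] are maps [K P -> G mu]. *)
Definition is_free (k : fieldType) (C : monoidal k) (M M' N : modcat C) (mu : M) (P : M') (Y : modfun M M')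
    (unit : hom P (Y mu)) : Prop :=
  (forall (K : modfun M' N) (G : modfun M N) (z z' : modnat (modfun_comp K Y) G),
     z mu ∘ fhom K unit = z' mu ∘ fhom K unit -> forall m, z m = z' m) /\
  (forall (K : modfun M' N) (G : modfun M N) (s : hom (K P) (G mu)),
     exists z : modnat (modfun_comp K Y) G, z mu ∘ fhom K unit = s).

Lemma free_mod_is_free (k : fieldType) (C : monoidal k) (rC : rigid C) (M M' N : modcat C) (IM : ihoms M)
  (mu : M) (P : M') : is_free N (free_unit rC IM mu P).
Proof.
split=> [K G z z' E|K G s].
  exact: (@yoneda_ext k C M mu _ _ (@ihP k C M IM mu) rC N M' P K G z z' E).
exists (yoneda_nat (@ihP k C M IM mu) rC s); exact: (yoneda_eval (@ihP k C M IM mu) rC).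
Qed.

Section FreePlain.
Variables (k : fieldType) (C : monoidal k) (M N : modcat C) (mu : M) (n : N).
Variables (Y : modfun M N) (unit : hom n (Y mu)).
Hypothesis yF : is_free N unit.

Lemma free_ext1 (G : modfun M N) (z z' : modnat Y G) :
  z mu ∘ unit = z' mu ∘ unit -> forall m, z m = z' m.
Proof.
move=> E m; exact: (proj1 yF (modfun_id N) G (to_id_comp z) (to_id_comp z') E m).
Qed.

Lemma free_ex1 (G : modfun M N) (s : hom n (G mu)) : exists z : modnat Y G, z mu ∘ unit = s.
Proof.
have [z zE] := proj2 yF (modfun_id N) G s.
by exists (of_id_comp z).
Qed.

End FreePlain.

(** * Maps out of the endofunctors X H Y *)

Section BimFree.
Variables (k : fieldType) (C : monoidal k) (M N : modcat C).
Variables (mu P : M) (X : modfun N N).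
Let A := modfun_cat M N.
Let FM := fun_modcat M N.
Variables (Y : modfun M M) (unit : hom P (Y mu)).
Hypothesis yF : is_free N unit.

Lemma bim_reassoc (H : modfun M N) (Y0 : modfun M M) x m :
  fwd (mstr (modfun_comp X (modfun_comp H Y0)) x m) =
  fwd (mstr (modfun_comp (modfun_comp X H) Y0) x m).
Proof. by rewrite /= fhomM compA. Qed.

Definition to_left (H G : modfun M N) (z : modnat (modfun_comp X (modfun_comp H Y)) G) :
  modnat (modfun_comp (modfun_comp X H) Y) G.
Proof.
exists (fun m => z m : hom (X (H (Y m))) (G m)); first exact: (nt_natural z).
by move=> x m; rewrite -bim_reassoc; exact: (nt_mod z x m).
Defined.

Definition to_right (H G : modfun M N) (z : modnat (modfun_comp (modfun_comp X H) Y) G) :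
  modnat (modfun_comp X (modfun_comp H Y)) G.
Proof.
exists (fun m => z m : hom (X (H (Y m))) (G m)); first exact: (nt_natural z).
by move=> x m; rewrite bim_reassoc; exact: (nt_mod z x m).
Defined.

Lemma bim_free_ext0 (H G : modfun M N) (z z' : modnat (modfun_comp X (modfun_comp H Y)) G) :
  z mu ∘ fhom X (fhom H unit) = z' mu ∘ fhom X (fhom H unit) -> forall m, z m = z' m.
Proof.
move=> E m; exact: (proj1 yF (modfun_comp X H) G (to_left z) (to_left z') E m).
Qed.

Variable y : modfun FM FM.

Lemma bim_free_ext (z z' : modnat (bim X Y) y) :
  (forall H : A, endo_at z H mu ∘ fhom X (fhom (H : modfun M N) unit) =
     endo_at z' H mu ∘ fhom X (fhom (H : modfun M N) unit)) ->
  (z : @hom k (modfun_cat FM FM) (bim X Y) y) = z'.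
Proof.
move=> E; apply: endo_atP => H m.
exact: (bim_free_ext0 (z := (z H : modnat _ _)) (z' := (z' H : modnat _ _)) (E H) m).
Qed.

Variable sg : modnat (post_eval X P) (endo_eval y mu).

(** For each H the freeness of [Y] on [P] at [mu] extends [sg H] to a module transformation on X H
    Y. Naturality in H and compatibility with the centre hold on the generator, hence everywhere by
    [bim_free_ext0]. *)
Lemma bim_free_ex : exists z : modnat (bim X Y) y, forall H : A,
  endo_at z H mu ∘ fhom X (fhom (H : modfun M N) unit) = sg H.
Proof.
have [zt ztE] : exists zt : forall H : A, modnat (modfun_comp X (modfun_comp (H : modfun M N) Y)) (y H),
    forall H : A, zt H mu ∘ fhom X (fhom (H : modfun M N) unit) = sg H.
  have [f fE] := dep_choice (fun H : A => proj2 yF (modfun_comp X (H : modfun M N)) (y H : modfun M N) (sg H)).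
  by exists (fun H => to_right (f H)).
have c3 (H H' : A) (t : hom H H') m : zt H' m ∘ nat_at (fhom (bim X Y) t) m =
    nat_at (fhom y t) m ∘ zt H m.
  apply: (bim_free_ext0 (z := modnat_comp (zt H') (fhom (bim X Y) t : modnat _ _))
    (z' := modnat_comp (fhom y t : modnat (y H) (y H')) (zt H))).
  change (zt H' mu ∘ fhom X ((t : modnat H H') (Y mu)) ∘ fhom X (fhom (H : modfun M N) unit) =
    nat_at (fhom y t) mu ∘ zt H mu ∘ fhom X (fhom (H : modfun M N) unit)).
  apply: (@etrans _ _ ((sg H' : hom (X ((H' : modfun M N) P)) ((y H' : modfun M N) mu)) ∘ fhom X ((t : modnat H H') P))).
    rewrite -compA -fhomM nt_natural fhomM compA; congr (_ ∘ _); exact: (ztE H').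
  apply: (@etrans _ _ (nat_at (fhom y t) mu ∘ (sg H : hom (X ((H : modfun M N) P)) ((y H : modfun M N) mu)))).
    exact: (nt_natural sg t).
  by rewrite -compA; congr (_ ∘ _); exact: esym (ztE H).
have c4 (z : center C) (H : A) m : nat_at (fwd (mstr y z H)) m ∘ zt (z ▷ (H : FM)) m =
    (idm (cob z) ▷' zt H m) ∘ nat_at (fwd (mstr (bim X Y) z H)) m.
  have hE p : fun_act_hom (center_id z) (zt H) p = idm (cob z) ▷' zt H p.
    by rewrite /= ahom1 compm1.
  rewrite -hE.
  apply: (@bim_free_ext0 (fun_act z H) (fun_act z (y H : modfun M N))
    (modnat_comp (fwd (mstr y z H) : modnat _ _) (zt (fun_act z H)))
    (modnat_comp (fun_act_hom (center_id z) (zt H)) (fwd (mstr (bim X Y) z H) : modnat _ _))).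
  have e1 := nt_mod sg z H.
  change (nat_at (fwd (mstr y z H)) mu ∘ zt (fun_act z H) mu ∘ fhom X (fhom (fun_act z H) unit) =
     fun_act_hom (center_id z) (zt H) mu ∘ mstr X (cob z) (H (Y mu)) ∘ fhom X (idm (cob z) ▷' fhom (H : modfun M N) unit)).
  pose sH (H' : A) : hom (X ((H' : modfun M N) P)) ((y H' : modfun M N) mu) := sg H'.
  have e2 : nat_at (fwd (mstr y z H)) mu ∘ sH (fun_act z H) = (idm (cob z) ▷' sH H) ∘ mstr X (cob z) ((H : modfun M N) P).
    by rewrite -(post_eval_str X P z H) -[X in X ∘ _ = _]comp1m; exact: e1.
  have e3 : (idm (cob z) ▷' zt H mu) ∘ (idm (cob z) ▷' fhom X (fhom (H : modfun M N) unit)) =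
      idm (cob z) ▷' sH H.
    exact: etrans (esym (@ahomMl k C N (cob z) _ _ _ (zt H mu) (fhom X (fhom (H : modfun M N) unit))))
      (congr1 (fun w => idm (cob z) ▷' w) (ztE H)).
  rewrite hE -!compA mstr_nat.
  apply: (@etrans _ _ (nat_at (fwd (mstr y z H)) mu ∘ sH (fun_act z H))).
    exact: (congr1 (fun w => nat_at (fwd (mstr y z H)) mu ∘ w) (ztE (fun_act z H))).
  by rewrite e2 -e3 -compA.
exists (@endo_nat k C M N (bim X Y) y (fun H m => zt H m) (fun H m n f => nt_natural (zt H) f)
  (fun H => nt_mod (zt H)) c3 c4).
exact: ztE.
Qed.

End BimFree.

Section Prescribe.
Variables (k : fieldType) (V : lmodType k).

Lemma functional_prescribe n (b : 'I_n -> V) (c : 'I_n -> k) : finite_dimensional V ->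
  independent b -> exists chi, functional chi /\ forall i, chi (b i) = c i.
Proof.
move=> fdV ib; pose D (u : 'rV[k]_n) := \sum_i u 0 i *: b i.
pose phi (u : 'rV[k]_n) := \sum_i u 0 i * c i.
have fdU : finite_dimensional 'rV[k]_n.
  by exists n, (fun i => delta_mx 0 i) => u; exists (fun i => u 0 i); apply: row_sum_delta.
have lD : linear D.
  move=> a u v; rewrite /D scaler_sumr -big_split /=; apply: eq_bigr => i _.
  by rewrite !mxE scalerDl scalerA.
have [|u uD|chi [fchi chiE]] := functional_factor (phi := phi) fdU fdV lD.
- move=> a u v; rewrite /phi mulr_sumr -big_split /=; apply: eq_bigr => i _.
  by rewrite !mxE mulrDl mulrA.
- by rewrite /phi big1 // => i _; rewrite (ib _ uD) mul0r.
exists chi; split=> // i.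
have -> : b i = D (delta_mx 0 i).
  rewrite /D (bigD1 i) //= big1 ?addr0 => [|j ji]; first by rewrite !mxE !eqxx scale1r.
  by rewrite !mxE eqxx (negbTE ji) scale0r.
rewrite chiE /phi (bigD1 i) //= big1 ?addr0 => [|j ji]; first by rewrite !mxE !eqxx mul1r.
by rewrite !mxE eqxx (negbTE ji) mul0r.
Qed.

End Prescribe.

Section Bilinear.
Variables (k : fieldType) (C : monoidal k) (M N : modcat C).
Let A := modfun_cat M N.
Let FM := fun_modcat M N.
Let E := modfun_cat FM FM.

Lemma endo_at_lin (y y' : modfun FM FM) (H : A) m :
  linear (fun z : @hom k E y y' => endo_at z H m).
Proof.
by move=> a z z'; rewrite /endo_at /nat_at /= !(scale1r, addr0).
Qed.

Variables (X : modfun N N) (Y : modfun M M).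

Lemma bim_to1_linearl (b : modnat Y (modfun_id M)) :
  linear (fun a : @hom k (modfun_cat N N) X (modfun_id N) => (bim_to1 a b : @hom k E (bim X Y) (modfun_id FM))).
Proof.
move=> c a a'; apply: endo_atP => H m; rewrite endo_at_lin !bim_to1E.
rewrite -comp_linearr; congr (_ ∘ _).
by rewrite /= !(scale1r, addr0).
Qed.

Lemma bim_to1_linearr (a : modnat X (modfun_id N)) :
  linear (fun b : @hom k (modfun_cat M M) Y (modfun_id M) => (bim_to1 a b : @hom k E (bim X Y) (modfun_id FM))).
Proof.
move=> c b b'; apply: endo_atP => H m; rewrite endo_at_lin !bim_to1E.
rewrite -comp_linearl -fhom_linear; congr (fhom _ _ ∘ _).
by rewrite /= !(scale1r, addr0).
Qed.

End Bilinear.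

Section Span.
Variables (k : fieldType) (C : monoidal k) (M N : modcat C).
Let A := modfun_cat M N.
Let FM := fun_modcat M N.
Let E := modfun_cat FM FM.
Variables (mu P : M) (X : modfun N N) (Y : modfun M M) (u0 : hom P (Y mu)).
Hypotheses (yN : is_free N u0) (yM : is_free M u0).
Hypothesis dec : forall (X' : modfun N N) (x : M) (sg : modnat (post_eval X P) (post_eval X' x)),
  decomposes (fun H : modfun M N => sg H : hom (X (H P)) (X' (H x))).

(** Restricted to the generator of [Y], the map [z] is a transformation from X(H P) to X'(H(Y' mu))
    over the centre. It decomposes by [dec], and each map from [P] to [Y' mu] is again a module
    transformation from [Y] to [Y']. *)
Lemma bim_span (X' : modfun N N) (Y' : modfun M M) (z : modnat (bim X Y) (bim X' Y')) :
  exists L : seq (modnat X X' * modnat Y Y')%type,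
    (z : @hom k E (bim X Y) (bim X' Y')) = \sum_(u <- L) (bim_nat u.1 u.2 : @hom k E (bim X Y) (bim X' Y')).
Proof.
pose sg (H : A) : hom (X ((H : modfun M N) P)) (X' ((H : modfun M N) (Y' mu))) :=
  locked_with act_key (endo_at z H mu ∘ fhom X (fhom (H : modfun M N) u0)).
have sgE H : sg H = endo_at z H mu ∘ fhom X (fhom (H : modfun M N) u0) by rewrite /sg unlock.
have s1 (H H' : A) (f : hom H H') : sg H' ∘ fhom X (nat_at f P) = fhom X' (nat_at f (Y' mu)) ∘ sg H.
  have e := endo_ntH z f mu; rewrite !sgE.
  have n1 : nat_at f (Y mu) ∘ fhom (H : modfun M N) u0 = fhom (H' : modfun M N) u0 ∘ nat_at f P.
    exact: nt_natural.
  rewrite -compA -fhomM -n1 fhomM compA; apply: esym; rewrite compA; congr (_ ∘ _).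
  exact: esym e.
have s2 (y : center C) (H : A) : mstr X' (cob y) ((H : modfun M N) (Y' mu)) ∘ sg (fun_act y H) =
    (idm (cob y) ▷' sg H) ∘ mstr X (cob y) ((H : modfun M N) P).
  have e := endo_modZ z y H mu; rewrite !sgE ahomMl -[RHS]compA -mstr_nat.
  rewrite [RHS]compA compA; congr (_ ∘ _); exact: e.
have [m mE] : exists m : modnat (post_eval X P : modfun FM (center_res N)) (post_eval X' (Y' mu)),
    forall H, m H = sg H.
  unshelve eexists (@Modnat k (center C) FM (center_res N) (post_eval X P) (post_eval X' (Y' mu)) sg _ _) => //.
  by move=> y H; rewrite !post_eval_str; exact: s2.
have [L LE] := dec m.
have [be beE] := dep_choice (fun u : hom P (Y' mu) * modnat X X' => free_ex1 yM u.1).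
exists [seq (u.2, be u) | u <- L]; rewrite big_map.
apply: (bim_free_ext yN) => H; rewrite -sgE -mE LE.
rewrite (lin_sum (@endo_at_lin k C M N _ _ H mu)) comp_suml; apply: eq_bigr => u _.
by rewrite bim_natE -[RHS]compA nt_natural compA -!fhomM beE.
Qed.

End Span.

Section Independence.
Variables (k : closedFieldType) (C : monoidal k) (M N : modcat C).
Hypotheses (tC : finite_tensor C) (mN : is_module_category N).
Let rC : rigid C. Proof. by case: tC => -[]. Qed.
Let abC : abelian_category C. Proof. by case: tC => -[[]]. Qed.

(** Independent maps out of the simple unit assemble into a mono from a sum of copies of the unit,
    and acting on [t] preserves monos. *)
Lemma unit_joint_mono (h : C) (n : nat) (b : 'I_n -> hom (tunit : C) h) (a t : N)
    (g : 'I_n -> hom a (tunit ▷ t)) : independent b ->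
  \sum_l (b l ▷' idm t) ∘ g l = 0 -> forall l, g l = 0.
Proof.
move=> ib e; have [S [i [p bs]]] := bigsum_ex abC (fun _ : 'I_n => tunit : C).
pose m := \sum_l b l ∘ p l.
have mm : mono m.
  apply/monoP => w c; rewrite /m comp_suml => mc.
  have pc l : p l ∘ c = 0.
    apply: (simple_joint_mono (c := fun l => p l ∘ c) abC (unit_simple tC) (unit_scalar tC) ib).
    by rewrite -[RHS]mc; apply: eq_bigr => j _; rewrite compA.
  case: bs => _ [_ bs]; rewrite -[c]comp1m -bs comp_suml big1 // => l _.
  by rewrite -compA pc comp0r.
case: mN => _ _ rN.
have {}e : \sum_l (i l ▷' idm t) ∘ g l = 0.
  apply: (exact_mono abC (rN t) mm); rewrite comp0r comp_sumr -[RHS]e.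
  apply: eq_bigr => l _; rewrite compA -ahomMr; congr ((_ ▷' _) ∘ _).
  exact: bigsum_in.
move=> l; have := congr1 (fun f => (p l ▷' idm t) ∘ f) e; rewrite comp0r comp_sumr.
rewrite (bigD1 l) //= big1 ?addr0 => [|j jl]; case: bs => o [d _].
  by rewrite compA -ahomMr d ahom1 comp1m.
by rewrite compA -ahomMr o 1?eq_sym // ahom0l comp0l.
Qed.

Variables (IM : ihoms M).
Variables (mu P : M) (t w : N) (X : modfun N N) (Y : modfun M M).
Variables (uX : hom w (X t)) (uY : hom P (Y mu)).
Hypotheses (xF : is_free N uX) (yF : is_free M uY).
Let FM := fun_modcat M N.
Let E := modfun_cat FM FM.
Let XN := @hom k (modfun_cat N N) X (modfun_id N).
Let YM := @hom k (modfun_cat M M) Y (modfun_id M).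

(** A relation is tested on one well-chosen functor H. There the maps [b l] turn into independent
    elements of the internal Hom from [P] to [mu], and simplicity of the unit forces the
    coefficients [g l] to vanish on the generator of [X]. *)
Lemma bim_independent (n : nat) (b : 'I_n -> YM) (g : 'I_n -> XN) : independent b ->
  \sum_l (bim_to1 (g l : modnat _ _) (b l : modnat _ _) : @hom k E (bim X Y) (modfun_id FM)) = 0 ->
  forall l, g l = 0.
Proof.
move=> ib e l; apply: modnatP; apply: (free_ext1 xF).
pose b0 i : hom P mu := (b i : modnat _ _) mu ∘ uY.
pose bh i : hom (tunit : C) (ih IM P mu) := fhom (ihom_mod (@ihP k C M IM P) rC) (b0 i) ∘ tr (@ihP k C M IM P) (aunit P).
have bhE i : ih_ev IM P mu ∘ (bh i ▷' idm P) = b0 i ∘ aunit P.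
  by rewrite /bh ahomMr compA ihom_fhomE -compA trE.
have ibh : independent bh.
  move=> c ce; apply: ib; apply: modnatP; apply: (free_ext1 yF).
  rewrite -[LHS]/(nat_at _ mu ∘ uY) (lin_sum (@nat_at_lin k C M M _ _ mu)) comp_suml comp0l.
  apply: (@etrans _ _ (\sum_i c i *: b0 i : hom P mu)).
    change (\sum_i (nat_at (c i *: b i) mu ∘ uY : hom P mu) = \sum_i c i *: b0 i); apply: eq_bigr => i _.
    by rewrite [X in X ∘ _](linZ (@nat_at_lin k C M M Y (modfun_id M) mu)) compZl.
  apply: (iso_epic (aunit P)); rewrite comp0l comp_suml.
  have -> : \sum_i (c i *: b0 i) ∘ aunit P = ih_ev IM P mu ∘ ((\sum_i c i *: bh i) ▷' idm P).
    by rewrite ahom_suml comp_sumr; apply: eq_bigr => i _; rewrite ahomZl compZr compZl bhE.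
  by rewrite ce ahom0l comp0r.
(* H is the free functor Hom(P, -) ▷ t, for which H applied to [b0 i] on the generator is the
   element [bh i] acting on [t]. *)
have [H [ph [jj HE]]] : exists (H : modfun M N) (ph : hom t (H P)) (jj : hom (H mu) (ih IM P mu ▷ t)),
    forall i, jj ∘ fhom H (b0 i) ∘ ph = (bh i ▷' idm t) ∘ bwd (aunit t).
  exists (free_mod rC IM P t), (free_unit rC IM P t), (idm _) => i.
  by rewrite comp1m /bh ahomMr /free_unit /ihom_unit [LHS]compA.
have eH : \sum_i fhom H (b0 i) ∘ (g i : modnat _ _) (H P) = 0.
  have := congr1 (fun z : @hom k E (bim X Y) (modfun_id FM) => endo_at z H mu ∘ fhom X (fhom H uY)) e.
  rewrite (lin_sum (@endo_at_lin k C M N _ _ H mu)) (lin0 (@endo_at_lin k C M N _ _ H mu)) comp0l comp_suml => e'.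
  apply: etrans e'; apply: eq_bigr => i _; rewrite bim_to1E -[RHS]compA.
  rewrite (nt_natural (g i : modnat _ _)) [fhom (modfun_id N) _]/= compA; congr (_ ∘ _).
  exact: (fhomM H).
have eg : \sum_i (bh i ▷' idm t) ∘ (bwd (aunit t) ∘ ((g i : modnat _ _) t ∘ uX)) = 0.
  have := congr1 (fun z => jj ∘ (z ∘ fhom X ph ∘ uX)) eH.
  rewrite !comp0l comp0r !comp_suml comp_sumr => e'; apply: etrans e'; apply: eq_bigr => i _.
  rewrite -(compA (fhom _ _)) (nt_natural (g i : modnat _ _)) [fhom (modfun_id N) _]/=.
  by rewrite !compA HE.
have g0 := unit_joint_mono ibh eg l.
rewrite [RHS]comp0l; apply: (iso_monic (iso_inv (aunit t))).
by rewrite [LHS]g0 comp0r.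
Qed.

End Independence.

Section BilinearFunctional.
Variables (k : fieldType) (U V W : lmodType k) (B : U -> V -> W).
Hypotheses (Bl : forall v, linear (B^~ v)) (Br : forall u, linear (B u)).
Hypotheses (fdU : finite_dimensional U) (fdV : finite_dimensional V) (fdW : finite_dimensional W).
Hypothesis Bi : forall n (b : 'I_n -> V) (g : 'I_n -> U), independent b ->
  \sum_l B (g l) (b l) = 0 -> forall l, g l = 0.

Lemma fd_matrix r q : finite_dimensional 'M[k]_(r, q).
Proof.
apply: (@fd_inj k 'M[k]_(r, q) 'rV[k]_(r * q) mxvec).
- by move=> a u v; rewrite linearP.
- exact: (can_inj mxvecK).
- by exists (r * q)%N, (fun i => delta_mx 0 i) => u; exists (fun i => u 0 i); apply: row_sum_delta.
Qed.

Lemma coord_independent n (b : 'I_n -> V) (c : 'I_n -> V -> k) :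
  (forall i, functional (c i)) -> (forall i j, c i (b j) = (i == j)%:R) -> independent b.
Proof.
move=> fc cb d e i; have := congr1 (c i) e; rewrite functional_sum // functional0 //.
by rewrite (bigD1 i) //= cb eqxx mulr1 big1 ?addr0 // => j ji; rewrite cb eq_sym (negbTE ji) mulr0.
Qed.

(** The hypothesis [Bi] says that [B] embeds the tensor product of [U] and [V] into [W]. With that
    tensor product coded as matrices over bases, the functional given by [phi] and [psi] vanishes on
    the kernel, which is zero, and so factors through [W]. *)
Lemma bilinear_functional (phi : U -> k) (psi : V -> k) : functional phi -> functional psi ->
  exists chi, functional chi /\ forall u v, chi (B u v) = phi u * psi v.
Proof.
move=> fphi fpsi; have [r [a [c [fc cE ca]]]] := fd_coord fdU.
have [q [b [d [fd dE db]]]] := fd_coord fdV.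
have ib := coord_independent fd db.
pose D (A : 'M[k]_(r, q)) := \sum_l B (\sum_i A i l *: a i) (b l).
pose f0 (A : 'M[k]_(r, q)) := \sum_l phi (\sum_i A i l *: a i) * psi (b l).
have sumE (A A' : 'M[k]_(r, q)) x l : \sum_i (x *: A + A') i l *: a i =
    x *: (\sum_i A i l *: a i) + \sum_i A' i l *: a i.
  rewrite scaler_sumr -big_split /=; apply: eq_bigr => i _.
  by rewrite !mxE scalerDl scalerA.
have lD : linear D.
  move=> x A A'; rewrite /D scaler_sumr -big_split /=; apply: eq_bigr => l _.
  by rewrite sumE Bl.
have lf : functional f0.
  move=> x A A'; rewrite /f0 mulr_sumr -big_split /=; apply: eq_bigr => l _.
  by rewrite sumE fphi mulrDl mulrA.
have [A DA|chi [fchi chiE]] := functional_factor (fd_matrix r q) fdW lD lf.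
  by rewrite /f0 big1 // => l _; rewrite (Bi ib DA) functional0 // mul0r.
exists chi; split=> // u v.
pose A := \matrix_(i < r, l < q) (d l v * c i u).
have AE l : \sum_i A i l *: a i = d l v *: u.
  rewrite [in RHS](cE u) scaler_sumr; apply: eq_bigr => i _.
  by rewrite mxE scalerA.
have -> : B u v = D A.
  rewrite [in LHS](dE v) (lin_sum (Br u)); apply: eq_bigr => l _.
  by rewrite AE (linZ (Br u)) (linZ (Bl (b l))).
rewrite chiE /f0 [in RHS](dE v) functional_sum // mulr_sumr; apply: eq_bigr => l _.
rewrite AE; have := fphi (d l v) u 0; rewrite addr0 functional0 // addr0 => ->.
by rewrite mulrCA mulrA.
Qed.

End BilinearFunctional.

Section Tensor.
Variables (k : closedFieldType) (C : monoidal k) (M N : modcat C).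
Hypotheses (tC : finite_tensor C) (mN : is_module_category N) (IM : ihoms M).
Variables (mu P : M) (t w : N) (X : modfun N N) (Y : modfun M M).
Variables (uX : hom w (X t)) (uY : hom P (Y mu)).
Hypotheses (xF : is_free N uX) (yM : is_free M uY) (yN : is_free N uY).
Hypothesis dec : forall (X' : modfun N N) (x : M) (sg : modnat (post_eval X P) (post_eval X' x)),
  decomposes (fun H : modfun M N => sg H : hom (X (H P)) (X' (H x))).
Let FM := fun_modcat M N.
Let E := modfun_cat FM FM.
Let XN := @hom k (modfun_cat N N) X (modfun_id N).
Let YM := @hom k (modfun_cat M M) Y (modfun_id M).
Let XY := @hom k E (bim X Y) (modfun_id FM).

Lemma bim_to1_span (z : XY) : exists L : seq (XN * YM)%type,
  z = \sum_(u <- L) (bim_to1 (u.1 : modnat _ _) (u.2 : modnat _ _) : XY).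
Proof.
have [L LE] := bim_span yN yM dec (modnat_comp (bim_unit_inv M N) (z : modnat _ _)).
exists L; rewrite -[z]comp1m.
have -> : idm (modfun_id FM : E) = (bim_unit M N : @hom k E _ _) ∘ bim_unit_inv M N.
  by apply: endo_atP => H m; rewrite /endo_at /nat_at /= comp1m.
rewrite -compA [X in _ ∘ X]LE comp_sumr; apply: eq_bigr => u _.
by [].
Qed.

Lemma tensor_ext (chi chi' : XY -> k) : functional chi -> functional chi' ->
  (forall a b, chi (bim_to1 a b) = chi' (bim_to1 a b)) -> chi = chi'.
Proof.
move=> f f' e; apply: funext => z; have [L ->] := bim_to1_span z.
have s (h : XY -> k) : functional h -> h (\sum_(u <- L) (bim_to1 (u.1 : modnat _ _) (u.2 : modnat _ _) : XY)) =
    \sum_(u <- L) h (bim_to1 (u.1 : modnat _ _) (u.2 : modnat _ _)).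
  move=> fh; have := functional_sum L (fun => 1) (fun u : XN * YM => (bim_to1 (u.1 : modnat _ _) (u.2 : modnat _ _) : XY)) fh.
  under eq_bigr do rewrite scale1r; move=> ->; apply: eq_bigr => u _; exact: mul1r.
by rewrite !s //; apply: eq_bigr.
Qed.

Hypotheses (fX : finite_dimensional XN) (fY : finite_dimensional YM) (fXY : finite_dimensional XY).

Lemma tensor_ex (phi : XN -> k) (psi : YM -> k) : functional phi -> functional psi ->
  exists chi : XY -> k, functional chi /\ forall (a : XN) (b : YM),
    chi (bim_to1 (a : modnat _ _) (b : modnat _ _)) = phi a * psi b.
Proof.
move=> fphi fpsi.
apply: (@bilinear_functional k XN YM XY (fun a b => bim_to1 (a : modnat _ _) (b : modnat _ _))) => //.
- by move=> v; apply: bim_to1_linearl.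
- by move=> u; apply: bim_to1_linearr.
- by move=> n b g; apply: (bim_independent tC mN IM xF yM).
Qed.

End Tensor.


(** * Ends as universal families indexed by functionals *)

Section FunctionalWedges.
Variables (k : fieldType) (D : category k) (one : D).

(** Maps [T -> Hom(p i, one) ⊗ p i] are presented as maps [T -> p i] depending linearly on a
    functional on [Hom(p i, one)]; on non-functionals the values are junk. *)
Definition fwedge (I : Type) (p : I -> D) (T : D) (tau : forall i, (hom (p i) one -> k) -> hom T (p i)) : Prop :=
  (forall i a phi psi, functional phi -> functional psi ->
     tau i (fun g => a * phi g + psi g) = a *: tau i phi + tau i psi) /\
  (forall i j (f : hom (p i) (p j)) phi, functional phi ->
     f ∘ tau i phi = tau j (fun g => phi (g ∘ f))).

Definition funiv (I : Type) (p : I -> D) (T : D) (tau : forall i, (hom (p i) one -> k) -> hom T (p i)) : Prop :=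
  fwedge tau /\ forall S (sg : forall i, (hom (p i) one -> k) -> hom S (p i)), fwedge sg ->
    exists! u : hom S T, forall i phi, functional phi -> tau i phi ∘ u = sg i phi.

Lemma functional_precomp x y (f : hom x y) (phi : hom x one -> k) :
  functional phi -> functional (fun g : hom y one => phi (g ∘ f)).
Proof. by move=> fp a u v; rewrite compDl compZl fp. Qed.

Hypotheses (abD : abelian_category D) (fdD : fd_homs D).
Variables (I : Type) (p : I -> D).
Hypothesis cov : forall y, exists i (e : hom (p i) y), epi e.

Lemma functional_along x y (e : hom x y) (phi : hom y one -> k) : epi e -> functional phi ->
  exists psi : hom x one -> k, functional psi /\ forall g, psi (g ∘ e) = phi g.
Proof.
move=> ee fp; apply: (functional_factor (D := fun g => g ∘ e)) => //.
  exact: comp_linearl.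
by move=> v /(proj1 (epiP e) ee) ->; apply: functional0.
Qed.

(** Let w be the epi from the sum of [p i] and [p j] onto [y] given by [c] and [e]. By hypothesis
    [rho] and [phi] have a difference that vanishes on maps factoring through w, so it comes from a
    functional on the maps out of some [p l] covering the kernel of w. By naturality the difference
    of the two sides is then w composed with its own kernel. *)
Lemma fwedge_key T (sg : forall i, (hom (p i) one -> k) -> hom T (p i)) y i j
    (c : hom (p i) y) (e : hom (p j) y) rho phi : fwedge sg -> epi e ->
  functional rho -> functional phi -> (forall g, rho (g ∘ c) = phi (g ∘ e)) ->
  c ∘ sg i rho = e ∘ sg j phi.
Proof.
move=> [sl sn] ee fr fp E; have [_ bi _ _ _] := abD.
have [s [i1 [i2 [p1 [p2 [b1 b2 b3 b4 b5]]]]]] := bi (p i) (p j).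
pose w := c ∘ p1 + e ∘ p2.
have w1 : w ∘ i1 = c by rewrite compDl -!compA b1 b4 compm1 comp0r addr0.
have w2 : w ∘ i2 = e by rewrite compDl -!compA b2 b3 compm1 comp0r add0r.
have ew : epi w by apply: (epi_cancel (f := i2)); rewrite w2.
have [K [ka kK]] := kernel_ex abD w; have [l [d ed]] := cov K.
have ck := epi_cokernel_kernel abD ew kK.
have [||h hd|psi [fpsi psiE]] := functional_factor (V := hom s one) (W := hom (p l) one)
   (D := fun h => h ∘ (ka ∘ d)) (phi := fun h => rho (h ∘ i1) - phi (h ∘ i2)) (fdD _ _) (fdD _ _).
- exact: comp_linearl.
- by move=> a u v; rewrite !compDl !compZl fr fp mulrBr opprD addrACA.
- have [|g <-] := cokernel_desc (g := h) ck.
    by apply: ed; rewrite comp0l -compA.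
  by rewrite -!compA w1 w2 E subrr.
have rE : rho = fun g => psi (g ∘ (p1 ∘ (ka ∘ d))).
  apply: funext => g; rewrite compA psiE -!compA b1 b3 compm1 comp0r functional0 //.
  by rewrite subr0.
have pE : phi = fun g => - 1 * psi (g ∘ (p2 ∘ (ka ∘ d))) + 0.
  apply: funext => g; rewrite compA psiE -!compA b2 b4 compm1 comp0r functional0 //.
  by rewrite add0r addr0 mulN1r opprK.
have f0 : functional (fun _ : hom (p j) one => 0 : k) by move=> *; rewrite mulr0 addr0.
have sg0 : sg j (fun=> 0) = 0.
  have := sl j (-1) _ _ f0 f0; under [X in sg j X]funext do rewrite mulr0 addr0.
  by rewrite scaleN1r addNr.
rewrite [in LHS]rE -sn // pE sl //; last exact: functional_precomp.
rewrite sg0 addr0 -sn // scaleN1r compNr !compA -[RHS]opprK opprK.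
apply/eqP; rewrite -subr_eq0 opprK -!compDl -/w.
by rewrite (proj1 kK) !comp0l.
Qed.

(** The value at [y] is defined by choosing a cover [p i -> y] and an extension of the functional
    along it; [fwedge_key] makes the result independent of both choices. Consequently the end over
    the covering family agrees with the end over all objects. *)
Lemma fwedge_extend T (sg : forall i, (hom (p i) one -> k) -> hom T (p i)) : fwedge sg ->
  exists sg' : forall y, (hom y one -> k) -> hom T y, fwedge (p := id) sg' /\
    forall i y (c : hom (p i) y) rho, functional rho ->
      sg' y (fun g => rho (g ∘ c)) = c ∘ sg i rho.
Proof.
move=> fs; have ex (a : {y : D & hom y one -> k}) : exists m : hom T (tag a),
    functional (tagged a) -> forall i (c : hom (p i) (tag a)) rho, functional rho ->
      (forall g, rho (g ∘ c) = tagged a g) -> m = c ∘ sg i rho.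
  case: a => y phi /=; have [fp|np] := pselect (functional phi); last by exists 0.
  have [j [e ee]] := cov y; have [psi [fpsi psiE]] := functional_along ee fp.
  exists (e ∘ sg j psi) => _ i c rho fr rE; apply: esym; apply: fwedge_key => // g.
  by rewrite rE psiE.
have [m mE] := dep_choice ex.
pose sg' y phi := m (existT _ y phi).
have sE y phi : functional phi -> forall i (c : hom (p i) y) rho, functional rho ->
    (forall g, rho (g ∘ c) = phi g) -> sg' y phi = c ∘ sg i rho.
  by move=> fp i c rho; apply: (mE (existT _ y phi)).
have sE' i y (c : hom (p i) y) rho : functional rho -> sg' y (fun g => rho (g ∘ c)) = c ∘ sg i rho.
  by move=> fr; apply: sE => //; apply: functional_precomp.
exists sg'; split=> //; split.
- move=> y a phi psi fp fs'; have [j [e ee]] := cov y.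
  have [phi1 [f1 e1]] := functional_along ee fp; have [psi1 [f2 e2]] := functional_along ee fs'.
  rewrite (sE _ _ fp _ e phi1) // (sE _ _ fs' _ e psi1) // -compZr -compDr -(proj1 fs) //.
  apply: sE => [b u v||g]; last by rewrite e1 e2.
  + by rewrite fp fs' !mulrDr !mulrA [b * a]mulrC addrACA.
  + by move=> b u v; rewrite f1 f2 !mulrDr !mulrA [b * a]mulrC addrACA.
- move=> x y f phi fp; have [j [e ee]] := cov x.
  have [phi1 [f1 e1]] := functional_along ee fp.
  rewrite (sE _ _ fp _ e phi1) // compA; apply: esym; apply: sE => // [|g].
    exact: functional_precomp.
  by rewrite compA e1.
Qed.

Lemma fwedge_restrict T (tau : forall y, (hom y one -> k) -> hom T y) :
  fwedge (p := id) tau -> fwedge (fun i => tau (p i)).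
Proof. by move=> [tl tn]; split=> *; [apply: tl | apply: tn]. Qed.

Lemma precomp_id i (phi : hom (p i) one -> k) : (fun g => phi (g ∘ idm _)) = phi.
Proof. by apply: funext => g; rewrite compm1. Qed.

Lemma funiv_restrict T (tau : forall y, (hom y one -> k) -> hom T y) :
  funiv (p := id) tau -> funiv (fun i => tau (p i)).
Proof.
move=> [tw tu]; split; first exact: fwedge_restrict.
move=> S sg ws; have [sg' [ws' sE]] := fwedge_extend ws; have [u [uE uU]] := tu S sg' ws'.
exists u; split.
  move=> i phi fp; rewrite uE // -[phi in LHS]precomp_id (sE _ _ (idm _)) // comp1m.
  by [].
move=> v vE; apply: uU => y phi fp; have [j [e ee]] := cov y.
have [psi [fpsi psiE]] := functional_along ee fp.
have -> : phi = fun g => psi (g ∘ e) by apply: funext.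
by rewrite sE // -(proj2 tw) // -compA vE.
Qed.

Lemma funiv_extend T (tau : forall i, (hom (p i) one -> k) -> hom T (p i)) :
  funiv tau -> exists tau' : forall y, (hom y one -> k) -> hom T y, funiv (p := id) tau'.
Proof.
move=> [tw tu]; have [tau' [wt tE]] := fwedge_extend tw; exists tau'; split=> // S sg ws.
have [u [uE uU]] := tu S _ (fwedge_restrict ws); exists u; split.
  move=> y phi fp; have [j [e ee]] := cov y.
  have [psi [fpsi psiE]] := functional_along ee fp.
  have -> : phi = fun g => psi (g ∘ e) by apply: funext.
  by rewrite tE // -compA uE // (proj2 ws).
move=> v vE; apply: uU => i phi fp.
by rewrite -vE // -[phi in RHS]precomp_id (tE _ _ (idm _)) // comp1m.
Qed.

End FunctionalWedges.

Section CopowerFunctionals.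
Variables (k : fieldType) (A : category k) (V : lmodType k) (y : A) (Q : copower V y).

Lemma cp_eval_ex : exists ev : (V -> k) -> hom (cp_ob Q) y,
  forall phi, functional phi -> forall v, ev phi ∘ cp_in Q v = phi v *: idm y.
Proof.
have ex (phi : V -> k) : exists e : hom (cp_ob Q) y,
    functional phi -> forall v, e ∘ cp_in Q v = phi v *: idm y.
  have [fp|np] := pselect (functional phi); last by exists 0.
  have lp : linear (fun v => phi v *: idm y).
    by move=> a u v; rewrite fp scalerDl scalerA.
  by exists (cp_desc Q lp) => _ v; rewrite cp_descE.
by have [ev evE] := dep_choice ex; exists ev => phi fp; apply: evE.
Qed.

(** The map from V ⊗ y to y given by a functional on [V]; for [V] finite-dimensional these maps are
    jointly mono and turn wedges into families indexed by functionals. *)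
Definition cp_eval : (V -> k) -> hom (cp_ob Q) y := projT1 (cid cp_eval_ex).

Lemma cp_evalE phi : functional phi -> forall v, cp_eval phi ∘ cp_in Q v = phi v *: idm y.
Proof. by rewrite /cp_eval; case: cid => ev /= evE; apply: evE. Qed.

Lemma family_sum x (tau : (V -> k) -> hom x y) (I : Type) (r : seq I) (a : I -> k) (c : I -> V -> k) :
  (forall b phi psi, functional phi -> functional psi ->
     tau (fun v => b * phi v + psi v) = b *: tau phi + tau psi) ->
  (forall i, functional (c i)) ->
  tau (fun v => \sum_(i <- r) a i * c i v) = \sum_(i <- r) a i *: tau (c i).
Proof.
move=> tl fc; have f0 : functional (fun _ : V => 0 : k) by move=> *; rewrite mulr0 addr0.
have t0 : tau (fun=> 0) = 0.
  have := tl (-1) _ _ f0 f0; under [X in tau X]funext do rewrite mulr0 addr0.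
  by rewrite scaleN1r addNr.
suff s : functional (fun v => \sum_(i <- r) a i * c i v) /\
   tau (fun v => \sum_(i <- r) a i * c i v) = \sum_(i <- r) a i *: tau (c i) by case: s.
elim: r => [|i r [fr IH]].
  by under [X in functional X]funext do rewrite big_nil; under [X in tau X]funext do rewrite big_nil; rewrite big_nil.
under [X in functional X]funext do rewrite big_cons; under [X in tau X]funext do rewrite big_cons.
rewrite big_cons -IH -tl //; split=> // b u v.
by rewrite fr fc !mulrDr !mulrA [a i * b]mulrC addrACA.
Qed.

Hypothesis fdV : finite_dimensional V.

Lemma cp_eval_joint x (f g : hom x (cp_ob Q)) :
  (forall phi, functional phi -> cp_eval phi ∘ f = cp_eval phi ∘ g) -> f = g.
Proof.
move=> e; have [n [b [c [fc cE _]]]] := fd_coord fdV.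
have id1 : \sum_i cp_in Q (b i) ∘ cp_eval (c i) = idm _.
  apply: cp_ext => v; rewrite comp1m comp_suml.
  rewrite [in RHS](cE v) (lin_sum (@cp_in_linear _ _ _ _ Q)); apply: eq_bigr => i _.
  by rewrite -compA cp_evalE // compZr compm1 (linZ (@cp_in_linear _ _ _ _ Q)).
rewrite -[f]comp1m -[g]comp1m -id1 !comp_suml; apply: eq_bigr => i _.
by rewrite -!compA e.
Qed.

Lemma cp_family x (tau : (V -> k) -> hom x y) :
  (forall b phi psi, functional phi -> functional psi ->
     tau (fun v => b * phi v + psi v) = b *: tau phi + tau psi) ->
  exists f : hom x (cp_ob Q), forall phi, functional phi -> cp_eval phi ∘ f = tau phi.
Proof.
move=> tl; have [n [b [c [fc cE _]]]] := fd_coord fdV.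
exists (\sum_i cp_in Q (b i) ∘ tau (c i)) => phi fp.
have pE : phi = fun v => \sum_i phi (b i) * c i v.
  apply: funext => v; rewrite [in LHS](cE v) functional_sum //.
  by apply: eq_bigr => i _; rewrite mulrC.
rewrite [in RHS]pE (family_sum (tau := tau)) // comp_sumr; apply: eq_bigr => i _.
by rewrite compA cp_evalE // compZl comp1m.
Qed.

End CopowerFunctionals.

Section Distinguished.
Variables (k : fieldType) (A : monoidal k).
Hypotheses (abA : abelian_category A) (fdA : fd_homs A).

Lemma cp_eval_map (V W : lmodType k) (y z : A) (P : copower V y) (Q : copower W z)
    (f : V -> W) (lf : linear f) (g : hom y z) (phi : W -> k) : functional phi ->
  cp_eval Q phi ∘ cp_map P Q lf g = g ∘ cp_eval P (fun v => phi (f v)).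
Proof.
move=> fp; apply: (cp_ext (c := P)) => v; rewrite -!compA cp_descE compA cp_evalE //.
rewrite cp_evalE => [|a u w]; last by rewrite lf fp.
by rewrite compZl comp1m compZr compm1.
Qed.

Lemma wedgeP (T : forall x y : A, copower (hom x tunit) y) (S : A) (pi : forall y, hom S (cp_ob (T y y))) :
  wedge pi <-> fwedge (one := tunit) (p := id) (fun y phi => cp_eval (T y y) phi ∘ pi y).
Proof.
split=> [w|[_ wn] x y f].
  split=> [y a phi psi fp fs|x y f phi fp].
    rewrite -compZl -compDl; congr (_ ∘ _); apply: cp_ext => v.
    rewrite compDl compZl !cp_evalE // ?scalerDl ?scalerA // => b u u'.
    by rewrite fp fs !mulrDr !mulrA [b * a]mulrC addrACA.
  have fid : functional (fun v : hom x tunit => phi v) by [].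
  have := congr1 (fun h => cp_eval (T x y) phi ∘ h) (w x y f).
  by rewrite !compA !cp_eval_map // comp1m.
apply: (cp_eval_joint (Q := T x y)) => // phi fp.
by rewrite !compA !cp_eval_map // comp1m -compA; exact: wn.
Qed.

Lemma distinguished_funiv (D : A) : is_distinguished D ->
  exists tau : forall y, (hom y tunit -> k) -> hom D y, funiv (p := id) tau.
Proof.
move=> [T [pi [w u]]]; exists (fun y phi => cp_eval (T y y) phi ∘ pi y).
split; first exact/wedgeP.
move=> S sg ws.
have [rho rhoE] := dep_choice (fun y => cp_family (T y y) (fdA _ _) (proj1 ws y)).
have wr : wedge rho.
  apply/wedgeP; split=> [y a phi psi fp fs|x y f phi fp].
    have fc : functional (fun v => a * phi v + psi v).
      by move=> b v v'; rewrite fp fs !mulrDr !mulrA [b * a]mulrC addrACA.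
    by rewrite !rhoE // (proj1 ws).
  by rewrite !rhoE // ?(proj2 ws) //; apply: functional_precomp.
have [v [vE vU]] := u S rho wr; exists v; split.
  by move=> y phi fp; rewrite -compA vE rhoE.
move=> v' v'E; apply: vU => y; apply: (cp_eval_joint (Q := T y y)) => // phi fp.
by rewrite compA v'E // rhoE.
Qed.

Lemma funiv_distinguished (D : A) (tau : forall y, (hom y tunit -> k) -> hom D y) :
  funiv (p := id) tau -> is_distinguished D.
Proof.
move=> [wt u]; have Tex (a : A * A) : exists T : copower (hom a.1 tunit) a.2, True.
  by have [Q] := copower_ex abA a.2 (fdA a.1 tunit); exists Q.
have [T0 _] := dep_choice Tex; pose T x y : copower (hom x tunit) y := T0 (x, y).
have [pi piE] := dep_choice (fun y => cp_family (T y y) (fdA _ _) (proj1 wt y)).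
exists T, pi; split.
  apply/wedgeP; split=> [y a phi psi fp fs|x y f phi fp].
    have fc : functional (fun v => a * phi v + psi v).
      by move=> b v v'; rewrite fp fs !mulrDr !mulrA [b * a]mulrC addrACA.
    by rewrite !piE // (proj1 wt).
  by rewrite !piE // ?(proj2 wt) //; apply: functional_precomp.
move=> S rho /wedgeP wr; have [v [vE vU]] := u S _ wr; exists v; split.
  move=> y; apply: (cp_eval_joint (Q := T y y)) => // phi fp.
  by rewrite compA piE // vE.
move=> v' v'E; apply: vU => y phi fp.
by rewrite -(piE y phi fp) -v'E compA.
Qed.

Lemma funiv_iso (D D' : A) (i : iso D' D) (tau : forall y, (hom y tunit -> k) -> hom D y) :
  funiv (p := id) tau -> funiv (p := id) (fun y phi => tau y phi ∘ i).
Proof.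
move=> [[wl wn] u]; split.
  split=> [y a phi psi fp fs|x y f phi fp].
    by rewrite wl // compDl compZl.
  by rewrite compA wn.
move=> S sg ws; have [v [vE vU]] := u S sg ws; exists (bwd i ∘ v); split.
  by move=> y phi fp; rewrite !compA isoK vE.
move=> v' v'E; have -> : v = i ∘ v'.
  by apply: vU => y phi fp; rewrite compA v'E.
by rewrite compA fwdK comp1m.
Qed.

End Distinguished.

(** * The product of two universal wedges *)

Section Pointwise.
Variables (k : fieldType) (C : monoidal k) (M : modcat C) (B : category k).
Variables (I : Type) (Y : I -> modfun M M).
Let D := modfun_cat M M.
Let one : D := modfun_id M.
Variable eta : forall i, (@hom k D (Y i) one -> k) -> @hom k D one (Y i).
Hypothesis univ : funiv (D := D) (one := one) (p := Y) eta.
Hypothesis free : forall (x c : M), exists (Q : modfun M M) (u : hom c (Q x)), is_free M u.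

Definition eta_at i (phi : @hom k D (Y i) one -> k) (x : M) : hom x (Y i x) := nat_at (@eta i phi) x.

(** [H] need not be a module functor: it only has to admit a left adjoint. *)
Variables (H : functor M B) (w : B).
Hypothesis corep : exists (c : M) (u : hom w (H c)),
  forall m (f : hom w (H m)), exists! g : hom c m, fhom H g ∘ u = f.

(** A family of maps from [w] to the H(Y i x) is a family from [c] to the Y i x by
    corepresentability, and a wedge from the functor [Q] free on [c] at [x] by freeness. The
    universal property in the dual category then gives a map from [Q] to the identity, that is, a
    map from [c] to [x]. *)
Lemma pointwise_univ (x : M) (sg : forall i, (@hom k D (Y i) one -> k) -> hom w (H (Y i x))) :
  (forall i a phi psi, functional phi -> functional psi ->
     sg i (fun g => a * phi g + psi g) = a *: sg i phi + sg i psi) ->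
  (forall i j (f : modnat (Y i) (Y j)) phi, functional phi ->
     fhom H (f x) ∘ sg i phi = sg j (fun g : @hom k D (Y j) one => phi (g ∘ (f : @hom k D (Y i) (Y j))))) ->
  exists! u : hom w (H x), forall i phi, functional phi -> fhom H (eta_at phi x) ∘ u = sg i phi.
Proof.
move=> sl sn; have [c [u0 u0P]] := corep; have [Q [q qF]] := free x c.
have [r rP] := dep_choice (fun a : {i : I & @hom k D (Y i) one -> k} =>
  u0P (Y (tag a) x) (sg (tag a) (tagged a))).
pose r' i phi : hom c (Y i x) := r (existT _ i phi).
have r'E i phi : fhom H (r' i phi) ∘ u0 = sg i phi by case: (rP (existT _ i phi)).
have uniq m (g g' : hom c m) : fhom H g ∘ u0 = fhom H g' ∘ u0 -> g = g'.
  by move=> e; have [h [_ hU]] := u0P m (fhom H g' ∘ u0); rewrite -(hU g) // -(hU g').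
clearbody r'.
have [z zP] := dep_choice (fun a : {i : I & @hom k D (Y i) one -> k} =>
  free_ex1 qF (r' (tag a) (tagged a))).
pose z' i phi : @hom k D Q (Y i) := z (existT _ i phi).
have z'E i phi : nat_at (z' i phi) x ∘ q = r' i phi by apply: (zP (existT _ i phi)).
clearbody z'.
have ext (G : modfun M M) (s t : @hom k D Q G) : nat_at s x ∘ q = nat_at t x ∘ q -> s = t.
  by move=> e; apply: nat_atP; apply: (free_ext1 qF).
have wz : fwedge (D := D) (one := one) (p := Y) z'.
  split=> [i a phi psi fp fs|i j f phi fp]; apply: ext.
    rewrite (@nat_at_lin k C M M Q (Y i) x) compDl compZl !z'E; apply: uniq.
    by rewrite fhom_linear compDl compZl !r'E sl.
  rewrite nat_at_comp -compA !z'E; apply: uniq.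
  by rewrite fhomM -compA !r'E; apply: (sn i j f).
have [v [vE vU]] := proj2 univ (Q : D) z' wz.
exists (fhom H (nat_at v x ∘ q) ∘ u0); split.
  move=> i phi fp; rewrite compA -fhomM -r'E; congr (fhom H _ ∘ _).
  rewrite compA; apply: etrans (z'E i phi).
  exact: (congr1 (fun s : @hom k D Q (Y i) => nat_at s x ∘ q) (vE i phi fp)).
move=> u uE; have [g [gE _]] := u0P x u.
have [v' v'E] := free_ex1 qF (G := modfun_id M) g.
have ve : v = (v' : @hom k D Q one).
  apply: vU => i phi fp; apply: ext; rewrite nat_at_comp -compA z'E.
  apply: uniq; rewrite r'E -uE // -gE [RHS]compA -(fhomM H (eta_at phi x) g); congr (fhom H (_ ∘ _) ∘ _).
  exact: v'E.
rewrite -gE; congr (fhom H _ ∘ _); rewrite ve; exact: v'E.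
Qed.

End Pointwise.

Record basis (k : fieldType) (V : lmodType k) := Basis {
  bdim : nat;
  bvec : 'I_bdim -> V;
  bco : 'I_bdim -> V -> k;
  bco_functional : forall i, functional (bco i);
  bcoE : forall v, v = \sum_i bco i v *: bvec i }.

Arguments bvec {k V} b i.
Arguments bco {k V} b i v.

Lemma basis_ex (k : fieldType) (V : lmodType k) : finite_dimensional V -> exists b : basis V, True.
Proof. by move=> /fd_coord [n [b [c [fc cE _]]]]; exists (Basis fc cE). Qed.

Lemma functional_basis (k : fieldType) (V : lmodType k) (b : basis V) (phi : V -> k) :
  functional phi -> phi = fun v => \sum_i phi (bvec b i) * bco b i v.
Proof.
move=> fp; apply: funext => v; rewrite [in LHS](bcoE b v) functional_sum //.
by apply: eq_bigr => i _; rewrite mulrC.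
Qed.

Section Assembly.
Variables (k : fieldType) (C : monoidal k) (M N : modcat C).
Let A := modfun_cat M N.
Let FM := fun_modcat M N.
Let E := modfun_cat FM FM.
Let DN := modfun_cat N N.
Let DM := modfun_cat M M.
Variables (J L : Type) (X : J -> modfun N N) (Y : L -> modfun M M).
Let XN j := @hom k DN (X j) (modfun_id N).
Let YM l := @hom k DM (Y l) (modfun_id M).
Let XY j l := @hom k E (bim (X j) (Y l)) (modfun_id FM).
Let Sp (j j' : J) (l l' : L) := @hom k E (bim (X j) (Y l)) (bim (X j') (Y l')).
Variable etaN : forall j (phi : XN j -> k), @hom k DN (modfun_id N) (X j).
Variable etaM : forall l (psi : YM l -> k), @hom k DM (modfun_id M) (Y l).
Arguments etaN : clear implicits.
Arguments etaM : clear implicits.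
Hypothesis uN : funiv (D := DN) (one := modfun_id N) (p := X) etaN.
Hypothesis uM : funiv (D := DM) (one := modfun_id M) (p := Y) etaM.
Hypothesis freeN : forall a c : N, exists (Q : modfun N N) (u : hom c (Q a)), is_free N u.
Hypothesis freeM : forall a c : M, exists (Q : modfun M M) (u : hom c (Q a)), is_free M u.
Hypothesis corep : forall (H : modfun M N) (w : N), exists (c : M) (u : hom w (H c)),
  forall m (f : hom w (H m)), exists! g : hom c m, fhom H g ∘ u = f.
Hypothesis span : forall j l j' l' (z : Sp j j' l l'),
  exists S : seq (modnat (X j) (X j') * modnat (Y l) (Y l'))%type,
    z = \sum_(u <- S) (bim_nat u.1 u.2 : Sp j j' l l').
Hypothesis text : forall j l (chi chi' : XY j l -> k), functional chi -> functional chi' ->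
  (forall a b, chi (bim_to1 a b) = chi' (bim_to1 a b)) -> chi = chi'.
Hypothesis tens : forall j l (phi : XN j -> k) (psi : YM l -> k), functional phi -> functional psi ->
  exists chi : XY j l -> k, functional chi /\ forall (a : XN j) (b : YM l),
    chi (bim_to1 (a : modnat _ _) (b : modnat _ _)) = phi a * psi b.
Hypotheses (fdX : forall j, finite_dimensional (XN j)) (fdY : forall l, finite_dimensional (YM l)).

Definition etaNM j l (phi : XN j -> k) (psi : YM l -> k) : @hom k E (modfun_id FM) (bim (X j) (Y l)) :=
  locked_with act_key (bim_of1 (etaN j phi : modnat _ _) (etaM l psi : modnat _ _) : @hom k E (modfun_id FM) (bim (X j) (Y l))).
Arguments etaNM : clear implicits.

Definition is_tensor j l (phi : XN j -> k) (psi : YM l -> k) (chi : XY j l -> k) : Prop :=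
  functional chi /\ forall (a : XN j) (b : YM l),
    chi (bim_to1 (a : modnat _ _) (b : modnat _ _)) = phi a * psi b.

Lemma etaNM_at j l phi psi (H : A) m : endo_at (etaNM j l phi psi : modnat _ _) H m =
  (etaN j phi : modnat _ _) ((H : modfun M N) (Y l m)) ∘ fhom (H : modfun M N) ((etaM l psi : modnat _ _) m).
Proof.
rewrite /etaNM unlock bim_of1E; apply: esym.
exact: (nt_natural (etaN j phi : modnat (modfun_id N) (X j)) (fhom (H : modfun M N) ((etaM l psi : modnat _ _) m))).
Qed.

(** Uniqueness in [pointwise_univ] for the identity functor: the components of a universal wedge are
    jointly mono at every object. *)
Lemma sepN (w a : N) (f g : hom w a) :
  (forall j phi, functional phi -> nat_at (etaN j phi) a ∘ f = nat_at (etaN j phi) a ∘ g) -> f = g.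
Proof.
move=> e.
have co : exists (c : N) (u : hom w (functor_id N c)), forall m (h : hom w (functor_id N m)),
    exists! g' : hom c m, fhom (functor_id N) g' ∘ u = h.
  exists w, (idm w) => m h; exists h; split; first exact: compm1.
  by move=> h' <-; rewrite /= compm1.
have [||u [_ uU]] := @pointwise_univ k C N N J X etaN uN freeN (functor_id N) w co a
   (fun j phi => nat_at (etaN j phi) a ∘ g).
- move=> j b phi psi fp fs; rewrite (proj1 (proj1 uN)) //.
  by rewrite (@nat_at_lin k C N N _ _ a) compDl compZl.
- move=> i j f' phi fp; rewrite -(proj2 (proj1 uN) i j f' phi fp) nat_at_comp -compA.
  by [].
transitivity u; last by apply: uU.
by apply: esym; apply: uU => j phi fp; apply: e.
Qed.

Lemma sepM (H : modfun M N) (w : N) (x : M) (f g : hom w (H x)) :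
  (forall l psi, functional psi -> fhom H (nat_at (etaM l psi) x) ∘ f = fhom H (nat_at (etaM l psi) x) ∘ g) -> f = g.
Proof.
move=> e.
have [||u [_ uU]] := @pointwise_univ k C M N L Y etaM uM freeM H w (corep H w) x
   (fun l psi => fhom H (nat_at (etaM l psi) x) ∘ g).
- move=> j b phi psi fp fs; rewrite (proj1 (proj1 uM)) //.
  by rewrite (@nat_at_lin k C M M _ _ x) fhom_linear compDl compZl.
- move=> i j f' phi fp; rewrite -(proj2 (proj1 uM) i j f' phi fp) nat_at_comp fhomM -compA.
  by [].
transitivity u; last by apply: uU.
by apply: esym; apply: uU => j phi fp; apply: e.
Qed.

Lemma sepNM (H : A) (w : N) (x : M) (f g : hom w ((H : modfun M N) x)) :
  (forall j l phi psi, functional phi -> functional psi ->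
    endo_at (etaNM j l phi psi : modnat _ _) H x ∘ f = endo_at (etaNM j l phi psi : modnat _ _) H x ∘ g) -> f = g.
Proof.
move=> e; apply: sepM => l psi fs; apply: sepN => j phi fp.
by have := e j l phi psi fp fs; rewrite !etaNM_at -!compA.
Qed.

Lemma tensor_choice j l (phi : XN j -> k) (psi : YM l -> k) : exists chi : XY j l -> k,
  functional phi -> functional psi -> is_tensor phi psi chi.
Proof.
have [fp|np] := pselect (functional phi); last by exists (fun=> 0).
have [fs|ns] := pselect (functional psi); last by exists (fun=> 0).
by have [chi h] := tens fp fs; exists chi.
Qed.

Definition tensor j l (phi : XN j -> k) (psi : YM l -> k) : XY j l -> k :=
  projT1 (cid (tensor_choice phi psi)).

Lemma tensorP j l (phi : XN j -> k) (psi : YM l -> k) : functional phi -> functional psi ->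
  is_tensor phi psi (tensor phi psi).
Proof. by rewrite /tensor; case: cid. Qed.

Lemma tensor_uniq j l (phi : XN j -> k) (psi : YM l -> k) chi chi' :
  is_tensor phi psi chi -> is_tensor phi psi chi' -> chi = chi'.
Proof. by move=> [f e] [f' e']; apply: text => // a b; rewrite (e a b) (e' a b). Qed.

Lemma functional_lin (V : lmodType k) (phi psi : V -> k) a :
  functional phi -> functional psi -> functional (fun v => a * phi v + psi v).
Proof. by move=> fp fs b u v; rewrite fp fs !mulrDr !mulrA [b * a]mulrC addrACA. Qed.

Lemma tensor_linl j l a (phi phi' : XN j -> k) (psi : YM l -> k) :
  functional phi -> functional phi' -> functional psi ->
  tensor (fun v => a * phi v + phi' v) psi = fun v => a * tensor phi psi v + tensor phi' psi v.
Proof.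
move=> f f' fs; have [h e] := tensorP f fs; have [h' e'] := tensorP f' fs.
apply: tensor_uniq; first by apply: tensorP => //; apply: functional_lin.
split; first exact: functional_lin.
by move=> u v; rewrite e e' mulrDl mulrA.
Qed.

Lemma tensor_linr j l a (phi : XN j -> k) (psi psi' : YM l -> k) :
  functional phi -> functional psi -> functional psi' ->
  tensor phi (fun v => a * psi v + psi' v) = fun v => a * tensor phi psi v + tensor phi psi' v.
Proof.
move=> f fs fs'; have [h e] := tensorP f fs; have [h' e'] := tensorP f fs'.
apply: tensor_uniq; first by apply: tensorP => //; apply: functional_lin.
split; first exact: functional_lin.
by move=> u v; rewrite e e' mulrDr mulrCA.
Qed.

Lemma tensor_push j l j' l' (a : modnat (X j) (X j')) (b : modnat (Y l) (Y l'))
    (phi : XN j -> k) (psi : YM l -> k) : functional phi -> functional psi ->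
  (fun g : XY j' l' => tensor phi psi (g ∘ (bim_nat a b : Sp j j' l l'))) =
  tensor (fun g : XN j' => phi (g ∘ (a : @hom k DN (X j) (X j'))))
    (fun g : YM l' => psi (g ∘ (b : @hom k DM (Y l) (Y l')))).
Proof.
move=> fp fs; have [h e] := tensorP fp fs.
apply: tensor_uniq (tensorP _ _); try exact: functional_precomp.
split; first exact: functional_precomp.
move=> u v; rewrite -e; congr (tensor _ _ _); apply: endo_atP => H m.
transitivity (endo_at (bim_to1 (u : modnat _ _) (v : modnat _ _)) H m ∘ endo_at (bim_nat a b) H m).
  by [].
rewrite !bim_to1E bim_natE /= fhomM -!compA; congr (_ ∘ _).
have := nt_natural (u : modnat (X j') (modfun_id N)) (fhom (H : modfun M N) (b m)) => /= e1.
by rewrite compA e1 -compA.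
Qed.

Section Universal.
Variables (S : E) (sg : forall a : J * L, (XY a.1 a.2 -> k) -> @hom k E S (bim (X a.1) (Y a.2))).
Arguments sg : clear implicits.
Hypothesis ws : fwedge (D := E) (one := modfun_id FM) (p := fun a : J * L => bim (X a.1) (Y a.2) : E) sg.

Let sgt j l phi psi (H : A) (m : M) :
  hom (((S : modfun FM FM) H : modfun M N) m) (X j ((H : modfun M N) (Y l m))) :=
  endo_at (sg (j, l) (tensor phi psi) : modnat _ _) H m.

Lemma sgt_push j l j' l' (a : modnat (X j) (X j')) (b : modnat (Y l) (Y l')) phi psi H m :
  functional phi -> functional psi ->
  endo_at (bim_nat a b) H m ∘ sgt phi psi H m =
  sgt (fun g : XN j' => phi (g ∘ (a : @hom k DN (X j) (X j'))))
    (fun g : YM l' => psi (g ∘ (b : @hom k DM (Y l) (Y l')))) H m.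
Proof.
move=> fp fs; have [h _] := tensorP fp fs.
rewrite /sgt -tensor_push //.
have e := proj2 ws (j, l) (j', l') (bim_nat a b : Sp j j' l l') _ h.
exact: (congr1 (fun z : @hom k E S (bim (X j') (Y l')) => endo_at (z : modnat _ _) H m) e).
Qed.

Lemma sgt_ex (H : A) (x : M) : exists u : hom (((S : modfun FM FM) H : modfun M N) x) ((H : modfun M N) x),
  forall j l phi psi, functional phi -> functional psi ->
    endo_at (etaNM j l phi psi : modnat _ _) H x ∘ u = sgt phi psi H x.
Proof.
pose w : N := ((S : modfun FM FM) H : modfun M N) x.
have step1 (a : {l : L & YM l -> k}) : exists v : hom w ((H : modfun M N) (Y (tag a) x)),
    functional (tagged a) -> forall j phi, functional phi ->
      nat_at (etaN j phi) _ ∘ v = sgt phi (tagged a) H x.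
  case: a => l psi /=; have [fs|ns] := pselect (functional psi); last by exists 0.
  have co : exists (c : N) (u : hom w (functor_id N c)), forall m (h : hom w (functor_id N m)),
      exists! g' : hom c m, fhom (functor_id N) g' ∘ u = h.
    exists w, (idm w) => m h; exists h; split; first exact: compm1.
    by move=> h' <-; rewrite /= compm1.
  have [||u [uE _]] := @pointwise_univ k C N N J X etaN uN freeN (functor_id N) w co
     ((H : modfun M N) (Y l x)) (fun j phi => sgt phi psi H x).
  - move=> j b phi phi' fp fp'; rewrite /sgt tensor_linl // (proj1 ws (j, l)).
    + exact: (@endo_at_lin k C M N S (bim (X j) (Y l)) H x b (sg (j, l) (tensor phi psi)) (sg (j, l) (tensor phi' psi))).
    + by case: (tensorP fp fs).
    + by case: (tensorP fp' fs).
  - move=> i j f phi fp.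
    have := sgt_push f (modnat_id (Y l)) H x fp fs.
    rewrite bim_natE /= fhom1 fhom1 comp1m => ->; congr (sgt _ _ H x).
    by apply: funext => g; exact: (congr1 psi (@compm1 k DM _ _ g)).
  by exists u => _ j phi fp; apply: uE.
have [v vE] := dep_choice step1.
pose v' l psi : hom w ((H : modfun M N) (Y l x)) := v (existT _ l psi).
have v'E l psi : functional psi -> forall j phi, functional phi ->
      nat_at (etaN j phi) _ ∘ v' l psi = sgt phi psi H x.
  by move=> fs; apply: (vE (existT _ l psi)).
clearbody v'.
have [||u [uE _]] := @pointwise_univ k C M N L Y etaM uM freeM (H : modfun M N) w (corep H w) x v'.
- move=> l b psi psi' fs fs'; apply: sepN => j phi fp.
  rewrite v'E // ?compDr ?compZr ?v'E //; last exact: functional_lin.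
  rewrite /sgt tensor_linr // (proj1 ws (j, l)).
  + exact: (@endo_at_lin k C M N S (bim (X j) (Y l)) H x b (sg (j, l) (tensor phi psi)) (sg (j, l) (tensor phi psi'))).
  + by case: (tensorP fp fs).
  + by case: (tensorP fp fs').
- move=> i l f psi fs; apply: sepN => j phi fp.
  rewrite v'E //; last exact: functional_precomp.
  have := sgt_push (modnat_id (X j)) f H x fp fs.
  rewrite bim_natE /= compm1.
  have -> : (fun g : XN j => phi (g ∘ (modnat_id (X j) : @hom k DN (X j) (X j)))) = phi.
    by apply: funext => g; exact: (congr1 phi (@compm1 k DN _ _ g)).
  move=> <-; rewrite -(v'E _ _ fs _ _ fp) !compA; congr (_ ∘ _).
  exact: (nt_natural (etaN j phi : modnat (modfun_id N) (X j)) (fhom (H : modfun M N) (f x))).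
exists u => j l phi psi fp fs.
by rewrite etaNM_at -(v'E _ _ fs _ _ fp) -(uE l psi fs) -!compA.
Qed.

(** The pointwise descents satisfy the axioms of a transformation over the centre because each
    identity can be checked after the jointly mono maps [etaNM], where it becomes an axiom for
    [sg]. *)
Lemma wedge_desc : exists u : @hom k E S (modfun_id FM), forall j l phi psi,
  functional phi -> functional psi -> etaNM j l phi psi ∘ u = sg (j, l) (tensor phi psi).
Proof.
have [u0 u0E] : exists u0 : forall (a : A * M), hom (((S : modfun FM FM) a.1 : modfun M N) a.2) ((a.1 : modfun M N) a.2),
    forall a j l phi psi, functional phi -> functional psi ->
    endo_at (etaNM j l phi psi : modnat _ _) a.1 a.2 ∘ u0 a = sgt phi psi a.1 a.2.
  by have [u0 u0E] := dep_choice (fun a : A * M => sgt_ex a.1 a.2); exists u0.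
pose u (H : A) m : hom (((S : modfun FM FM) H : modfun M N) m) ((H : modfun M N) m) := u0 (H, m).
have uE H m j l phi psi : functional phi -> functional psi ->
    endo_at (etaNM j l phi psi : modnat _ _) H m ∘ u H m = sgt phi psi H m.
  by move=> fp fs; exact: (u0E (H, m)).
clearbody u.
have c1 (H : A) m n (f : hom m n) : u H n ∘ fhom ((S : modfun FM FM) H : modfun M N) f = fhom (H : modfun M N) f ∘ u H m.
  apply: sepNM => j l phi psi fp fs; rewrite compA uE //.
  rewrite /sgt endo_nt compA [X in _ = X ∘ _](endo_nt (etaNM j l phi psi : modnat _ _) H f).
  by rewrite -[RHS]compA uE.
have c3 (H H' : A) (t : hom H H') m : u H' m ∘ nat_at (fhom (S : modfun FM FM) t) m = nat_at t m ∘ u H m.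
  apply: sepNM => j l phi psi fp fs; rewrite compA uE //.
  rewrite /sgt endo_ntH compA [X in _ = X ∘ _](endo_ntH (etaNM j l phi psi : modnat _ _) t m).
  by rewrite -[RHS]compA uE.
have c2 (H : A) : is_modnat (fun x m => mstr ((S : modfun FM FM) H : modfun M N) x m)
   (fun x m => mstr (H : modfun M N) x m) (u H).
  move=> x m; apply: (iso_monic (iso_inv (mstr (H : modfun M N) x m))); rewrite /= !compA fwdK comp1m.
  apply: sepNM => j l phi psi fp fs; rewrite uE // /sgt !compA.
  have e1 := endo_mod (etaNM j l phi psi : modnat _ _) H x m.
  have e2 := endo_mod (sg (j, l) (tensor phi psi) : modnat _ _) H x m.
  pose W := bim (X j) (Y l) H : modfun M N.
  apply: (iso_monic (mstr W x m)); rewrite e2 !compA [X in _ = X ∘ _ ∘ _ ∘ _]e1 isoK.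
  by rewrite -ahomMl uE.
have c4 (z : center C) (H : A) m : nat_at (fwd (mstr (modfun_id FM) z H)) m ∘ u (z ▷ (H : FM)) m =
    (idm (cob z) ▷' u H m) ∘ nat_at (fwd (mstr (S : modfun FM FM) z H)) m.
  rewrite [nat_at (fwd (mstr (modfun_id FM) z H)) m]/nat_at [X in X ∘ _ = _]/= comp1m.
  apply: sepNM => j l phi psi fp fs; rewrite uE // /sgt !compA.
  have e1 := endo_modZ (etaNM j l phi psi : modnat _ _) z H m.
  have e2 := endo_modZ (sg (j, l) (tensor phi psi) : modnat _ _) z H m.
  rewrite [X in _ = _ ∘ X]/nat_at [X in _ = _ ∘ X]/= compm1 in e1.
  apply: (iso_monic (mstr (X j) (cob z) ((H : modfun M N) (Y l m)))).
  rewrite [LHS]e2 !compA [X in _ = X ∘ _ ∘ _]e1.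
  by rewrite -ahomMl uE.
exists (@endo_nat k C M N S (modfun_id FM) u c1 c2 c3 c4) => j l phi psi fp fs.
by apply: endo_atP => H m; apply: uE.
Qed.

End Universal.

Lemma etaNM_linl j l psi : linear (fun a : @hom k DN (modfun_id N) (X j) =>
  (bim_of1 (a : modnat _ _) (etaM l psi : modnat _ _) : @hom k E (modfun_id FM) (bim (X j) (Y l)))).
Proof.
move=> c a a'; apply: endo_atP => H m; rewrite endo_at_lin !bim_of1E.
by rewrite -comp_linearr; congr (_ ∘ _); rewrite /= !(scale1r, addr0).
Qed.

Lemma etaNM_linr j l (a : modnat (modfun_id N) (X j)) : linear (fun b : @hom k DM (modfun_id M) (Y l) =>
  (bim_of1 a (b : modnat _ _) : @hom k E (modfun_id FM) (bim (X j) (Y l)))).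
Proof.
move=> c b b'; apply: endo_atP => H m; rewrite endo_at_lin !bim_of1E.
by rewrite /= !(scale1r, addr0) !fhom_linear comp_linearl.
Qed.

Variables (bN : forall j, basis (XN j)) (bM : forall l, basis (YM l)).

Let Ix (a : J * L) := ('I_(bdim (bN a.1)) * 'I_(bdim (bM a.2)))%type.
Let el (a : J * L) (p : Ix a) : XY a.1 a.2 :=
  bim_to1 (bvec (bN a.1) p.1 : modnat _ _) (bvec (bM a.2) p.2 : modnat _ _).
Let tn (a : J * L) (p : Ix a) := tensor (bco (bN a.1) p.1) (bco (bM a.2) p.2).
Let en (a : J * L) (p : Ix a) := etaNM a.1 a.2 (bco (bN a.1) p.1) (bco (bM a.2) p.2).

(** Linear extension from pure tensors to all functionals on Hom([bim X Y], id), written in the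
    chosen bases. By [etaE_tensor] its value on a pure tensor does not depend on them. *)
Definition etaE (a : J * L) (chi : XY a.1 a.2 -> k) :
    @hom k E (modfun_id FM) (bim (X a.1) (Y a.2)) :=
  \sum_(p : Ix a) chi (el p) *: en p.
Arguments etaE : clear implicits.

Lemma tensor_basis (a : J * L) (chi : XY a.1 a.2 -> k) : functional chi ->
  chi = fun g => \sum_(p : Ix a) chi (el p) * tn p g.
Proof.
move=> fc; apply: text => //.
  move=> b u v; rewrite mulr_sumr -big_split /=; apply: eq_bigr => p _.
  have [h _] := tensorP (bco_functional p.1) (bco_functional p.2).
  by rewrite /tn h mulrDr mulrCA.
move=> f g; transitivity (\sum_(i < bdim (bN a.1)) \sum_(m < bdim (bM a.2))
    chi (el (a := a) (i, m)) * (bco (bN a.1) i f * bco (bM a.2) m g)); last first.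
  rewrite pair_bigA /=; apply: eq_bigr => p _.
  have [_ e] := tensorP (bco_functional p.1) (bco_functional p.2).
  by rewrite /tn e.
have e1 := bcoE (bN a.1) (f : XN a.1); have e2 := bcoE (bM a.2) (g : YM a.2).
rewrite [X in bim_to1 X]e1.
rewrite [X in chi X](lin_sum (@bim_to1_linearl k C M N (X a.1) (Y a.2) g)).
under [X in chi X]eq_bigr do rewrite (linZ (@bim_to1_linearl k C M N (X a.1) (Y a.2) g)).
rewrite functional_sum //; apply: eq_bigr => i _.
rewrite [X in bim_to1 _ X]e2.
rewrite [X in chi X](lin_sum (@bim_to1_linearr k C M N (X a.1) (Y a.2) _)).
under [X in chi X]eq_bigr do rewrite (linZ (@bim_to1_linearr k C M N (X a.1) (Y a.2) _)).
rewrite functional_sum // mulr_sumr; apply: eq_bigr => m _.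
by rewrite mulrA mulrC.
Qed.

Lemma etaE_tensor (a : J * L) phi psi : functional phi -> functional psi ->
  etaE a (tensor phi psi) = etaNM a.1 a.2 phi psi.
Proof.
move=> fp fs; rewrite [in RHS](functional_basis (bN a.1) fp) [in RHS](functional_basis (bM a.2) fs).
rewrite [RHS]/etaNM unlock (family_sum (tau := etaN a.1)) //; last 2 first.
- exact: (proj1 (proj1 uN) a.1).
- exact: bco_functional.
rewrite (family_sum (tau := etaM a.2)) //; last 2 first.
- exact: (proj1 (proj1 uM) a.2).
- exact: bco_functional.
rewrite (lin_sum (@etaNM_linr a.1 a.2 _)).
transitivity (\sum_(m < bdim (bM a.2)) \sum_(i < bdim (bN a.1)) (phi (bvec (bN a.1) i) * psi (bvec (bM a.2) m))
    *: en (a := a) (i, m)).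
  rewrite exchange_big pair_bigA /=; apply: eq_bigr => p _.
  by have [_ e] := tensorP fp fs; rewrite /el e; case: p.
apply: eq_bigr => m _; rewrite (linZ (@etaNM_linr a.1 a.2 _)) (lin_sum (@etaNM_linl a.1 a.2 _)).
rewrite scaler_sumr; apply: eq_bigr => i _.
rewrite (linZ (@etaNM_linl a.1 a.2 _)) scalerA mulrC; congr (_ *: _).
by rewrite /en /etaNM unlock.
Qed.

Lemma etaE_linear (a : J * L) c (chi chi' : XY a.1 a.2 -> k) :
  etaE a (fun g => c * chi g + chi' g) = c *: etaE a chi + etaE a chi'.
Proof.
rewrite /etaE scaler_sumr -big_split /=; apply: eq_bigr => p _.
by rewrite scalerDl scalerA.
Qed.

Lemma etaNM_push j l j' l' (f : modnat (X j) (X j')) (g : modnat (Y l) (Y l')) phi psi :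
  functional phi -> functional psi ->
  (bim_nat f g : Sp j j' l l') ∘ etaNM j l phi psi =
  etaNM j' l' (fun h => phi (h ∘ (f : @hom k DN (X j) (X j')))) (fun h => psi (h ∘ (g : @hom k DM (Y l) (Y l')))).
Proof.
move=> fp fs; apply: endo_atP => H m.
have e1 := proj2 (proj1 uN) j j' f phi fp; have e2 := proj2 (proj1 uM) l l' g psi fs.
transitivity (endo_at (bim_nat f g) H m ∘ endo_at (etaNM j l phi psi : modnat _ _) H m); first by [].
rewrite bim_natE etaNM_at [RHS]etaNM_at -e1 -e2.
rewrite [in RHS]/= fhomM !compA; congr (_ ∘ _).
rewrite -!compA; apply: esym; have := nt_natural ((f : @hom k DN (X j) (X j')) ∘ etaN j phi : modnat _ _) (fhom (H : modfun M N) (g m)).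
by rewrite /= !compA.
Qed.

(** Maps between the objects [bim X Y] are sums of products by [span] and functionals are
    combinations of pure tensors by [tensor_basis], so naturality reduces to that of the two given
    wedges ([etaNM_push]). *)
Lemma etaE_natural (a b : J * L) (f : Sp a.1 b.1 a.2 b.2) chi : functional chi ->
  f ∘ etaE a chi = etaE b (fun g => chi (g ∘ f)).
Proof.
move=> fc.
have en1 phi psi : functional phi -> functional psi ->
    f ∘ etaNM a.1 a.2 phi psi = etaE b (fun g => tensor phi psi (g ∘ f)).
  move=> fp fs; have [ft _] := tensorP fp fs; have [s ->] := span f.
  transitivity (etaE b (fun g => \sum_(u <- s) 1 * tensor phi psi (g ∘ (bim_nat u.1 u.2 : Sp a.1 b.1 a.2 b.2)))).
    rewrite (family_sum (tau := etaE b)); last 2 first.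
    - by move=> *; apply: etaE_linear.
    - by move=> u; apply: functional_precomp.
    rewrite comp_suml; apply: eq_bigr => u _; rewrite scale1r etaNM_push // tensor_push //.
    by rewrite etaE_tensor //; apply: functional_precomp.
  congr (etaE b _); apply: funext => g; rewrite comp_sumr.
  rewrite -(functional_sum s (fun=> 1) (fun u => g ∘ (bim_nat u.1 u.2 : Sp a.1 b.1 a.2 b.2)) ft).
  by congr (tensor _ _ _); apply: eq_bigr => u _; rewrite scale1r.
have cE := tensor_basis fc.
transitivity (etaE b (fun g => \sum_(p : Ix a) chi (el p) * tn p (g ∘ f))); last first.
  by congr (etaE b _); apply: funext => g; rewrite [in RHS]cE.
rewrite (family_sum (tau := etaE b)); last 2 first.
- by move=> *; apply: etaE_linear.
- move=> p; apply: functional_precomp.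
  by have [] := tensorP (bco_functional (b := bN a.1) p.1) (bco_functional (b := bM a.2) p.2).
rewrite /etaE comp_sumr; apply: eq_bigr => p _.
by rewrite compZr en1 //; apply: bco_functional.
Qed.

(** A wedge in E is determined on pure tensors, where [wedge_desc] provides the descent; uniqueness
    is the joint monicity [sepNM]. *)
Theorem bim_univ : funiv (D := E) (one := modfun_id FM) (p := fun a : J * L => bim (X a.1) (Y a.2) : E) etaE.
Proof.
split.
  split=> [a c phi psi _ _|a b f phi fp]; first exact: etaE_linear.
  exact: etaE_natural.
move=> S sg ws; have [u uE] := wedge_desc ws.
exists u; split.
  move=> a chi fc; rewrite [in RHS](tensor_basis fc).
  rewrite (family_sum (tau := sg a)); last 2 first.
  - exact: (proj1 ws a).
  - move=> p; by have [] := tensorP (bco_functional (b := bN a.1) p.1) (bco_functional (b := bM a.2) p.2).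
  rewrite /etaE comp_suml; apply: eq_bigr => p _; rewrite compZl; congr (_ *: _).
  case: a chi fc p => j l chi fc p /=.
  exact: (uE j l _ _ (bco_functional p.1) (bco_functional p.2)).
move=> v vE; apply: endo_atP => H m; apply: sepNM => j l phi psi fp fs.
have [ft _] := tensorP fp fs.
have := vE (j, l) _ ft; rewrite etaE_tensor // -uE // => e.
exact: (esym (congr1 (fun z : @hom k E S (bim (X j) (Y l)) => endo_at (z : modnat _ _) H m) e)).
Qed.

End Assembly.

(** What the generation argument uses of the functor [Hom(t, -) ▷ w]. *)
Record ihom_like (k : fieldType) (C : monoidal k) (N : modcat C) (t w : N) (X : modfun N N) := IhomLike {
  il_ob : N -> C;
  il_ev : forall y, hom (il_ob y ▷ t) y;
  il_iso : forall y, hom (X y) (il_ob y ▷ w);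
  il_map : forall y y', hom y y' -> hom (il_ob y) (il_ob y');
  il_mapE : forall y y' (f : hom y y'), il_ev y' ∘ (il_map f ▷' idm t) = f ∘ il_ev y;
  il_natural : forall y y' (f : hom y y'), il_iso y' ∘ fhom X f = (il_map f ▷' idm w) ∘ il_iso y;
  il_str : forall z y, hom (il_ob (z ▷ y)) (z ⊗ il_ob y);
  il_strE : forall z y, (idm z ▷' il_ev y) ∘ aassoc z (il_ob y) t ∘ (il_str z y ▷' idm t) = il_ev (z ▷ y);
  il_mstr : forall z y, (idm z ▷' il_iso y) ∘ mstr X z y =
    aassoc z (il_ob y) w ∘ (il_str z y ▷' idm w) ∘ il_iso (z ▷ y);
  il_elem : forall c y (f : hom (c ▷ t) y), exists (b : hom c (il_ob y)) (h : hom (c ▷ w) (X y)),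
    il_ev y ∘ (b ▷' idm t) = f /\ il_iso y ∘ h = b ▷' idm w }.
Arguments il_map {k C N t w X} i {y y'} f.
Arguments il_ob {k C N t w X} i y.
Arguments il_ev {k C N t w X} i y.
Arguments il_iso {k C N t w X} i y.
Arguments il_str {k C N t w X} i z y.

Lemma free_mod_like (k : fieldType) (C : monoidal k) (rC : rigid C) (N : modcat C) (IN : ihoms N) (t w : N) :
  ihom_like t w (free_mod rC IN t w).
Proof.
pose hP := @ihP k C N IN t.
apply: (@IhomLike k C N t w (free_mod rC IN t w) (ih IN t) (ih_ev IN t) (fun y => idm _)
  (fun y y' f => fhom (ihom_mod hP rC) f) _ _ (fun z y => ihom_str hP rC z y)).
- by move=> y y' f; exact: (ihom_fhomE hP).
- by move=> y y' f; rewrite comp1m compm1.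
- by move=> z y; exact: ihom_strE.
- by move=> z y; rewrite ahom1 comp1m compm1.
- by move=> c y f; exists (tr hP f), (tr hP f ▷' idm w); rewrite trE comp1m.
Qed.

(** * Every endofunctor over the centre is a quotient of some X H Y *)

Section Generation.
Variables (k : closedFieldType) (C : monoidal k) (M N : modcat C).
Hypotheses (rC : rigid C) (fC : finite_category C).
Variables (IN : ihoms N) (Ls : forall q : C, induced q) (F : modfun M N).
Variables (v v' : C) (ev : hom (v ⊗ v') tunit) (coev : hom tunit (v' ⊗ v)).
Hypothesis E2 : lunit v ∘ (ev ⊗' idm v) ∘ bwd (assoc v v' v) ∘ (idm v ⊗' coev) = runit v.
Variables (n : nat) (s Q : 'I_n -> M) (e : forall j, hom (Q j) (s j)).
Hypothesis flM : forall x : M, finite_length x.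
Hypothesis sc : simple_covers e.
Let T : functor M N := functor_comp (act_left N v') F.
Variables (tau : forall j, hom (T (s j)) (T (Q j))).
Hypotheses (eT : exact_functor T) (tauE : forall j, fhom T (e j) ∘ tau j = idm (T (s j))).
Variables (t : N) (it : forall j, hom (T (s j)) t) (pt : forall j, hom t (T (s j))).
Hypothesis bt : bigsum it pt.
Variables (P : M) (ip : forall j, hom (Q j) P) (pp : forall j, hom P (Q j)).
Hypothesis bP : bigsum ip pp.
Let FM := fun_modcat M N.
Variables (K : modfun FM (center_res N)).
Let W : N := K (F : FM).
Let nn : N := v' ▷ W.
Variables (X : modfun N N) (X_ : ihom_like t nn X).

Let lam c : hom (c ▷ nn) ((c ⊗ v') ▷ (v ▷ nn)) :=
  locked_with act_key (bwd (aassoc c v' (v ▷ nn)) ∘ (idm c ▷' act_coev coev nn)).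

Lemma lam_natural c c' (b : hom c c') : lam c' ∘ (b ▷' idm nn) = ((b ⊗' idm v') ▷' idm (v ▷ nn)) ∘ lam c.
Proof.
rewrite /lam !unlock -compA ahom_swap compA.
have := bwd_aassoc_natural b (idm v') (idm (v ▷ nn)); rewrite ahom1 => ->.
by rewrite -compA.
Qed.

Lemma lam_assoc z a : aassoc z (a ⊗ v') (v ▷ nn) ∘ (assoc z a v' ▷' idm _) ∘ lam (z ⊗ a) =
  (idm z ▷' lam a) ∘ aassoc z a nn.
Proof.
apply: (iso_monic (fiso (act_left N z) (aassoc a v' (v ▷ nn)))) => /=.
rewrite !compA -apentagon /lam !unlock !compA isoK -ahomMl !compA bwdK comp1m.
by rewrite -thom1 aassoc_natural.
Qed.

Let a_ (H : modfun M N) := il_ob X_ (H P).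
Let l_ (H : modfun M N) j : hom (a_ H ▷ T (s j)) (H (Q j)) :=
  fhom H (pp j) ∘ (il_ev X_ (H P) ∘ (idm (a_ H) ▷' it j)).

(** A plain transformation from [a_ H ▷ T] to [H] is free to be prescribed on the generators. Here
    it evaluates the internal Hom from [t], the sum of all [T (s j)], to [H P], where [P] is the sum
    of all covers, and takes the matching component. *)
Lemma theta_ex : (forall c x y (f g : hom (c ▷ T x) y),
    (forall j (h : hom (Q j) x), f ∘ (idm c ▷' (fhom T h ∘ tau j)) = g ∘ (idm c ▷' (fhom T h ∘ tau j))) -> f = g) /\
  exists th : forall (H : modfun M N) m, hom (a_ H ▷ T m) (H m),
    (forall H m m' (f : hom m m'), th H m' ∘ (idm (a_ H) ▷' fhom T f) = fhom H f ∘ th H m) /\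
    forall H x j (f : hom (Q j) x), th H x ∘ (idm (a_ H) ▷' (fhom T f ∘ tau j)) = fhom H f ∘ l_ H j.
Proof.
have [L [L1 [_ L2]]] := free_functor_family flM sc eT tauE; split.
  move=> c x y f g E; rewrite -[f]compm1 -[g]compm1 -ahom1 -L1 ahom_sumr !comp_sumr.
  by apply: eq_bigr => u _; rewrite ahomMl !compA E.
have [th thE] : exists th : forall (H : modfun M N) m, hom (a_ H ▷ T m) (H m), forall H m, th H m =
     \sum_(u <- L m) fhom H (tagged u).1 ∘ l_ H (tag u) ∘ fhom (act_left N (a_ H)) (tagged u).2 by eexists.
exists th; split=> H; have [t1 t2] := L2 N (act_left N (a_ H)) H (l_ H) (th H) (thE H).
  exact: t2.
exact: t1.
Qed.

Let g : hom (v ▷ nn) W := act_ev ev W.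

Lemma aassoc_swap z (c a : C) (f : hom c (z ⊗ a)) (y y' : N) (x : hom y y') :
  aassoc z a y' ∘ (f ▷' idm y') ∘ (idm c ▷' x) =
  (idm z ▷' (idm a ▷' x)) ∘ (aassoc z a y ∘ (f ▷' idm y)).
Proof.
by rewrite [RHS]compA -aassoc_natural thom1 -!compA -!ahom_lr -ahom_rl.
Qed.

(** The transfers of the transformations of [theta_ex] fit together into one transformation [sg]
    over the centre. On [F] it reaches everything, because the evaluation from [v ▷ T] to [F] is
    itself obtained from the test transformation by choosing an element of the internal Hom. *)
Lemma generation_ex : exists sg : modnat (post_eval X P : modfun FM (center_res N)) K,
  exists h : hom (v ▷ nn) (X (F P)), (sg (F : FM) : hom (X (F P)) W) ∘ h = g.
Proof.
have [ext [th [thN thE]]] := theta_ex.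
have zN H : plain_nat (F := F) (q := a_ H ⊗ v') (fun m => th H m ∘ aassoc (a_ H) v' (F m)).
  move=> p q f; rewrite -compA -[idm (a_ H ⊗ v')]thom1 aassoc_natural compA.
  rewrite ?compA; congr (_ ∘ _); exact: (thN H p q f).
pose sg (H : modfun M N) : hom (X (H P)) (K (H : FM) : N) :=
  locked_with act_key (transfer rC IN Ls (K := K) g (zN H) ∘ lam (a_ H) ∘ il_iso X_ (H P)).
have sgE H : sg H = transfer rC IN Ls (K := K) g (zN H) ∘ lam (a_ H) ∘ il_iso X_ (H P) by rewrite /sg unlock.
have s1 (H H' : modfun M N) (x : modnat H H') :
    sg H' ∘ fhom X (x P) = fhom K (x : @hom k FM H H') ∘ sg H.
  rewrite !sgE -(compA _ (il_iso X_ _) (fhom X _)) il_natural !compA -(compA _ (lam _)) lam_natural compA.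
  congr (_ ∘ _ ∘ _); apply: esym; apply: transfer_post; [exact: fC | move=> m].
  rewrite -[RHS]compA aassoc_nat_id !compA; congr (_ ∘ _).
  apply: (ext (a_ H) m (H' m)) => j h.
  have e1 : th H' m ∘ (idm (a_ H') ▷' (fhom T h ∘ tau j)) = fhom H' h ∘ l_ H' j by apply: thE.
  have e2 : th H m ∘ (idm (a_ H) ▷' (fhom T h ∘ tau j)) = fhom H h ∘ l_ H j by apply: thE.
  rewrite -[LHS]compA e2 -[RHS]compA -ahom_swap [RHS]compA e1 /l_ !compA nt_natural.
  rewrite -!(compA (fhom H' h)); congr (_ ∘ _); rewrite nt_natural -!compA; congr (_ ∘ _).
  by rewrite ahom_swap !compA il_mapE.
have s2 (z : center C) (H : modfun M N) : fwd (mstr K z (H : FM)) ∘ sg (fun_act z H) =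
    (idm (cob z) ▷' sg H) ∘ mstr X (cob z) (H P).
  rewrite !sgE !ahomMl -[RHS]compA il_mstr.
  have hyp m : modnat_id (fun_act z H) m ∘ (th (fun_act z H) m ∘ aassoc (a_ (fun_act z H)) v' (F m)) =
      (idm (cob z) ▷' (th H m ∘ aassoc (a_ H) v' (F m))) ∘ aassoc (cob z) (a_ H ⊗ v') (F m)
      ∘ ((assoc (cob z) (a_ H) v' ∘ (il_str X_ (cob z) (H P) ⊗' idm v')) ▷' idm (F m)).
    have e3 : th (fun_act z H) m =
        (idm (cob z) ▷' th H m) ∘ (aassoc (cob z) (a_ H) (T m) ∘ (il_str X_ (cob z) (H P) ▷' idm (T m))).
      apply: (ext (a_ (fun_act z H)) m (cob z ▷ H m)) => j h.
      have e1 : th (fun_act z H) m ∘ (idm (a_ (fun_act z H)) ▷' (fhom T h ∘ tau j)) =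
        (idm (cob z) ▷' fhom H h) ∘ l_ (fun_act z H) j by apply: thE.
      have e2 : th H m ∘ (idm (a_ H) ▷' (fhom T h ∘ tau j)) = fhom H h ∘ l_ H j by apply: thE.
      rewrite e1 -[RHS]compA aassoc_swap [RHS]compA -ahomMl e2 ahomMl -!compA; congr (_ ∘ _).
      have -> : l_ (fun_act z H) j = (idm (cob z) ▷' fhom H (pp j)) ∘
        (il_ev X_ (cob z ▷ H P) ∘ (idm (a_ (fun_act z H)) ▷' it j)) by [].
      rewrite /l_ !ahomMl -!compA; congr (_ ∘ _).
      by rewrite -il_strE -!compA; congr (_ ∘ _); rewrite compA aassoc_swap.
    rewrite /= comp1m e3 !ahomMl ahomMr.
    have e4 := aassoc_nat_id v' (F m) (il_str X_ (cob z) (H P)).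
    have e5 := apentagon (cob z) (a_ H) v' (F m).
    rewrite [RHS]compA -(compA _ (aassoc (cob z) (a_ H ⊗ v') _)) -(compA _ (_ ▷' aassoc _ _ _)).
    rewrite (compA (_ ▷' aassoc _ _ _)) -e5 -!compA; congr (_ ∘ (_ ∘ _)).
    by rewrite e4.
  have tn := transfer_natural rC fC IN Ls g (zN H) (zN (fun_act z H)) (z := z)
    (f := assoc (cob z) (a_ H) v' ∘ (il_str X_ (cob z) (H P) ⊗' idm v')) (xi := modnat_id (fun_act z H)) hyp.
  have k1 : fhom K (modnat_id (fun_act z H) : @hom k FM (fun_act z H) (fun_act z H)) = idm _.
    exact: (fhom1 K (fun_act z H : FM)).
  have {}tn : fwd (mstr K z (H : FM)) ∘ transfer rC IN Ls (K := K) g (zN (fun_act z H)) = 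
    (idm (cob z) ▷' transfer rC IN Ls (K := K) g (zN H)) ∘ aassoc (cob z) (a_ H ⊗ v') (v ▷ nn)
    ∘ ((assoc (cob z) (a_ H) v' ∘ (il_str X_ (cob z) (H P) ⊗' idm v')) ▷' idm (v ▷ nn)).
    apply: etrans tn; rewrite k1; congr (_ ∘ _); exact: (esym (compm1 _)).
  rewrite -(compA (transfer _ _ _ _ _)) [LHS]compA [X in X ∘ _]tn -!compA; congr (_ ∘ _).
  have la := lam_assoc (cob z) (a_ H).
  have ln := lam_natural (il_str X_ (cob z) (H P)).
  rewrite (compA (_ ▷' lam _)) -la -!compA; congr (_ ∘ _).
  rewrite ahomMr -!compA; congr (_ ∘ _); rewrite ?compA; congr (_ ∘ _).
  exact: (esym ln).
have s2' (z : center C) (H : FM) : fwd (mstr K z H) ∘ sg (z ▷ H) =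
    (idm z ▷' (sg H : @hom k (center_res N) (X (H P)) (K H))) ∘ mstr (post_eval X P) z H.
  by rewrite post_eval_str; exact: s2.
exists (@Modnat k (center C) FM (center_res N) (post_eval X P) K (fun H : FM => sg H) s1 s2').
(* The diagonal map whose components are the values of the evaluation transformation on the
   generators [tau j]; the element [b] of the internal Hom names it. *)
pose be : hom (v ▷ t) (F P) :=
  \sum_j fhom F (ip j) ∘ (act_ev ev (F (Q j)) ∘ (idm v ▷' (tau j ∘ pt j))).
have beE j : fhom F (pp j) ∘ be ∘ (idm v ▷' it j) = act_ev ev (F (Q j)) ∘ (idm v ▷' tau j).
  have [o [ob _]] := bP; have [_ [tb _]] := bt.
  have tjj : tau j ∘ pt j ∘ it j = tau j by rewrite -compA tb compm1.
  rewrite /be comp_sumr (bigD1 j) //= big1 => [|i ni].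
    by rewrite addr0 compA -fhomM ob fhom1 comp1m -compA -ahomMl tjj.
  by rewrite compA -fhomM o ?fhom0 ?comp0l // eq_sym.
have [b [h [bE hE]]] := il_elem X_ be.
exists h.
(* Both sides are plain transformations out of [v ▷ T], so agreement on the generators is enough. *)
have thb m : th F m ∘ (b ▷' idm (T m)) = act_ev ev (F m).
  apply: (ext v m (F m)) => j f.
  have e1 : th F m ∘ (idm (a_ F) ▷' (fhom T f ∘ tau j)) = fhom F f ∘ l_ F j by apply: thE.
  rewrite -[LHS]compA -ahom_swap compA e1 ahomMl [RHS]compA.
  have -> : act_ev ev (F m) ∘ (idm v ▷' fhom T f) = fhom F f ∘ act_ev ev (F (Q j)).
    exact: act_ev_natural.
  rewrite -[RHS]compA -[LHS]compA -beE /l_ -!compA; congr (_ ∘ _); congr (_ ∘ _).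
  by rewrite ahom_swap compA bE.
have zu : plain_nat (F := F) (q := tunit) (fun m => fwd (aunit (F m))).
  by move=> p q f; exact: aunit_natural.
have zv : plain_nat (F := F) (q := v ⊗ v') (fun m => aunit (F m) ∘ (ev ▷' idm (F m))).
  by move=> p q f; rewrite -compA -ahom_swap compA aunit_natural -compA.
have kF : fhom K (modnat_id F : @hom k FM F F) = idm _ by exact: (fhom1 K (F : FM)).
(* The evaluation transformation is transferred in two ways, through the unit object and through
   [a_ F]. The first gives [g] after a zigzag, the second gives [sg F]. *)
have t1 : transfer rC IN Ls (K := K) g zv = transfer rC IN Ls (K := K) g zu ∘ (ev ▷' idm (v ▷ nn)).
  rewrite -(transfer_post rC fC IN Ls g zu zv (f := ev) (xi := modnat_id F)); last first.
    by move=> m; rewrite comp1m.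
  rewrite kF; exact: esym (comp1m _).
have t2 : transfer rC IN Ls (K := K) g zv =
    transfer rC IN Ls (K := K) g (zN F) ∘ ((b ⊗' idm v') ▷' idm (v ▷ nn)).
  rewrite -(transfer_post rC fC IN Ls g (zN F) zv (f := b ⊗' idm v') (xi := modnat_id F)); last first.
    move=> m; rewrite /= comp1m -[RHS]compA aassoc_nat_id [RHS]compA.
    have := thb m; rewrite /T /= => ->.
    by rewrite /act_ev unlock isoVK.
  rewrite kF; exact: esym (comp1m _).
rewrite /= sgE -[LHS]compA hE -[LHS]compA lam_natural compA -t2 t1.
rewrite (@transfer_unit _ _ _ _ rC fC IN Ls _ _ _ _ _ zu) //.
have le : aunit (v ▷ nn) ∘ ((ev ▷' idm (v ▷ nn)) ∘ lam v) = idm (v ▷ nn).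
  by apply: etrans (act_zigzag2 nn E2); rewrite /lam /act_ev !unlock !compA.
by rewrite -!compA; apply: etrans (congr1 (fun x => g ∘ x) le) (compm1 _).
Qed.
End Generation.

Lemma epi_of_comp (k : fieldType) (A : category k) (x y z : A) (g : hom y z) (f : hom x y) (h : hom x z) :
  g ∘ f = h -> epi h -> epi g.
Proof. by move=> <-; exact: epi_cancel. Qed.

Section EndofunctorGeneration.
Variables (k : closedFieldType) (C : monoidal k) (M N : modcat C).
Hypotheses (tC : finite_tensor C) (xM : exact_module M) (xN : exact_module N).
Let rC : rigid C := finite_tensor_rigid tC.
Let fC : finite_category C. Proof. by case: tC => -[]. Qed.
Variables (IM : ihoms M) (IN : ihoms N) (Ls : forall q : C, induced q).
Let FM := fun_modcat M N.
Let E := modfun_cat FM FM.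

(** Apply [generation_ex] to H |-> (y H)(mu), with F and mu generators, and extend the result to
    [bim X Y] by freeness of Y. The map is epi at F and mu since the evaluation of the nonzero
    object v' is epi, and exactness of [y F] and [y] spreads this to all objects. *)
Lemma fun_endo_generated (y : modfun FM FM) :
  exists (t w : N) (mu P : M) (z : modnat (bim (free_mod rC IN t w) (free_mod rC IM mu P)) y),
  [/\ projective t, projective P & epi (z : @hom k E _ _)].
Proof.
have [mN pN] := xN; have [mM pM] := xM; have [fM eM rM] := mM; have [fN eN rN] := mN.
have [abM fdM flM _ _] := fM; have [abN fdN _ _ _] := fN.
have fA : finite_category (modfun_cat M N) by apply: modfun_cat_finite.
have [abA fdA _ _ _] := fA; have [F gF] := finite_generator fA.
have [mu gmu] := finite_generator fM.
have [v' [q [pv' eq]]] := proj_unit_ex fC; have [[v [ev [coev [E1 E2]]]] _] := rC v'.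
have nz : ~ is_zero v'.
  move=> zv; have [n1 _] := unit_simple tC; apply: n1; apply: eq.
  by rewrite comp1m comp0l -[q]compm1 zv comp0r.
have abC : abelian_category C by case: fC.
have eev : epi ev by apply: (dual_ev_epi tC E1 nz).
have [n [s [Qs [e [_ sc]]]]] := simple_covers_ex fM.
have [pQ eE _ _ _] := sc.
have eF : exact_functor (F : modfun M N) by apply: (exact_module_exact fC).
pose T : functor M N := functor_comp (act_left N v') (F : modfun M N).
have eT : exact_functor T by move=> a b c i0 p0 h; apply: (eN v'); apply: eF.
have [tau tauE] := sections_ex (fun j => exact_epi abM eT (eE j)) (fun j => pN _ _ pv').
have [t [it [pt bt]]] := bigsum_ex abN (fun j => T (s j)).
have [P [ip [pp bP]]] := bigsum_ex abM Qs.
pose K : modfun FM (center_res N) := endo_eval y mu.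
have [sg [h sgE]] := generation_ex rC fC IN Ls E2 flM sc eT tauE bt bP
  (free_mod_like rC IN t (v' ▷ (K (F : FM) : N))).
have [z zE] := bim_free_ex (free_mod_is_free rC N IM mu P) sg.
exists t, (v' ▷ (K (F : FM) : N)), mu, P, z; split.
- by apply: (bigsum_proj bt) => j; apply: pN.
- by apply: (bigsum_proj bP).
have e1 : epi (act_ev ev (K (F : FM) : N)).
  rewrite /act_ev unlock; apply: epi_comp; last exact: (iso_epi (iso_inv _)).
  by apply: epi_comp; [exact: iso_epi | exact: (exact_epi abC (rN _) eev)].
have e2 : epi (endo_at z F mu).
  have e3 : epi (sg (F : FM) : @hom k N _ _) by apply: epi_cancel (_ : epi (_ ∘ h)); rewrite sgE.
  exact: epi_of_comp (zE (F : modfun_cat M N)) e3.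
have e4 : epi (z (F : FM)).
  apply: modnat_epi_of => m.
  exact: (modnat_gen_epi abM gmu fdM (t := (z (F : FM) : modnat _ _)) (exact_module_exact fC (y (F : FM) : modfun M N) xM mN) e2).
apply: modnat_epi_of => H.
exact: (modnat_gen_epi (abA : abelian_category FM) gF fdA (fun_endo_exact rC fC xM xN y) e4).
Qed.

End EndofunctorGeneration.

(** * Assembly *)

Section Corepresentability.
Variables (k : fieldType) (A B : category k) (H : functor A B).
Hypotheses (fA : finite_category A) (fdB : fd_homs B) (eH : exact_functor H).

(** An exact functor has a left adjoint: [representable] is applied in the opposite category, with
    an injective cogenerator in place of the generator. *)
Lemma exact_corep (w : B) : exists (c : A) (u : hom w (H c)),
  forall m (f : hom w (H m)), exists! g : hom c m, fhom H g ∘ u = f.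
Proof.
have [I gI] := injective_cogenerator fA; case: (fA) => abA fdA _ _ _.
apply: (@representable k (op A) I (op_abelian abA) gI (fun x => fdA x I)
  (fun m => hom w (H m)) (fun b b' g f => fhom H g ∘ f)).
- by move=> b b' g; apply: comp_linearr.
- by move=> b b' f a g g'; rewrite fhom_linear comp_linearl.
- by move=> b f; rewrite fhom1 comp1m.
- by move=> b b' b'' g f t; rewrite /= fhomM compA.
- move=> b b' b'' i p f [_ cp] e.
  have mp : mono (p : hom (c := A) b'' b').
    by move=> v g h; exact: (cokernel_epi cp).
  by apply: (exact_mono abA eH mp); rewrite e comp0r.
- move=> b b' b'' i p f [_ [pi cp]] e.
  have kp : is_kernel (p : hom (c := A) b'' b') (i : hom (c := A) b' b) by split.
  exact: kernel_lift (exact_kernel abA eH kp) e.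
- exact: fdB.
Qed.

End Corepresentability.

Lemma free_map_epi (k : fieldType) (C : monoidal k) (rC : rigid C) (M N : modcat C) (IM : ihoms M)
    (m : M) (n : N) (G : modfun M N) (f : hom n (G m)) :
  abelian_category M -> generator m -> fd_homs M -> exact_functor G -> epi f ->
  epi (free_map rC IM f : @hom k (modfun_cat M N) _ _).
Proof.
move=> abM gm fdM eG ef; apply: modnat_epi_of.
apply: (modnat_gen_epi abM gm fdM eG).
exact: epi_of_comp (free_map_unit rC IM f) ef.
Qed.

Section Assembly.
Variables (k : closedFieldType) (C : monoidal k) (M N : modcat C).
Hypotheses (tC : finite_tensor C) (uM : unimodular M) (uN : unimodular N) (IM : ihoms M).
Let rC : rigid C := finite_tensor_rigid tC.
Let FM := fun_modcat M N.
Let E := modfun_cat FM FM.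
Variables (J L : Type) (X : J -> modfun N N) (Y : L -> modfun M M).
Variables (t w : J -> N) (uX : forall j, hom (w j) (X j (t j))).
Variables (mu P : L -> M) (uY : forall l, hom (P l) (Y l (mu l))).
Hypothesis freeX : forall j, is_free N (uX j).
Hypotheses (freeYM : forall l, is_free M (uY l)) (freeYN : forall l, is_free N (uY l)).
Hypothesis dec : forall j l (X' : modfun N N) (x : M) (sg : modnat (post_eval (X j) (P l)) (post_eval X' x)),
  decomposes (fun H : modfun M N => sg H : hom (X j (H (P l))) (X' (H x))).
Hypothesis freeN : forall a c : N, exists (Q : modfun N N) (u : hom c (Q a)), is_free N u.
Hypothesis freeM : forall a c : M, exists (Q : modfun M M) (u : hom c (Q a)), is_free M u.
Hypothesis covN : forall X' : modfun_cat N N, exists j (e : @hom k (modfun_cat N N) (X j) X'), epi e.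
Hypothesis covM : forall Y' : modfun_cat M M, exists l (e : @hom k (modfun_cat M M) (Y l) Y'), epi e.
Hypothesis covE : forall y : E, exists (a : J * L) (e : @hom k E (bim (X a.1) (Y a.2)) y), epi e.

Lemma fun_unimodular : unimodular FM.
Proof.
have [xM [DM [dM [iM]]]] := uM; have [xN [DN [dN [iN]]]] := uN.
have fC : finite_category C by case: tC => -[].
have [mN pN] := xN; have [mM pM] := xM; have [fM eM rM] := mM; have [fN eN rN] := mN.
have [_ fdN _ _ _] := fN.
have fA : finite_category (modfun_cat M N) by apply: modfun_cat_finite.
have [abA fdA _ _ _] := fA; have [F gF] := finite_generator fA.
have [abEM fdEM _ _ _] : finite_category (modfun_cat M M) by apply: modfun_cat_finite.
have [abEN fdEN _ _ _] : finite_category (modfun_cat N N) by apply: modfun_cat_finite.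
have eE (y : modfun FM FM) : exact_functor y := fun_endo_exact rC fC xM xN y.
have abE : abelian_category E.
  apply: modfun_cat_abelian; first exact: abA.
  by case: (fun_module rC fC xM xN).
have fdE : fd_homs E.
  move=> y y'; apply: (modnat_fd (abA : abelian_category FM) gF fdA (eE y)); exact: fdA.
have [tM tMU] := distinguished_funiv (A := dual_cat M) fdEM dM.
have [tN tNU] := distinguished_funiv (A := dual_cat N) fdEN dN.
(* Unimodularity enters here: the universal wedge is moved along the isomorphism so that it starts
   at the identity functor. *)
have UM := funiv_restrict abEM fdEM covM (funiv_iso iM tMU).
have UN := funiv_restrict abEN fdEN covN (funiv_iso iN tNU).
have [bN _] := dep_choice (fun j => basis_ex (fdEN (X j) (modfun_id N))).
have [bM _] := dep_choice (fun l => basis_ex (fdEM (Y l) (modfun_id M))).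
have corep (H : modfun M N) (v : N) := exact_corep fM fdN (exact_module_exact fC H xM mN) v.
have U := bim_univ UN UM freeN freeM corep
  (fun j l j' l' z => bim_span (freeYN l) (freeYM l) (dec (j := j) (l := l)) z)
  (fun j l chi chi' => tensor_ext (freeYM l) (freeYN l) (dec (j := j) (l := l)) (chi := chi) (chi' := chi'))
  (fun j l phi psi => tensor_ex tC mN IM (freeX j) (freeYM l) (fdEN _ _) (fdEM _ _) (fdE _ _)
    (phi := phi) (psi := psi)) bN bM.
have [tE tEU] := funiv_extend abE fdE covE U.
split; first exact: fun_exact.
exists (tunit : dual_cat FM); split; last by constructor; exact: iso_id.
exact: (funiv_distinguished (A := dual_cat FM) abE fdE tEU).
Qed.

End Assembly.

Theorem proposition6p10 (k : closedFieldType) (C : monoidal k) (M N : modcat C) :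
  finite_tensor C -> unimodular M -> unimodular N ->
  unimodular (fun_modcat M N).
Proof.
move=> tC uM uN; have [xM _] := uM; have [xN _] := uN.
have fC : finite_category C by case: tC => -[].
pose rC := finite_tensor_rigid tC.
have [mN pN] := xN; have [mM pM] := xM; have [fM eM rM] := mM; have [fN eN rN] := mN.
have [abM fdM _ covM _] := fM; have [abN fdN _ _ _] := fN.
have [IM] := ihoms_ex fC mM; have [IN] := ihoms_ex fC mN.
have LsP (q : C) : exists L : induced q, True by have [L] := induced_ex rC fC q; exists L.
have [Ls _] := dep_choice LsP.
have [M0 gM] := finite_generator fM; have [N0 gN] := finite_generator fN.
(* Projectivity of the point [t] for X and of the generator [P] for Y is what [center_natural]
   requires. The families still cover: X' is a quotient of the functor free at a projective
   generator of N on its value there, and Y' of one free on a projective above its value at a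
   generator of M. *)
pose J := {a : N * N | projective a.1}; pose L := {a : M * M | projective a.2}.
apply: (@fun_unimodular k C M N tC uM uN IM J L
  (fun j => free_mod rC IN (sval j).1 (sval j).2) (fun l => free_mod rC IM (sval l).1 (sval l).2)
  (fun j => (sval j).1) (fun j => (sval j).2) (fun j => free_unit rC IN (sval j).1 (sval j).2)
  (fun l => (sval l).1) (fun l => (sval l).2) (fun l => free_unit rC IM (sval l).1 (sval l).2)).
- by move=> j; exact: (free_mod_is_free rC N IN).
- by move=> l; exact: (free_mod_is_free rC M IM).
- by move=> l; exact: (free_mod_is_free rC N IM).
- by move=> [j pj] [l pl] X' x sg; apply: (center_natural xM xN IM Ls sg).
- by move=> a c; exists (free_mod rC IN a c), (free_unit rC IN a c); exact: (free_mod_is_free rC N IN).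
- by move=> a c; exists (free_mod rC IM a c), (free_unit rC IM a c); exact: (free_mod_is_free rC M IM).
- move=> X'; have e1 : epi (idm ((X' : modfun N N) N0)) by exact: (iso_epi (iso_id _)).
  exists (exist (fun a : N * N => projective a.1) (N0, (X' : modfun N N) N0) (proj1 gN)).
  exists (free_map rC IN (idm ((X' : modfun N N) N0))).
  exact: (free_map_epi abN gN fdN (exact_module_exact fC (X' : modfun N N) xN mN) e1).
- move=> Y'; have [P [e [pP eP]]] := covM ((Y' : modfun M M) M0).
  exists (exist (fun a : M * M => projective a.2) (M0, P) pP), (free_map rC IM e).
  exact: (free_map_epi abM gM fdM (exact_module_exact fC (Y' : modfun M M) xM mM) eP).
- move=> y; have [t [w [mu [P [z [pt pP ez]]]]]] := fun_endo_generated tC xM xN IM IN Ls y.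
  by exists (exist (fun a : N * N => projective a.1) (t, w) pt,
             exist (fun a : M * M => projective a.2) (mu, P) pP), z.
Qed.
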